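(* For a continuous map $\Psi:\mathrm{Conv}(\mathbb{R}^n,\mathbb{R})\rightarrow\mathcal{M}(\mathbb{R}^n)$ the following are equivalent: \begin{enumerate} \item $\Psi\in\mathrm{MAVal}_k(\mathbb{R}^n)$. \item $\Psi$ is a linear combination of mixed Monge-Amp\`ere operators of quadratic type of degree $k$. \item There exists a differential form $\tau\in\Lambda^{n-k,k}$ such that for all $f\in\mathrm{Conv}(\mathbb{R}^n,\mathbb{R})\cap C^2(\mathbb{R}^n)$, \begin{align*} \Psi(f)[B]=\int_{\pi^{-1}(B)\cap \mathrm{graph}(df)}\tau\quad\text{for all bounded Borel subsets}~B\subset\mathbb{R}^n. \end{align*} \item There exists a polynomial $P$ on the space of symmetric $(n\times n)$-matrices that is a linear combination of the $(k\times k)$-minors such that for all $f\in\mathrm{Conv}(\mathbb{R}^n,\mathbb{R})\cap C^2(\mathbb{R}^n)$, \begin{align*} \Psi(f)[B]=\int_B P(D^2f(x))dx\quad\text{for all bounded Borel sets}~B\subset \mathbb{R}^n. \end{align*} \end{enumerate}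
   Context: $\mathrm{Conv}(\mathbb{R}^n,\mathbb{R})$ is the space of finite-valued convex functions on $\mathbb{R}^n$ (topology of locally uniform convergence), $\mathcal{M}(\mathbb{R}^n)$ the complex Radon measures with the weak*-topology. $\mathrm{MAVal}(\mathbb{R}^n)$ is the space of continuous valuations $\Psi:\mathrm{Conv}(\mathbb{R}^n,\mathbb{R})\to\mathcal{M}(\mathbb{R}^n)$ that are dually epi-translation invariant ($\Psi(f+l)=\Psi(f)$ for affine $l$), locally determined ($f\equiv h$ on open $V$ implies $\Psi(f)[B\cap V]=\Psi(h)[B\cap V]$ for bounded Borel $B$) and translation equivariant ($\Psi(f(\cdot+x))[B]=\Psi(f)[B+x]$); $\mathrm{MAVal}_k(\mathbb{R}^n)$ is the subspace of $k$-homogeneous ones ($\Psi(tf)=t^k\Psi(f)$, $t\ge0$). The mixed Monge-Amp\`ere measure is $\mathrm{MA}(f_1,\dots,f_n)=\frac{1}{n!}\frac{\partial^n}{\partial\lambda_1\cdots\partial\lambda_n}\big|_0\mathrm{MA}(\sum\lambda_if_i)$, where $\mathrm{MA}$ is the real Monge-Amp\`ere measure; a mixed Monge-Amp\`ere operator of quadratic type of degree $k$ is $f\mapsto\mathrm{MA}(f[k],f_1,\dots,f_{n-k})$ ($f$ repeated $k$ times) with $f_1,\dots,f_{n-k}$ quadratic polynomials. $\Lambda^{n-k,k}=\Lambda^{n-k}\mathbb{R}^n\otimes\Lambda^k(\mathbb{R}^n)^*$ is the space of constant complex differential forms of bidegree $(n-k,k)$ on $T^*\mathbb{R}^n=\mathbb{R}^n\times(\mathbb{R}^n)^*$,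 and $\pi:T^*\mathbb{R}^n\to\mathbb{R}^n$ is the projection onto the first factor. *)

(* Defs.v *)
From HB Require Import structures.
From mathcomp Require Import all_boot all_order all_algebra.
From mathcomp Require Import all_classical all_reals all_analysis.
From mathcomp Require Import complex.
Import Order.TTheory GRing.Theory Num.Theory.
Import numFieldNormedType.Exports.

Set Implicit Arguments.
Unset Strict Implicit.
Unset Printing Implicit Defensive.

Local Open Scope classical_set_scope.
Local Open Scope ring_scope.
Local Open Scope complex_scope.

Section MAVal.
Variable R : realType.
Variable n : nat.

(* R^n is 'rV[R]_n; its dual (R^n)^* is identified with R^n via the
   standard inner product. *)
Local Notation V := 'rV[R]_n.

Definition inner (y x : V) : R := \sum_(i < n) y ord0 i * x ord0 i.

Definition evec (i : 'I_n) : V := delta_mx ord0 i.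

Definition convex_fun (f : V -> R) : Prop :=
  forall (x y : V) (t : R), 0 <= t <= 1 ->
    f (t *: x + (1 - t) *: y) <= t * f x + (1 - t) * f y.

Definition affine_fun (l : V -> R) : Prop :=
  exists (y : V) (c : R), forall x, l x = inner y x + c.

Definition quadratic_poly (q : V -> R) : Prop :=
  exists (A : 'M[R]_n) (b : V) (c : R),
    forall x, q x = (x *m A *m x^T) ord0 ord0 + inner b x + c.

Definition C2_fun (f : V -> R) : Prop :=
  (forall x, differentiable f x) /\
  (forall (i : 'I_n) x, differentiable ('D_(evec i) f) x) /\
  (forall i j : 'I_n, continuous ('D_(evec j) ('D_(evec i) f))).

Definition hessian (f : V -> R) (x : V) : 'M[R]_n :=
  \matrix_(i < n, j < n) 'D_(evec j) ('D_(evec i) f) x.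

Definition borel (B : set V) : Prop := <<s [set: V], @open V >> B.

(* A complex Radon measure on R^n is represented by its values on bounded
   Borel sets (values on other sets are irrelevant): a set function
   set V -> R[i] which is countably additive on the Borel subsets of every
   bounded set (convergence in C written out on real and imaginary parts). *)
Definition cmeasure := set V -> R[i].

Definition is_radon (mu : cmeasure) : Prop :=
  forall (K : set V), bounded_set K ->
  forall (A : nat -> set V), (forall j, borel (A j)) -> (forall j, A j `<=` K) ->
    trivIset setT A ->
    ((fun N => \sum_(0 <= j < N) complex.Re (mu (A j))) @ \oo --> complex.Re (mu (\bigcup_j A j)))
    /\
    ((fun N => \sum_(0 <= j < N) complex.Im (mu (A j))) @ \oo --> complex.Im (mu (\bigcup_j A j))).

Definition meq (mu nu : cmeasure) : Prop :=
  forall B, bounded_set B -> borel B -> mu B = nu B.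

(* ---------- integration of a bounded real function against a real set
   function, via the layer-cake formula
     int g dm = int_0^oo m{g > t} dt - int_0^oo m{g < -t} dt  ---------- *)
Definition layer_int (m : set V -> R) (g : V -> R) : R :=
  Rintegral lebesgue_measure [set t : R | 0 <= t] (fun t => m [set x | t < g x])
  - Rintegral lebesgue_measure [set t : R | 0 <= t] (fun t => m [set x | g x < - t]).

Definition box (a b : 'I_n -> R) : set V :=
  [set x | forall i, a i <= x ord0 i <= b i].

Definition box_vol (a b : 'I_n -> R) : R := \prod_(i < n) (b i - a i).

Definition leb_outer (A : set V) : \bar R :=
  ereal_inf [set s | exists (u : nat -> bool) (a b : nat -> 'I_n -> R),
    (forall j i, a j i <= b j i) /\
    A `<=` \bigcup_(j in [set j | u j]) box (a j) (b j) /\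
    s = (\sum_(0 <= j <oo) (if u j then (box_vol (a j) (b j))%:E else 0%E))%E].

Definition leb_int (B : set V) (g : V -> R) : R :=
  layer_int (fun A => fine (leb_outer (B `&` A))) g.

Definition leb_cint (B : set V) (h : V -> R[i]) : R[i] :=
  leb_int B (fun x => complex.Re (h x)) +i* leb_int B (fun x => complex.Im (h x)).

Definition compact_support (phi : V -> R) : Prop :=
  exists r : R, forall x : V, r < `|x| -> phi x = 0.

Definition weak_cvg (mus : nat -> cmeasure) (mu : cmeasure) : Prop :=
  forall phi : V -> R, continuous phi -> compact_support phi ->
    ((fun j => layer_int (fun A => complex.Re (mus j A)) phi) @ \oo -->
        layer_int (fun A => complex.Re (mu A)) phi) /\
    ((fun j => layer_int (fun A => complex.Im (mus j A)) phi) @ \oo -->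
        layer_int (fun A => complex.Im (mu A)) phi).

Definition loc_unif_cvg (fs : nat -> V -> R) (f : V -> R) : Prop :=
  forall r e : R, 0 < e ->
    \forall j \near \oo, forall x : V, `|x| <= r -> `|fs j x - f x| < e.

(* continuity of Psi : Conv(R^n,R) -> M(R^n); Conv(R^n,R) is metrizable,
   so continuity is sequential continuity. *)
Definition conv_continuous (Psi : (V -> R) -> cmeasure) : Prop :=
  forall (fs : nat -> V -> R) (f : V -> R),
    (forall j, convex_fun (fs j)) -> convex_fun f -> loc_unif_cvg fs f ->
    weak_cvg (fun j => Psi (fs j)) (Psi f).

Definition subdiff (f : V -> R) (x : V) : set V :=
  [set y | forall z, f x + inner y (z - x) <= f z].

Definition MA (f : V -> R) : cmeasure :=
  fun B => (fine (leb_outer (\bigcup_(x in B) subdiff f x)))%:C.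

(* one-sided partial derivative in lambda_i (lambda ranges over [0,oo)^n) *)
Definition rpartial (i : 'I_n) (G : ('I_n -> R) -> R) (lam : 'I_n -> R) : R :=
  lim ((fun t : R => (G (fun j => lam j + (if j == i then t else 0)) - G lam) / t)
         @ 0^'+).

Fixpoint dmix (l : seq 'I_n) (G : ('I_n -> R) -> R) : ('I_n -> R) -> R :=
  match l with
  | [::] => G
  | i :: l' => rpartial i (dmix l' G)
  end.

Definition mixedMA (fs : 'I_n -> V -> R) : cmeasure :=
  fun B =>
    ((dmix (enum 'I_n)
       (fun lam => complex.Re (MA (fun x => \sum_(i < n) lam i * fs i x) B))
       (fun _ => 0)) / (n `!)%:R)%:C.

Definition quad_args (k : nat) (f : V -> R) (q : nat -> V -> R) : 'I_n -> V -> R :=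
  fun i => if (i < k)%N then f else q (i - k)%N.

Definition is_MAVal_k (k : nat) (Psi : (V -> R) -> cmeasure) : Prop :=
  [/\
      (forall f g, convex_fun f -> convex_fun g ->
         convex_fun (fun x => Num.min (f x) (g x)) ->
         meq (fun B => Psi (fun x => Num.max (f x) (g x)) B
                       + Psi (fun x => Num.min (f x) (g x)) B)
             (fun B => Psi f B + Psi g B)),
      (forall f l, convex_fun f -> affine_fun l ->
         meq (Psi (fun x => f x + l x)) (Psi f)),
      (forall f h (U : set V), convex_fun f -> convex_fun h -> open U ->
         (forall x, U x -> f x = h x) ->
         forall B, bounded_set B -> borel B -> Psi f (B `&` U) = Psi h (B `&` U)),
      (forall f (x : V), convex_fun f ->
         forall B, bounded_set B -> borel B ->
           Psi (fun y => f (y + x)) B = Psi f [set b + x | b in B]) &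
      (forall f (t : R), convex_fun f -> 0 <= t ->
         meq (Psi (fun x => t * f x)) (fun B => (t ^+ k)%:C * Psi f B))].

(* A tangent vector of T^*R^n = R^n x (R^n)^* is a pair (v, w).
   Coordinates: inl i = x_i, inr j = xi_j. *)
Definition pcoord (p : V * V) (s : 'I_n + 'I_n) : R :=
  match s with inl i => p.1 ord0 i | inr j => p.2 ord0 j end.

(* dx_I /\ dxi_J (I, J in increasing order) evaluated on n vectors:
   det (dz_{s_a}(v_b))_{a,b} *)
Definition dxdxi (I J : {set 'I_n}) (vs : 'I_n -> V * V) : R :=
  \det (\matrix_(a < n, b < n)
          pcoord (vs b) (nth (inl a) ([seq inl i | i <- enum I] ++
                                      [seq inr j | j <- enum J]) a)).

Definition form_eval (k : nat) (c : {set 'I_n} -> {set 'I_n} -> R[i])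
    (vs : 'I_n -> V * V) : R[i] :=
  \sum_(I : {set 'I_n} | #|I| == (n - k)%N)
    \sum_(J : {set 'I_n} | #|J| == k) c I J * (dxdxi I J vs)%:C.

(* int_{pi^{-1}(B) cap graph(df)} tau, the graph being parametrized by
   x |-> (x, df(x)) and oriented by the standard orientation of R^n *)
Definition graph_int (k : nat) (c : {set 'I_n} -> {set 'I_n} -> R[i])
    (f : V -> R) (B : set V) : R[i] :=
  leb_cint B (fun x => form_eval k c
     (fun b => (evec b, \row_(j < n) hessian f x j b))).

Definition incr_map (k : nat) (s : {ffun 'I_k -> 'I_n}) : bool :=
  [forall a : 'I_k, forall b : 'I_k, (a < b)%N ==> (s a < s b)%N].

Definition minor (k : nat) (rs cs : {ffun 'I_k -> 'I_n}) (A : 'M[R]_n) : R :=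
  \det (\matrix_(a < k, b < k) A (rs a) (cs b)).

Definition minor_comb (k : nat)
    (c : {ffun 'I_k -> 'I_n} -> {ffun 'I_k -> 'I_n} -> R[i]) (A : 'M[R]_n) : R[i] :=
  \sum_(rs | incr_map rs) \sum_(cs | incr_map cs) c rs cs * (minor rs cs A)%:C.

End MAVal.

(* Main.v *)
(* Real and imaginary parts reduce everything to real-valued valuations [Psi].
   For [l = inner y], the valuation property applied to F + a (l - s)_- and
   F + c (l - s')_+ with s <= s' (whose maximum adds both terms and whose minimum
   is F) makes Psi(F + sum_j c_j (l - s_j)_+) - Psi(F) a sum of jumps, one for each
   j, linear in c_j and carried by {l = s_j}.  Approximating convex profiles g by
   such sums, c |-> Psi(F + c g(l)) is affine, and the jump functional of exp(l) is
   exp(l) times that of l^2/2.  On quadratic functions Psi(f) is translation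
   invariant, hence p(D^2 f) dx with p homogeneous and affine in rank-one
   directions; the two ridge rules propagate the formula to sums of exponentials,
   and mollifying a cut-off of f with a kernel that is itself a sum of exponentials
   on a large cube reaches every convex f of class C^2; these are dense.
   A k-homogeneous rank-one affine p on the positive semidefinite matrices is
   polarised by its second differences D_{x,y}; since D_{a,a}^2 = 0, the signed sum
   over permutations of D_{x_1,x_s(1)}...D_{x_k,x_s(k)} p is a positive multiple of
   p(sum_i x_i x_i^T), which exhibits p as a combination of k x k minors.  A Gram
   matrix argument rewrites it as sum_j c_j det(x_1,...,x_k,w_j)^2, the density of a
   combination of mixed Monge-Ampere operators of quadratic type. *)

(* The obstacle is that a valuation is known only on convex functions, whereas the cut-off of [f]
   and its exponential approximants are merely semiconvex. Adding a large diagonal quadratic form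
   restores convexity; since both sides of the density formula depend affinely on each nonnegative
   coefficient of a ridge function, an identity valid for large coefficients descends to small ones.
   Exponentials are chosen because their second differences at a node s are exp(s) times a constant:
   the jump functional of t^2/2, which the quadratic case controls, then yields that of every
   exponential. The Monge-Ampere operator is treated by the same theory. Its valuation axioms are
   derived from subdifferentials, the classification in top degree makes its density a multiple of
   det D^2 f, and |x|^2/2 fixes the multiple, so no change of variables is used. Measures are given
   as set functions, and integrals by the layer-cake formula with an outer measure defined by box
   covers; hence the preliminary theory that identifies these with genuine measures and
   integrals. *)
Require Import Defs.
From HB Require Import structures.
From mathcomp Require Import all_boot all_order all_algebra fingroup perm.
From mathcomp Require Import all_classical all_reals all_analysis.
From mathcomp Require Import complex measurable_realfun.
From mathcomp Require Import ring lra zify.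
Import Order.TTheory GRing.Theory Num.Theory.
Import numFieldNormedType.Exports.
Set Implicit Arguments.
Unset Strict Implicit.
Unset Printing Implicit Defensive.
Local Open Scope classical_set_scope.
Local Open Scope ring_scope.

(* Makes [borel B] convertible to [measurable B]. *)
HB.instance Definition _ (R : realType) (m n : nat) :=
  @isMeasurable.Build (sigma_display (@open 'M[R]_(m, n))) 'M[R]_(m, n) <<s @open 'M[R]_(m, n) >>
  (@sigma_algebra0 _ setT (@open 'M[R]_(m, n))) (@sigma_algebraC _ (@open 'M[R]_(m, n)))
  (@sigma_algebra_bigcup _ setT (@open 'M[R]_(m, n))).

(** * Lebesgue measure from box coverings *)

Section LebesgueOuter.
Variables (R : realType) (n : nat).
Local Notation V := 'rV[R]_n.
Implicit Types A B : set V.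

(** A cover is a sequence of flagged boxes. A cleared flag drops the box, which is how finite
    families and, for n = 0, where every box has volume 1, the empty family become sequences. *)
Let cov := (nat -> bool * ('I_n -> R) * ('I_n -> R))%type.
Definition cover_vol (w : bool * ('I_n -> R) * ('I_n -> R)) : \bar R :=
  if w.1.1 then (box_vol w.1.2 w.2)%:E else 0%E.
Definition covers (c : cov) A :=
  (forall j i, (c j).1.2 i <= (c j).2 i) /\
  A `<=` [set x | exists2 j, (c j).1.1 & box (c j).1.2 (c j).2 x].

Lemma box_vol_ge0 (a b : 'I_n -> R) : (forall i, a i <= b i) -> 0 <= box_vol a b.
Proof. by move=> ab; apply: prodr_ge0 => i _; rewrite subr_ge0. Qed.

Lemma cover_vol_ge0 c A j : covers c A -> (0 <= cover_vol (c j))%E.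
Proof.
by move=> [ab _]; rewrite /cover_vol; case: ifP => // _; rewrite lee_fin box_vol_ge0.
Qed.

Lemma leb_outerE A : leb_outer A =
  ereal_inf [set s | exists2 c, covers c A & s = (\sum_(0 <= j <oo) cover_vol (c j))%E].
Proof.
congr ereal_inf; apply/seteqP; split => [s [u [a [b [ab [Ab ->]]]]]|s [c [ab Ac] ->]].
  by exists (fun j => (u j, a j, b j)) => //; split => // x /Ab [j uj bx]; exists j.
exists (fun j => (c j).1.1), (fun j => (c j).1.2), (fun j => (c j).2).
by split => //; split => // x /Ac [j uj bx]; exists j.
Qed.

Lemma leb_outer_ge0 A : (0 <= leb_outer A)%E.
Proof.
rewrite leb_outerE; apply: le_ereal_inf_tmp => _ [c cA ->].
by apply: nneseries_ge0 => j _ _; exact: cover_vol_ge0 cA.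
Qed.

Lemma le_leb_outer A B : A `<=` B -> (leb_outer A <= leb_outer B)%E.
Proof.
move=> AB; rewrite !leb_outerE; apply: ereal_inf_le_tmp => _ [c [c1 c2] ->].
exists c => //; split => //; exact: subset_trans AB c2.
Qed.

Lemma leb_outer0 : leb_outer (set0 : set V) = 0%E.
Proof.
apply/eqP; rewrite eq_le leb_outer_ge0 andbT leb_outerE.
apply: ereal_inf_lbound; exists (fun=> (false, fun=> 0, fun=> 0)); first by split.
by rewrite eseries0.
Qed.

(** Covers of the [A k] with excess e / 2^(k+1) are merged into one cover along a bijection of nat
    with nat * nat. *)
Lemma leb_outer_sigma_subadditive : sigma_subadditive (@leb_outer R n).
Proof.
move=> A; have [[i ioo]|] := pselect (exists i, leb_outer (A i) = +oo%E).
  rewrite (eseries_pinfty _ _ ioo) ?leey// => k _.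
  by rewrite -ltNye (lt_le_trans _ (leb_outer_ge0 _)).
rewrite -forallNE => Aoo.
suff add2e (e : {posnum R}) :
    (leb_outer (\bigcup_n A n) <= \sum_(i <oo) leb_outer (A i) + e%:num%:E)%E.
  by apply/lee_addgt0Pr => _/posnumP[].
rewrite (le_trans _ (epsilon_trick _ _ _))//; last first.
  by move=> k; exact: leb_outer_ge0.
pose P k (c : cov) := covers c (A k) /\
  (\sum_(j <oo) cover_vol (c j) <= leb_outer (A k) + (e%:num / (2 ^ k.+1)%:R)%:E)%E.
have [G PG] : {G : nat -> cov & forall k, P k (G k)}.
  apply: (@choice _ _ P) => k; rewrite /P leb_outerE.
  set S := (X in ereal_inf X); move infS : (ereal_inf S) => iS.
  case: iS infS => [r Sr|Soo|Soo].
  - have en1 : (0 < e%:num / (2 ^ k.+1)%:R)%R by [].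
    have /(lb_ereal_inf_adherent en1) : ereal_inf S \is a fin_num by rewrite Sr.
    by move=> [x [B cB ->] xS]; exists B; split => //; rewrite -Sr; exact/ltW.
  - by have := Aoo k; rewrite leb_outerE -/S Soo.
  - suff : lbound S 0%E by move/le_ereal_inf_tmp; rewrite Soo.
    by move=> /= _ [c cA ->]; apply: nneseries_ge0 => j _ _; exact: cover_vol_ge0 cA.
pose v (p : nat * nat) := cover_vol (G p.1 p.2).
have v0 p : (0 <= v p)%E by exact: cover_vol_ge0 (PG p.1).1.
have /card_esym/ppcard_eqP[f] := card_nat2.
rewrite leb_outerE.
apply: (@le_trans _ _ (\esum_(p in setT) v p)).
  apply: ereal_inf_lbound; exists (fun j => G (f j).1 (f j).2); last first.
    rewrite nneseries_esumT; last by move=> j; exact: (v0 (f j)).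
    by rewrite (reindex_esum setT setT f).
  split => [j i|x [i _ /((PG i).1.2) [j uj bj]]]; first exact: (PG (f j).1).1.1.
  by exists (f^-1%FUN (i, j)) => //=; rewrite invK ?inE.
have -> : \esum_(p in setT) v p = (\sum_(i <oo) \sum_(j <oo) cover_vol (G i j))%E.
  rewrite nneseries_esumT; last first.
    by move=> i; apply: nneseries_ge0 => j _ _; exact: (v0 (i, j)).
  rewrite (eq_esum (b := fun i => \esum_(j in setT) cover_vol (G i j))); last first.
    by move=> i _; rewrite nneseries_esumT// => j; exact: (v0 (i, j)).
  rewrite esum_esum; last by move=> i j _ _; exact: (v0 (i, j)).
  congr esum; apply/seteqP; split => //.
apply: lee_nneseries => [k _ _|k _ /=]; last exact: (PG k).2.
by apply: nneseries_ge0 => j _ _; exact: (v0 (k, j)).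
Qed.

HB.instance Definition _ := isOuterMeasure.Build R V (@leb_outer R n)
  leb_outer0 leb_outer_ge0 le_leb_outer leb_outer_sigma_subadditive.

Lemma leb_outer_shift A (x : V) : leb_outer [set a + x | a in A] = leb_outer A.
Proof.
have le B (y : V) : (leb_outer [set (a + y)%R | a in B] <= leb_outer B)%E.
  rewrite !leb_outerE; apply: ereal_inf_le_tmp => _ [c [ab Bc] ->].
  exists (fun j => ((c j).1.1, fun i => (c j).1.2 i + y ord0 i, fun i => (c j).2 i + y ord0 i)).
    split => [j i|_ [z /Bc [j uj bz] <-]]; first by rewrite /= lerD2r.
    by exists j => // i /=; rewrite mxE !lerD2r; exact: bz.
  apply: eq_eseriesr => j _; rewrite /cover_vol /=; case: ifP => // _; congr (_%:E).
  by apply: eq_bigr => i _; ring.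
apply/eqP; rewrite eq_le le /=.
apply: le_trans (le [set a + x | a in A] (- x)).
by apply: le_leb_outer => z Az; exists (z + x); [exists z|rewrite addrK].
Qed.

Lemma leb_outer_scale A (t : R) : 0 < t ->
  leb_outer [set t *: a | a in A] = ((t ^+ n)%:E * leb_outer A)%E.
Proof.
move=> t0.
have le B (s : R) : 0 < s -> (leb_outer [set (s *: a)%R | a in B] <= (s ^+ n)%:E * leb_outer B)%E.
  move=> s0; rewrite -lee_pdivrMl ?exprn_gt0// (leb_outerE B).
  apply: le_ereal_inf_tmp => _ [c [ab Bc] ->].
  rewrite lee_pdivrMl ?exprn_gt0// leb_outerE; apply: ereal_inf_lbound.
  exists (fun j => ((c j).1.1, fun i => s * (c j).1.2 i, fun i => s * (c j).2 i)).
    split => [j i|_ [z /Bc [j uj bz] <-]]; first by rewrite /= ler_pM2l.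
    by exists j => // i /=; rewrite mxE !ler_pM2l//; exact: bz.
  rewrite -nneseriesZl; last by move=> j _; exact: cover_vol_ge0 (conj ab Bc).
  apply: eq_eseriesr => j _; rewrite /cover_vol /=; case: ifP => // _; last by rewrite mule0.
  rewrite /box_vol -EFinM; congr (_%:E).
  rewrite (_ : s ^+ n = \prod_(i < n) s); last by rewrite prodr_const card_ord.
  by rewrite -big_split /=; apply: eq_bigr => i _; rewrite mulrBr.
apply/eqP; rewrite eq_le le//= -lee_pdivlMl ?exprn_gt0//.
have := le [set t *: a | a in A] t^-1; rewrite invr_gt0 t0 => /(_ isT).
rewrite exprVn => /(le_trans _); apply; apply: le_leb_outer => z Az.
by exists (t *: z); [exists z|rewrite scalerA mulVf ?gt_eqF// scale1r].
Qed.

Lemma leb_outer_box (a b : 'I_n -> R) : (forall i, a i <= b i) ->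
  (leb_outer (box a b) <= (box_vol a b)%:E)%E.
Proof.
move=> ab; rewrite leb_outerE; apply: ereal_inf_lbound.
exists (fun j => (j == 0%N, a, b)); first by split => // x bx; exists 0%N.
rewrite (nneseries_split 0 1)//; last first.
  by move=> k _; rewrite /cover_vol; case: ifP => // _; rewrite lee_fin box_vol_ge0.
by rewrite big_nat1 eseries0 ?adde0// => -[].
Qed.

End LebesgueOuter.

(** * Boxes as generators of the Borel sets *)

Section BorelBoxes.
Variables (R : realType) (n : nat).
Local Notation V := 'rV[R]_n.

Lemma mx_ballP (x y : V) (e : R) : 0 < e ->
  (forall i, `|x ord0 i - y ord0 i| < e) -> ball x e y.
Proof.
move=> e0 xy; rewrite mx_norm_ball /ball_ /= -[Num.norm _]/(mx_norm (x - y)).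
have [->//|/mx_norm_neq0[[i j] -> /=]] := eqVneq (mx_norm (x - y)) 0.
by rewrite (ord1 i) !mxE.
Qed.

(** Boxes with rational corners are countably many, so this makes every open set a countable union
    of boxes. *)
Lemma open_sub_rational_box (O : set V) (x : V) : open O -> O x ->
  exists ab : {ffun 'I_n -> rat * rat},
    (forall i, ratr (ab i).1 < x ord0 i < ratr (ab i).2) /\
    [set y : V | forall i, ratr (ab i).1 <= y ord0 i <= ratr (ab i).2] `<=` O.
Proof.
move=> oO Ox; have /nbhs_ballP[e /= e0 eO] : nbhs x O by exact: open_nbhs_nbhs.
have /choice[a aP] : forall i : 'I_n, exists q : rat, ratr q \in `]x ord0 i - e / 2, x ord0 i[.
  by move=> i; apply: rat_in_itvoo; rewrite ltrBlDr ltrDl divr_gt0.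
have /choice[b bP] : forall i : 'I_n, exists q : rat, ratr q \in `]x ord0 i, x ord0 i + e / 2[.
  by move=> i; apply: rat_in_itvoo; rewrite ltrDl divr_gt0.
exists [ffun i => (a i, b i)]; split=> [i|y yab].
  by rewrite ffunE /=; move: (aP i) (bP i); rewrite !in_itv/= => /andP[_ ->] /andP[-> _].
apply/eO/mx_ballP => // i; move: (yab i) (aP i) (bP i); rewrite ffunE/= !in_itv/=.
move=> /andP[y1 y2] /andP[a1 a2] /andP[b1 b2]; rewrite ltr_norml; apply/andP; split; lra.
Qed.

Lemma sigma_algebra_box (M : set (set V)) (a b : 'I_n -> R) : sigma_algebra setT M ->
  (forall i c, M [set x : V | x ord0 i <= c]) -> M (box a b).
Proof.
move=> sM Mhalf.
have [M0 MD Mcup] := sM.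
have MC : forall A, M A -> M (~` A) by move=> A MA; rewrite -setTD; exact: MD.
have Mlt i c : M [set x : V | x ord0 i < c].
  rewrite (_ : mkset _ = \bigcup_k [set x : V | x ord0 i <= c - k.+1%:R^-1]).
    by apply: (Mcup) => k; exact: Mhalf.
  apply/seteqP; split=> [x /= xc|x [k _ /=]].
    by have [k ck] := ltr_add_invr xc; exists k => //=; rewrite lerBrDr ltW.
  by move=> /le_lt_trans; apply; rewrite ltrBlDr ltrDl invr_gt0 ltr0n.
have MI A B : M A -> M B -> M (A `&` B).
  by move=> MA MB; rewrite -(setCK (A `&` B)) setCI; apply: (MC); rewrite -bigcup2E;
     apply: (Mcup) => -[|[|k]] //=; exact: (MC).
have Ms (s : seq 'I_n) : M [set x : V | forall i, i \in s -> a i <= x ord0 i <= b i].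
  elim: s => [|i s ih].
    rewrite (_ : mkset _ = ~` set0); first exact: (MC).
    by apply/seteqP; split=> x; [move=> _ []|move=> _ i; rewrite in_nil].
  rewrite (_ : mkset _ = ([set x : V | x ord0 i <= b i] `&` ~` [set x : V | x ord0 i < a i])
     `&` [set x : V | forall i, i \in s -> a i <= x ord0 i <= b i]).
    by apply: (MI) => //; apply: (MI) => //; exact: (MC).
  apply/seteqP; split=> [x xP|x [[xi1 /= /negP xi2] xs] j].
    split=> [|j js]; last by apply: xP; rewrite inE js orbT.
    by have /andP[x1 x2] := xP i (mem_head _ _); split => //=; rewrite ltNge x1.
  by rewrite inE => /orP[/eqP->|/xs//]; rewrite xi1 andbT leNgt.
rewrite (_ : box a b = [set x : V | forall i, i \in enum 'I_n -> a i <= x ord0 i <= b i]) //.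
by apply/seteqP; split=> [x bx i _|x bx i]; [exact: bx|apply: bx; rewrite mem_enum].
Qed.

Lemma sigma_algebra_open (M : set (set V)) : sigma_algebra setT M ->
  (forall i c, M [set x : V | x ord0 i <= c]) -> forall O, open O -> M O.
Proof.
move=> sM Mhalf O oO; have [M0 _ Mcup] := sM.
pose F (ab : {ffun 'I_n -> rat * rat}) : set V :=
  let B := box (fun i => ratr (ab i).1) (fun i => ratr (ab i).2) in
  if `[< B `<=` O >] then B else set0.
have -> : O = \bigcup_ab F ab.
  apply/seteqP; split=> [x Ox|x [ab _]]; last by rewrite /F; case: asboolP => // BO /BO.
  have [ab [xab abO]] := open_sub_rational_box oO Ox.
  exists ab => //; rewrite /F; case: asboolP => // _ i.
  by case/andP: (xab i) => ? ?; rewrite !ltW.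
have MF ab : M (F ab).
  by rewrite /F; case: asboolP => // _; exact: sigma_algebra_box.
pose G k := if unpickle k is Some ab then F ab else set0.
have -> : \bigcup_ab F ab = \bigcup_k G k.
  apply/seteqP; split=> [x [ab _ Fx]|x [k _]].
    by exists (pickle ab) => //; rewrite /G pickleK.
  by rewrite /G; case: unpickle => // ab Fx; exists ab.
by apply: (Mcup) => k; rewrite /G; case: unpickle.
Qed.

(** [M] is arbitrary because the principle is applied to Caratheodory-measurable sets, to preimages
    under translations and to sets with measurable subgradient image. *)
Lemma sigma_algebra_borel (M : set (set V)) : sigma_algebra setT M ->
  (forall i c, M [set x : V | x ord0 i <= c]) -> measurable `<=` M.
Proof.
by move=> sM Mhalf; apply: smallest_sub => //; exact: sigma_algebra_open.
Qed.
End BorelBoxes.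

(** * Lebesgue measure on the Borel sets *)

Section LebesgueMeasure.
Variables (R : realType) (n : nat).
Local Notation V := 'rV[R]_n.

(** A hyperplane cuts each box of a cover into two boxes whose volumes add up to the original one,
    so a cover of [X] splits into covers of both parts at no cost. *)
Lemma caratheodory_halfspace (i : 'I_n) (c : R) :
  caratheodory_measurable (@leb_outer R n) [set x : V | x ord0 i <= c].
Proof.
pose H := [set x : V | x ord0 i <= c].
suff lebX (X : set V) : (leb_outer (X `&` H) + leb_outer (X `&` ~` H) <= leb_outer X)%E.
  by apply: le_caratheodory_measurable => X; exact: lebX.
rewrite (leb_outerE X).
apply: le_ereal_inf_tmp => _ [w [ab Xw] ->].
(* The clamps keep the edges ordered: if the hyperplane misses the box, one of the two pieces is
   degenerate and has volume 0. *)
pose b' j k := if k == i then Num.max ((w j).1.2 i) (Num.min ((w j).2 i) c) else (w j).2 k.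
pose a' j k := if k == i then Num.min ((w j).2 i) (Num.max ((w j).1.2 i) c) else (w j).1.2 k.
pose wl j := ((w j).1.1, (w j).1.2, b' j).
pose wr j := ((w j).1.1, a' j, (w j).2).
have cl : covers wl (X `&` [set x | x ord0 i <= c]).
  split => [j k|x [/Xw[j uj bj] xc]] /=.
    by rewrite /b'; case: eqP => [->|]//; rewrite le_max lexx.
  exists j => // k /=; rewrite /b'; case: eqP => [->|_]; last exact: bj.
  by have /andP[-> xb] := bj i; rewrite le_max le_min xb xc orbT.
have cr : covers wr (X `&` ~` [set x | x ord0 i <= c]).
  split => [j k|x [/Xw[j uj bj] /= /negP xc]] /=.
    by rewrite /a'; case: eqP => [->|]//; rewrite ge_min lexx.
  exists j => // k /=; rewrite /a'; case: eqP => [->|_]; last exact: bj.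
  have /andP[ax ->] := bj i; rewrite ge_min ge_max ax /= andbT.
  by rewrite -ltNge in xc; rewrite (ltW xc) orbT.
have -> : (\sum_(0 <= j <oo) cover_vol (w j) =
    \sum_(0 <= j <oo) cover_vol (wl j) + \sum_(0 <= j <oo) cover_vol (wr j))%E.
  rewrite -nneseriesD; last 2 first.
  - by move=> j _ _; exact: cover_vol_ge0 cl.
  - by move=> j _ _; exact: cover_vol_ge0 cr.
  apply: eq_eseriesr => j _; rewrite /cover_vol /=; case: ifP => _; last by rewrite adde0.
  rewrite -EFinD; congr (_%:E).
  have volE a b : box_vol a b = (b i - a i) * \prod_(k | k != i) (b k - a k) := bigD1 i isT.
  rewrite !volE /a' /b' eqxx.
  rewrite [X in _ = _ * X + _](eq_bigr (fun k => (w j).2 k - (w j).1.2 k)); last first.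
    by move=> k /negbTE ->.
  rewrite [X in _ = _ + _ * X](eq_bigr (fun k => (w j).2 k - (w j).1.2 k)); last first.
    by move=> k /negbTE ->.
  rewrite -mulrDl; congr (_ * _).
  have := ab j i; move: ((w j).1.2 i) ((w j).2 i) => p q pq.
  have [qc|/ltW cq] := leP q c.
    by rewrite (max_r pq) (max_r (le_trans pq qc)) (min_l qc); lra.
  have [pc|/ltW cp] := leP p c.
    by rewrite (min_r cq); lra.
  by rewrite (min_r pq); lra.
by apply: leeD; rewrite leb_outerE; apply: ereal_inf_lbound; [exists wl|exists wr].
Qed.

Lemma borel_caratheodory (A : set V) : measurable A -> caratheodory_measurable (@leb_outer R n) A.
Proof.
move: A; apply: sigma_algebra_borel; last exact: caratheodory_halfspace.
split; first exact: caratheodory_measurable_set0.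
- by move=> A mA; rewrite setTD; exact: caratheodory_measurable_setC.
- exact: caratheodory_measurable_bigcup.
Qed.

Definition leb (A : set V) : \bar R := leb_outer A.

Let leb0 : leb set0 = 0%E. Proof. exact: leb_outer0. Qed.
Let leb_ge0 A : (0 <= leb A)%E. Proof. exact: leb_outer_ge0. Qed.
Let leb_sigma_additive : semi_sigma_additive leb.
Proof.
move=> A mA tA mUA.
have := @caratheodory_measure_sigma_additive R V (@leb_outer R n) A.
by apply => // [k|]; exact: borel_caratheodory.
Qed.

HB.instance Definition _ := isMeasure.Build _ V R leb leb0 leb_ge0 leb_sigma_additive.

Lemma measurable_open_rV (A : set V) : open A -> measurable A.
Proof. exact: sub_sigma_algebra. Qed.

Lemma measurable_closed_rV (A : set V) : closed A -> measurable A.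
Proof.
by move=> cA; rewrite -(setCK A); apply: measurableC; apply: measurable_open_rV; exact: closed_openC.
Qed.

Lemma measurable_halfspace (i : 'I_n) (c : R) : measurable [set x : V | x ord0 i <= c].
Proof.
apply: measurable_closed_rV; rewrite (_ : mkset _ = (fun x : V => x ord0 i) @^-1` [set y | y <= c])//.
by apply: closed_comp; [move=> x _; exact: coord_continuous|exact: closed_le].
Qed.

Lemma measurable_box (a b : 'I_n -> R) : measurable (box a b : set V).
Proof.
apply: sigma_algebra_box measurable_halfspace.
split; first exact: measurable0.
- by move=> A mA; rewrite setTD; exact: measurableC.
- by move=> A mA; exact: bigcupT_measurable.
Qed.

Lemma measurable_continuous_rV (f : V -> R) (D : set V) : continuous f -> measurable D ->
  measurable_fun D f.
Proof.
move=> cf mD; apply: (measurability _ (RGenOInfty.measurableE R)).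
move=> _ [_ [c ->] <-]; apply: measurableI => //; apply: measurable_open_rV.
by apply: open_comp; [move=> x _; exact: cf|exact: interval_open].
Qed.

Lemma leb_shift (A : set V) x : leb [set a + x | a in A] = leb A.
Proof. exact: leb_outer_shift. Qed.

Lemma coord_le_norm (x : V) i : `|x ord0 i| <= `|x|.
Proof.
rewrite -[leRHS]/(mx_norm x) mx_normrE.
exact: (le_bigmax _ (fun ij : 'I_1 * 'I_n => `|x ij.1 ij.2|) (ord0, i)).
Qed.

Lemma norm_le_coord (x : V) (c : R) : 0 <= c -> (forall i, `|x ord0 i| <= c) -> `|x| <= c.
Proof.
move=> c0 xc; rewrite -[leLHS]/(mx_norm x) mx_normrE; apply: bigmax_le => //= -[i j] _ /=.
by rewrite (ord1 i).
Qed.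

Lemma bounded_sub_box (A : set V) : bounded_set A ->
  exists2 M : R, 0 < M & A `<=` box (fun=> - M) (fun=> M).
Proof.
move=> [M [Mr AM]]; exists (`|M| + 1); first by rewrite ltr_wpDl.
move=> x Ax i; rewrite -ler_norml.
have /AM/(_ x Ax) : M < `|M| + 1 by rewrite (le_lt_trans (ler_norm _))// ltrDl.
by move=> xM; apply: le_trans (coord_le_norm x i) xM.
Qed.

Lemma leb_outer_bounded (A : set V) : bounded_set A -> (leb_outer A < +oo)%E.
Proof.
move=> /bounded_sub_box[M M0 AM].
apply: le_lt_trans (le_leb_outer AM) _; apply: le_lt_trans (leb_outer_box _) (ltry _) => i.
by rewrite ge0_cp// ltW.
Qed.

End LebesgueMeasure.

(** * The unit cube has measure one *)

Section CubeVolume.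
Variable R : realType.

(** Induction on the dimension. Integrating the covering inequality over the first coordinate turns
    a weighted cover of the (n+1)-cube into one of the n-cube, the first edge length joining the
    weight; only integrals over the line occur. *)
Lemma cover_cube_ge1 n (w : nat -> R) (a b : nat -> 'I_n -> R) :
  (forall j, 0 <= w j) -> (forall j i, a j i <= b j i) ->
  (forall x : 'I_n -> R, (forall i, 0 <= x i <= 1) ->
    (1 <= \sum_(0 <= j <oo) (w j * \prod_(i < n) (a j i <= x i <= b j i)%R%:R)%:E)%E) ->
  (1 <= \sum_(0 <= j <oo) (w j * \prod_(i < n) (b j i - a j i))%:E)%E.
Proof.
elim: n w a b => [|n ih] w a b w0 ab cov.
  have := cov (fun=> 0) (fun i => ltac:(by case: i)).
  by under eq_eseriesr do rewrite big_ord0; under [X in _ -> (_ <= X)%E]eq_eseriesr do rewrite big_ord0.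
pose w' j := w j * (b j ord0 - a j ord0).
suff: (1 <= \sum_(0 <= j <oo) (w' j * \prod_(i < n) (b j (lift ord0 i) - a j (lift ord0 i)))%:E)%E.
  rewrite (eq_eseriesr (g := fun j => (w j * \prod_(i < n.+1) (b j i - a j i))%:E))//.
  by move=> j _; rewrite /w' -mulrA [in RHS]big_ord_recl.
apply: ih => [j|j i|x x01]; [by rewrite mulr_ge0// subr_ge0|exact: ab|].
pose c j := w j * \prod_(i < n) (a j (lift ord0 i) <= x i <= b j (lift ord0 i))%R%:R.
have c0 j : 0 <= c j by rewrite mulr_ge0// prodr_ge0.
have cov' (y : R) : y \in `[0, 1] -> (1 <= \sum_(0 <= j <oo) (c j * \1_`[a j ord0, b j ord0] y)%:E)%E.
  rewrite in_itv/= => y01.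
  have := cov (fun i => if unlift ord0 i is Some i' then x i' else y) _.
  rewrite (_ : (\sum_(0 <= j <oo) _)%E = (\sum_(0 <= j <oo) (c j * \1_`[a j ord0, b j ord0] y)%:E)%E).
    by apply => i; case: unliftP => [i' _|_].
  apply: eq_eseriesr => j _; congr (_%:E); rewrite big_ord_recl unlift_none mulrCA mulrC.
  by rewrite indicE mem_setE in_itv/=; under eq_bigr do rewrite liftK.
have : (\int[lebesgue_measure]_(y in `[0%R, 1%R]) 1 <=
   \int[lebesgue_measure]_(y in `[0%R, 1%R]) \sum_(0 <= j <oo) (c j * \1_`[a j ord0, b j ord0] y)%:E)%E.
  apply: ge0_le_integral => //=.
    apply: (@ge0_emeasurable_sum _ _ _ _ (fun j y => (c j * \1_`[a j ord0, b j ord0] y)%:E) xpredT) => [j y _ _|j _].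
      by rewrite lee_fin mulr_ge0.
    by apply/measurable_EFinP; apply: measurable_funM => //; exact: measurable_indic.
rewrite [X in (X <= _)%E -> _](integral_cst _ _ 1%E)//= lebesgue_measure_itv/= lte_fin ltr01 oppr0 adde0 mul1e.
move/le_trans; apply.
rewrite integral_nneseries//; last 2 first.
- by move=> j; apply/measurable_EFinP; apply: measurable_funM => //; exact: measurable_indic.
- by move=> j y _; rewrite lee_fin mulr_ge0.
apply: lee_nneseries => [j _ _|j _].
  by apply: integral_ge0 => y _; rewrite lee_fin mulr_ge0.
under eq_integral do rewrite EFinM.
rewrite ge0_integralZl//; last 2 first.
- by apply/measurable_EFinP; exact: measurable_indic.
- by rewrite lee_fin.
rewrite integral_indic//.
rewrite [leRHS](_ : _ = (c j)%:E * (b j ord0 - a j ord0)%:E)%E; last first.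
  by rewrite -EFinM /w' /c mulrAC.
apply: lee_wpmul2l; first by rewrite lee_fin.
apply: le_trans (_ : lebesgue_measure `[a j ord0, b j ord0] <= _)%E.
  by apply: le_measure; rewrite ?inE//; exact: measurableI.
rewrite lebesgue_measure_itv/=; case: ifP => _; first by [].
by rewrite lee_fin subr_ge0.
Qed.

Lemma leb_unit_box n : leb_outer (box (fun=> 0) (fun=> 1) : set 'rV[R]_n) = 1%E.
Proof.
apply/eqP; rewrite eq_le; apply/andP; split.
  apply: le_trans (leb_outer_box _) _ => //.
  by rewrite /box_vol big1// => i _; rewrite subr0.
rewrite leb_outerE; apply: le_ereal_inf_tmp => _ [w [ab cov] ->].
have -> : (\sum_(0 <= j <oo) cover_vol (w j) =
    \sum_(0 <= j <oo) ((w j).1.1%:R * \prod_(i < n) ((w j).2 i - (w j).1.2 i))%:E)%E.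
  by apply: eq_eseriesr => j _; rewrite /cover_vol; case: (w j).1.1; rewrite ?mul1r ?mul0r.
apply: cover_cube_ge1 => // x x01.
have [|j uj bj] := cov (\row_i x i); first by move=> i; rewrite mxE.
rewrite (nneseries_split 0 j.+1); last by move=> k _; rewrite lee_fin mulr_ge0// prodr_ge0.
rewrite add0n big_nat_recr//= uj mul1r.
have -> : \prod_(i < n) ((w j).1.2 i <= x i <= (w j).2 i)%R%:R = 1 :> R.
  by apply: big1 => i _; have := bj i; rewrite mxE => ->.
rewrite -[leLHS]add0e -[leLHS]adde0; apply: leeD; first apply: leeD => //.
  by apply: sume_ge0 => k _; rewrite lee_fin mulr_ge0// prodr_ge0.
by apply: nneseries_ge0 => k _ _; rewrite lee_fin mulr_ge0// prodr_ge0.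
Qed.
End CubeVolume.

(** * Signed Radon set functions and layer-cake integrals *)

Section LayerCake.
Context d (T : measurableType d) (R : realType).
Variable mu : {sigma_finite_measure set T -> \bar R}.
Local Notation D := [set t : R | 0 <= t].

Lemma nonneg_itv : D = `[0, +oo[%classic.
Proof. by apply/seteqP; split => t /=; rewrite in_itv/= andbT. Qed.

Lemma measurable_nonneg : measurable (D : set (measurableTypeR R)).
Proof. by rewrite nonneg_itv; exact: measurable_itv. Qed.

Variables (w g : T -> R).
Hypotheses (mw : measurable_fun setT w) (mg : measurable_fun setT g).
Hypothesis w0 : forall x, 0 <= w x.

Let GR := measurableTypeR R.
Let F (p : T * GR) : \bar R := (w p.1 * \1_[set q : T * R | 0 <= q.2 /\ q.2 < g q.1] p)%:E.

Let mF : measurable_fun setT F.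
Proof.
apply/measurable_EFinP; apply: measurable_funM; first exact: measurableT_comp.
apply: measurable_indic.
rewrite (_ : mkset _ = ((fun p : T * GR => 0 <= p.2) @^-1` [set true]) `&`
    ((fun p : T * GR => (p.2 : R) < g p.1) @^-1` [set true])); last by [].
apply: measurableI.
- have : measurable_fun setT (fun p : T * GR => 0 <= p.2) by exact: measurable_fun_ler.
  by move=> /(_ measurableT [set true]); rewrite setTI; exact.
- have : measurable_fun setT (fun p : T * GR => (p.2 : R) < g p.1).
    by apply: measurable_fun_ltr => //; exact: measurableT_comp.
  by move=> /(_ measurableT [set true]); rewrite setTI; exact.
Qed.

Let F0 p : (0 <= F p)%E. Proof. by rewrite lee_fin mulr_ge0. Qed.

Definition layer (t : R) : \bar R := (\int[mu]_(x in [set x | (t < g x)%R]) (w x)%:E)%E.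

Let layerE t : 0 <= t -> layer t = (\int[mu]_x F (x, t))%E.
Proof.
move=> t0; rewrite /layer integral_mkcond; apply: eq_integral => x _.
rewrite /F /= patchE indicE; case: ifPn => xt.
  by rewrite mem_set ?mulr1//=; split => //; rewrite inE in xt.
by rewrite memNset ?mulr0//= => -[_ xt']; rewrite notin_setE/= in xt.
Qed.

Lemma measurable_layer : measurable_fun D layer.
Proof.
apply: (eq_measurable_fun (fun t => \int[mu]_x F (x, t))%E).
  by move=> t; rewrite inE => /layerE.
apply: measurable_funTS; exact: (measurable_fun_fubini_tonelli_G F).
Qed.

(** Tonelli for the region 0 <= t < g x with weight [w]: integrating in x first gives [layer t],
    integrating in t first gives the length max(g x, 0). *)
Lemma layer_cake : (\int[lebesgue_measure]_(t in D) layer t = \int[mu]_x (w x * Num.max (g x) 0)%:E)%E.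
Proof.
transitivity (\int[lebesgue_measure]_t \int[mu]_x F (x, t))%E.
  rewrite [LHS]integral_mkcond; apply: eq_integral => t _; rewrite patchE.
  case: ifPn => [|]; first by rewrite inE => /layerE.
  rewrite notin_setE/= => /negP; rewrite -ltNge => t0.
  rewrite integral0_eq// => x _; rewrite /F indicE memNset ?mulr0//=.
  by move=> [/=]; rewrite leNgt t0.
transitivity (\int[mu]_x \int[lebesgue_measure]_t F (x, t))%E.
  by apply/esym; exact: (fubini_tonelli (m1 := mu) (m2 := (lebesgue_measure : {sigma_finite_measure set GR -> \bar R})) F).
apply: eq_integral => x _.
rewrite /F /=; under eq_integral do rewrite EFinM.
rewrite ge0_integralZl//; last 2 first.
- apply/measurable_EFinP; apply: measurable_indic.
  rewrite [X in measurable X](_ : _ = `[0, g x[%classic)//.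
  by apply/seteqP; split => t /=; rewrite in_itv/= => /andP.
- by rewrite lee_fin.
rewrite EFinM; congr (_ * _)%E.
transitivity (\int[lebesgue_measure]_t (\1_(`[0, g x[%classic) t)%:E)%E.
  apply: eq_integral => t _; rewrite !indicE (_ : ((x, t) \in _) = (t \in `[0, g x[%classic))//.
  apply/idP/idP; first by rewrite !inE/= in_itv/= => -[-> ->].
  by rewrite !inE/= in_itv/= => /andP.
transitivity (lebesgue_measure (`[0, g x[%classic : set R)).
  by rewrite integral_indic// setIT.
rewrite lebesgue_measure_itv/= lte_fin.
by rewrite /Num.max; case: ltgtP => [g0|g0|<-]; rewrite ?EFinN ?oppr0 ?sube0.
Qed.

Hypothesis ig : mu.-integrable setT (fun x => (w x * g x)%:E).

Let max_integrable : mu.-integrable setT (fun x => (w x * Num.max (g x) 0)%:E).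
Proof.
apply: le_integrable ig => //.
  apply/measurable_EFinP; apply: measurable_funM => //.
  exact: measurable_maxr.
move=> x _; rewrite lee_fin !normrM ler_wpM2l// /Num.max; case: ltP => // gx.
by rewrite normr0.
Qed.

Lemma integrable_layer : lebesgue_measure.-integrable D layer.
Proof.
apply/integrableP; split; first exact: measurable_layer.
have -> : (\int[lebesgue_measure]_(x in D) `|layer x| = \int[lebesgue_measure]_(x in D) layer x)%E.
  by apply: eq_integral => t _; rewrite gee0_abs//; apply: integral_ge0 => x _; rewrite lee_fin.
by rewrite layer_cake; exact: integrable_lty max_integrable.
Qed.

Hypothesis lfin : forall t, 0 <= t -> (layer t < +oo)%E.

Lemma fine_layer_cake : lebesgue_measure.-integrable D (fun t => (fine (layer t))%:E) /\
  Rintegral lebesgue_measure D (fun t => fine (layer t)) =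
  Rintegral mu setT (fun x => w x * Num.max (g x) 0).
Proof.
have lE : {in D, (fun t => (fine (layer t))%:E) =1 layer}.
  move=> t; rewrite inE => t0; rewrite fineK// ge0_fin_numE ?lfin//.
  by apply: integral_ge0 => x _; rewrite lee_fin.
split.
  apply: (eq_integrable measurable_nonneg layer _ _ integrable_layer).
  by move=> t tD; rewrite lE.
rewrite /Rintegral -layer_cake; congr fine.
by apply: eq_integral => t; exact: lE.
Qed.

End LayerCake.

Section LayerPair.
Variable R : realType.
Local Notation D := [set t : R | 0 <= t].

(** A relation rather than a value: the two tail integrals of [layer_int] add up over sums of set
    functions only when they are known to be integrable, so integrability travels with the value. *)
Definition is_layer (u v : R -> R) (I : R) :=
  [/\ lebesgue_measure.-integrable D (EFin \o u), lebesgue_measure.-integrable D (EFin \o v) &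
    Rintegral lebesgue_measure D u - Rintegral lebesgue_measure D v = I].

Lemma eq_is_layer u v u' v' I : {in D, u =1 u'} -> {in D, v =1 v'} ->
  is_layer u v I -> is_layer u' v' I.
Proof.
move=> uu' vv' [iu iv <-]; split.
- by apply: (eq_integrable (@measurable_nonneg R) _ _ _ iu) => t tD /=; rewrite uu'.
- by apply: (eq_integrable (@measurable_nonneg R) _ _ _ iv) => t tD /=; rewrite vv'.
- by congr (_ - _); apply: eq_Rintegral => t tD; rewrite ?uu' ?vv'.
Qed.

Lemma is_layerD u v I u' v' I' : is_layer u v I -> is_layer u' v' I' ->
  is_layer (fun t => u t + u' t) (fun t => v t + v' t) (I + I').
Proof.
move=> [iu iv <-] [iu' iv' <-]; have mD := @measurable_nonneg R; split.
- by apply: (eq_integrable mD _ _ _ (integrableD mD iu iu')) => t tD /=; rewrite ?EFinD ?EFinM.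
- by apply: (eq_integrable mD _ _ _ (integrableD mD iv iv')) => t tD /=; rewrite ?EFinD ?EFinM.
- by rewrite !RintegralD//; lra.
Qed.

Lemma is_layerZ c u v I : is_layer u v I ->
  is_layer (fun t => c * u t) (fun t => c * v t) (c * I).
Proof.
move=> [iu iv <-]; have mD := @measurable_nonneg R; split.
- by apply: (eq_integrable mD _ _ _ (integrableZl mD c iu)) => t tD /=; rewrite ?EFinD ?EFinM.
- by apply: (eq_integrable mD _ _ _ (integrableZl mD c iv)) => t tD /=; rewrite ?EFinD ?EFinM.
- by rewrite !RintegralZl//; lra.
Qed.

Lemma is_layer_measure d (T : measurableType d) (mu : {sigma_finite_measure set T -> \bar R})
    (w g : T -> R) :
  measurable_fun setT w -> measurable_fun setT g -> (forall x, 0 <= w x) ->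
  mu.-integrable setT (fun x => (w x * g x)%:E) ->
  (forall t, 0 <= t -> (layer mu w g t < +oo)%E) ->
  (forall t, 0 <= t -> (layer mu w (fun x => - g x)%R t < +oo)%E) ->
  is_layer (fun t => fine (layer mu w g t)) (fun t => fine (layer mu w (fun x => - g x)%R t))
    (Rintegral mu setT (fun x => w x * g x)).
Proof.
move=> mw mg w0 ig l1 l2.
have mg' : measurable_fun setT (fun x => - g x) by exact: measurableT_comp.
have ig' : mu.-integrable setT (fun x => (w x * - g x)%:E).
  by under eq_fun do rewrite mulrN; exact: (integrableN ig).
have [i1 e1] := fine_layer_cake mw mg w0 ig l1.
have [i2 e2] := fine_layer_cake mw mg' w0 ig' l2.
split => //; rewrite e1 e2 -RintegralB//; last 2 first.
- apply: le_integrable ig => //.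
    apply/measurable_EFinP; apply: measurable_funM => //; exact: measurable_maxr.
  move=> x _; rewrite lee_fin !normrM ler_wpM2l// /Num.max; case: ltP => // gx.
  by rewrite normr0.
- apply: le_integrable ig' => //.
    apply/measurable_EFinP; apply: measurable_funM => //; exact: measurable_maxr.
  move=> x _; rewrite lee_fin !normrM ler_wpM2l// /Num.max; case: ltP => // gx.
  by rewrite normr0.
apply: eq_Rintegral => x _; rewrite -mulrBr /Num.max; congr (_ * _).
rewrite oppr_lt0; have [g0|g0|->] := ltgtP (g x) 0; rewrite ?subr0 ?sub0r ?opprK ?oppr0 //.
Qed.

End LayerPair.

(** * Set functions that are countably additive on bounded Borel sets *)

Section Radon.
Variables (R : realType) (n : nat).
Local Notation V := 'rV[R]_n.
Local Notation D := [set t : R | 0 <= t].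

Definition rradon (m : set V -> R) := forall K : set V, bounded_set K ->
  forall A : nat -> set V, (forall j, measurable (A j)) -> (forall j, A j `<=` K) ->
  trivIset setT A ->
  (fun N => \sum_(0 <= j < N) m (A j)) @ \oo --> m (\bigcup_j A j).

Lemma rradon0 m : rradon m -> m set0 = 0.
Proof.
move=> mr.
have b0 : bounded_set (set0 : set V) by exists 0; split; [exact: num_real|move=> ? _ ? []].
have h := mr set0 b0 (fun=> set0) (fun=> measurable0) (fun=> @subset_refl _ _).
have {}h : (fun N => \sum_(0 <= j < N) m set0) @ \oo --> m set0.
  have U0 : \bigcup_(j in @setT nat) (set0 : set V) = set0 by apply: bigcup0.
  by move: h; rewrite U0; apply => i j _ _ [x []].
have /cvg_series_cvg_0 : cvgn (series (fun=> m set0 : R)) by apply/cvgP: h.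
by move/(cvg_lim (@Rhausdorff R)); rewrite lim_cst.
Qed.

Lemma rradonU m (A B : set V) : rradon m -> measurable A -> measurable B ->
  bounded_set (A `|` B) -> A `&` B = set0 -> m (A `|` B) = m A + m B.
Proof.
move=> mr mA mB bAB AB0.
have := mr _ bAB (bigcup2 A B).
rewrite bigcup2E => h.
have {h} : (fun N => \sum_(0 <= j < N) m (bigcup2 A B j)) @ \oo --> m (A `|` B).
  apply: h; [by case=> [|[|j]] //=; exact: measurable0| |by rewrite -trivIset_bigcup2].
  by case=> [|[|j]] /=; [left|right|].
rewrite -(cvg_shiftn 2) => /(cvg_lim (@Rhausdorff R)) <-.
rewrite (_ : (fun N => _) = cst (m A + m B)) ?lim_cst//.
apply/funext => N; rewrite addn2 !big_nat_recl//= big1 ?addr0// => j _.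
by rewrite rradon0.
Qed.

Lemma rradonD m m' : rradon m -> rradon m' -> rradon (fun A => m A + m' A).
Proof.
move=> mr mr' K bK A mA AK tA.
rewrite (_ : (fun N => _) = (fun N => \sum_(0 <= j < N) m (A j) + \sum_(0 <= j < N) m' (A j))).
  by apply: cvgD; [exact: mr bK _ mA AK tA|exact: mr' bK _ mA AK tA].
by apply/funext => N; rewrite big_split.
Qed.

Lemma rradonZ m c : rradon m -> rradon (fun A => c * m A).
Proof.
move=> mr K bK A mA AK tA.
rewrite (_ : (fun N => _) = (fun N => c * \sum_(0 <= j < N) m (A j))).
  by apply: cvgMr; exact: mr bK _ mA AK tA.
by apply/funext => N; rewrite mulr_sumr.
Qed.

Definition cube (r : R) : set V := box (fun=> - r) (fun=> r).

Lemma bounded_box (a b : 'I_n -> R) : bounded_set (box a b : set V).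
Proof.
exists (\sum_i (`|a i| + `|b i|)); split; first exact: num_real.
move=> M hM x bx; apply: norm_le_coord => [|i].
  by apply: le_trans (ltW hM); apply: sumr_ge0 => i _; rewrite addr_ge0.
apply: le_trans (ltW hM); rewrite (bigD1 i)//=.
have : 0 <= \sum_(j | j != i) (`|a j| + `|b j|) by apply: sumr_ge0 => j _; rewrite addr_ge0.
have /andP[] := bx i; have := ler_norm (b i); have := ler_norm (- a i).
rewrite normrN; have := normr_ge0 (a i); have := normr_ge0 (b i).
move: (\sum_(_ | _) _) (Num.norm (a i)) (Num.norm (b i)) => S na nb.
by move=> *; rewrite ler_norml; apply/andP; split; lra.
Qed.

Lemma bounded_cube r : bounded_set (cube r). Proof. exact: bounded_box. Qed.

Lemma measurable_cube r : measurable (cube r). Proof. exact: measurable_box. Qed.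

Lemma cube_norm r x : 0 <= r -> cube r x <-> `|x| <= r.
Proof.
move=> r0; split => [cx|xr i].
  by apply: norm_le_coord => // i; rewrite ler_norml; exact: cx.
by rewrite -ler_norml; apply: le_trans (coord_le_norm x i) xr.
Qed.

Section JordanRep.
Variables (m : set V -> R) (mr : rradon m) (r : R).
(** [m] is controlled on bounded sets only; its restriction to a cube is a finite charge, to which
    the Hahn decomposition applies. *)
Definition rcharge (A : set V) : \bar R := (m (A `&` cube r))%:E.

Let rcharge0 : rcharge set0 = 0%E. Proof. by rewrite /rcharge set0I rradon0. Qed.
Let rcharge_fin A : measurable A -> rcharge A \is a fin_num. Proof. by []. Qed.
Let rcharge_additive : semi_sigma_additive rcharge.
Proof.
move=> A mA tA mUA; rewrite /rcharge setI_bigcupl.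
rewrite (_ : (fun N => _) = (fun N => (\sum_(0 <= j < N) m (A j `&` cube r))%:E)); last first.
  by apply/funext => N; rewrite sumEFin.
apply: cvg_EFin; first by near=> N.
apply: mr (bounded_cube r) _ _ _ _.
- by move=> j; apply: measurableI => //; exact: measurable_cube.
- by move=> j x [].
- exact: trivIset_setIr.
Unshelve. all: by end_near. Qed.

HB.instance Definition _ := isCharge.Build _ V R rcharge rcharge0 rcharge_fin rcharge_additive.

Lemma rradon_jordan : exists mp mn : {finite_measure set V -> \bar R},
  forall A, measurable A -> A `<=` cube r -> m A = fine (mp A) - fine (mn A).
Proof.
have [P [N nuPN]] := Hahn_decomposition rcharge.
exists (jordan_pos nuPN), (jordan_neg nuPN) => A mA Ar.
have := jordan_decomp nuPN mA.
rewrite /cadd /= cscaleN1 /rcharge (setIidl Ar) => mE.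
rewrite -[LHS]/(fine (m A)%:E) mE fineB//.
- exact: (fin_num_measure (jordan_pos nuPN)).
- exact: (fin_num_measure (jordan_neg nuPN)).
Qed.
End JordanRep.

End Radon.

Section RealContinuity.
Variables (R : realType) (T : topologicalType).
Implicit Types f g : T -> R.

Lemma ctsD f g : continuous f -> continuous g -> continuous (fun x => f x + g x).
Proof. by move=> cf cg x; exact: (cvgD (cf x) (cg x)). Qed.

Lemma ctsN f : continuous f -> continuous (fun x => - f x).
Proof. by move=> cf x; exact: (cvgN (cf x)). Qed.

Lemma ctsB f g : continuous f -> continuous g -> continuous (fun x => f x - g x).
Proof. by move=> cf cg x; exact: (cvgB (cf x) (cg x)). Qed.

Lemma ctsM f g : continuous f -> continuous g -> continuous (fun x => f x * g x).
Proof. by move=> cf cg x; exact: (cvgM (cf x) (cg x)). Qed.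

Lemma cts_cst (c : R) : continuous (fun _ : T => c).
Proof. by move=> x; exact: cvg_cst. Qed.

Lemma ctsZ c f : continuous f -> continuous (fun x => c * f x).
Proof. by move=> cf; apply: ctsM => //; exact: cts_cst. Qed.

Lemma cts_min f g : continuous f -> continuous g -> continuous (fun x => Num.min (f x) (g x)).
Proof. by move=> cf cg x; apply: (@continuous_min R T f g x); [exact: cf|exact: cg]. Qed.

Lemma cts_max f g : continuous f -> continuous g -> continuous (fun x => Num.max (f x) (g x)).
Proof. by move=> cf cg x; apply: (@continuous_max R T f g x); [exact: cf|exact: cg]. Qed.

Lemma cts_sum (I : Type) (r : seq I) (P : pred I) (F : I -> T -> R) :
  (forall i, P i -> continuous (F i)) -> continuous (fun x => \sum_(i <- r | P i) F i x).
Proof.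
by apply: (@continuous_big R I +%R 0 P) => -[x y]; exact: (cvgD cvg_fst cvg_snd).
Qed.

Lemma cts_prod (I : Type) (r : seq I) (P : pred I) (F : I -> T -> R) :
  (forall i, P i -> continuous (F i)) -> continuous (fun x => \prod_(i <- r | P i) F i x).
Proof.
by apply: (@continuous_big R I *%R 1 P) => -[x y]; exact: (cvgM cvg_fst cvg_snd).
Qed.

End RealContinuity.

Section RealDCT.
Context d (T : measurableType d) (R : realType).
Variable mu : {measure set T -> \bar R}.

Lemma Rintegral_dct (f_ : nat -> T -> R) (f g : T -> R) :
  (forall j, measurable_fun setT (f_ j)) -> measurable_fun setT f ->
  {ae mu, forall x, (fun j => f_ j x) @ \oo --> f x} ->
  mu.-integrable setT (EFin \o g) -> (forall x j, `|f_ j x| <= g x) ->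
  (fun j => Rintegral mu setT (f_ j)) @ \oo --> Rintegral mu setT f.
Proof.
move=> mf_ mf f_f ig f_g.
have [|||||iF _ H] := @dominated_convergence _ T R mu setT measurableT
  (fun j x => (f_ j x)%:E) (fun x => (f x)%:E) (fun x => (g x)%:E).
- by move=> j; exact/measurable_EFinP.
- exact/measurable_EFinP.
- by apply: filterS f_f => x fx _; apply: cvg_EFin => //; exact: nearW.
- exact: ig.
- by apply: aeW => x j _ /=; rewrite lee_fin.
by apply: fine_cvg; rewrite fineK// integrable_fin_num.
Qed.

End RealDCT.

(** * Integration against signed set functions, and uniqueness *)

Section RadonRep.
Variables (R : realType) (n : nat).
Local Notation V := 'rV[R]_n.
Implicit Types (m : set V -> R) (phi : V -> R).

Lemma measurable_gt (g : V -> R) t : continuous g -> measurable [set x : V | t < g x].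
Proof.
move=> cg; apply: measurable_open_rV.
rewrite (_ : mkset _ = g @^-1` [set y | t < y])//.
by apply: open_comp; [move=> x _; exact: cg|exact: open_gt].
Qed.

Lemma measurable_lt (g : V -> R) t : continuous g -> measurable [set x : V | g x < t].
Proof.
move=> cg; apply: measurable_open_rV.
rewrite (_ : mkset _ = g @^-1` [set y | y < t])//.
by apply: open_comp; [move=> x _; exact: cg|exact: open_lt].
Qed.

Lemma sub_bounded_set (A B : set V) : A `<=` B -> bounded_set B -> bounded_set A.
Proof. by move=> AB [M [Mr BM]]; exists M; split => // N /BM BN x /AB /BN. Qed.

Definition supp_in phi (A : set V) := forall x, phi x != 0 -> A x.

Lemma compact_support_cube phi : compact_support phi ->
  exists2 r, 0 <= r & supp_in phi (cube r).
Proof.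
move=> [r pr]; exists (Num.max r 0); first by rewrite le_max lexx orbT.
move=> x px; apply/cube_norm; first by rewrite le_max lexx orbT.
by rewrite leNgt; apply: contra px; rewrite gt_max => /andP[/pr ->].
Qed.

Lemma supp_in_compact phi r : supp_in phi (cube r) -> compact_support phi.
Proof.
move=> sp; exists (Num.max r 0) => x; rewrite gt_max => /andP[rx x0].
apply/eqP; apply: contraTT rx => /sp cx; rewrite -leNgt.
have [r0|r0] := leP 0 r; first exact/cube_norm.
move: x0; rewrite (_ : x = 0) ?normr0 ?ltxx//.
apply/rowP => i; have /andP[x1 x2] := cx i.
by move: (le_trans x1 x2); rewrite leNgt => /negP[]; lra.
Qed.

Lemma supp_gt phi A t : supp_in phi A -> 0 <= t -> [set x | t < phi x] `<=` A.
Proof. by move=> sp t0 x /= tx; apply: sp; rewrite gt_eqF// (le_lt_trans t0). Qed.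

Lemma supp_lt phi A t : supp_in phi A -> 0 <= t -> [set x | phi x < - t] `<=` A.
Proof. by move=> sp t0 x /= tx; apply: sp; rewrite lt_eqF// (lt_le_trans tx)// oppr_le0. Qed.

Lemma compact_cube r : compact (cube r : set V).
Proof.
apply: bounded_closed_compact; first exact: bounded_cube.
rewrite (_ : cube r = \bigcap_(i in setT) [set x : V | - r <= x ord0 i <= r]); last first.
  by apply/seteqP; split=> [x cx i _|x cx i]; [exact: cx|exact: (cx i I)].
apply: closed_bigI => i _.
rewrite (_ : mkset _ = (fun x : V => x ord0 i) @^-1` `[- r, r]%classic); last first.
  by apply/seteqP; split => x /=; rewrite in_itv.
by apply: closed_comp; [move=> x _; exact: coord_continuous|exact: interval_closed].
Qed.

Lemma continuous_bounded_cube (g : V -> R) r : continuous g ->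
  exists2 M, 0 < M & forall x, cube r x -> `|g x| <= M.
Proof.
move=> cg; have /compact_bounded[M [_ gM]] : compact (g @` cube r).
  by apply: continuous_compact; [exact: continuous_subspaceT|exact: compact_cube].
exists (`|M| + 1); first by rewrite ltr_wpDl.
move=> x cx; apply: (gM (`|M| + 1)); last by exists x.
by rewrite (le_lt_trans (ler_norm _))// ltrDl.
Qed.

Lemma continuous_supp_bounded phi r : continuous phi -> supp_in phi (cube r) ->
  exists2 M, 0 < M & forall x, `|phi x| <= M.
Proof.
move=> cp sp; have [M M0 pM] := continuous_bounded_cube r cp.
exists M => // x; have [->|/sp/pM//] := eqVneq (phi x) 0; by rewrite normr0 ltW.
Qed.

Lemma finite_measure_integrable (mu : {finite_measure set V -> \bar R}) phi M :
  continuous phi -> (forall x, `|phi x| <= M) -> mu.-integrable setT (EFin \o phi).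
Proof.
move=> cp pM; apply: measurable_bounded_integrable => //.
- by rewrite ltey_eq fin_num_measure.
- exact: measurable_continuous_rV.
- exists M; split; first exact: num_real.
  by move=> y My x _ /=; apply: le_trans (pM x) (ltW My).
Qed.

Lemma layer_finite (mu : {finite_measure set V -> \bar R}) phi t :
  continuous phi -> layer mu (cst 1) phi t = mu [set x | t < phi x].
Proof.
move=> cp; transitivity (\int[mu]_(x in [set x | (t < phi x)%R]) (cst 1%E x))%E => //.
by rewrite integral_cst ?mul1e//; exact: measurable_gt.
Qed.

(** For functions supported in the cube, [layer_int] becomes a difference of two integrals against
    finite measures; linearity in the function and limit theorems come from there. *)
Lemma rradon_rep m r : rradon m -> exists mp mn : {finite_measure set V -> \bar R},
  (forall A, measurable A -> A `<=` cube r -> m A = fine (mp A) - fine (mn A)) /\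
  forall phi, continuous phi -> supp_in phi (cube r) ->
    is_layer (fun t => m [set x | t < phi x]) (fun t => m [set x | phi x < - t])
      (Rintegral mp setT phi - Rintegral mn setT phi).
Proof.
move=> mr; have [mp [mn mE]] := rradon_jordan mr r.
exists mp, mn; split => // phi cp sp.
have [M M0 pM] := continuous_supp_bounded cp sp.
have cNp : continuous (fun x => - phi x) by move=> x; exact: (cvgN (cp x)).
have lay (mu : {finite_measure set V -> \bar R}) :
    is_layer (fun t => fine (mu [set x | t < phi x])) (fun t => fine (mu [set x | phi x < - t]))
      (Rintegral mu setT phi).
  have ip := finite_measure_integrable mu cp pM.
  have := @is_layer_measure R _ V mu (cst 1) phi.
  rewrite (_ : (fun x => _ * _) = phi); last by apply/funext => x; rewrite mul1r.
  move=> h; apply: (eq_is_layer _ _ (h _ _ _ _ _ _)) => //.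
  - by move=> t _; rewrite layer_finite.
  - by move=> t _; rewrite layer_finite//; congr (fine (mu _)); apply/seteqP; split => x /=; rewrite ltrNr.
  - exact: measurable_continuous_rV.
  - by rewrite (_ : (fun x => _) = EFin \o phi)//; apply/funext => x /=; rewrite mul1r.
  - by move=> t _; rewrite layer_finite// ltey_eq fin_num_measure//; exact: measurable_gt.
  - by move=> t _; rewrite layer_finite// ltey_eq fin_num_measure//; exact: measurable_gt.
have := is_layerD (lay mp) (is_layerZ (-1) (lay mn)); rewrite mulN1r.
apply: eq_is_layer => t; rewrite inE /= => t0; rewrite mulN1r mE//.
- exact: measurable_gt.
- exact: supp_gt.
- exact: measurable_lt.
- exact: supp_lt.
Qed.

Lemma layer_intE m phi I :
  is_layer (fun t => m [set x | t < phi x]) (fun t => m [set x | phi x < - t]) I ->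
  layer_int m phi = I.
Proof. by case. Qed.

Lemma rradon_is_layer m phi : rradon m -> continuous phi -> compact_support phi ->
  is_layer (fun t => m [set x | t < phi x]) (fun t => m [set x | phi x < - t]) (layer_int m phi).
Proof.
move=> mr cp /compact_support_cube[r _ sp].
have [mp [mn [_ /(_ _ cp sp) h]]] := rradon_rep r mr.
by rewrite (layer_intE h).
Qed.

Lemma layer_intD m m' phi : rradon m -> rradon m' -> continuous phi -> compact_support phi ->
  layer_int (fun A => m A + m' A) phi = layer_int m phi + layer_int m' phi.
Proof.
move=> mr mr' cp sp; apply: (@layer_intE (fun A => m A + m' A)).
exact: is_layerD (rradon_is_layer mr cp sp) (rradon_is_layer mr' cp sp).
Qed.

Lemma layer_intZ m c phi : rradon m -> continuous phi -> compact_support phi ->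
  layer_int (fun A => c * m A) phi = c * layer_int m phi.
Proof.
move=> mr cp sp; apply: (@layer_intE (fun A => c * m A)).
exact: is_layerZ c _ _ _ (rradon_is_layer mr cp sp).
Qed.

Lemma eq_layer_int m m' phi r : continuous phi -> supp_in phi (cube r) ->
  (forall A : set V, bounded_set A -> measurable A -> A `<=` [set x | phi x != 0] -> m A = m' A) ->
  layer_int m phi = layer_int m' phi.
Proof.
move=> cp sp mm'; congr (_ - _); apply: eq_Rintegral => t; rewrite inE /= => t0.
  apply: mm'; [|exact: measurable_gt|exact: supp_gt].
  by apply: (sub_bounded_set _ (@bounded_cube _ _ r)); exact: supp_gt.
apply: mm'; [|exact: measurable_lt|exact: supp_lt].
by apply: (sub_bounded_set _ (@bounded_cube _ _ r)); exact: supp_lt.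
Qed.

Lemma layer_int_funZ m c phi : rradon m -> continuous phi -> compact_support phi ->
  layer_int m (fun x => c * phi x) = c * layer_int m phi.
Proof.
move=> mr cp /compact_support_cube[r _ sp].
have [mp [mn [_ h]]] := rradon_rep r mr.
have cp' : continuous (fun x => c * phi x) by move=> x; exact: (cvgM (cvg_cst c) (cp x)).
have sp' : supp_in (fun x => c * phi x) (cube r).
  by move=> x; rewrite mulf_eq0 negb_or => /andP[_ /sp].
have [M M0 pM] := continuous_supp_bounded cp sp.
rewrite (layer_intE (h _ cp sp)) (layer_intE (h _ cp' sp')).
rewrite !RintegralZl// ?mulrBr//.
- exact: finite_measure_integrable pM.
- exact: finite_measure_integrable pM.
Qed.

(** Level sets of functions that agree on the carrier [H] meet [H] in the same set, and [m] ignores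
    what lies outside [H]. *)
Lemma layer_int_concentrated m (H : set V) phi psi : rradon m ->
  measurable H -> (forall A : set V, bounded_set A -> measurable A -> A `&` H = set0 -> m A = 0) ->
  continuous phi -> continuous psi -> compact_support phi -> compact_support psi ->
  (forall x, H x -> phi x = psi x) -> layer_int m phi = layer_int m psi.
Proof.
move=> mr mH m0 cp cq /compact_support_cube[r _ sp] /compact_support_cube[r' _ sq] pq.
have mI (A : set V) K : measurable A -> A `<=` cube K -> m A = m (A `&` H).
  move=> mA AK; have bA := sub_bounded_set AK (@bounded_cube _ _ K).
  have AE : (A `&` H) `|` (A `\` H) = A.
    apply/seteqP; split => x; first by move=> [[]|[]].
    by move=> Ax; have [Hx|Hx] := pselect (H x); [left|right].
  rewrite -[in LHS]AE rradonU//.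
  - rewrite (m0 (A `\` H)) ?addr0//.
    + by apply: sub_bounded_set bA => x [].
    + exact: measurableD.
    + by apply/seteqP; split => x // [[_ xH] /xH].
  - exact: measurableI.
  - exact: measurableD.
  - by rewrite AE.
  - by apply/seteqP; split => x // [[_ xH] [_ /(_ xH)]].
congr (_ - _); apply: eq_Rintegral => t; rewrite inE /= => t0.
  rewrite (mI _ r (measurable_gt _ cp) (supp_gt sp t0)) (mI _ r' (measurable_gt _ cq) (supp_gt sq t0)).
  by congr m; apply/seteqP; split => x /= [h Hx]; split => //; move: h; rewrite pq.
rewrite (mI _ r (measurable_lt _ cp) (supp_lt sp t0)) (mI _ r' (measurable_lt _ cq) (supp_lt sq t0)).
by congr m; apply/seteqP; split => x /= [h Hx]; split => //; move: h; rewrite pq.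
Qed.

Definition obox (a b : 'I_n -> R) : set V := [set x | forall i, a i < x ord0 i < b i].

Lemma measurable_obox a b : measurable (obox a b).
Proof.
rewrite (_ : obox a b = \bigcap_(i in setT) [set x : V | a i < x ord0 i < b i]); last first.
  by apply/seteqP; split=> [x ox i _|x ox i]; [exact: ox|exact: (ox i I)].
apply: fin_bigcap_measurable => // i _.
rewrite (_ : mkset _ = [set x : V | a i < x ord0 i] `&` [set x : V | x ord0 i < b i]); last first.
  by apply/seteqP; split => x /=; [move=> /andP|move=> [-> ->]].
by apply: measurableI; [apply: measurable_gt|apply: measurable_lt]; exact: coord_continuous.
Qed.

(** Truncated distances to the faces, rising to the indicator of the open box as [j] grows. *)
Definition box_bump (a b : 'I_n -> R) (j : nat) (x : V) : R :=
  \prod_(i < n) Num.min 1 (Num.max 0 (j%:R * Num.min (x ord0 i - a i) (b i - x ord0 i))).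

Lemma continuous_box_bump a b j : continuous (box_bump a b j).
Proof.
have cc i : continuous (fun x : V => x ord0 i) by exact: coord_continuous.
apply: cts_prod => i _; apply: cts_min; first exact: cts_cst.
apply: cts_max; first exact: cts_cst.
by apply: ctsZ; apply: cts_min; apply: ctsB => //; exact: cts_cst.
Qed.

Lemma box_bump_itv a b j x : 0 <= box_bump a b j x <= 1.
Proof.
apply/andP; split; first by apply: prodr_ge0 => i _; rewrite le_min ler01 le_max lexx.
by apply: prodr_ile1 => i _; rewrite le_min ler01 le_max lexx ge_min lexx.
Qed.

Lemma box_bump_supp a b j : supp_in (box_bump a b j) (obox a b).
Proof.
move=> x; apply: contraNP => /existsNP[i /negP xi].
rewrite /box_bump (bigD1 i)//= (max_l (y := _ * _)) ?(min_r ler01) ?mul0r//.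
rewrite mulr_ge0_le0// ge_min !subr_le0 !leNgt -negb_and.
by [].
Qed.

Lemma box_bump_cvg a b x : (fun j => box_bump a b j x) @ \oo --> (\1_(obox a b) x : R).
Proof.
rewrite indicE; have [xo|xo] := pselect (obox a b x); last first.
  rewrite memNset// (_ : (fun j => _) = cst 0); first exact: cvg_cst.
  by apply/funext => j; apply/eqP; apply: contra_notT xo => /box_bump_supp.
rewrite mem_set//; apply: cvg_near_cst.
have : \forall j \near \oo, forall i : 'I_n,
    1 <= j%:R * Num.min (x ord0 i - a i) (b i - x ord0 i).
  apply: filter_forall => i; have /andP[xa xb] := xo i.
  have p : 0 < Num.min (x ord0 i - a i) (b i - x ord0 i) by rewrite lt_min !subr_gt0 xa xb.
  near=> j; rewrite -ler_pdivrMr// ltW//.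
  by near: j; exact: nbhs_infty_gtr.
apply: filterS => j xj; apply: big1 => i _.
by rewrite (max_r (le_trans ler01 (xj i))) (min_l (xj i)).
Unshelve. all: by end_near. Qed.

Lemma layer_int_bump_cvg m a b : rradon m ->
  (fun j => layer_int m (box_bump a b j)) @ \oo --> m (obox a b).
Proof.
move=> mr; have [r0 _ ob] := bounded_sub_box (bounded_box a b).
have {}ob : obox a b `<=` cube r0.
  by move=> x ox; apply: ob => i; have /andP[? ?] := ox i; rewrite !ltW.
have [mp [mn [mE h]]] := rradon_rep r0 mr.
rewrite mE//; last exact: measurable_obox.
rewrite (_ : (fun j => _) = (fun j => Rintegral mp setT (box_bump a b j) - Rintegral mn setT (box_bump a b j))); last first.
  apply/funext => j; apply: layer_intE; apply: h; first exact: continuous_box_bump.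
  by move=> x /box_bump_supp; exact: ob.
have lim (mu : {finite_measure set V -> \bar R}) :
    (fun j => Rintegral mu setT (box_bump a b j)) @ \oo --> fine (mu (obox a b)).
  have mo := measurable_obox a b.
  have -> : fine (mu (obox a b)) = Rintegral mu setT (\1_(obox a b)).
    by rewrite /Rintegral integral_indic// setIT.
  apply: (@Rintegral_dct _ _ _ _ _ _ (cst 1)).
  - by move=> j; apply: measurable_continuous_rV => //; exact: continuous_box_bump.
  - exact: measurable_indic.
  - by apply: aeW => x; exact: box_bump_cvg.
  - exact: finite_measure_integrable_cst.
  - by move=> x j; have /andP[p0 p1] := box_bump_itv a b j x; rewrite ger0_norm.
by apply: cvgB; exact: lim.
Qed.

(** The pi-lambda argument, carried out inside one bounded open box [K] because the set functions
    are controlled on bounded sets only. *)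
Lemma rradon_eq_obox m1 m2 : rradon m1 -> rradon m2 ->
  (forall a b, m1 (obox a b) = m2 (obox a b)) ->
  forall B : set V, bounded_set B -> measurable B -> m1 B = m2 B.
Proof.
move=> r1 r2 m12 B bB mB.
have [M M0 BM] := bounded_sub_box bB.
pose K := obox (fun=> - (M + 1)) (fun=> M + 1).
have mK : measurable K by exact: measurable_obox.
have bK : bounded_set K.
  apply: sub_bounded_set (@bounded_cube _ _ (M + 1)) => x Kx i.
  by have /andP[? ?] := Kx i; rewrite !ltW.
have BK : B `<=` K.
  by move=> x /BM xM i; have /andP[x1 x2] := xM i; apply/andP; split; lra.
pose G := [set A : set V | measurable A /\ m1 (A `&` K) = m2 (A `&` K)].
pose P := [set A : set V | exists ab : ('I_n -> R) * ('I_n -> R), A = obox ab.1 ab.2].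
have bI (A : set V) : bounded_set (A `&` K) by apply: sub_bounded_set bK => x [].
have dG : dynkin G.
  split.
  - by split => //; rewrite setTI; exact: m12.
  - move=> A [mA mAE]; split; first exact: measurableC.
    have sp m : rradon m -> m (~` A `&` K) = m K - m (A `&` K).
      move=> mr; apply/eqP; rewrite eq_sym subr_eq eq_sym -rradonU//.
      - by rewrite -setIUl setvU setTI.
      - by apply: measurableI => //; exact: measurableC.
      - exact: measurableI.
      - by rewrite -setIUl setvU setTI.
      - by apply/seteqP; split => x // [[nA _] [/nA]].
    by rewrite !sp// mAE m12.
  - move=> F tF GF; split; first by apply: bigcupT_measurable => j; case: (GF j).
    rewrite setI_bigcupl.
    have c1 := r1 K bK (fun j => F j `&` K).
    have c2 := r2 K bK (fun j => F j `&` K).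
    have tFK : trivIset setT (fun j => F j `&` K) by exact: trivIset_setIr.
    have mFK j : measurable (F j `&` K) by apply: measurableI => //; case: (GF j).
    have FK j : F j `&` K `<=` K by move=> x [].
    have := c1 mFK FK tFK; have := c2 mFK FK tFK.
    rewrite (_ : (fun N => \sum_(0 <= j < N) m1 (F j `&` K)) = (fun N => \sum_(0 <= j < N) m2 (F j `&` K))).
      by move=> /(cvg_lim (@Rhausdorff R)) <- /(cvg_lim (@Rhausdorff R)) <-.
    by apply/funext => N; apply: eq_bigr => j _; case: (GF j).
have PI : setI_closed P.
  move=> _ _ [[a b] ->] [[a' b'] ->] /=.
  exists (fun i => Num.max (a i) (a' i), fun i => Num.min (b i) (b' i)).
  apply/seteqP; split => [x [h h'] i|x h].
    by rewrite gt_max lt_min; have /andP[-> ->] := h i; have /andP[-> ->] := h' i.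
  by split=> i; have := h i; rewrite gt_max lt_min => /andP[/andP[h1 h2] /andP[h3 h4]]; apply/andP.
have PG : P `<=` G.
  move=> _ [[a b] ->] /=; split; first exact: measurable_obox.
  by have [[a' b'] ->] := PI _ _ (ex_intro _ (a, b) erefl) (ex_intro _ (_, _) erefl : P K).
have : <<s P >> `<=` G.
  by rewrite -setI_closed_g_dynkin_g_sigma_algebra//; exact: smallest_sub.
have mP : measurable `<=` <<s P >>.
  apply: smallest_sub; first exact: smallest_sigma_algebra.
  move=> O oO; pose F (ab : {ffun 'I_n -> rat * rat}) : set V :=
    let B := obox (fun i => ratr (ab i).1) (fun i => ratr (ab i).2) in
    if `[< B `<=` O >] then B else set0.
  have -> : O = \bigcup_ab F ab.
    apply/seteqP; split=> [x Ox|x [ab _]]; last by rewrite /F; case: asboolP => // BO /BO.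
    have [ab [xab abO]] := open_sub_rational_box oO Ox.
    exists ab => //; rewrite /F; case: asboolP => // -[].
    by move=> y yab; apply: abO => i; have /andP[? ?] := yab i; rewrite !ltW.
  have [S0 _ Scup] := @smallest_sigma_algebra _ setT P.
  have SF ab : <<s P >> (F ab).
    rewrite /F; case: asboolP => // _; apply: sub_sigma_algebra; by eexists (_, _).
  pose G' k := if unpickle k is Some ab then F ab else set0.
  have -> : \bigcup_ab F ab = \bigcup_k G' k.
    apply/seteqP; split=> [x [ab _ Fx]|x [k _]].
      by exists (pickle ab) => //; rewrite /G' pickleK.
    by rewrite /G'; case: unpickle => // ab Fx; exists ab.
  by apply: (Scup) => k; rewrite /G'; case: unpickle.
by move=> /(_ _ (mP _ mB))[_]; rewrite setIidl.
Qed.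

Lemma rradon_eq m1 m2 : rradon m1 -> rradon m2 ->
  (forall phi, continuous phi -> compact_support phi -> layer_int m1 phi = layer_int m2 phi) ->
  forall B : set V, bounded_set B -> measurable B -> m1 B = m2 B.
Proof.
move=> r1 r2 m12; apply: rradon_eq_obox => // a b.
have := layer_int_bump_cvg (a := a) (b := b) r1; have := layer_int_bump_cvg (a := a) (b := b) r2.
rewrite (_ : (fun j => layer_int m1 _) = (fun j => layer_int m2 (box_bump a b j))).
  by move=> /(cvg_lim (@Rhausdorff R)) <- /(cvg_lim (@Rhausdorff R)) <-.
apply/funext => j; apply: m12; first exact: continuous_box_bump.
have [r _ ob] := bounded_sub_box (bounded_box a b).
apply: (@supp_in_compact _ r) => x /box_bump_supp ox; apply: ob => i.
by have /andP[? ?] := ox i; rewrite !ltW.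
Qed.

End RadonRep.

(** * Valuations and ridge perturbations *)

Section ConvexFunctions.
Variables (R : realType) (n : nat).
Local Notation V := 'rV[R]_n.
Implicit Types (f g : V -> R) (x y : V).

Lemma innerD y x x' : inner y (x + x') = inner y x + inner y x'.
Proof. by rewrite /inner -big_split; apply: eq_bigr => i _; rewrite mxE mulrDr. Qed.
Lemma innerZ y c x : inner y (c *: x) = c * inner y x.
Proof. by rewrite /inner mulr_sumr; apply: eq_bigr => i _; rewrite mxE mulrCA. Qed.
Lemma innerN y x : inner y (- x) = - inner y x.
Proof. by rewrite -scaleN1r innerZ mulN1r. Qed.
Lemma innerB y x x' : inner y (x - x') = inner y x - inner y x'.
Proof. by rewrite innerD innerN. Qed.
Lemma innerC y x : inner y x = inner x y.
Proof. by apply: eq_bigr => i _; rewrite mulrC. Qed.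
Lemma innerDl y y' x : inner (y + y') x = inner y x + inner y' x.
Proof. by rewrite !(innerC _ x) innerD. Qed.
Lemma innerZl y c x : inner (c *: y) x = c * inner y x.
Proof. by rewrite !(innerC _ x) innerZ. Qed.
Lemma innerNl y x : inner (- y) x = - inner y x.
Proof. by rewrite !(innerC _ x) innerN. Qed.
Lemma inner0 y : inner y 0 = 0.
Proof. by rewrite -(scale0r 0) innerZ mul0r. Qed.
Lemma inner0l y : inner 0 y = 0.
Proof. by rewrite innerC inner0. Qed.

Lemma inner_bound y x : `|inner y x| <= (\sum_i `|y ord0 i|) * `|x|.
Proof.
rewrite mulr_suml; apply: le_trans (ler_norm_sum _ _ _) _; apply: ler_sum => i _.
by rewrite normrM ler_wpM2l// coord_le_norm.
Qed.

Lemma continuous_inner y : continuous (inner y).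
Proof.
apply: cts_sum => i _; apply: ctsZ; exact: coord_continuous.
Qed.

Lemma convex_ext f g : f =1 g -> convex_fun f -> convex_fun g.
Proof. by move=> fg cf x y t t01; rewrite -!fg; exact: cf. Qed.

Lemma convex_funD f g : convex_fun f -> convex_fun g -> convex_fun (fun x => f x + g x).
Proof. by move=> cf cg x y t t01; have := cf x y t t01; have := cg x y t t01; lra. Qed.

Lemma convex_funZ c f : 0 <= c -> convex_fun f -> convex_fun (fun x => c * f x).
Proof.
move=> c0 cf x y t t01; rewrite mulrCA [_ * (c * f y)]mulrCA -mulrDr ler_wpM2l//; exact: cf.
Qed.

Lemma convex_fun_cst c : convex_fun (fun _ : V => c).
Proof. by move=> x y t t01; lra. Qed.

Lemma convex_fun_max f g : convex_fun f -> convex_fun g -> convex_fun (fun x => Num.max (f x) (g x)).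
Proof.
move=> cf cg x y t t01; rewrite ge_max; have [t0 t1] := andP t01.
have t1' : 0 <= 1 - t by rewrite subr_ge0.
have h (a b : R) z : Num.max a b * z = Num.max a b * z by [].
apply/andP; split.
  apply: le_trans (cf _ _ _ t01) _; apply: lerD; apply: ler_wpM2l => //; rewrite le_max lexx//.
by apply: le_trans (cg _ _ _ t01) _; apply: lerD; apply: ler_wpM2l => //; rewrite le_max lexx orbT.
Qed.

Lemma convex_fun_sum (I : Type) (r : seq I) (P : pred I) (F : I -> V -> R) :
  (forall i, P i -> convex_fun (F i)) -> convex_fun (fun x => \sum_(i <- r | P i) F i x).
Proof.
move=> cF; elim: r => [|i r ih].
  by apply: convex_ext (convex_fun_cst 0) => x; rewrite big_nil.
have [Pi|Pi] := boolP (P i).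
  by apply: convex_ext (convex_funD (cF i Pi) ih) => x; rewrite big_cons Pi.
by apply: convex_ext ih => x; rewrite big_cons (negbTE Pi).
Qed.

Lemma convex_inner y : convex_fun (inner y).
Proof. by move=> x z t _; rewrite innerD !innerZ. Qed.

Lemma convex_affine l : affine_fun l -> @convex_fun R n l.
Proof.
move=> [y [c lE]]; apply: (@convex_ext (fun x => inner y x + c)); first by move=> x; rewrite lE.
exact: convex_funD (convex_inner y) (convex_fun_cst c).
Qed.

Definition convex1 (g : R -> R) := forall a b t, 0 <= t <= 1 ->
  g (t * a + (1 - t) * b) <= t * g a + (1 - t) * g b.

Lemma convex_ridge (g : R -> R) y : convex1 g -> convex_fun (fun x => g (inner y x)).
Proof. by move=> cg x z t t01; rewrite innerD !innerZ; exact: cg. Qed.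

(** The tangent at the mean point m, from 1 + u <= exp u. *)
Lemma convex1_expR : convex1 expR.
Proof.
move=> a b t /andP[t0 t1]; set m := t * a + _.
have h z : expR m * (1 + (z - m)) <= expR z.
  have -> : expR z = expR m * expR (z - m) by rewrite -expRD addrC subrK.
  by rewrite ler_wpM2l ?expR_ge0// expR_ge1Dx.
have := h a; have := h b; have t1' : 0 <= 1 - t by lra.
move=> /(ler_wpM2l t1') hb /(ler_wpM2l t0) ha; apply: le_trans (lerD ha hb).
rewrite le_eqVlt; apply/orP; left; apply/eqP.
by rewrite /m; ring.
Qed.

Lemma convex1_sqr : convex1 (fun t => t ^+ 2 / 2).
Proof.
move=> a b t /andP[t0 t1]; rewrite -subr_ge0.
rewrite (_ : _ - _ = t * (1 - t) * (a - b) ^+ 2 / 2); last by field.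
by rewrite divr_ge0// mulr_ge0 ?sqr_ge0// mulr_ge0// subr_ge0.
Qed.

Definition ramp (s t : R) : R := Num.max (t - s) 0.

Lemma convex1_ramp s : convex1 (ramp s).
Proof.
move=> a b t /andP[t0 t1]; rewrite /ramp ge_max; have t1' : 0 <= 1 - t by lra.
have m1 c : c - s <= Num.max (c - s) 0 by rewrite le_max lexx.
have m2 c : 0 <= Num.max (c - s) 0 by rewrite le_max lexx orbT.
apply/andP; split; last by rewrite addr_ge0// mulr_ge0.
apply: le_trans (lerD (ler_wpM2l t0 (m1 a)) (ler_wpM2l t1' (m1 b))).
by rewrite le_eqVlt; apply/orP; left; apply/eqP; ring.
Qed.

End ConvexFunctions.

(** * Jumps caused by ramps along a linear form *)

Section Valuations.
Variables (R : realType) (n : nat).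
Local Notation V := 'rV[R]_n.

(** Countable additivity and weak continuity are bundled with the algebraic axioms, so that
    operators built in the proof, [maf] and combinations of mixed measures, can be shown to be
    valuations and fed to the same theory. *)
Record maval (k : nat) (Psi : (V -> R) -> set V -> R) : Prop := Maval {
  mv_radon : forall f, convex_fun f -> rradon (Psi f);
  mv_cts : forall fs f, (forall j, convex_fun (fs j)) -> convex_fun f -> loc_unif_cvg fs f ->
    forall phi, continuous phi -> compact_support phi ->
    (fun j => layer_int (Psi (fs j)) phi) @ \oo --> layer_int (Psi f) phi;
  mv_val : forall f g, convex_fun f -> convex_fun g ->
    convex_fun (fun x => Num.min (f x) (g x)) -> forall B : set V, bounded_set B -> measurable B ->
    Psi (fun x => Num.max (f x) (g x)) B + Psi (fun x => Num.min (f x) (g x)) B = Psi f B + Psi g B;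
  mv_aff : forall f l, convex_fun f -> affine_fun l -> forall B : set V, bounded_set B -> measurable B ->
    Psi (fun x => f x + l x) B = Psi f B;
  mv_loc : forall f h (U : set V), convex_fun f -> convex_fun h -> open U ->
    (forall x, U x -> f x = h x) ->
    forall B : set V, bounded_set B -> measurable B -> Psi f (B `&` U) = Psi h (B `&` U);
  mv_trans : forall f (x : V), convex_fun f -> forall B : set V, bounded_set B -> measurable B ->
    Psi (fun y => f (y + x)) B = Psi f [set b + x | b in B];
  mv_hom : forall f (t : R), convex_fun f -> 0 <= t -> forall B : set V, bounded_set B -> measurable B ->
    Psi (fun x => t * f x) B = t ^+ k * Psi f B }.

Lemma layer_int_eq (m m' : set V -> R) phi : continuous phi -> compact_support phi ->
  (forall B : set V, bounded_set B -> measurable B -> m B = m' B) -> layer_int m phi = layer_int m' phi.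
Proof.
move=> cp /compact_support_cube[r _ sp] mm'; apply: (eq_layer_int cp sp) => A bA mA _; exact: mm'.
Qed.

Lemma rradonB (m m' : set V -> R) : rradon m -> rradon m' -> rradon (fun A => m A - m' A).
Proof.
move=> mr mr'; rewrite (_ : (fun A => _) = (fun A => m A + (-1) * m' A)).
  by apply: rradonD => //; exact: rradonZ.
by apply/funext => A; rewrite mulN1r.
Qed.

Lemma layer_intB (m m' : set V -> R) phi : rradon m -> rradon m' -> continuous phi -> compact_support phi ->
  layer_int (fun A => m A - m' A) phi = layer_int m phi - layer_int m' phi.
Proof.
move=> mr mr' cp sp; rewrite (_ : (fun A => _) = (fun A => m A + (-1) * m' A)).
  by rewrite layer_intD ?layer_intZ// ?mulN1r//; exact: rradonZ.
by apply/funext => A; rewrite mulN1r.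
Qed.

Variables (k : nat) (Psi : (V -> R) -> set V -> R) (mv : maval k Psi).
Variables (y : V).
Implicit Types (F : V -> R) (phi : V -> R).

Let ramp_convex c s : 0 <= c -> convex_fun (fun x : V => c * ramp s (inner y x)).
Proof. by move=> c0; apply: convex_funZ => //; apply: convex_ridge; exact: convex1_ramp. Qed.

Let rampN_convex c s : 0 <= c -> convex_fun (fun x : V => c * Num.max (s - inner y x) 0).
Proof.
move=> c0; apply: convex_funZ => //; apply: convex_fun_max; last exact: convex_fun_cst.
apply: (@convex_ext _ _ (fun x => s + inner (- y) x)) => [x|]; first by rewrite innerNl.
by apply: convex_funD; [exact: convex_fun_cst|exact: convex_inner].
Qed.

Definition rampsum F (r : seq (R * R)) : V -> R := fun x => F x + \sum_(cs <- r) cs.1 * ramp cs.2 (inner y x).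

Lemma rampsum_convex F r : convex_fun F -> (forall cs, cs \in r -> 0 <= cs.1) -> convex_fun (rampsum F r).
Proof.
move=> cF r0; apply: convex_funD => //; rewrite /rampsum.
apply: (@convex_ext _ _ (fun x => \sum_(cs <- r | cs \in r) cs.1 * ramp cs.2 (inner y x))).
  by move=> x; rewrite -big_seq.
by apply: convex_fun_sum => cs csr; apply: ramp_convex; exact: r0.
Qed.

Lemma rampE (s t : R) : ramp s t = Num.max (s - t) 0 + (t - s).
Proof. rewrite /ramp; have [h|h] := leP 0 (t - s); have [h'|h'] := leP 0 (s - t); lra. Qed.

(* Up to an affine function the old ramps live on the left of [s] and the new one on its right,
   so that the maximum of the two perturbations of [F] is their sum and the minimum is [F]. *)
Lemma val_rampsum_rcons F r c s : convex_fun F -> (forall cs, cs \in r -> 0 <= cs.1 /\ cs.2 <= s) ->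
  0 <= c -> forall B : set V, bounded_set B -> measurable B ->
  Psi (rampsum F (rcons r (c, s))) B - Psi F B =
  (Psi (rampsum F r) B - Psi F B) + (Psi (rampsum F [:: (c, s)]) B - Psi F B).
Proof.
move=> cF r0 c0 B bB mB.
pose u x : R := F x + \sum_(cs <- r) cs.1 * Num.max (cs.2 - inner y x) 0.
pose v x : R := F x + c * ramp s (inner y x).
have u0 x : 0 <= \sum_(cs <- r) cs.1 * Num.max (cs.2 - inner y x) 0.
  rewrite big_seq; apply: sumr_ge0 => cs /r0[c1 _].
  by rewrite mulr_ge0// le_max lexx orbT.
have v0 x : 0 <= c * ramp s (inner y x) by rewrite mulr_ge0// le_max lexx orbT.
have uv x : (\sum_(cs <- r) cs.1 * Num.max (cs.2 - inner y x) 0 = 0) \/ c * ramp s (inner y x) = 0.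
  have [h|h] := leP (inner y x) s.
    by right; rewrite /ramp max_r ?mulr0// subr_le0.
  left; rewrite big_seq; apply: big1 => cs /r0[_ cs2]; rewrite max_r ?mulr0//; lra.
have cu : convex_fun u.
  apply: convex_funD => //.
  apply: (@convex_ext _ _ (fun x => \sum_(cs <- r | cs \in r) cs.1 * Num.max (cs.2 - inner y x) 0)).
    by move=> x; rewrite -big_seq.
  by apply: convex_fun_sum => cs /r0[c1 _]; exact: rampN_convex.
have cv : convex_fun v by apply: convex_funD => //; exact: ramp_convex.
have minE : (fun x => Num.min (u x) (v x)) = F.
  apply/funext => x; rewrite /u /v; have := u0 x; have := v0 x; case: (uv x) => ->; rewrite addr0 => h1 h2.
    by rewrite min_l// lerDl.
  by rewrite min_r// lerDl.
pose a x : R := \sum_(cs <- r) cs.1 * (inner y x - cs.2).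
have aa : affine_fun a.
  exists ((\sum_(cs <- r) cs.1) *: y), (- \sum_(cs <- r) cs.1 * cs.2) => x.
  rewrite innerZl mulr_suml -sumrB; apply: eq_bigr => cs _; by rewrite mulrBr.
have sumE x : \sum_(cs <- r) cs.1 * ramp cs.2 (inner y x) =
    \sum_(cs <- r) cs.1 * Num.max (cs.2 - inner y x) 0 + a x.
  by rewrite /a -big_split /=; apply: eq_bigr => cs _; rewrite rampE mulrDr.
have maxE x : rampsum F (rcons r (c, s)) x = Num.max (u x) (v x) + a x.
  rewrite /rampsum -cats1 big_cat big_seq1 /= sumE /u /v.
  have := u0 x; have := v0 x; case: (uv x) => ->; rewrite ?addr0 ?add0r => h1 h2.
    by rewrite max_r ?lerDl//; ring.
  by rewrite max_l ?lerDl//; ring.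
have cmax := convex_fun_max cu cv.
rewrite (_ : rampsum F (rcons _ _) = (fun x => Num.max (u x) (v x) + a x)); last exact/funext.
rewrite (mv_aff mv cmax aa bB mB).
rewrite (_ : rampsum F r = (fun x => u x + a x)); last by apply/funext => x; rewrite /rampsum sumE /u addrA.
rewrite (mv_aff mv cu aa bB mB).
rewrite (_ : rampsum F [:: _] = v); last by apply/funext => x; rewrite /rampsum big_seq1.
have := mv_val mv cu cv; rewrite minE => /(_ cF B bB mB); lra.
Qed.

Definition ramp_jump F phi c s := layer_int (Psi (rampsum F [:: (c, s)])) phi - layer_int (Psi F) phi.

Section JumpLinear.
Variables (F phi : V -> R).
Hypotheses (cF : convex_fun F) (cp : continuous phi) (sp : compact_support phi).

Let radF r : (forall cs, cs \in r -> 0 <= cs.1) -> rradon (Psi (rampsum F r)).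
Proof. by move=> r0; apply: (mv_radon mv); exact: rampsum_convex. Qed.
Let radF0 : rradon (Psi F). Proof. exact: (mv_radon mv). Qed.

Lemma int_rampsum_rcons r c s : (forall cs, cs \in r -> 0 <= cs.1 /\ cs.2 <= s) -> 0 <= c ->
  layer_int (Psi (rampsum F (rcons r (c, s)))) phi - layer_int (Psi F) phi =
  (layer_int (Psi (rampsum F r)) phi - layer_int (Psi F) phi) + ramp_jump F phi c s.
Proof.
move=> r0 c0; have r1 cs : cs \in rcons r (c, s) -> 0 <= cs.1.
  by rewrite mem_rcons inE => /predU1P[->//|/r0[]].
have r2 cs : cs \in r -> 0 <= cs.1 by move=> /r0[].
have r3 cs : cs \in [:: (c, s)] -> 0 <= cs.1 by rewrite inE => /eqP ->.
rewrite /ramp_jump -!layer_intB ?radF//.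
rewrite -layer_intD//; [|by apply: rradonB; [exact: radF|exact: radF0]..].
- by apply: layer_int_eq => // B bB mB; exact: val_rampsum_rcons.
all: exact: radF.
Qed.

(** The nodes are sorted so that the last ramp lies to the right of all others and can be split
    off. *)
Lemma int_rampsum r : sorted <=%R [seq cs.2 | cs <- r] -> (forall cs, cs \in r -> 0 <= cs.1) ->
  layer_int (Psi (rampsum F r)) phi - layer_int (Psi F) phi = \sum_(cs <- r) ramp_jump F phi cs.1 cs.2.
Proof.
elim/last_ind: r => [|r [c s] ih] sr r0.
  rewrite big_nil (_ : rampsum F [::] = F) ?subrr//.
  by apply/funext => x; rewrite /rampsum big_nil addr0.
have r0' cs : cs \in r -> 0 <= cs.1 by move=> csr; apply: r0; rewrite mem_rcons inE csr orbT.
have c0 : 0 <= c by apply: (r0 (c, s)); rewrite mem_rcons mem_head.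
have sr' : sorted <=%R [seq cs.2 | cs <- r] by move: sr; rewrite map_rcons => /(subseq_sorted le_trans (subseq_rcons _ _)).
have sm cs : cs \in r -> cs.2 <= s.
  move=> csr; move: sr; rewrite map_rcons -cats1 sorted_pairwise; last exact: le_trans.
  rewrite pairwise_cat /= !andbT => /andP[/allrelP h _].
  by apply: h; [exact: map_f|rewrite inE].
rewrite int_rampsum_rcons//; last by move=> cs csr; split; [exact: r0'|exact: sm].
by rewrite ih// -cats1 big_cat big_seq1.
Qed.

(** [int_rampsum] admits ties among the nodes, so one ramp may be split into two with the same
    node. *)
Lemma ramp_jumpD a c s : 0 <= a -> 0 <= c -> ramp_jump F phi (a + c) s = ramp_jump F phi a s + ramp_jump F phi c s.
Proof.
move=> a0 c0; have := @int_rampsum [:: (a, s); (c, s)].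
rewrite /= lexx !big_cons big_nil addr0 => <-//.
  rewrite /ramp_jump; congr (layer_int (Psi _) _ - _); apply/funext => x.
  by rewrite /rampsum !big_cons big_nil /= !addr0 mulrDl.
by move=> cs; rewrite !inE => /orP[] /eqP ->.
Qed.

End JumpLinear.
End Valuations.

(** * Rank-one affine functions on positive semidefinite matrices *)

Section RankOneAffine.
Variables (R : realType) (n : nat).
Local Notation V := 'rV[R]_n.
Implicit Types (A : 'M[R]_n) (v w x y : V) (p q : 'M[R]_n -> R).

Definition sq v : 'M[R]_n := v^T *m v.

Lemma sqE v i j : sq v i j = v ord0 i * v ord0 j.
Proof. by rewrite mxE big_ord1 !mxE. Qed.

Definition sumsq (s : seq V) : 'M[R]_n := \sum_(v <- s) sq v.
(** The positive semidefinite matrices, given as sums of rank-one squares: induction on the list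
    takes the place of spectral arguments. *)
Definition SR A := exists s, A = sumsq s.

Lemma SR0 : SR 0. Proof. by exists [::]; rewrite /sumsq big_nil. Qed.
Lemma SRD A B : SR A -> SR B -> SR (A + B).
Proof. by move=> [s ->] [t ->]; exists (s ++ t); rewrite /sumsq big_cat. Qed.
Lemma sqZ c v : sq (c *: v) = c ^+ 2 *: sq v.
Proof. by apply/matrixP => i j; rewrite !mxE !big_ord1 !mxE; ring. Qed.
Lemma sumsqZ c s : 0 <= c -> c *: sumsq s = sumsq [seq Num.sqrt c *: v | v <- s].
Proof.
by move=> c0; rewrite /sumsq big_map scaler_sumr; apply: eq_bigr => v _; rewrite sqZ sqr_sqrtr.
Qed.
Lemma SRZ c A : 0 <= c -> SR A -> SR (c *: A).
Proof. by move=> c0 [s ->]; rewrite sumsqZ//; eexists. Qed.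
Lemma SR_sq v : SR (sq v). Proof. by exists [:: v]; rewrite /sumsq big_seq1. Qed.
Lemma SR_sumsq s : SR (sumsq s). Proof. by exists s. Qed.
#[local] Hint Resolve SR0 SR_sq SR_sumsq : core.

Definition rank1_affine p := forall A v s, SR A -> 0 <= s ->
  p (A + s *: sq v) = p A + s * (p (A + sq v) - p A).
Definition hom_deg k p := forall A t, SR A -> 0 <= t -> p (t *: A) = t ^+ k * p A.

Definition D1 v p A := p (A + sq v) - p A.

Lemma D1_affine v p : rank1_affine p -> rank1_affine (D1 v p).
Proof.
move=> rp A w s SA s0; rewrite /D1.
have := rp (A + sq v) w s (SRD SA (SR_sq v)) s0; have := rp A w s SA s0.
rewrite [A + s *: sq w + sq v]addrAC [A + sq w + sq v]addrAC => -> ->; ring.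
Qed.

Lemma D1C v w p A : D1 v (D1 w p) A = D1 w (D1 v p) A.
Proof. by rewrite /D1 (addrAC A (sq v) (sq w)); ring. Qed.

Lemma sumsq_cons v s : sumsq (v :: s) = sq v + sumsq s.
Proof. by rewrite /sumsq big_cons. Qed.

(** The remainder is kept as a polynomial so that the coefficient of t can be isolated by comparing
    values for t > 0. *)
Lemma D1_expand p s : rank1_affine p -> forall A, SR A -> exists r : {poly R},
  forall t, 0 <= t -> p (A + t *: sumsq s) = p A + t * (\sum_(v <- s) D1 v p A) + t ^+ 2 * r.[t].
Proof.
elim: s p => [|v s ih] p rp A SA.
  by exists 0 => t _; rewrite /sumsq !big_nil scaler0 addr0 horner0 !mulr0 !addr0.
have [r rE] := ih p rp A SA.
have [r' rE'] := ih _ (D1_affine v rp) A SA.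
exists (r + (\sum_(w <- s) D1 w (D1 v p) A)%:P + 'X * r') => t t0.
rewrite sumsq_cons scalerDr addrCA addrC rp//; last by apply: SRD => //; exact: SRZ.
rewrite -/(D1 v p (A + t *: sumsq s)) rE// rE'// big_cons !hornerE; ring.
Qed.

Lemma poly_pos_eq0 (r : {poly R}) : (forall t, 0 < t -> r.[t] = 0) -> r = 0.
Proof.
move=> r0; apply/eqP/negPn/negP => rn0.
have := @max_poly_roots R r [seq i.+1%:R | i <- iota 0 (size r)] rn0.
rewrite size_map size_iota ltnn => H; suff: false by []; apply: H => //.
  by apply/allP => _ /mapP[i _ ->]; apply/eqP/r0; rewrite ltr0n.
by rewrite map_inj_uniq ?iota_uniq// => i j /eqP; rewrite eqr_nat => /eqP[].
Qed.

(** The coefficient of t in p (A + t *: sumsq s) sees only the matrix [sumsq s], not its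
    decomposition into squares. *)
Lemma D1_sumsq_eq p s s' A : rank1_affine p -> SR A -> sumsq s = sumsq s' ->
  \sum_(v <- s) D1 v p A = \sum_(v <- s') D1 v p A.
Proof.
move=> rp SA ss'; have [r rE] := D1_expand s rp SA; have [r' rE'] := D1_expand s' rp SA.
set a := \sum_(v <- s) _; set a' := \sum_(v <- s') _.
have : (a - a')%:P + 'X * (r - r') = 0.
  apply: poly_pos_eq0 => t t0; rewrite !hornerE.
  have := rE t (ltW t0); rewrite ss' rE' ?ltW// -/a -/a' => /eqP.
  rewrite -subr_eq0 => /eqP h; apply: (mulfI (lt0r_neq0 t0)); rewrite mulr0 -[RHS]oppr0 -h; ring.
by move/(congr1 (fun q : {poly R} => q.[0])); rewrite !hornerE => /eqP; rewrite subr_eq0 => /eqP.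
Qed.

Lemma D1Z c v p A : rank1_affine p -> SR A -> D1 (c *: v) p A = c ^+ 2 * D1 v p A.
Proof. by move=> rp SA; rewrite /D1 sqZ rp ?sqr_ge0//; ring. Qed.

(** Terms with negative coefficients are moved to the other side, which presents one matrix as two
    sums of squares. Thus [D1] is linear in the square of its direction, for all real
    coefficients. *)
Lemma D1_lin0 p A (l : seq (R * V)) : rank1_affine p -> SR A ->
  \sum_(cx <- l) cx.1 *: sq cx.2 = 0 -> \sum_(cx <- l) cx.1 * D1 cx.2 p A = 0.
Proof.
move=> rp SA l0.
pose u := [seq Num.sqrt cx.1 *: cx.2 | cx <- l & 0 <= cx.1].
pose w := [seq Num.sqrt (- cx.1) *: cx.2 | cx <- l & ~~ (0 <= cx.1)].
have split (W : lmodType R) (h : V -> W) :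
    (forall c v, h (c *: v) = c ^+ 2 *: h v) ->
    \sum_(cx <- l) cx.1 *: h cx.2 = \sum_(v <- u) h v - \sum_(v <- w) h v.
  move=> hZ; rewrite (bigID (fun cx => 0 <= cx.1))/= !big_map !big_filter; congr (_ + _).
    by apply: eq_bigr => cx c0; rewrite hZ sqr_sqrtr.
  rewrite -sumrN; apply: eq_bigr => cx; rewrite -ltNge => c0.
  by rewrite hZ sqr_sqrtr ?scaleNr ?opprK// oppr_ge0 ltW.
have uw : sumsq u = sumsq w.
  by move: l0; rewrite (split _ sq sqZ) => /eqP; rewrite subr_eq0 => /eqP.
have h := split R^o (fun v => D1 v p A) (fun c v => D1Z c v rp SA).
transitivity (\sum_(v <- u) D1 v p A - \sum_(v <- w) D1 v p A); first exact: h.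
by rewrite (D1_sumsq_eq rp SA uw) subrr.
Qed.

(** The difference of [p] in the direction of the symmetric product (x^T y + y^T x) / 2, written
    through the two squares that polarise it. *)
Definition D2 x y p A : R := (D1 (x + y) p A - D1 (x - y) p A) / 4.

Lemma D2_affine x y p : rank1_affine p -> rank1_affine (D2 x y p).
Proof.
move=> rp A w s SA s0; rewrite /D2 (D1_affine (x + y) rp)// (D1_affine (x - y) rp)//; ring.
Qed.

Lemma D2C x y z w p A : D2 x y (D2 z w p) A = D2 z w (D2 x y p) A.
Proof.
have h v v' u u' : D1 v (fun B => (D1 u p B - D1 u' p B) / 4) A -
    D1 v' (fun B => (D1 u p B - D1 u' p B) / 4) A =
    (D1 v (D1 u p) A - D1 v (D1 u' p) A - D1 v' (D1 u p) A + D1 v' (D1 u' p) A) / 4.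
  by rewrite /D1; ring.
by rewrite /D2 !h !(D1C (z + w)) !(D1C (z - w)); congr (_ / _ / _); ring.
Qed.

Lemma D2_sym x y p A : D2 x y p A = D2 y x p A.
Proof.
have h : sq (x - y) = sq (y - x) by rewrite -opprB -scaleN1r sqZ sqrrN expr1n scale1r.
by rewrite /D2 /D1 h (addrC x y).
Qed.

Lemma D2xx x p A : rank1_affine p -> SR A -> D2 x x p A = D1 x p A.
Proof.
move=> rp SA; rewrite /D2 subrr -mulr2n -scaler_nat D1Z//.
by rewrite /D1 {2}/sq mulmx0 addr0; field.
Qed.

Lemma eq_D2 x y p q : (forall A, SR A -> p A = q A) -> forall A, SR A -> D2 x y p A = D2 x y q A.
Proof. by move=> pq A SA; rewrite /D2 /D1 !pq//; apply: SRD. Qed.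

Lemma D2_expand x y p A : rank1_affine p -> SR A ->
  D2 x y p A = \sum_i \sum_j x ord0 i * y ord0 j * D2 (evec R i) (evec R j) p A.
Proof.
move=> rp SA.
pose P := index_enum ('I_n * 'I_n)%type.
(* The list encodes, as a vanishing combination of squares, the identity that expands the symmetric
   product of x and y in coordinates. *)
pose l := [:: (4^-1, x + y); (- 4^-1, x - y)] ++
  [seq (- (x ord0 ij.1 * y ord0 ij.2) / 4, evec R ij.1 + evec R ij.2) | ij <- P] ++
  [seq (x ord0 ij.1 * y ord0 ij.2 / 4, evec R ij.1 - evec R ij.2) | ij <- P].
have : \sum_(cx <- l) cx.1 * D1 cx.2 p A = 0.
  apply: D1_lin0 => //; rewrite /l !big_cat !big_cons big_nil !big_map/= addr0.
  rewrite -big_split /=.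
  apply/matrixP => a b; rewrite !mxE !big_ord1 !mxE summxE.
  rewrite (eq_bigr (fun ij : 'I_n * 'I_n => - (x ord0 ij.1 * y ord0 ij.2 / 2) *
     ((a == ij.1)%:R * (b == ij.2)%:R + (a == ij.2)%:R * (b == ij.1)%:R))); last first.
    by move=> [i j] _ /=; rewrite !mxE !big_ord1 !mxE eqxx /=; field.
  rewrite -(pair_bigA _ (fun i j => - (x ord0 i * y ord0 j / 2) *
     ((a == i)%:R * (b == j)%:R + (a == j)%:R * (b == i)%:R)))/=.
  have -> : \sum_i \sum_j - (x ord0 i * y ord0 j / 2) *
     ((a == i)%:R * (b == j)%:R + (a == j)%:R * (b == i)%:R) =
     - ((x ord0 a * y ord0 b + x ord0 b * y ord0 a) / 2).
    under eq_bigr do under eq_bigr do rewrite mulrDr.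
    under eq_bigr do rewrite big_split /=.
    rewrite big_split /= (bigD1 a)//= [X in _ + X + _]big1; last first.
      by move=> i ia; apply: big1 => j _; rewrite [a == i]eq_sym (negbTE ia) mul0r mulr0.
    rewrite (bigD1 b)//= [X in (_ + X) + _ + _]big1; last first.
      by move=> j jb; rewrite [b == j]eq_sym (negbTE jb) mulr0 mulr0.
    rewrite [X in _ + X](bigD1 b)//= [X in _ + (_ + X)]big1; last first.
      by move=> i ib; apply: big1 => j _; rewrite [b == i]eq_sym (negbTE ib) mulr0 mulr0.
    rewrite [X in _ + (X + _)](bigD1 a)//= [X in _ + (_ + X + _)]big1; last first.
      by move=> j ja; rewrite [a == j]eq_sym (negbTE ja) mul0r mulr0.
    by rewrite !eqxx !mulr1 !addr0; field.
  by field.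
rewrite /l !big_cat !big_cons big_nil !big_map/= addr0 -big_split /=.
rewrite (pair_bigA _ (fun i j => x ord0 i * y ord0 j * D2 (evec R i) (evec R j) p A))/=.
rewrite {1}/D2 => /eqP; rewrite addr_eq0 -sumrN => /eqP h.
transitivity (4^-1 * D1 (x + y) p A + - 4^-1 * D1 (x - y) p A); first by field.
rewrite h; apply: eq_bigr => -[i j] _ /=; rewrite /D2; by field.
Qed.

Lemma D2DZ c x x' y p A : rank1_affine p -> SR A ->
  D2 (c *: x + x') y p A = c * D2 x y p A + D2 x' y p A.
Proof.
move=> rp SA; rewrite !(D2_expand _ y rp SA) mulr_sumr -big_split /=; apply: eq_bigr => i _.
rewrite mulr_sumr -big_split /=; apply: eq_bigr => j _; rewrite !mxE; ring.
Qed.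

(* Polarisation of D_{a,a} D_{a,a} = 0, which says that [p] is affine in the direction [sq a]. *)
Lemma D2_curvature a z w p A : rank1_affine p -> SR A ->
  D2 a z (D2 a w p) A = - 2^-1 * D2 a a (D2 z w p) A.
Proof.
move=> rp SA.
pose H x y z w := D2 x y (D2 z w p) A.
have HD c x x' y z' w' : H (c *: x + x') y z' w' = c * H x y z' w' + H x' y z' w'.
  by rewrite /H D2DZ//; exact: D2_affine.
have Hs1 x y z' w' : H x y z' w' = H y x z' w' by exact: D2_sym.
have Hs3 x y z' w' : H x y z' w' = H z' w' x y by exact: D2C.
have Hs2 x y z' w' : H x y z' w' = H x y w' z' by rewrite Hs3 Hs1 Hs3.
have H0 x : H x x x x = 0.
  rewrite /H D2xx//; last exact: D2_affine.
  rewrite /D1 !D2xx//; last exact: SRD.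
  rewrite /D1 -[A + sq x + sq x]addrA -mulr2n -scaler_nat rp ?ler0n//; ring.
have HD2 c x y y' z' w' : H x (c *: y + y') z' w' = c * H x y z' w' + H x y' z' w'.
  by rewrite Hs1 HD !(Hs1 _ x).
have HD3 c x y x' y' w' : H x y (c *: x' + y') w' = c * H x y x' w' + H x y y' w'.
  by rewrite Hs3 HD !(Hs3 _ w').
have HD4 c x y x' y' w' : H x y w' (c *: x' + y') = c * H x y w' x' + H x y w' y'.
  by rewrite Hs2 HD3 !(Hs2 _ _ w').
(* Adding the quartic form at a + v and at v - a cancels the terms of odd degree. *)
have Hav v : 2 * H a v a v = - H a a v v.
  have := H0 (1 *: a + v); have := H0 ((-1) *: a + v).
  rewrite !(HD, HD2, HD3, HD4) !H0 !mul1r.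
  rewrite (Hs1 v a) (Hs2 _ _ v a) (Hs3 v v a a) ?(Hs1 v a) ?(Hs2 _ _ v a).
  rewrite (Hs3 a v v v) (Hs3 a v a a).
  lra.
have := Hav (1 *: z + w); rewrite !(HD, HD2, HD3, HD4) !mul1r.
have := Hav z; have := Hav w.
rewrite (Hs3 a w a z) (Hs2 a a w z) -/(H a z a w) -/(H a a z w).
lra.
Qed.

Lemma poly_ge0_eq (r q : {poly R}) : (forall t, 0 < t -> r.[t] = q.[t]) -> r = q.
Proof.
move=> rq; apply/eqP; rewrite -subr_eq0; apply/eqP/poly_pos_eq0 => t t0.
by rewrite !hornerE rq// subrr.
Qed.

(** For t > 0 the increment is rescaled; the case t = 0, where one cannot divide by t, follows from
    two polynomials in t that agree for t > 0. *)
Lemma D1_hom k v p : rank1_affine p -> hom_deg k.+1 p -> hom_deg k (D1 v p).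
Proof.
move=> rp hp.
have pos A t : SR A -> 0 < t -> D1 v p (t *: A) = t ^+ k * D1 v p A.
  move=> SA t0; have tn : t != 0 by exact: lt0r_neq0.
  have e : D1 v p (t *: A) = t^-1 * (p (t *: A + t *: sq v) - p (t *: A)).
    rewrite rp ?ltW//; last by apply: SRZ => //; exact: ltW.
    by rewrite /D1; field.
  rewrite e -scalerDr !hp ?ltW//; last exact: SRD.
  by rewrite /D1 exprS; field.
move=> A t SA; rewrite le_eqVlt => /predU1P[<-|]; last exact: pos.
have [s sE] : exists s, A = sumsq s by [].
have [r rE] := D1_expand s (D1_affine v rp) SR0.
pose a := D1 v p A.
have : 'X ^+ k * a%:P = (D1 v p 0)%:P + 'X * (\sum_(v0 <- s) D1 v0 (D1 v p) 0)%:P + 'X ^+ 2 * r.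
  apply: poly_ge0_eq => t' t0'; rewrite !hornerE.
  by rewrite -pos// -{1}[_ *: A]add0r sE rE ?ltW.
move/(congr1 (fun q : {poly R} => q.[0])).
rewrite /a hornerM hornerXn hornerC => ->; rewrite scale0r !hornerE; ring.
Qed.

Lemma D2_hom k x y p : rank1_affine p -> hom_deg k.+1 p -> hom_deg k (D2 x y p).
Proof.
move=> rp hp A t SA t0.
rewrite /D2 (D1_hom (x + y) rp hp)// (D1_hom (x - y) rp hp)//; ring.
Qed.

Lemma hom_deg_0 k p : hom_deg k.+1 p -> p 0 = 0.
Proof. by move=> hp; rewrite -[0](scale0r (0 : 'M[R]_n)) hp// expr0n mul0r. Qed.

Lemma hom0_const p A : hom_deg 0 p -> SR A -> p A = p 0.
Proof. by move=> hp SA; rewrite -[in RHS](scale0r A) hp// expr0 mul1r. Qed.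

Fixpoint opL (L : seq (V * V)) (p : 'M[R]_n -> R) : 'M[R]_n -> R :=
  if L is xy :: L' then D2 xy.1 xy.2 (opL L' p) else p.

Lemma opL_affine L p : rank1_affine p -> rank1_affine (opL L p).
Proof. by move=> rp; elim: L => //= xy L ih; exact: D2_affine. Qed.

Lemma opL_D2 x y L p A : opL L (D2 x y p) A = D2 x y (opL L p) A.
Proof.
elim: L A => //= xy L ih A.
rewrite [RHS]D2C /D2 /D1 !ih; by [].
Qed.

Lemma opL_perm L L' p A : perm_eq L L' -> opL L p A = opL L' p A.
Proof.
have aux L1 xy L2 B : opL (L1 ++ xy :: L2) p B = opL (xy :: L1 ++ L2) p B.
  elim: L1 B => //= zw L1 ih B; rewrite -[RHS]D2C.
  by rewrite {1}/D2 [in RHS]/D2 /D1 !ih.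
elim: L L' A => [|xy L ih] L' A; first by rewrite perm_sym => /perm_nilP ->.
move=> LL'; have : xy \in L' by rewrite -(perm_mem LL') mem_head.
move=> /splitPr LE; move: LE LL' => [L1 L2] LL'; rewrite aux /=.
have {}LL' : perm_eq L (L1 ++ L2).
  by rewrite -(perm_cons xy) (perm_trans LL')// -cat1s perm_catCA.
by rewrite /D2 /D1 !(ih _ _ LL').
Qed.

(** The abstract form of minors vanishing on matrices of lower rank: removing a square lowers the
    degree by at most one, and a form of positive degree vanishes at 0. *)
Lemma hom_lt_sumsq_eq0 k p s : rank1_affine p -> hom_deg k p -> (size s < k)%N -> p (sumsq s) = 0.
Proof.
elim: s k p => [|v s ih] [|k] p rp hp // sk; first by rewrite /sumsq big_nil; exact: hom_deg_0 hp.
rewrite sumsq_cons addrC.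
have -> : p (sumsq s + sq v) = D1 v p (sumsq s) + p (sumsq s) by rewrite /D1 subrK.
rewrite (ih k.+1 p)//; last exact: ltnW.
by rewrite addr0 (ih k (D1 v p))//; [exact: D1_affine|exact: D1_hom].
Qed.

(** D2 v v is D1 v, and of the two terms of this difference the one with fewer squares vanishes by
    degree. *)
Lemma opL_diag s p : rank1_affine p -> hom_deg (size s) p ->
  opL [seq (v, v) | v <- s] p 0 = p (sumsq s).
Proof.
elim: s p => [|v s ih] p rp hp /=; first by rewrite /sumsq big_nil.
rewrite -opL_D2 ih; [|exact: D2_affine|exact: D2_hom].
rewrite D2xx// /D1 sumsq_cons addrC [sq v + _]addrC.
by rewrite (hom_lt_sumsq_eq0 rp hp)// oppr0 add0r.
Qed.

(** A form of degree k is determined on sums of k squares: passing to a longer sum adds a first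
    difference, which is a form of degree k - 1 vanishing on sums of k - 1 squares. *)
Lemma hom_eq0 k p : rank1_affine p -> hom_deg k p ->
  (forall s, size s = k -> p (sumsq s) = 0) -> forall A, SR A -> p A = 0.
Proof.
elim: k p => [|k ih] p rp hp p0 A SA.
  by rewrite (hom0_const hp SA) -(p0 [::])// /sumsq big_nil.
have [s ->] : exists s, A = sumsq s by [].
elim: s => [|v s ihs]; first by rewrite /sumsq big_nil; exact: hom_deg_0 hp.
rewrite sumsq_cons addrC.
have -> : p (sumsq s + sq v) = D1 v p (sumsq s) + p (sumsq s) by rewrite /D1 subrK.
rewrite ihs addr0; apply: ih => //; [exact: D1_affine|exact: D1_hom|].
move=> t tk; rewrite /D1 addrC (hom_lt_sumsq_eq0 rp hp) ?tk// oppr0 add0r.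
by rewrite addrC -sumsq_cons p0//= tk.
Qed.

End RankOneAffine.

(** * Expansion of homogeneous functions into products of minors *)

Section HomogeneousExpansion.
Variables (R : realType) (n k : nat).
Local Notation V := 'rV[R]_n.
Implicit Types (A : 'M[R]_n) (v w x y : V) (p q : 'M[R]_n -> R).
Variable p : 'M[R]_n -> R.
Hypotheses (rp : rank1_affine p) (hp : hom_deg k p).

Definition pairL (xi : 'I_k -> V) (s : 'S_k) := [seq (xi i, xi (s i)) | i <- enum 'I_k].

Definition supp_perm (s : 'S_k) := [set i | s i != i]%SET.

(* A transposition in [s] is removed by [D2_curvature] at the price of a factor -1/2, so every
   permutation contributes with the sign that makes [c] positive and independent of [xi]. *)
Lemma opL_pairL (s : 'S_k) : exists c : R, 0 < c /\ forall xi,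
  (-1) ^+ s * opL (pairL xi s) p 0 = c * p (\sum_i sq (xi i)).
Proof.
have [m] := ubnP #|supp_perm s|; elim: m s => // m ih s; rewrite ltnS => sm.
have [s1|s1] := eqVneq s 1%g.
  exists 1; split => // xi; rewrite s1 odd_perm1 expr0 !mul1r /pairL.
  have -> : [seq (xi i, xi ((1%g : 'S_k) i)) | i <- enum 'I_k] =
      [seq (v, v) | v <- [seq xi i | i <- enum 'I_k]].
    by rewrite -map_comp; apply: eq_map => i /=; rewrite perm1.
  have hp' : hom_deg (size [seq xi i | i <- enum 'I_k]) p by rewrite size_map size_enum_ord.
  by rewrite (opL_diag rp hp') /sumsq big_map big_enum.
have [i si] : exists i, s i != i.
  apply/existsP; apply: contraR s1; rewrite negb_exists => /forallP h.
  by apply/eqP/permP => i; rewrite perm1; apply/eqP; have := h i; rewrite negbK.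
(* Composing with the transposition of i and j = s i splits off j as a fixed point, so the support
   shrinks. *)
pose j := s i; pose s' := (tperm i j * s)%g.
have ij : i != j by rewrite eq_sym.
have s'j : s' j = j by rewrite permM tpermR.
have s'i : s' i = s j by rewrite permM tpermL.
have s'o l : l != i -> l != j -> s' l = s l by move=> li lj; rewrite permM tpermD// eq_sym.
have [] := ih s'.
  apply: leq_trans sm; apply: proper_card; apply/properP; split.
    apply/fintype.subsetP => l; rewrite !inE.
    have [->|li] := eqVneq l i; first by rewrite si.
    have [->|lj] := eqVneq l j; first by rewrite s'j eqxx.
    by rewrite s'o.
  exists j; rewrite !inE ?s'j ?eqxx//; apply/negP => /eqP /perm_inj /eqP.
  by rewrite eq_sym (negbTE ij).
move=> c [c0 cE]; exists (2^-1 * c); split=> [|xi]; first by rewrite mulr_gt0// invr_gt0.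
have sgn : (-1) ^+ s = - (-1) ^+ s' :> R.
  by rewrite odd_permM odd_tperm ij /= signrN opprK.
rewrite sgn -mulrA -cE.
suff -> : opL (pairL xi s) p 0 = - 2^-1 * opL (pairL xi s') p 0 by rewrite !mulNr mulrN opprK mulrCA.
pose rest := [seq l <- enum 'I_k | (l != i) && (l != j)].
have pe : perm_eq (enum 'I_k) (j :: i :: rest).
  apply: uniq_perm; first exact: enum_uniq.
    rewrite /= !inE !mem_filter !eqxx /= andbF orbF eq_sym ij /=.
    by rewrite filter_uniq// enum_uniq.
  move=> l; rewrite mem_enum !in_cons mem_filter mem_enum andbT.
  by rewrite inE; case: (l == j); case: (l == i).
rewrite /pairL (opL_perm _ _ (perm_map _ pe)) (opL_perm (L' := [seq (xi i, xi (s' i)) | i <- j :: i :: rest]) _ _ (perm_map _ pe)) /=.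
have -> : [seq (xi i0, xi (s i0)) | i0 <- rest] = [seq (xi i0, xi (s' i0)) | i0 <- rest].
  apply/eq_in_map => l; rewrite mem_filter => /andP[/andP[li lj] _].
  by rewrite s'o.
set q := opL _ p; rewrite s'j s'i.
have rq : rank1_affine q by exact: opL_affine.
have S0 := SR0 R n.
(* For s the pairs at j and i are (xi j, xi (s j)) and (xi i, xi j). With a = xi j, [D2_curvature]
   trades them for (xi j, xi j) and (xi i, xi (s j)), which are the pairs of s'. *)
transitivity (D2 (xi j) (xi (s j)) (D2 (xi j) (xi i) q) 0).
  by apply: eq_D2 S0 => B _; exact: D2_sym.
rewrite D2_curvature//; congr (_ * _).
by apply: eq_D2 S0 => B _; exact: D2_sym.
Qed.

Lemma sum_ffunS (J : finType) (j0 : nat) (F : J -> {ffun 'I_j0 -> J} -> R) :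
  \sum_(f : {ffun 'I_j0.+1 -> J}) F (f ord0) [ffun i => f (lift ord0 i)] =
  \sum_j \sum_(f : {ffun 'I_j0 -> J}) F j f.
Proof.
rewrite (pair_bigA _ (fun j f => F j f))/=.
pose h (jf : J * {ffun 'I_j0 -> J}) : {ffun 'I_j0.+1 -> J} :=
  [ffun i => if unlift ord0 i is Some i' then jf.2 i' else jf.1].
have hb : bijective h.
  exists (fun f : {ffun 'I_j0.+1 -> J} => (f ord0, [ffun i => f (lift ord0 i)])).
    move=> [j f]; rewrite /h ffunE unlift_none /=; congr (_, _).
    by apply/ffunP => i; rewrite !ffunE liftK.
  move=> f; apply/ffunP => i; rewrite ffunE /=; case: unliftP => [i' ->|->//].
  by rewrite ffunE.
rewrite (reindex h); last exact: onW_bij.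
apply: eq_bigr => -[j f] _ /=; congr (F _ _); first by rewrite ffunE unlift_none.
by apply/ffunP => i; rewrite !ffunE liftK.
Qed.

Lemma D2_lin (I : finType) (c : I -> R) (q : I -> 'M[R]_n -> R) x y A :
  D2 x y (fun B => \sum_i c i * q i B) A = \sum_i c i * D2 x y (q i) A.
Proof.
rewrite /D2 /D1 -!sumrB mulr_suml; apply: eq_bigr => i _; ring.
Qed.

Lemma opL_expand j (x y : 'I_j -> V) A : SR A ->
  opL [seq (x i, y i) | i <- enum 'I_j] p A =
  \sum_(f : {ffun 'I_j -> 'I_n * 'I_n})
     (\prod_i (x i ord0 (f i).1 * y i ord0 (f i).2)) *
     opL [seq (evec R (f i).1, evec R (f i).2) | i <- enum 'I_j] p A.
Proof.
elim: j x y A => [|j ih] x y A SA.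
  have e0 : enum 'I_0 = [::] by apply/size0nil; rewrite size_enum_ord.
  rewrite e0 /= (big_pred1 (ffun0 (card_ord 0))).
    by rewrite big_ord0 mul1r.
  by move=> f; apply/esym/eqP/ffunP => -[].
pose L (f : {ffun 'I_j -> 'I_n * 'I_n}) := [seq (evec R (f i).1, evec R (f i).2) | i <- enum 'I_j].
pose F (ab : 'I_n * 'I_n) (f : {ffun 'I_j -> 'I_n * 'I_n}) := (x ord0 ord0 ab.1 * y ord0 ord0 ab.2) *
   (\prod_i (x (lift ord0 i) ord0 (f i).1 * y (lift ord0 i) ord0 (f i).2)) *
   D2 (evec R ab.1) (evec R ab.2) (opL (L f) p) A.
rewrite [RHS](eq_bigr (fun f : {ffun 'I_j.+1 -> _} => F (f ord0) [ffun i => f (lift ord0 i)])); last first.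
  move=> f _; rewrite big_ord_recl /= /F /L enum_ordSl /= -map_comp; congr (_ * _ * _).
    by apply: eq_bigr => i _; rewrite ffunE.
  by congr (D2 _ _ (opL _ p) A); apply: eq_map => i /=; rewrite ffunE.
rewrite (sum_ffunS F) enum_ordSl /= -map_comp.
transitivity (D2 (x ord0) (y ord0) (fun B => \sum_(f : {ffun 'I_j -> 'I_n * 'I_n})
   (\prod_i (x (lift ord0 i) ord0 (f i).1 * y (lift ord0 i) ord0 (f i).2)) * opL (L f) p B) A).
  by apply: eq_D2 SA => B SB; exact: ih.
rewrite D2_lin exchange_big/=; apply: eq_bigr => f _.
rewrite (D2_expand _ _ (opL_affine (L f) rp) SA).
rewrite (pair_bigA _ (fun a b => x ord0 ord0 a * y ord0 ord0 b * D2 (evec R a) (evec R b) (opL (L f) p) A))/=.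
rewrite mulr_sumr; apply: eq_bigr => -[a b] _; rewrite /F /=.
by rewrite mulrA [X in X * _]mulrC.
Qed.

Definition cdet (xi : 'I_k -> V) (r : {ffun 'I_k -> 'I_n}) := \det (\matrix_(a, b) xi a ord0 (r b)).

Lemma cdet_perm xi r (s : 'S_k) : cdet (fun a => xi (s a)) r = (-1) ^+ s * cdet xi r.
Proof.
rewrite /cdet -[(-1) ^+ s]det_perm -det_mulmx; congr (\det _).
by rewrite -row_permE; apply/matrixP => a b; rewrite !mxE.
Qed.

(** Summing [opL_pairL] over all s and expanding in coordinates assembles the second entries of the
    pairs into a determinant by the Leibniz formula; summing once more over reorderings of [xi] does
    the same for the first entries. *)
Lemma det_expansion : exists b : {ffun 'I_k -> 'I_n * 'I_n} -> R, forall xi : 'I_k -> V,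
  p (\sum_i sq (xi i)) =
  \sum_(h : {ffun 'I_k -> 'I_n * 'I_n})
     b h * (cdet xi [ffun i => (h i).1] * cdet xi [ffun i => (h i).2]).
Proof.
have [c cP] := choice opL_pairL.
pose C := \sum_s c s.
have C0 : 0 < C.
  rewrite /C (bigD1 (1%g : 'S_k))//= ltr_pwDl ?(cP _).1// sumr_ge0// => s _.
  exact: ltW (cP s).1.
pose b0 (h : {ffun 'I_k -> 'I_n * 'I_n}) :=
  opL [seq (evec R (h i).1, evec R (h i).2) | i <- enum 'I_k] p 0.
have half xi : C * p (\sum_i sq (xi i)) = \sum_(h : {ffun 'I_k -> 'I_n * 'I_n})
     b0 h * ((\prod_i xi i ord0 (h i).1) * cdet xi [ffun i => (h i).2]).
  rewrite /C mulr_suml; under eq_bigr do rewrite -(cP _).2 (opL_expand _ _ (SR0 _ _)) mulr_sumr.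
  rewrite exchange_big/=; apply: eq_bigr => h _.
  rewrite /cdet -det_tr /determinant !mulr_sumr; apply: eq_bigr => s _.
  rewrite big_split /= -/(b0 h).
  rewrite [X in _ = _ * (_ * (_ * X))](eq_bigr (fun i => xi (s i) ord0 (h i).2)); last first.
    by move=> i _; rewrite !mxE ffunE.
  by move: (b0 h) (\prod_(i < k) xi i ord0 (h i).1) (\prod_(i < k) xi (s i) ord0 (h i).2)
    ((-1) ^+ s : R) => a1 a2 a3 a4; ring.
(* k! counts the reorderings of [xi]; C collects the positive constants of [opL_pairL]. *)
exists (fun h => b0 h / (k`!%:R * C)) => xi.
have kC : k`!%:R * C != 0 by rewrite mulf_neq0 ?gt_eqF// ltr0n fact_gt0.
apply: (mulfI kC); rewrite -mulrA mulr_sumr.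
transitivity (\sum_(s : 'S_k) C * p (\sum_i sq (xi (s i)))).
  rewrite [RHS](eq_bigr (fun=> C * p (\sum_i sq (xi i)))); last first.
    by move=> s _; rewrite [in RHS](reindex_inj (@perm_inj _ s)).
  by rewrite sumr_const card_Sn -[RHS]mulr_natl.
under eq_bigr do rewrite (half (fun i => xi (_ i))).
rewrite exchange_big/=; apply: eq_bigr => h _.
rewrite -mulr_sumr [RHS](_ : _ = b0 h * (cdet xi [ffun i => (h i).1] * cdet xi [ffun i => (h i).2])); last first.
  by rewrite !mulrA -[k`!%:R * C * b0 h]mulrC mulfK.
congr (_ * _).
under eq_bigr do rewrite (cdet_perm xi).
rewrite /cdet -[\det (\matrix_(_, _) xi _ ord0 ([ffun i => (h i).1] _))]det_tr {2}/determinant mulr_suml.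
apply: eq_bigr => s _; rewrite mulrCA mulrA; congr (_ * _ * _).
by apply: eq_bigr => i _; rewrite !mxE ffunE.
Qed.

End HomogeneousExpansion.

(** * The Monge-Ampere measure *)

Section ConvexRegularity.
Variables (R : realType) (n : nat).
Local Notation V := 'rV[R]_n.
Implicit Types (f : V -> R) (x y z : V).

Lemma convex_average f m (x : 'I_m.+1 -> V) : convex_fun f ->
  f (m.+1%:R^-1 *: \sum_i x i) <= m.+1%:R^-1 * \sum_i f (x i).
Proof.
move=> cf; elim: m x => [|m ih] x; first by rewrite !big_ord1 invr1 scale1r mul1r.
rewrite big_ord_recr [\sum_(i < m.+2) f _]big_ord_recr scalerDr mulrDr /=.
have m1 : m.+1%:R != 0 :> R by rewrite pnatr_eq0.
have m2 : m.+2%:R != 0 :> R by rewrite pnatr_eq0.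
pose t : R := m.+1%:R / m.+2%:R.
have t1 : 1 - t = m.+2%:R^-1.
  by rewrite /t -[X in X - _](divff m2) -mulrBl -natrB// subSnn mul1r.
have tE : t * m.+1%:R^-1 = m.+2%:R^-1 by rewrite /t mulrAC divff// mul1r.
have t0 : 0 <= t by rewrite divr_ge0.
have t01 : 0 <= t <= 1 by rewrite t0 -subr_ge0 t1 invr_ge0 ler0n.
have := cf (m.+1%:R^-1 *: \sum_(i < m.+1) x (widen_ord (leqnSn m.+1) i)) (x ord_max) t t01.
rewrite scalerA tE t1 => /le_trans; apply; rewrite lerD2r -tE -[X in _ <= X]mulrA ler_wpM2l//.
Qed.

Lemma convex_axis_bound f (r : R) i : convex_fun f -> 0 < r ->
  exists C, forall s, `|s| <= r -> f (s *: evec R i) <= C.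
Proof.
move=> cf r0; exists (`|f (r *: evec R i)| + `|f (- r *: evec R i)|) => s sr.
pose t := (s + r) / (2 * r).
have r2 : 0 < 2 * r by rewrite mulr_gt0.
have t01 : 0 <= t <= 1.
  move: sr; rewrite ler_norml => /andP[s1 s2]; apply/andP; split.
    by apply: divr_ge0; [lra|exact: ltW].
  by rewrite ler_pdivrMr//; lra.
have := cf (r *: evec R i) (- r *: evec R i) t t01.
rewrite !scalerA -scalerDl (_ : t * r + (1 - t) * - r = s); last by rewrite /t; field; rewrite gt_eqF.
move=> /le_trans; apply; have [t0 t1] := andP t01.
apply: lerD; apply: (le_trans (ler_norm _)); rewrite normrM ler_piMl// ger0_norm//; lra.
Qed.

(** From above: x is the mean of 0 and the n axis points (n+1) x_i e_i, and [f] is bounded on every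
    axis segment. From below: reflection in 0. *)
Lemma convex_bounded f (r : R) : convex_fun f -> exists2 C, 0 <= C & forall x, `|x| <= r -> `|f x| <= C.
Proof.
move=> cf.
suff [C hC] : exists C, forall x, `|x| <= r -> f x <= C.
  exists (`|C| + 2 * `|f 0|) => [|x xr]; first by rewrite addr_ge0// mulr_ge0.
  have h1 := hC _ xr; have h2 := hC (- x); rewrite normrN in h2; have {}h2 := h2 xr.
  have h0 : 0 <= (2^-1 : R) by lra.
  have h1' : (2^-1 : R) <= 1 by lra.
  have := cf x (- x) 2^-1; rewrite h0 h1' => /(_ isT).
  rewrite scalerN -scalerBl (_ : 2^-1 - (1 - 2^-1) = 0); last by field.
  rewrite scale0r => h3; have := ler_norm C; have := ler_norm (- f 0); rewrite normrN => h4 h5.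
  have := normr_ge0 (f 0); have := normr_ge0 C.
  rewrite ler_norml; lra.
pose r' := n.+1%:R * (`|r| + 1).
have r'0 : 0 < r' by rewrite mulr_gt0 ?ltr0n// ltr_wpDl.
have /choice[C hC] i : exists C, forall s, `|s| <= r' -> f (s *: evec R i) <= C.
  exact: convex_axis_bound.
exists (n.+1%:R^-1 * (f 0 + \sum_i C i)) => x xr.
have n0 : n.+1%:R != 0 :> R by rewrite pnatr_eq0.
pose u (j : 'I_n.+1) : V := if unlift ord0 j is Some i then (n.+1%:R * x ord0 i) *: evec R i else 0.
have -> : x = n.+1%:R^-1 *: \sum_j u j.
  rewrite big_ord_recl /u unlift_none add0r.
  apply/rowP => i; rewrite !mxE summxE (bigD1 i)//= big1 ?addr0.
    by rewrite liftK !mxE !eqxx mulr1 mulKf.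
  by move=> j ji; rewrite liftK !mxE eqxx [i == j]eq_sym (negbTE ji) mulr0.
apply: le_trans (convex_average u cf) _; rewrite ler_wpM2l ?invr_ge0//.
rewrite big_ord_recl /u unlift_none lerD2l; apply: ler_sum => i _; rewrite liftK.
apply: hC; rewrite normrM /r' ger0_norm// ler_wpM2l//.
by apply: (le_trans (coord_le_norm _ _)); rewrite (le_trans xr)// ler_wpDr// ler_norm.
Qed.

(** The slope from x to y is at most the slope from x to the point z at unit distance beyond y,
    which still lies in the larger ball. *)
Lemma convex_lip f (r C : R) : convex_fun f -> (forall x, `|x| <= r + 1 -> `|f x| <= C) ->
  forall x y, `|x| <= r -> `|y| <= r -> `|f x - f y| <= 2 * C * `|x - y|.
Proof.
move=> cf fC.
suff h x y : `|x| <= r -> `|y| <= r -> f y - f x <= 2 * C * `|x - y|.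
  move=> x y xr yr; rewrite ler_norml; have := h x y xr yr; have := h y x yr xr.
  rewrite [`|y - x|]distrC; lra.
move=> xr yr; have [->|xy] := eqVneq x y; first by rewrite !subrr normr0 mulr0.
set d := `|x - y|.
have d0 : 0 < d by rewrite normr_gt0 subr_eq0.
have dn : d != 0 by rewrite gt_eqF.
pose z := y + d^-1 *: (y - x).
have zr : `|z| <= r + 1.
  apply: le_trans (ler_normD _ _) _; apply: lerD => //.
  have -> : `|d^-1 *: (y - x)| = 1 by rewrite normrZ [`|y - x|]distrC -/d gtr0_norm ?invr_gt0// mulVf.
  exact: lexx.
have d1 : 1 + d != 0 by rewrite gt_eqF// addr_gt0.
pose t := (1 + d)^-1.
have dp : 0 < 1 + d by rewrite addr_gt0.
have t01 : 0 <= t <= 1.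
  by apply/andP; rewrite /t; split; [rewrite invr_ge0 ltW|rewrite invf_le1// lerDl ltW].
have yE : y = t *: x + (1 - t) *: z.
  apply/rowP => i; rewrite !mxE /t.
  by field; rewrite d1 gt_eqF.
have := cf x z t t01; rewrite -yE => h1.
have fx := fC x; have fz := fC z zr; have xr1 : `|x| <= r + 1 by rewrite ler_wpDr.
have {}fx := fx xr1.
have e : t * f x + (1 - t) * f z - f x = (d / (1 + d)) * (f z - f x) by rewrite /t; field.
have h2 : f y - f x <= d / (1 + d) * (f z - f x) by lra.
apply: le_trans h2 _; have C0 : 0 <= C by exact: le_trans (normr_ge0 _) fx.
have h3 : f z - f x <= 2 * C.
  move: fx fz; rewrite !ler_norml => /andP[? ?] /andP[? ?]; lra.
apply: (@le_trans _ _ (d / (1 + d) * (2 * C))).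
  by rewrite ler_wpM2l// divr_ge0 ?ltW// addr_gt0.
rewrite mulrC; apply: ler_wpM2l; first by rewrite mulr_ge0.
by rewrite ler_pdivrMr//; apply: ler_peMr; [exact: ltW|rewrite lerDl; exact: ltW].
Qed.

Lemma convex_continuous f : convex_fun f -> continuous f.
Proof.
move=> cf x; have [C C0 hC] := convex_bounded (`|x| + 1 + 1) cf.
have lip := convex_lip cf hC.
have C1 : 0 < 2 * C + 1 by rewrite ltr_wpDl// mulr_ge0.
apply/(@cvgrPdist_lt _ _ _ _ (nbhs_filter (x : V))) => e e0; apply/nbhs_ballP; exists (Num.min 1 (e / (2 * C + 1))).
  by rewrite /= lt_min ltr01 divr_gt0.
move=> y; rewrite mx_norm_ball /ball_ /=.
rewrite lt_min => /andP[yx]; rewrite ltr_pdivlMr// => yx2.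
have yr : `|y| <= `|x| + 1.
  rewrite -[y](subrKC x); apply: le_trans (ler_normD _ _) _; rewrite lerD2l distrC ltW//.
apply: le_lt_trans (lip _ _ _ yr) _; first by rewrite lerDl.
by apply: le_lt_trans yx2; rewrite mulrC ler_wpM2l// lerDl.
Qed.

(** The Legendre transform of [f] restricted to [A]; for bounded nonempty [A] it is a finite convex
    function, hence continuous. *)
Definition conj_on f (A : set V) y : R := sup [set inner y x - f x | x in A].

Lemma conj_on_sup f A y : convex_fun f -> bounded_set A -> A !=set0 -> has_sup [set inner y x - f x | x in A].
Proof.
move=> cf bA [a Aa]; split; first by exists (inner y a - f a), a.
have [M M0 AM] := bounded_sub_box bA.
have [C C0 hC] := convex_bounded M cf.
exists ((\sum_i `|y ord0 i|) * M + C) => _ [x Ax <-].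
have xM : `|x| <= M by apply/cube_norm; [exact: ltW|exact: AM].
apply: lerD; first by apply: le_trans (ler_norm _) (le_trans (inner_bound y x) _); rewrite ler_wpM2l// sumr_ge0.
by apply: le_trans (ler_norm _) _; rewrite normrN; exact: hC.
Qed.

Lemma conj_on_ub f A y x : convex_fun f -> bounded_set A -> A x -> inner y x - f x <= conj_on f A y.
Proof.
move=> cf bA Ax; apply: sup_upper_bound; last by exists x.
by apply: conj_on_sup => //; exists x.
Qed.

Lemma conj_on_le f A y c : A !=set0 -> (forall x, A x -> inner y x - f x <= c) -> conj_on f A y <= c.
Proof.
move=> [a Aa] h; apply: ge_sup; first by exists (inner y a - f a), a.
by move=> _ [x Ax <-]; exact: h.
Qed.

Lemma conj_on_convex f A : convex_fun f -> bounded_set A -> A !=set0 -> convex_fun (conj_on f A).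
Proof.
move=> cf bA A0 y z t /andP[t0 t1]; apply: conj_on_le => // x Ax.
have h1 := conj_on_ub y cf bA Ax; have h2 := conj_on_ub z cf bA Ax.
have t1' : 0 <= 1 - t by rewrite subr_ge0.
rewrite innerDl !innerZl.
have := lerD (ler_wpM2l t0 h1) (ler_wpM2l t1' h2); lra.
Qed.

Definition subgrad f (A : set V) : set V := \bigcup_(x in A) subdiff f x.

Lemma subgradS f A B : A `<=` B -> subgrad f A `<=` subgrad f B.
Proof. by move=> AB y [x Ax yx]; exists x => //; exact: AB. Qed.

Lemma subgrad_bigcup f (I : Type) (P : set I) (A : I -> set V) :
  subgrad f (\bigcup_(i in P) A i) = \bigcup_(i in P) subgrad f (A i).
Proof.
apply/seteqP; split => y.
  by move=> [x [i Pi Ax] yx]; exists i => //; exists x.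
by move=> [i Pi [x Ax yx]]; exists x => //; exists i.
Qed.

(** A slope touches [f] somewhere on [K] exactly when the transform over [K] is already as large as
    that over every cube; by continuity of both this is a closed condition on y. *)
Lemma subgrad_compact f K : convex_fun f -> compact K ->
  subgrad f K = [set y | K !=set0 /\ forall m : nat, conj_on f (cube m%:R) y <= conj_on f K y].
Proof.
move=> cf cK; have bK : bounded_set K by exact: compact_bounded.
apply/seteqP; split => y.
  move=> [x Kx yx]; split; first by exists x.
  move=> m; apply: conj_on_le; first by exists 0 => i; rewrite mxE oppr_le0 ler0n.
  move=> z _; apply: le_trans (conj_on_ub y cf bK Kx).
  by have := yx z; rewrite innerB; lra.
move=> [K0 h].
have cc : continuous (fun x : V => inner y x - f x).
  by apply: ctsB; [exact: continuous_inner|exact: convex_continuous].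
have [x Kx xmax] := EVT_max_rV K0 cK (continuous_subspaceT cc).
rewrite inE in Kx.
exists x => // z; rewrite innerB.
have hK : conj_on f K y <= inner y x - f x.
  by apply: conj_on_le => // w Kw; apply: xmax; rewrite inE.
pose m := (Num.truncn `|z|).+1.
have zm : cube m%:R z.
  apply/cube_norm => //; exact/ltW/Num.Theory.truncnS_gt.
have := conj_on_ub y cf (@bounded_cube _ _ m%:R) zm; have := h m; lra.
Qed.

Lemma subgrad_compact_closed f K : convex_fun f -> compact K -> closed (subgrad f K).
Proof.
move=> cf cK; rewrite subgrad_compact//.
have bK : bounded_set K by exact: compact_bounded.
have [K0|K0] := pselect (K !=set0); last first.
  by rewrite (_ : mkset _ = set0); [exact: closed0|apply/seteqP; split => // y []].
rewrite (_ : mkset _ = \bigcap_(m in @setT nat) [set y | conj_on f (cube m%:R) y - conj_on f K y <= 0]).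
  apply: closed_bigI => m _.
  rewrite (_ : mkset _ = (fun y => conj_on f (cube m%:R) y - conj_on f K y) @^-1` [set t | t <= 0])//.
  apply: closed_comp; last exact: closed_le.
  move=> y _; apply: ctsB; apply/convex_continuous/conj_on_convex => //; first exact: bounded_cube.
  by exists 0 => i; rewrite mxE oppr_le0 ler0n.
apply/seteqP; split => y.
  by move=> [_ h] m _ /=; rewrite subr_le0.
by move=> h; split => // m; have := h m I; rewrite /= subr_le0.
Qed.

Lemma closed_bigcup_compact (A : set V) : A = \bigcup_(m in @setT nat) (A `&` cube m%:R).
Proof.
apply/seteqP; split => [x Ax|x [m _ []//]].
exists (Num.truncn `|x|).+1 => //; split => //; apply/cube_norm => //; exact/ltW/Num.Theory.truncnS_gt.
Qed.

Lemma subgrad_closed_measurable f A : convex_fun f -> closed A -> measurable (subgrad f A).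
Proof.
move=> cf cA; rewrite (closed_bigcup_compact A) subgrad_bigcup.
apply: bigcupT_measurable => m; apply: measurable_closed_rV; apply: subgrad_compact_closed => //.
rewrite setIC; exact: compact_closedI (@compact_cube _ _ m%:R) cA.
Qed.

(** The subgradient inequality tested at x + e_i and x - e_i bounds each coordinate of the slope. *)
Lemma subgrad_bounded f (r C : R) : convex_fun f -> (forall x, `|x| <= r + 1 -> `|f x| <= C) ->
  forall y, subgrad f [set x | `|x| <= r] y -> `|y| <= 2 * C.
Proof.
move=> cf hC y [x /= xr yx].
have C0 : 0 <= C by apply: le_trans (hC x _); rewrite ?ler_wpDr.
have evn i : `|evec R i| <= (1 : R).
  by apply: norm_le_coord => // j; rewrite /evec mxE; case: (_ && _); rewrite ?normr1 ?normr0.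
have h s i : s = 1 \/ s = -1 -> s * y ord0 i <= 2 * C.
  move=> s1; have := yx (x + s *: evec R i).
  rewrite (addrC x) addrK innerZ.
  have -> : inner y (evec R i) = y ord0 i.
    rewrite /inner (bigD1 i)//= big1 ?addr0; first by rewrite /evec mxE !eqxx mulr1.
    by move=> j ji; rewrite /evec mxE (negbTE ji) andbF mulr0.
  have b1 : `|f x| <= C by apply: hC; rewrite ler_wpDr.
  have b2 : `|f (s *: evec R i + x)| <= C.
    apply: hC; rewrite addrC; apply: le_trans (ler_normD _ _) _; apply: lerD => //.
    by rewrite normrZ; case: s1 => ->; rewrite ?normrN normr1 mul1r evn.
  move: b1 b2; rewrite !ler_norml => /andP[? ?] /andP[? ?]; lra.
apply: norm_le_coord => [|i]; first by rewrite mulr_ge0.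
have := h 1 i (or_introl erefl); have := h (-1) i (or_intror erefl).
rewrite ler_norml; lra.
Qed.

End ConvexRegularity.

(** * Null sets of Lebesgue measure *)

Section LebSigmaFinite.
Variables (R : realType) (n : nat).
Local Notation V := 'rV[R]_n.

Lemma leb_sigma_finite : sigma_finite setT (@leb R n).
Proof.
exists (fun m : nat => cube m%:R).
  apply/esym/seteqP; split => // x _; exists (Num.truncn `|x|).+1 => //.
  by apply/cube_norm => //; exact/ltW/Num.Theory.truncnS_gt.
move=> m; split; first exact: measurable_cube.
exact/leb_outer_bounded/bounded_cube.
Qed.

HB.instance Definition _ := @Measure_isSigmaFinite.Build _ V R (@leb R n) leb_sigma_finite.

Lemma leb_outer_null (A N : set V) : leb_outer N = 0%E -> leb_outer (A `\` N) = leb_outer A.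
Proof.
move=> N0; apply/eqP; rewrite eq_le; apply/andP; split.
  by apply: le_leb_outer; exact: subDsetl.
apply: (@le_trans _ _ (leb_outer ((A `\` N) `|` N))).
  by apply: le_leb_outer => x Ax; have [|] := pselect (N x); [right|left].
apply: le_trans (outer_measureU2 (@leb_outer R n) _ _) _.
by rewrite [X in (_ + X)%E](_ : _ = 0%E) ?adde0.
Qed.

Lemma leb_bigcup_null (A : nat -> set V) : (forall k, leb_outer (A k) = 0%E) -> leb_outer (\bigcup_k A k) = 0%E.
Proof.
move=> A0; apply/eqP; rewrite eq_le leb_outer_ge0 andbT.
apply: le_trans (leb_outer_sigma_subadditive A) _.
by rewrite eseries0// => k _ _.
Qed.

Lemma measurable_shift (a : V) (A : set V) : measurable A -> measurable [set x | A (x + a)].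
Proof.
move: A; apply: sigma_algebra_borel.
  split => [|A mA|A mA].
  - by rewrite (_ : mkset _ = set0)//; apply/seteqP; split.
  - rewrite (_ : mkset _ = ~` [set x | A (x + a)]); first exact: measurableC.
    by apply/seteqP; split => [x []//|x /= h]; split.
  - rewrite (_ : mkset _ = \bigcup_k [set x | A k (x + a)]); first exact: bigcupT_measurable.
    by apply/seteqP; split => x [k _ h]; exists k.
move=> i c /=; rewrite (_ : mkset _ = [set x : V | x ord0 i <= c - a ord0 i]).
  exact: measurable_halfspace.
by apply/seteqP; split => x /=; rewrite mxE lerBrDr.
Qed.

(** The translates of a bounded part of [M] by e_i / (j + 1) are disjoint, have equal measure and
    stay in one bounded set, so that measure is 0. *)
Lemma leb_line_null (M : set V) (i : 'I_n) : measurable M ->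
  (forall y t, 0 < t -> M y -> ~ M (y + t *: evec R i)) -> leb_outer M = 0%E.
Proof.
move=> mM hM; rewrite (_ : M = \bigcup_k (M `&` cube k%:R)); last first.
  apply/seteqP; split => [x Mx|x [k _ []//]].
  exists (Num.truncn `|x|).+1 => //; split => //.
  by apply/cube_norm => //; exact/ltW/Num.Theory.truncnS_gt.
apply: leb_bigcup_null => k; set Mk := M `&` _.
have mMk : measurable Mk by apply: measurableI => //; exact: measurable_cube.
pose sh (j : nat) : set V := [set x + j.+1%:R^-1 *: evec R i | x in Mk].
have shE j : sh j = (fun x : V => x - j.+1%:R^-1 *: evec R i) @^-1` Mk.
  apply/seteqP; split => [_ [x Mx <-]|x /= Mx]; first by rewrite /= addrK.
  by exists (x - j.+1%:R^-1 *: evec R i) => //; rewrite subrK.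
have msh j : measurable (sh j).
  rewrite shE; exact: (measurable_shift (- _) mMk).
have tsh : trivIset setT sh.
  apply/trivIsetP => a b _ _ ab; apply/seteqP; split => // x [].
  rewrite !shE /= => -[h1 _] [h2 _].
  wlog lab : a b ab h1 h2 / (a < b)%N.
    move=> H; move: (ab); rewrite neq_ltn => /orP[|] lab; first exact: (H a b).
    by apply: (H b a) => //; rewrite eq_sym.
  apply: (hM _ (a.+1%:R^-1 - b.+1%:R^-1) _ h1); last first.
    by rewrite scalerBl addrA subrK.
  by rewrite subr_gt0 ltf_pV2 ?posrE ?ltr0n// ltr_nat ltnS.
have shc j : sh j `<=` cube (k%:R + 1).
  move=> _ [x [_ cx] <-]; apply/cube_norm; first by rewrite addr_ge0.
  apply: le_trans (ler_normD _ _) _; apply: lerD; first exact/cube_norm.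
  rewrite normrZ ger0_norm ?invr_ge0// -[leRHS]mulr1 ler_pM ?invr_ge0//.
    by rewrite invf_le1 ?ltr0n// ler1n.
  by apply: norm_le_coord => // j'; rewrite /evec mxE; case: (_ && _); rewrite ?normr1 ?normr0.
have le j : (\sum_(l < j) leb (sh l) <= leb (cube (k%:R + 1) : set V))%E.
  rewrite -(measure_semi_additive_ord_I (@leb R n))//; last 2 first.
  - exact: sub_trivIset tsh.
  - exact: bigsetU_measurable.
  have sub : \big[setU/set0]_(l < j) sh l `<=` cube (k%:R + 1) by rewrite -bigcup_mkord; exact: bigcup_sub.
  by apply: le_measure => //; rewrite inE; [exact: bigsetU_measurable|exact: measurable_cube].
have bMk : (leb Mk < +oo)%E.
  by apply: leb_outer_bounded; apply: sub_bounded_set (@bounded_cube _ _ k%:R) => x [].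
have bc : (leb (cube (k%:R + 1) : set V) < +oo)%E by exact/leb_outer_bounded/bounded_cube.
have {}le j : j%:R * fine (leb Mk) <= fine (leb (cube (k%:R + 1) : set V)).
  rewrite -lee_fin fineK ?ge0_fin_numE ?leb_outer_ge0//; apply: le_trans (le j).
  rewrite (eq_bigr (fun=> leb Mk)); last by move=> l _; exact: leb_shift.
  have -> : leb Mk = (fine (leb Mk))%:E by rewrite fineK// ge0_fin_numE// leb_outer_ge0.
  by rewrite sumEFin sumr_const card_ord lee_fin mulr_natl.
rewrite -[leb_outer Mk]/(leb Mk) -[leb Mk]fineK ?ge0_fin_numE ?leb_outer_ge0//; congr (_%:E).
apply/eqP/negPn/negP => m0.
have mp : 0 < fine (leb Mk) by rewrite lt_neqAle eq_sym m0 fine_ge0// leb_outer_ge0.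
have := le (Num.truncn (fine (leb (cube (k%:R + 1) : set V)) / fine (leb Mk))).+1.
rewrite leNgt => /negP; apply; rewrite -ltr_pdivrMr//; exact: Num.Theory.truncnS_gt.
Qed.

Lemma bigcup_count (T : countType) (F : T -> set V) :
  \bigcup_t F t = \bigcup_k (if unpickle k is Some t then F t else set0).
Proof.
apply/seteqP; split => [x [t _ Fx]|x [k _]]; first by exists (pickle t) => //; rewrite pickleK.
by case: unpickle => // t Fx; exists t.
Qed.

End LebSigmaFinite.

(** * Countable additivity of the Monge-Ampere measure *)

Section MongeAmpereMeasure.
Variables (R : realType) (n : nat).
Local Notation V := 'rV[R]_n.
Implicit Types (f g : V -> R).

(** Slopes attained at more than one point. Off this set disjoint sets have disjoint subgradient
    images, which is what countable additivity rests on. *)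
Definition nonuniq f : set V := [set y | exists x x', x != x' /\ subdiff f x y /\ subdiff f x' y].

Lemma subdiff_monotone f x x' (y y' : V) : subdiff f x y -> subdiff f x' y' ->
  0 <= inner (y' - y) (x' - x).
Proof.
move=> h h'; have := h x'; have := h' x; rewrite innerDl innerNl !innerB; lra.
Qed.

(** Slopes attained on both sides of a slab with rational faces: countably many pieces, each built
    from images of closed sets. *)
Definition nonuniq_slab f (w : 'I_n * (rat * rat)) : set V :=
  if w.2.1 < w.2.2 then subgrad f [set x | x ord0 w.1 <= ratr w.2.1] `&` subgrad f [set x | ratr w.2.2 <= x ord0 w.1]
  else set0.

Lemma nonuniqE f : nonuniq f = \bigcup_w nonuniq_slab f w.
Proof.
apply/seteqP; split => y.
  move=> [x [x' [xx' [yx yx']]]].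
  wlog [i hi] : x x' xx' yx yx' / exists i, x ord0 i < x' ord0 i.
    move=> H; have [i hi] : exists i, x ord0 i != x' ord0 i.
      apply/existsP; apply: contraR xx'; rewrite negb_exists => /forallP h.
      by apply/eqP/rowP => i; apply/eqP; have := h i; rewrite negbK.
    move: (hi); rewrite neq_lt => /orP[] lt; first by apply: (H x x') => //; exists i.
    by apply: (H x' x) => //; [rewrite eq_sym|exists i].
  have [q /andP[q1 q2]] : exists q : rat, x ord0 i < ratr q < x' ord0 i.
    by have [q] := rat_in_itvoo hi; rewrite in_itv/=; exists q.
  have [p] := rat_in_itvoo q1; rewrite in_itv /= => /andP[p1 p2].
  exists (i, (p, q)) => //; rewrite /nonuniq_slab /=.
  rewrite -(ltr_rat R) p2; split; [exists x|exists x'] => //=; exact: ltW.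
move=> [[i [p q]] _]; rewrite /nonuniq_slab /=; case: ifPn => // pq [[x /= xp yx] [x' /= xq yx']].
exists x, x'; split => //; apply/eqP => xx'; move: (le_trans xq (eq_ind x (fun z => z ord0 i <= ratr p) xp x' xx')).
by rewrite ler_rat leNgt pq.
Qed.

Lemma closed_coord_le i c : closed [set x : V | x ord0 i <= c].
Proof.
rewrite (_ : mkset _ = (fun x : V => x ord0 i) @^-1` [set t | t <= c])//.
by apply: closed_comp; [move=> x _; exact: coord_continuous|exact: closed_le].
Qed.

Lemma closed_coord_ge i c : closed [set x : V | c <= x ord0 i].
Proof.
rewrite (_ : mkset _ = (fun x : V => x ord0 i) @^-1` [set t | c <= t])//.
by apply: closed_comp; [move=> x _; exact: coord_continuous|exact: closed_ge].
Qed.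

Section ForConvex.
Variables (f : V -> R).
Hypothesis cf : convex_fun f.

Lemma nonuniq_slab_measurable w : measurable (nonuniq_slab f w).
Proof.
rewrite /nonuniq_slab; case: ifP => // _; apply: measurableI; apply: subgrad_closed_measurable => //.
- exact: closed_coord_le.
- exact: closed_coord_ge.
Qed.

Lemma nonuniq_measurable : measurable (nonuniq f).
Proof.
rewrite nonuniqE bigcup_count; apply: bigcupT_measurable => k.
case: unpickle => // w; exact: nonuniq_slab_measurable.
Qed.

(** By monotonicity of the subdifferential, raising the slope along e_i cannot move a contact point
    from the right of the slab to its left, so every line in that direction meets the piece at most
    once. *)
Lemma nonuniq_null : leb_outer (nonuniq f) = 0%E.
Proof.
rewrite nonuniqE bigcup_count; apply: leb_bigcup_null => k.
case: unpickle => [w|]; last exact: leb_outer0.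
apply: (@leb_line_null _ _ _ w.1); first exact: nonuniq_slab_measurable.
rewrite /nonuniq_slab; case: ifP => // pq y t t0 [_ [x' /= xq yx']] [[x /= xp yx] _].
have := subdiff_monotone yx' yx.
rewrite addrC addKr innerZl.
rewrite [inner _ _](_ : _ = x ord0 w.1 - x' ord0 w.1).
  rewrite pmulr_rge0// subr_ge0 => h.
  by move: (le_trans xq (le_trans h xp)); rewrite ler_rat leNgt pq.
rewrite /inner (bigD1 w.1)//= big1 ?addr0; first by rewrite /evec !mxE !eqxx mul1r.
by move=> j ji; rewrite /evec !mxE (negbTE ji) andbF mul0r.
Qed.

(** Once [nonuniq f] is removed, taking subgradient images commutes with complements, and the good
    sets form a sigma-algebra. *)
Lemma subgradD_measurable (B : set V) : measurable B -> measurable (subgrad f B `\` nonuniq f).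
Proof.
move: B; apply: sigma_algebra_borel; last first.
  move=> i c; apply: measurableD; last exact: nonuniq_measurable.
  by apply: subgrad_closed_measurable => //; exact: closed_coord_le.
split => [|A mA|A mA].
- by rewrite (_ : _ `\` _ = set0)//; apply/seteqP; split => // y [[]].
- rewrite (_ : _ `\` _ = (subgrad f setT `\` nonuniq f) `\` (subgrad f A `\` nonuniq f)).
    apply: measurableD => //; apply: measurableD; last exact: nonuniq_measurable.
    by apply: subgrad_closed_measurable => //; exact: closedT.
  apply/seteqP; split => y.
    move=> [[x [_ nAx] yx] ny]; split; first by split => //; exists x.
    move=> [[x' Ax' yx'] _]; apply: ny; exists x, x'; split => //.
    by apply/eqP => xx'; apply: nAx; rewrite xx'.
  move=> [[[x _ yx] ny] h]; split => //; exists x => //; split => // Ax.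
  by apply: h; split => //; exists x.
- rewrite subgrad_bigcup setD_bigcupl; exact: bigcupT_measurable.
Qed.

Lemma leb_subgrad (B : set V) : leb_outer (subgrad f B) = leb (subgrad f B `\` nonuniq f).
Proof. by rewrite -(leb_outer_null _ nonuniq_null). Qed.

Lemma subgrad_bounded_set (B : set V) : bounded_set B -> bounded_set (subgrad f B).
Proof.
move=> bB; have [M M0 BM] := bounded_sub_box bB.
have [C C0 hC] := convex_bounded (M + 1) cf.
exists (2 * C); split; first exact: num_real.
move=> D CD y yB; apply: (le_trans _ (ltW CD)); apply: (subgrad_bounded cf hC).
by apply: subgradS yB => x /BM h; apply/cube_norm => //; exact: ltW.
Qed.

Lemma leb_subgrad_fin (B : set V) : bounded_set B -> leb_outer (subgrad f B) \is a fin_num.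
Proof.
move=> bB; rewrite ge0_fin_numE ?leb_outer_ge0//.
exact/leb_outer_bounded/subgrad_bounded_set.
Qed.

End ForConvex.

Definition maf f (B : set V) : R := fine (leb_outer (subgrad f B)).

Lemma maf_radon f : convex_fun f -> rradon (maf f).
Proof.
move=> cf K bK A mA AK tA.
pose P j := subgrad f (A j) `\` nonuniq f.
have mP j : measurable (P j) by exact: subgradD_measurable.
have tP : trivIset setT P.
  apply/trivIsetP => i j _ _ ij; apply/seteqP; split => // y [[[x Ax yx] ny] [[x' Ax' yx'] _]].
  apply: ny; exists x, x'; split => //; apply/eqP => xx'; rewrite -xx' in Ax'.
  by move/trivIsetP : tA => /(_ i j I I ij) h; have : (A i `&` A j) x by []; rewrite h.
have UP : subgrad f (\bigcup_j A j) `\` nonuniq f = \bigcup_j P j.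
  by rewrite subgrad_bigcup setD_bigcupl.
have bU : bounded_set (\bigcup_j A j) by apply: sub_bounded_set bK; exact: bigcup_sub.
have fj j : leb (P j) \is a fin_num.
  by rewrite -leb_subgrad//; apply: leb_subgrad_fin => //; exact: sub_bounded_set (AK j) bK.
have h : ((fun N => \sum_(0 <= j < N) leb (P j)) @ \oo --> leb_outer (subgrad f (\bigcup_j A j)))%E.
  rewrite (leb_subgrad cf) UP; exact: (@measure_sigma_additive _ _ _ (@leb R n) P mP tP).
rewrite /maf (_ : (fun N => _) = (fun N => fine (\sum_(0 <= j < N) leb (P j)))%E).
  by apply: (fine_cvg); rewrite fineK ?leb_subgrad_fin.
apply/funext => N; rewrite -sum_fine; last by move=> j _; exact: fj.
by apply: eq_bigr => j _; rewrite /P -(leb_subgrad cf).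
Qed.

End MongeAmpereMeasure.

(** * Weak continuity of the Monge-Ampere measure *)

Section MongeAmpereContinuity.
Variables (R : realType) (n : nat).
Local Notation V := 'rV[R]_n.
Implicit Types (f g phi : V -> R).
Local Notation lebS := (@leb R n : {sigma_finite_measure set V -> \bar R}).

Definition argmin f y : V := xget 0 [set x | subdiff f x y].
(* [argmin f y] is only meaningful where the subgradient [y] is attained at one point. *)
Definition pull f phi y : R := if `[< (subgrad f setT `\` nonuniq f) y >] then phi (argmin f y) else 0.

Lemma pullE f phi x y : ~ nonuniq f y -> subdiff f x y -> pull f phi y = phi x.
Proof.
move=> ny yx; rewrite /pull asboolT; last by split => //; exists x.
have h : subdiff f (argmin f y) y by exact: (@xgetPex _ 0 [set x | subdiff f x y] (ex_intro _ x yx)).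
by congr phi; apply/eqP; apply: contra_notT ny => xy; exists (argmin f y), x.
Qed.

Lemma pull0 f phi y : ~ (exists x, phi x != 0 /\ subdiff f x y) -> pull f phi y = 0.
Proof.
move=> h; rewrite /pull; case: asboolP => // -[[x _ yx] ny].
have hx : subdiff f (argmin f y) y by exact: (@xgetPex _ 0 [set x | subdiff f x y] (ex_intro _ x yx)).
by apply/eqP; apply: contra_notT h => p0; exists (argmin f y).
Qed.

Lemma pull_nonuniq f phi y : nonuniq f y -> pull f phi y = 0.
Proof. by move=> ny; rewrite /pull asboolF// => -[]. Qed.

Lemma pullN f phi y : pull f (fun x => - phi x) y = - pull f phi y.
Proof. by rewrite /pull; case: ifP => //; rewrite oppr0. Qed.

Lemma pull_gt f phi t : 0 <= t ->
  [set y | t < pull f phi y] = subgrad f [set x | t < phi x] `\` nonuniq f.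
Proof.
move=> t0; apply/seteqP; split => y /=.
  move=> ty; have ny : ~ nonuniq f y by move=> /pull_nonuniq e; move: ty; rewrite e ltNge t0.
  have [[x [px yx]]|h] := pselect (exists x, phi x != 0 /\ subdiff f x y); last first.
    by move: ty; rewrite pull0// ltNge t0.
  by split => //; exists x => //=; move: ty; rewrite (pullE _ ny yx).
by move=> [[x /= tx yx] ny]; rewrite (pullE _ ny yx).
Qed.

Lemma pull_ge f phi t : 0 < t ->
  [set y | t <= pull f phi y] = subgrad f [set x | t <= phi x] `\` nonuniq f.
Proof.
move=> t0; apply/seteqP; split => y /=.
  move=> ty; have ny : ~ nonuniq f y by move=> /pull_nonuniq e; move: ty; rewrite e leNgt t0.
  have [[x [px yx]]|h] := pselect (exists x, phi x != 0 /\ subdiff f x y); last first.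
    by move: ty; rewrite pull0// leNgt t0.
  by split => //; exists x => //=; move: ty; rewrite (pullE _ ny yx).
by move=> [[x /= tx yx] ny]; rewrite (pullE _ ny yx).
Qed.

Lemma measurable_pull f phi : convex_fun f -> continuous phi -> measurable_fun setT (pull f phi).
Proof.
move=> cf cp; apply: (measurability (@RGenOInfty.G R)); first exact: RGenOInfty.measurableE.
move=> _ [_ [t ->] <-]; rewrite setTI.
have [t0|t0] := leP 0 t.
  rewrite (_ : _ @^-1` _ = [set y | t < pull f phi y]); last first.
    by apply/seteqP; split => y /=; rewrite in_itv/= andbT.
  rewrite pull_gt//; apply: subgradD_measurable => //; exact: measurable_gt.
(* A negative threshold is brought to a positive one by passing to the complement and to -phi; this
   is why [pull_ge] is stated besides [pull_gt]. *)
rewrite (_ : _ @^-1` _ = ~` [set y | - t <= pull f (fun x => - phi x) y]); last first.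
  by apply/seteqP; split => y /=; rewrite in_itv/= andbT pullN lerN2 ltNge => /negP.
apply: measurableC; rewrite pull_ge ?oppr_gt0//; apply: subgradD_measurable => //.
rewrite (_ : mkset _ = ~` [set x | t < phi x]); first by apply: measurableC; exact: measurable_gt.
by apply/seteqP; split => x /=; rewrite lerN2 ltNge; [move=> ->|move=> /negP; rewrite negbK].
Qed.

Lemma pull_le f phi M y : (forall x, `|phi x| <= M) -> `|pull f phi y| <= M.
Proof.
move=> pM; rewrite /pull; case: ifP => // _; rewrite normr0.
exact: le_trans (normr_ge0 _) (pM 0).
Qed.

Lemma pull_supp f phi (r C : R) : convex_fun f -> supp_in phi (cube r) -> 0 <= r ->
  (forall x, `|x| <= r + 1 -> `|f x| <= C) -> supp_in (pull f phi) (cube (2 * C)).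
Proof.
move=> cf sp r0 hC y py.
have C0 : 0 <= C by apply: le_trans (hC 0 _); rewrite ?normr0 ?addr_ge0.
apply/cube_norm; first by rewrite mulr_ge0.
apply: (subgrad_bounded cf hC).
have [[x [px yx]]|h] := pselect (exists x, phi x != 0 /\ subdiff f x y).
  by exists x => //=; apply/cube_norm => //; exact: sp.
by move: py; rewrite pull0// eqxx.
Qed.

Lemma integrable_bounded_supp (h : V -> R) M r : measurable_fun setT h ->
  (forall y, `|h y| <= M) -> supp_in h (cube r) -> (@leb R n).-integrable setT (EFin \o h).
Proof.
move=> mh hM sh; have M0 : 0 <= M by exact: le_trans (normr_ge0 _) (hM 0).
have : (@leb R n).-integrable setT (EFin \o (fun y => M * \1_(cube r) y)).
  apply/integrableP; split.
    by apply/measurable_EFinP; apply: measurable_funM => //; exact: measurable_indic (measurable_cube r).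
  under eq_integral do rewrite /= ger0_norm ?mulr_ge0// EFinM.
  rewrite ge0_integralZl//; last first.
    by apply/measurable_EFinP; exact: measurable_indic (measurable_cube r).
  rewrite integral_indic ?setIT//; last exact: measurable_cube.
  rewrite lte_mul_pinfty ?lee_fin//.
  exact/leb_outer_bounded/bounded_cube.
apply: le_integrable => //; first exact/measurable_EFinP.
move=> y _ /=; rewrite lee_fin indicE; have [h0|/sh/mem_set ->] := eqVneq (h y) 0.
  by rewrite h0 normr0.
by rewrite mulr1; apply: le_trans (hM y) (ler_norm _).
Qed.

Lemma layer_cst (h : V -> R) t : measurable_fun setT h ->
  layer lebS (fun=> 1) h t = leb [set y | t < h y].
Proof.
move=> mh; rewrite /layer; transitivity (\int[@leb R n]_(x in [set y | (t < h y)%R]) (cst 1%E x))%E => //.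
rewrite integral_cst ?mul1e//.
rewrite (_ : mkset _ = h @^-1` `]t, +oo[%classic).
  by rewrite -[X in measurable X]setTI; exact: mh.
by apply/seteqP; split => y /=; rewrite in_itv/= andbT.
Qed.

(** Integration against the Monge-Ampere measure is Lebesgue integration over slopes of [phi]
    evaluated at the contact point: the level sets of [pull f phi] are subgradient images of those
    of [phi]. *)
Lemma maf_layer_int f phi : convex_fun f -> continuous phi -> compact_support phi ->
  layer_int (maf f) phi = Rintegral (@leb R n) setT (pull f phi).
Proof.
move=> cf cp /compact_support_cube[r r0 sp].
have [M M0 pM] := continuous_supp_bounded cp sp.
have [C C0 hC] := convex_bounded (r + 1) cf.
have mp := measurable_pull cf cp.
have ip : (@leb R n).-integrable setT (EFin \o pull f phi).
  by apply: integrable_bounded_supp (pull_supp cf sp r0 hC) => // y; exact: pull_le.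
have mp' : measurable_fun setT (fun y => - pull f phi y) by exact: measurableT_comp.
have bs (q : V -> R) t : supp_in q (cube r) -> 0 <= t -> bounded_set [set x | t < q x].
  by move=> sq t0; apply: sub_bounded_set (supp_gt sq t0) (@bounded_cube _ _ r).
have spN : supp_in (fun x => - phi x) (cube r) by move=> x; rewrite oppr_eq0 => /sp.
have e1 t : 0 <= t -> layer lebS (fun=> 1) (pull f phi) t = leb_outer (subgrad f [set x | t < phi x]).
  by move=> t0; rewrite layer_cst// pull_gt// -leb_subgrad.
have e2 t : 0 <= t -> layer lebS (fun=> 1) (fun y => - pull f phi y) t = leb_outer (subgrad f [set x | phi x < - t]).
  move=> t0; rewrite layer_cst// (_ : mkset _ = [set y | t < pull f (fun x => - phi x) y]); last first.
    by apply/seteqP; split => y /=; rewrite pullN.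
  rewrite pull_gt// -leb_subgrad//; congr (leb_outer (subgrad f _)).
  by apply/seteqP; split => x /=; rewrite ltrNr.
apply: layer_intE.
have h := @is_layer_measure R _ V lebS (fun=> 1) (pull f phi).
have {h} : is_layer (fun t => fine (layer lebS (fun=> 1) (pull f phi) t))
   (fun t => fine (layer lebS (fun=> 1) (fun y => - pull f phi y) t))
   (Rintegral (@leb R n) setT (pull f phi)).
  rewrite [X in is_layer _ _ X](_ : _ = Rintegral (@leb R n) setT (fun y => 1 * pull f phi y)); last first.
    by apply: eq_Rintegral => y _; rewrite mul1r.
  apply: h => //.
  - by apply: eq_integrable ip => // y _ /=; rewrite mul1r.
  - move=> t t0; rewrite e1// -ge0_fin_numE ?leb_outer_ge0//; apply: leb_subgrad_fin => //; exact: bs.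
  - move=> t t0; rewrite e2// -ge0_fin_numE ?leb_outer_ge0//; apply: leb_subgrad_fin => //.
    by apply: sub_bounded_set (supp_lt sp t0) (@bounded_cube _ _ r).
by apply: eq_is_layer => t; rewrite inE /= => t0; rewrite ?e1 ?e2.
Qed.

(** f - inner y has a strict minimum at x, and by compactness a margin eta on the sphere of radius
    d. Nearby functions then have a minimiser inside the ball, local at first and global by
    convexity. *)
Lemma argmin_stable (fs : nat -> V -> R) f x y : (forall j, convex_fun (fs j)) -> convex_fun f ->
  loc_unif_cvg fs f -> subdiff f x y -> ~ nonuniq f y -> forall d, 0 < d ->
  \forall j \near \oo, exists2 z, `|z - x| <= d & subdiff (fs j) z y.
Proof.
move=> cfs cf fsf yx ny d d0.
pose u z := f z - inner y z; pose us j z := fs j z - inner y z.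
have cu : continuous u by apply: ctsB; [exact: convex_continuous|exact: continuous_inner].
have ux z : u x <= u z by have := yx z; rewrite innerB /u; lra.
pose S : set V := [set z | `|z - x| = d].
pose D : set V := [set z | `|z - x| <= d].
have cnorm : continuous (fun z : V => `|z - x|).
  apply: convex_continuous => a b t /andP[t0 t1].
  have -> : t *: a + (1 - t) *: b - x = t *: (a - x) + (1 - t) *: (b - x).
    by apply/rowP => i; rewrite !mxE; ring.
  apply: le_trans (ler_normD _ _) _.
  by rewrite !normrZ !ger0_norm// subr_ge0.
have bD : bounded_set D.
  exists (`|x| + d); split; first exact: num_real.
  move=> K dK z /= zd; apply/ltW/le_lt_trans/dK.
  by rewrite -[z](subrK x) addrC; apply: le_trans (ler_normD _ _) _; rewrite lerD2l.
have cD : compact D.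
  apply: bounded_closed_compact => //.
  rewrite (_ : D = (fun z : V => `|z - x|) @^-1` [set t | t <= d])//.
  by apply: closed_comp; [move=> z _; exact: cnorm|exact: closed_le].
have cS : compact S.
  apply: (subclosed_compact _ cD); last by move=> z Sz; rewrite /D /= Sz.
  rewrite (_ : S = (fun z : V => `|z - x|) @^-1` [set d])//.
  by apply: closed_comp; [move=> z _; exact: cnorm|exact: closed_eq].
have [eta eta0 hS] : exists2 eta, 0 < eta & forall z, S z -> u x + eta <= u z.
  have [S0|S0] := pselect (S !=set0); last by exists 1 => // z Sz; exfalso; apply: S0; exists z.
  have [z0 Sz0 hz0] := EVT_min_rV S0 cS (continuous_subspaceT cu).
  rewrite inE in Sz0.
  exists (u z0 - u x); last by move=> z Sz; rewrite addrC subrK; apply: hz0; rewrite inE.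
  rewrite subr_gt0 lt_neqAle ux andbT; apply/negP => /eqP e.
  apply: ny; exists x, z0; split; last split => // z.
    by apply/eqP => xz; move: Sz0 d0; rewrite /S /= -xz subrr normr0 => <-; rewrite ltxx.
  have := ux z; rewrite e /u innerB; lra.
have e3 : 0 < eta / 3 by rewrite divr_gt0.
have := fsf (`|x| + d) (eta / 3) e3; apply: filterS => j hj.
have Dr z : D z -> `|z| <= `|x| + d.
  by move=> /= zd; rewrite -[z](subrK x) addrC; apply: le_trans (ler_normD _ _) _; rewrite lerD2l.
have cus : continuous (us j) by apply: ctsB; [exact: convex_continuous|exact: continuous_inner].
have D0 : D x by rewrite /D /= subrr normr0 ltW.
have [z Dz hz] := EVT_min_rV (ex_intro _ x D0) cD (continuous_subspaceT cus).
rewrite inE in Dz; exists z => //.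
have hzx : us j z <= us j x by apply: hz; rewrite inE.
have husx : us j x <= u x + eta / 3.
  by have := hj x (Dr _ D0); rewrite /us /u ltr_norml => /andP[_]; lra.
suff glob w : us j z <= us j w by move=> w; have := glob w; rewrite /us innerB; lra.
have [wD|wD] := pselect (D w); first by apply: hz; rewrite inE.
have wd : d < `|w - x| by rewrite ltNge; apply/negP.
have wp : 0 < `|w - x| by exact: lt_trans wd.
pose t := d / `|w - x|.
have t0 : 0 < t by rewrite divr_gt0.
have t1 : t <= 1 by rewrite ler_pdivrMr// mul1r ltW.
pose s := t *: w + (1 - t) *: x.
have sx : s - x = t *: (w - x) by rewrite /s; apply/rowP => i; rewrite !mxE; ring.
have Ss : S s.
  by rewrite /S /= sx normrZ gtr0_norm// /t divfK// gt_eqF.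
have Ds : D s by rewrite /D /= (_ : `|s - x| = d).
have uss : u x + eta - eta / 3 <= us j s.
  have := hj s (Dr _ Ds); have := hS _ Ss; rewrite /us /u ltr_norml => h1 /andP[h2 _]; lra.
have t01 : 0 <= t <= 1 by rewrite ltW.
have := cfs j w x t t01; rewrite -/s => conv.
have inn : inner y s = t * inner y w + (1 - t) * inner y x by rewrite /s innerD !innerZ.
have {}conv : us j s <= t * us j w + (1 - t) * us j x by rewrite /us inn; lra.
have h4 : us j x < us j s by lra.
have h5 : 0 < t * (us j w - us j x) by lra.
move: h5; rewrite pmulr_rgt0// subr_gt0 => h5; lra.
Qed.

(** If y is no slope of [f], some point undercuts the minimum of f - inner y over the cube by a gap
    that survives small perturbations. *)
Lemma argmin_escape (fs : nat -> V -> R) f y r : convex_fun f ->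
  loc_unif_cvg fs f -> ~ subgrad f setT y -> 0 <= r ->
  \forall j \near \oo, forall x, cube r x -> ~ subdiff (fs j) x y.
Proof.
move=> cf fsf ny r0.
pose u z := f z - inner y z.
have cu : continuous u by apply: ctsB; [exact: convex_continuous|exact: continuous_inner].
have c0 : cube r (0 : V) by apply/cube_norm => //; rewrite normr0.
have [x0 cx0 hx0] := EVT_min_rV (ex_intro _ _ c0) (@compact_cube _ _ r) (continuous_subspaceT cu).
have [z hz] : exists z, u z < u x0.
  apply: contra_notP ny => h; exists x0 => // z.
  rewrite innerB leNgt; apply/negP => hz; apply: h; exists z; rewrite /u; lra.
pose eta := (u x0 - u z) / 3.
have e0 : 0 < eta by rewrite divr_gt0// subr_gt0.
have := fsf (r + `|z|) eta e0; apply: filterS => j hj x cx yx.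
have xr : `|x| <= r + `|z| by rewrite ler_wpDr//; exact/cube_norm.
have zr : `|z| <= r + `|z| by rewrite ler_wpDl.
have h1 := hj x xr; have h2 := hj z zr; have h3 := yx z; rewrite innerB in h3.
have h4 : u x0 <= u x by apply: hx0; rewrite inE.
move: h1 h2; rewrite !ltr_norml => /andP[h11 h12] /andP[h21 h22].
have : u x0 - u z = 3 * eta by rewrite /eta; field.
rewrite /u in h4 *; lra.
Qed.

(** Dominated convergence over slopes: off a null set the pulled-back test functions converge, by
    [argmin_stable] at slopes of [f] and by [argmin_escape] elsewhere. *)
Lemma maf_continuous (fs : nat -> V -> R) f phi : (forall j, convex_fun (fs j)) -> convex_fun f ->
  loc_unif_cvg fs f -> continuous phi -> compact_support phi ->
  (fun j => layer_int (maf (fs j)) phi) @ \oo --> layer_int (maf f) phi.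
Proof.
move=> cfs cf fsf cp sp; have [r r0 spr] := compact_support_cube sp.
have [M M0 pM] := continuous_supp_bounded cp spr.
have [C C0 hC] := convex_bounded (r + 1) cf.
have [J _ hJ] := fsf (r + 1) 1 ltr01.
(* From index J on the functions share one bound near the support of [phi], so all relevant slopes
   lie in one cube. *)
rewrite -(cvg_shiftn J) maf_layer_int//.
rewrite (_ : (fun j => _) = (fun j => Rintegral (@leb R n) setT (pull (fs (j + J)%N) phi))); last first.
  by apply/funext => j; rewrite maf_layer_int.
have hCj j x : `|x| <= r + 1 -> `|fs (j + J)%N x| <= C + 1.
  move=> xr; have := hJ (j + J)%N (leq_addl _ _) x xr; have := hC x xr => h1 h2.
  by rewrite -[fs _ x](subrK (f x)); apply: le_trans (ler_normD _ _) _; rewrite addrC lerD// ltW.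
apply: (@Rintegral_dct _ _ _ _ _ _ (fun y => M * \1_(cube (2 * (C + 1)) : set V) y)).
- by move=> j; exact: measurable_pull.
- exact: measurable_pull.
- pose N := nonuniq f `|` \bigcup_j nonuniq (fs (j + J)%N).
  have mN : measurable N.
    apply: measurableU; first exact: nonuniq_measurable.
    by apply: bigcupT_measurable => j; exact: nonuniq_measurable.
  exists N; split => //.
    apply/eqP; rewrite eq_le [X in _ && X]leb_outer_ge0 andbT.
    apply: le_trans (outer_measureU2 (@leb_outer R n) _ _) _.
    rewrite [X in (X + _)%E](nonuniq_null cf) add0e.
    by rewrite [X in (X <= _)%E]leb_bigcup_null// => j; exact: nonuniq_null.
  move=> y /= ny; apply: contrapT => nN; apply: ny.
  have ny : ~ nonuniq f y by move=> h; apply: nN; left.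
  have nyj j : ~ nonuniq (fs (j + J)%N) y by move=> h; apply: nN; right; exists j.
  rewrite (cvg_shiftn J (fun j => pull (fs j) phi y)).
  have [[x _ yx]|nsub] := pselect (subgrad f setT y).
    rewrite (pullE _ ny yx); apply/cvgrPdist_lt => e e0.
    have /cvgrPdist_lt/(_ e e0) := cp x.
    move=> /nbhs_ballP[d /= d0 hd].
    have d2 : 0 < d / 2 by rewrite divr_gt0.
    have := argmin_stable cfs cf fsf yx ny d2 => H.
    near=> j.
    have [z zx yz] : exists2 z, `|z - x| <= d / 2 & subdiff (fs j) z y by near: j.
    have jJ : (J <= j)%N by near: j; exists J.
    have nj : ~ nonuniq (fs j) y by rewrite -(subnK jJ).
    rewrite (pullE _ nj yz); apply: hd.
    rewrite mx_norm_ball /ball_ /= distrC; apply: (le_lt_trans zx); lra.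
  rewrite pull0; last by move=> [x [_ yx]]; apply: nsub; exists x.
  apply: cvg_near_cst.
  have := argmin_escape cf fsf nsub r0; apply: filterS => j hj.
  by apply: pull0 => -[x [px yx]]; exact: (hj x (spr _ px)).
- apply: (@integrable_bounded_supp _ M (2 * (C + 1))).
  + by apply: measurable_funM => //; exact: measurable_indic (measurable_cube _).
  + by move=> y; rewrite indicE; case: (_ \in _); rewrite ?mulr1 ?mulr0 ?normr0 ?ger0_norm// ltW.
  + move=> y; rewrite indicE; case: (boolP (y \in cube _)); first by rewrite inE.
    by rewrite mulr0 eqxx.
- move=> y j; rewrite indicE; have [e|ny] := eqVneq (pull (fs (j + J)%N) phi y) 0.
    by rewrite e normr0 mulr_ge0// ltW.
  have := pull_supp (cfs (j + J)%N) spr r0 (@hCj j) ny; move/mem_set ->.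
  by rewrite mulr1; exact: pull_le.
Unshelve. all: by end_near. Qed.

End MongeAmpereContinuity.

(** * The Monge-Ampere operator as a valuation *)

Section MongeAmpereValuation.
Variables (R : realType) (n : nat).
Local Notation V := 'rV[R]_n.
Implicit Types (f g : V -> R).

(** A supporting inequality valid near x extends to all points along segments, by convexity. *)
Lemma subdiff_local f h (U : set V) x : convex_fun f -> convex_fun h -> open U ->
  (forall z, U z -> f z = h z) -> U x -> subdiff f x `<=` subdiff h x.
Proof.
move=> cf ch oU fh Ux y yx z; rewrite -(fh x Ux).
have /nbhs_ballP[e /= e0 he] : nbhs x U by exact: open_nbhs_nbhs.
have [->|zx] := eqVneq z x; first by rewrite subrr inner0 addr0 fh.
have dz : 0 < `|z - x| by rewrite normr_gt0 subr_eq0.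
pose t := Num.min 1 (e / 2 / `|z - x|).
have t0 : 0 < t by rewrite lt_min ltr01 /= divr_gt0// divr_gt0.
have t1 : t <= 1 by rewrite /t ge_min lexx.
have t01 : 0 <= t <= 1 by rewrite ltW.
pose w := t *: z + (1 - t) *: x.
have wx : w - x = t *: (z - x) by rewrite /w; apply/rowP => i; rewrite !mxE; ring.
have Uw : U w.
  apply: he; rewrite mx_norm_ball /ball_ /= distrC wx normrZ gtr0_norm//.
  apply: (@le_lt_trans _ _ (e / 2)); last by rewrite ltr_pdivrMr// ltr_pMr// ltr1n.
  by rewrite -ler_pdivlMr// /t ge_min lexx orbT.
have := yx w; rewrite wx innerZ (fh w Uw) => h1.
have := ch z x t t01; rewrite -/w -(fh x Ux) => h2.
have : 0 <= t * (h z - f x - inner y (z - x)) by lra.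
by rewrite pmulr_rge0//; lra.
Qed.

Lemma maf_local f h (U B : set V) : convex_fun f -> convex_fun h -> open U ->
  (forall x, U x -> f x = h x) -> maf f (B `&` U) = maf h (B `&` U).
Proof.
move=> cf ch oU fh; rewrite /maf; congr (fine (leb_outer _)); apply/seteqP; split => y [x [Bx Ux] yx].
  by exists x => //; exact: (subdiff_local cf ch oU fh).
exists x => //; apply: (subdiff_local ch cf oU _ Ux yx) => z Uz; by rewrite fh.
Qed.

Lemma maf_affine f l (B : set V) : affine_fun l -> maf (fun x => f x + l x) B = maf f B.
Proof.
move=> [y0 [c lE]]; rewrite /maf; congr fine; rewrite -[RHS](leb_outer_shift _ y0); congr leb_outer.
have e x y : subdiff (fun x => f x + l x) x (y + y0) <-> subdiff f x y.
  split => h z; have := h z; rewrite !lE innerDl !innerB; lra.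
apply/seteqP; split => [y [x Bx yx]|_ [y [x Bx yx] <-]].
  by exists (y - y0); [exists x => //; apply/e; rewrite subrK|rewrite subrK].
by exists x => //; apply/e.
Qed.

Lemma maf_trans f (x : V) (B : set V) : maf (fun y => f (y + x)) B = maf f [set b + x | b in B].
Proof.
rewrite /maf; congr (fine (leb_outer _)); apply/seteqP; split => y.
  move=> [b Bb yb]; exists (b + x); first by exists b.
  by move=> z; have := yb (z - x); rewrite subrK -addrA -opprD [x + b]addrC.
move=> [_ [b Bb <-] yb]; exists b => // z; have := yb (z + x).
by rewrite opprD addrACA subrr addr0.
Qed.

Lemma leb_outer_point (y : V) : (0 < n)%N -> leb_outer [set y] = 0%E.
Proof.
move=> n0; apply: (@leb_line_null _ _ _ (Ordinal n0)).
  rewrite (_ : [set y] = box (y ord0) (y ord0)); first exact: measurable_box.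
  apply/seteqP; split => [_ -> i|x xy]; first by rewrite lexx.
  by apply/rowP => i; apply/eqP; rewrite eq_le andbC; exact: xy.
move=> z t t0 /= -> /eqP; rewrite -subr_eq0 addrC addKr => /eqP/rowP/(_ (Ordinal n0)).
by rewrite !mxE !eqxx mulr1 => /eqP; rewrite gt_eqF.
Qed.

Lemma maf_hom f t (B : set V) : convex_fun f -> 0 <= t -> bounded_set B ->
  maf (fun x => t * f x) B = t ^+ n * maf f B.
Proof.
move=> cf; rewrite le_eqVlt => /predU1P[<- bB|t0 bB]; last first.
  have fin := leb_subgrad_fin cf bB.
  rewrite /maf; transitivity (fine ((t ^+ n)%:E * leb_outer (subgrad f B))%E); last first.
    by rewrite fineM.
  rewrite -leb_outer_scale//; congr (fine (leb_outer _)).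
  have tn : t != 0 by rewrite gt_eqF.
  apply/seteqP; split => y.
    move=> [x Bx yx]; exists (t^-1 *: y); last by rewrite scalerA divff// scale1r.
    exists x => // z; rewrite innerZl -(ler_pM2l t0) mulrDr mulrA divff// mul1r; exact: yx.
  move=> [y' [x Bx yx] <-]; exists x => // z.
  by rewrite innerZl -mulrDr ler_pM2l//; exact: yx.
(* For t = 0 the only slope is 0, a null set if n > 0; for n = 0 the space is a point and 0 ^+ 0 =
   1. *)
have -> : (fun x => 0 * f x) = (fun=> 0) by apply/funext => x; rewrite mul0r.
have [n0|n0] := posnP n; last first.
  rewrite expr0n gtn_eqF// mul0r /maf.
  suff -> : leb_outer (subgrad (fun=> 0) B) = 0%E by [].
  apply/eqP; rewrite eq_le leb_outer_ge0 andbT -(leb_outer_point 0 n0); apply: le_leb_outer.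
  move=> y [x _ yx] /=; apply/eqP; apply/negPn/negP => y0.
  have := yx (x + y); rewrite (addrC x) addrK add0r leNgt => /negP; apply.
  rewrite lt_neqAle; apply/andP; split; last by apply: sumr_ge0 => i _; rewrite -expr2 sqr_ge0.
  rewrite eq_sym; apply: contra y0 => /eqP e; apply/eqP/rowP => i; rewrite mxE.
  apply/eqP; rewrite -sqrf_eq0 expr2.
  by move/eqP: e; rewrite psumr_eq0; [move=> /allP/(_ i (mem_index_enum i))|move=> j _; rewrite -expr2 sqr_ge0].
have sub (x y : V) : x = y by apply/rowP => i; exfalso; have := ltn_ord i; rewrite {2}n0.
have -> : (0 : R) ^+ n = 1 by rewrite n0 expr0.
rewrite mul1r /maf; congr (fine (leb_outer _)).
apply/seteqP; split => y [x Bx yx]; exists x => // z; rewrite (sub z x) subrr inner0 addr0//.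
Qed.

Lemma subdiff_maxl f g x : f x = g x -> subdiff f x `<=` subdiff (fun x => Num.max (f x) (g x)) x.
Proof.
move=> fg y yx z; rewrite /= -fg maxxx; apply: (le_trans (yx z)); by rewrite le_max lexx.
Qed.

(** Suppose y supports the maximum, but fails for [f] at z1 and for [g] at z2. On the segment from
    z2 to z1 the sign of f - g changes; where f = g, the convex minimum would lie strictly below the
    supporting plane and the maximum above it, although they are equal. *)
Lemma subdiff_max f g x : convex_fun f -> convex_fun g -> convex_fun (fun x => Num.min (f x) (g x)) ->
  f x = g x -> subdiff (fun x => Num.max (f x) (g x)) x = subdiff f x `|` subdiff g x.
Proof.
move=> cf cg cm fg; apply/seteqP; split; last first.
  move=> y [] h; first exact: subdiff_maxl.
  rewrite (_ : (fun x => _) = (fun x => Num.max (g x) (f x))); first by apply: subdiff_maxl.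
  by apply/funext => z; rewrite maxC.
move=> y yx; apply: contrapT => /not_orP[nf ng].
have [z1 /negP] : exists z, ~ (f x + inner y (z - x) <= f z) by apply/existsNP.
rewrite -ltNge => h1.
have [z2 /negP] : exists z, ~ (g x + inner y (z - x) <= g z) by apply/existsNP.
rewrite -ltNge => h2.
have hm z : f x + inner y (z - x) <= Num.max (f z) (g z).
  by have := yx z; rewrite /= -fg maxxx.
pose z (t : R) := t *: z1 + (1 - t) *: z2.
pose a (w : V) := f x + inner y (w - x).
have az t : a (z t) = t * a z1 + (1 - t) * a z2 by rewrite /a /z !innerB innerD !innerZ; ring.
have zc : continuous z.
  move=> t; apply: cvgD; first by apply: cvgZr_tmp; exact: cvg_id.
  by apply: cvgZr_tmp; apply: cvgB; [exact: cvg_cst|exact: cvg_id].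
pose d (t : R) := f (z t) - g (z t).
have dc : continuous d.
  by apply: ctsB => t; apply: continuous_comp; [exact: zc|exact: convex_continuous| exact: zc|exact: convex_continuous].
have d0 : 0 < d 0.
  rewrite /d /z scale0r add0r subr0 scale1r subr_gt0.
  have := hm z2; rewrite le_max => /orP[h|h]; last by move: h; rewrite fg leNgt h2.
  by apply: lt_le_trans h; rewrite fg.
have d1 : d 1 < 0.
  rewrite /d /z subrr scale0r addr0 scale1r subr_lt0.
  have := hm z1; rewrite le_max => /orP[h|h]; first by move: h; rewrite leNgt h1.
  by apply: lt_le_trans h.
have [t t01 dt] : exists2 t, t \in `[(0 : R), 1] & d t = 0.
  apply: (@IVT R d 0 1 0); first exact: ler01.
    exact: continuous_subspaceT.
  by have d10 := ltW (lt_trans d1 d0); rewrite (min_r d10) (max_l d10) (ltW d0) (ltW d1).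
move: t01; rewrite in_itv /= => t01; have [t0 t1] := andP t01.
have fgt : f (z t) = g (z t) by apply/eqP; rewrite -subr_eq0; apply/eqP.
have := hm (z t); rewrite -fgt maxxx -/(a (z t)) az => h.
have := cm z1 z2 t t01; rewrite -/(z t) -fgt minxx => h'.
have m1 : Num.min (f z1) (g z1) < a z1 by rewrite gt_min h1.
have m2 : Num.min (f z2) (g z2) < a z2 by rewrite gt_min /a fg h2 orbT.
have [t_0|t_0] := eqVneq t 0.
  by move: h h'; rewrite t_0; lra.
have tp : 0 < t by rewrite lt_neqAle eq_sym t_0.
have : t * Num.min (f z1) (g z1) < t * a z1 by rewrite ltr_pM2l.
have : (1 - t) * Num.min (f z2) (g z2) <= (1 - t) * a z2 by rewrite ler_wpM2l ?subr_ge0// ltW.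
lra.
Qed.

(** A slope touching [f] at x and [g] at x', both contact points, gives the same supporting plane at
    both, which therefore lies below the minimum. *)
Lemma subgrad_min_contact f g (C : set V) : (forall x, C x -> f x = g x) ->
  subgrad (fun x => Num.min (f x) (g x)) C = subgrad f C `&` subgrad g C.
Proof.
move=> fg; apply/seteqP; split => y.
  move=> [x Cx yx]; split; exists x => // z; have := yx z; rewrite /= -(fg x Cx) minxx => h;
    by apply: (le_trans h); rewrite ge_min lexx ?orbT.
move=> [[x Cx yx] [x' Cx' yx']]; exists x => // z.
have h1 := yx x'; have h2 := yx' x; have h3 := yx z; have h4 := yx' z.
rewrite /= (fg x Cx) minxx; rewrite !innerB (fg x Cx) in h1 h2 h3 h4 *.
rewrite (fg x' Cx') in h1.
by rewrite le_min; apply/andP; split; lra.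
Qed.

Lemma subgrad_max_contact f g (C : set V) : convex_fun f -> convex_fun g ->
  convex_fun (fun x => Num.min (f x) (g x)) -> (forall x, C x -> f x = g x) ->
  subgrad (fun x => Num.max (f x) (g x)) C = subgrad f C `|` subgrad g C.
Proof.
move=> cf cg cm fg; apply/seteqP; split => y.
  by move=> [x Cx]; rewrite subdiff_max ?fg// => -[h|h]; [left|right]; exists x.
by move=> [] [x Cx h]; exists x => //; rewrite subdiff_max ?fg//; [left|right].
Qed.

(** On the contact set the valuation identity is inclusion-exclusion for the Lebesgue measure of
    subgradient images. *)
Lemma maf_val_contact f g (C : set V) : convex_fun f -> convex_fun g ->
  convex_fun (fun x => Num.min (f x) (g x)) -> (forall x, C x -> f x = g x) ->
  bounded_set C -> measurable C ->
  maf (fun x => Num.max (f x) (g x)) C + maf (fun x => Num.min (f x) (g x)) C = maf f C + maf g C.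
Proof.
move=> cf cg cm fg bC mC; rewrite /maf subgrad_max_contact// subgrad_min_contact//.
pose N := nonuniq f `|` nonuniq g.
have mN : measurable N by apply: measurableU; exact: nonuniq_measurable.
have N0 : leb_outer N = 0%E.
  apply/eqP; rewrite eq_le leb_outer_ge0 andbT.
  apply: le_trans (outer_measureU2 (@leb_outer R n) _ _) _.
  by rewrite [X in (X + _)%E](nonuniq_null cf) [X in (_ + X)%E](nonuniq_null cg) adde0.
have mP : measurable (subgrad f C `\` N).
  by rewrite /N -setDDl; apply: measurableD; [exact: subgradD_measurable|exact: nonuniq_measurable].
have mQ : measurable (subgrad g C `\` N).
  by rewrite /N setUC -setDDl; apply: measurableD; [exact: subgradD_measurable|exact: nonuniq_measurable].
have fin h (A : set V) : convex_fun h -> A `<=` subgrad h C -> leb_outer A \is a fin_num.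
  move=> ch AC; rewrite ge0_fin_numE ?leb_outer_ge0//; apply: leb_outer_bounded.
  by apply: sub_bounded_set AC _; exact: subgrad_bounded_set.
rewrite -(leb_outer_null (subgrad f C `|` subgrad g C) N0) -(leb_outer_null (subgrad f C `&` subgrad g C) N0).
rewrite -(leb_outer_null (subgrad f C) N0) -(leb_outer_null (subgrad g C) N0).
set P := subgrad f C `\` N in mP *; set Q := subgrad g C `\` N in mQ *.
have -> : (subgrad f C `|` subgrad g C) `\` N = P `|` Q by rewrite setDUl.
have -> : (subgrad f C `&` subgrad g C) `\` N = P `&` Q.
  by apply/seteqP; split => [y [[? ?] ?]|y [[? ?] [? ?]]].
have fP : leb_outer P \is a fin_num by apply: (fin f) => // y [].
have fQ : leb_outer Q \is a fin_num by apply: (fin g) => // y [].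
have fPQ : leb_outer (P `&` Q) \is a fin_num by apply: (fin f) => // y [[]].
have := @measureUfinl _ _ _ (@leb R n) P Q mP mQ.
rewrite -ge0_fin_numE ?leb_outer_ge0// => /(_ fP) e.
have -> : leb_outer (P `|` Q) = (leb_outer P + leb_outer Q - leb_outer (P `&` Q))%E by exact: e.
by rewrite fineB ?fin_numD ?fP ?fQ// fineD// subrK.
Qed.

Lemma open_lt_continuous f g : continuous f -> continuous g -> open [set x | f x < g x].
Proof.
move=> cf cg; rewrite (_ : mkset _ = (fun x => g x - f x) @^-1` [set t | 0 < t]); last first.
  by apply/seteqP; split => x /=; rewrite subr_gt0.
by apply: open_comp; [move=> x _; exact: (ctsB cg cf)|exact: open_gt].
Qed.

(** On the open sets f < g and g < f the identity follows from locality; what is left is the contact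
    set. *)
Lemma maf_valuation f g (B : set V) : convex_fun f -> convex_fun g ->
  convex_fun (fun x => Num.min (f x) (g x)) -> bounded_set B -> measurable B ->
  maf (fun x => Num.max (f x) (g x)) B + maf (fun x => Num.min (f x) (g x)) B = maf f B + maf g B.
Proof.
move=> cf cg cm bB mB; have cM := convex_fun_max cf cg.
pose U1 := [set x | f x < g x]; pose U2 := [set x | g x < f x].
pose C := B `\` (U1 `|` U2).
have oU1 : open U1 by apply: open_lt_continuous; exact: convex_continuous.
have oU2 : open U2 by apply: open_lt_continuous; exact: convex_continuous.
have mU1 := measurable_open_rV oU1; have mU2 := measurable_open_rV oU2.
have mC : measurable C by apply: measurableD => //; exact: measurableU.
have bC : bounded_set C by apply: sub_bounded_set bB => x [].
have split3 h : convex_fun h -> maf h B = maf h (B `&` U1) + maf h (B `&` U2) + maf h C.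
  move=> ch; have rh := maf_radon ch.
  have mB1 : measurable (B `&` U1) by exact: measurableI.
  have mB2 : measurable (B `&` U2) by exact: measurableI.
  have sub A : A `<=` B -> bounded_set A by move=> AB; exact: sub_bounded_set AB bB.
  have B12 : (B `&` U1) `&` (B `&` U2) = set0.
    by apply/seteqP; split => // x [[_ h1] [_ h2]]; move: (lt_trans h1 h2); rewrite ltxx.
  rewrite -(rradonU rh mB1 mB2 _ B12); last by apply: sub => x [] [].
  rewrite -(rradonU rh (measurableU _ _ mB1 mB2) mC); last 2 first.
  - by apply: sub => x [[|]|] [].
  - by apply/seteqP; split => // x [[[Bx hx]|[Bx hx]] [_ nh]]; apply: nh; [left|right].
  congr (maf h); apply/seteqP; split => x; last by move=> [[[]|[]]|[]].
  move=> Bx; have [h1|h1] := pselect (U1 x); first by left; left.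
  have [h2|h2] := pselect (U2 x); first by left; right.
  by right; split => // -[].
have hC x : C x -> f x = g x.
  move=> [_ h]; apply/eqP; rewrite eq_le !leNgt; apply/andP; split; apply/negP => h'; apply: h.
    by right.
  by left.
have vC := maf_val_contact cf cg cm hC bC mC.
rewrite (split3 _ cM) (split3 _ cm) (split3 _ cf) (split3 _ cg).
rewrite (@maf_local _ g U1 B cM cg oU1); last by move=> x /= h; rewrite max_r// ltW.
rewrite (@maf_local _ f U2 B cM cf oU2); last by move=> x /= h; rewrite max_l// ltW.
rewrite (@maf_local _ f U1 B cm cf oU1); last by move=> x /= h; rewrite min_l// ltW.
rewrite (@maf_local _ g U2 B cm cg oU2); last by move=> x /= h; rewrite min_r// ltW.
lra.
Qed.

Theorem maval_maf : maval n (@maf R n).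
Proof.
split.
- exact: maf_radon.
- by move=> fs f cfs cf fsf phi cp sp; exact: maf_continuous.
- by move=> f g cf cg cm B bB mB; exact: maf_valuation.
- by move=> f l cf al B bB mB; exact: maf_affine.
- by move=> f h U cf ch oU fh B bB mB; exact: maf_local.
- by move=> f x cf B bB mB; exact: maf_trans.
- by move=> f t cf t0 B bB mB; exact: maf_hom.
Qed.

End MongeAmpereValuation.

(** * Twice continuously differentiable functions and exponential sums *)

Section SecondOrderCalculus.
Variables (R : realType) (n : nat).
Local Notation V := 'rV[R]_n.
Implicit Types (f h : V -> R) (g : 'I_n -> V -> R).

(** Two uses of the mean value theorem put the graph above its tangents. *)
Lemma convex1_deriv2 (f f1 f2 : R -> R) : (forall x : R, is_derive x 1 f (f1 x)) ->
  (forall x : R, is_derive x 1 f1 (f2 x)) -> (forall x, 0 <= f2 x) -> convex1 f.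
Proof.
move=> df df1 f2p.
have cts (u u' : R -> R) : (forall x : R, is_derive x 1 u (u' x)) -> continuous u.
  by move=> du x; apply: differentiable_continuous; apply/derivable1_diffP; have [] := du x.
have tangent m b : f m + f1 m * (b - m) <= f b.
  have [bm|mb|->] := ltgtP b m; last by rewrite subrr mulr0 addr0.
    have [c /[!in_itv]/= /andP[c1 c2] e] := MVT bm (fun x _ => df x) (continuous_subspaceT (cts _ _ df)).
    have [d _ e'] := MVT_segment (ltW c2) (fun x _ => df1 x) (continuous_subspaceT (cts _ _ df1)).
    have : 0 <= f2 d * (m - c) by rewrite mulr_ge0// subr_ge0 ltW.
    rewrite -e' => h; have : 0 <= (f1 m - f1 c) * (m - b) by rewrite mulr_ge0// subr_ge0 ltW.
    move: e; move: (f m) (f b) (f1 m) (f1 c) => A B C E; nra.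
  have [c /[!in_itv]/= /andP[c1 c2] e] := MVT mb (fun x _ => df x) (continuous_subspaceT (cts _ _ df)).
  have [d _ e'] := MVT_segment (ltW c1) (fun x _ => df1 x) (continuous_subspaceT (cts _ _ df1)).
  have : 0 <= f2 d * (c - m) by rewrite mulr_ge0// subr_ge0 ltW.
  rewrite -e' => h; have : 0 <= (f1 c - f1 m) * (b - m) by rewrite mulr_ge0// subr_ge0 ltW.
  move: e; move: (f m) (f b) (f1 m) (f1 c) => A B C E; nra.
move=> a b t /andP[t0 t1]; set m := t * a + _.
have t1' : 0 <= 1 - t by rewrite subr_ge0.
have := lerD (ler_wpM2l t0 (tangent m a)) (ler_wpM2l t1' (tangent m b)).
apply: le_trans; rewrite le_eqVlt; apply/orP; left; apply/eqP; rewrite /m; ring.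
Qed.

Definition has_grad f g := forall x, differentiable f x /\ forall i, 'D_(evec R i) f x = g i x.

Lemma has_grad_ext f f' g g' : f =1 f' -> (forall i, g i =1 g' i) -> has_grad f g -> has_grad f' g'.
Proof. by move=> /funext <- gg' fg x; have [d e] := fg x; split => // i; rewrite e gg'. Qed.

Lemma has_grad_continuous f g : has_grad f g -> continuous f.
Proof. by move=> fg x; apply: differentiable_continuous; have [] := fg x. Qed.

Lemma has_grad_cst c : has_grad (fun=> c) (fun _ _ => 0).
Proof. by move=> x; split => [|i]; [exact: differentiable_cst|exact: derive_cst]. Qed.

Lemma has_gradD f h g g' : has_grad f g -> has_grad h g' ->
  has_grad (fun x => f x + h x) (fun i x => g i x + g' i x).
Proof.
move=> fg hg' x; have [df ef] := fg x; have [dh eh] := hg' x.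
split => [|i]; first exact: differentiableD.
by rewrite (@deriveD _ _ _ f h) ?ef ?eh//; exact: diff_derivable.
Qed.

Lemma has_gradM f h g g' : has_grad f g -> has_grad h g' ->
  has_grad (fun x => f x * h x) (fun i x => f x * g' i x + h x * g i x).
Proof.
move=> fg hg' x; have [df ef] := fg x; have [dh eh] := hg' x.
split => [|i]; first exact: differentiableM.
by rewrite (@deriveM _ _ f h) ?ef ?eh//; exact: diff_derivable.
Qed.

Lemma has_gradZ c f g : has_grad f g -> has_grad (fun x => c * f x) (fun i x => c * g i x).
Proof.
move=> fg; apply: has_grad_ext (has_gradM (has_grad_cst c) fg) => // i x.
by rewrite mulr0 addr0.
Qed.

Lemma has_grad_sum (I : Type) (r : seq I) (F : I -> V -> R) (G : I -> 'I_n -> V -> R) :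
  (forall k, has_grad (F k) (G k)) ->
  has_grad (fun x => \sum_(k <- r) F k x) (fun i x => \sum_(k <- r) G k i x).
Proof.
move=> FG; elim: r => [|k r ih].
  by apply: has_grad_ext (has_grad_cst 0) => [x|i x]; rewrite big_nil.
by apply: has_grad_ext (has_gradD (FG k) ih) => [x|i x]; rewrite big_cons.
Qed.

Lemma has_grad_dir f g x v : has_grad f g -> 'D_v f x = \sum_i v ord0 i * g i x.
Proof.
move=> fg; have [df ef] := fg x.
rewrite deriveE// [in LHS](row_sum_delta v) raddf_sum; apply: eq_bigr => i _.
transitivity (v ord0 i *: ('d f x (evec R i) : R)); first exact: linearZ.
by rewrite -deriveE// ef.
Qed.

Lemma has_grad_line f g (x v : V) (t : R) : has_grad f g ->
  is_derive t 1 (fun t : R => f (x + t *: v)) (\sum_i v ord0 i * g i (x + t *: v)).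
Proof.
move=> fg; have [df ef] := fg (x + t *: v).
have E : (fun h : R => h^-1 *: (((fun t : R => f (x + t *: v)) \o shift t) (h *: 1) - f (x + t *: v))) =
    (fun h : R => h^-1 *: ((f \o shift (x + t *: v)) (h *: v) - f (x + t *: v))).
  apply/funext => h /=; congr (_ *: (f _ - _)).
  by rewrite [h *: (1 : R)]mulr1 scalerDl addrCA.
apply: DeriveDef; first by rewrite /derivable E; exact: diff_derivable.
by rewrite /derive E -/(derive f (x + t *: v) v) (has_grad_dir _ _ fg).
Qed.

Lemma has_grad_comp (q q' : R -> R) f g : (forall t : R, is_derive t 1 q (q' t)) -> has_grad f g ->
  has_grad (fun x => q (f x)) (fun i x => q' (f x) * g i x).
Proof.
move=> dq fg x; have [df ef] := fg x.
have [dqx eq] := dq (f x).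
have dqx' : differentiable q (f x) by apply/derivable1_diffP.
split => [|i]; first exact: (differentiable_comp df dqx').
rewrite (@deriveE _ _ _ (q \o f)); last exact: (differentiable_comp df dqx').
by rewrite diff_comp//= deriv1E// -deriveE// ef derive1E eq [LHS]mulrC.
Qed.

Lemma has_grad_coord j : has_grad (fun x : V => x ord0 j) (fun i _ => (i == j)%:R).
Proof.
move=> x; split => [|i]; first exact: differentiable_coord.
rewrite deriveE; last exact: differentiable_coord.
have lin : linear (fun y : V => y ord0 j : R^o) by move=> a u w; rewrite !mxE.
pose M := GRing.isLinear.Build _ _ _ _ _ lin.
pose L : {linear V -> R^o} := HB.pack (fun y : V => y ord0 j : R^o) M.
have -> : (fun x : V => x ord0 j) = L by [].
rewrite diff_lin; last exact: coord_continuous.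
by rewrite /= /evec mxE eqxx eq_sym.
Qed.

Lemma has_grad_inner y : has_grad (inner y) (fun i _ => y ord0 i).
Proof.
apply: has_grad_ext (has_grad_sum (index_enum 'I_n) (fun k => has_gradZ (y ord0 k) (has_grad_coord k))) => // i x.
rewrite (bigD1 i)//= eqxx mulr1 big1 ?addr0// => k ki; by rewrite eq_sym (negbTE ki) mulr0.
Qed.

(** C^2 regularity with gradient and Hessian as explicit data, so that the closure rules also
    compute Hessians. *)
Definition smooth2 f g (H : 'I_n -> 'I_n -> V -> R) :=
  [/\ has_grad f g, forall i, has_grad (g i) (H i) & forall i j, continuous (H i j)].

Lemma smooth2P f : C2_fun f <-> exists g H, smooth2 f g H.
Proof.
split => [[df [dDf cDDf]]|[g [H [fg gH cH]]]].
  exists (fun i => 'D_(evec R i) f), (fun i j => 'D_(evec R j) ('D_(evec R i) f)).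
  by split => // i x; split.
have eg i : 'D_(evec R i) f = g i by apply/funext => x; have [_ ->] := fg x.
split; first by move=> x; have [] := fg x.
split=> [i x|i j]; rewrite eg; first by have [] := gH i x.
have -> : 'D_(evec R j) (g i) = H i j by apply/funext => x; have [_ ->] := gH i x.
exact: cH.
Qed.

Lemma smooth2_hessian f g H x : smooth2 f g H -> hessian f x = \matrix_(i, j) H i j x.
Proof.
move=> [fg gH _]; apply/matrixP => i j; rewrite !mxE.
have -> : 'D_(evec R i) f = g i by apply/funext => y; have [_ ->] := fg y.
by have [_ ->] := gH i x.
Qed.

Lemma smooth2D f g H f' g' H' : smooth2 f g H -> smooth2 f' g' H' ->
  smooth2 (fun x => f x + f' x) (fun i x => g i x + g' i x) (fun i j x => H i j x + H' i j x).
Proof.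
move=> [fg gH cH] [fg' gH' cH']; split.
- exact: has_gradD.
- by move=> i; exact: has_gradD.
- by move=> i j; exact: ctsD.
Qed.

Lemma smooth2Z c f g H : smooth2 f g H ->
  smooth2 (fun x => c * f x) (fun i x => c * g i x) (fun i j x => c * H i j x).
Proof.
move=> [fg gH cH]; split.
- exact: has_gradZ.
- by move=> i; exact: has_gradZ.
- by move=> i j; exact: ctsZ.
Qed.

Lemma smooth2M f g H f' g' H' : smooth2 f g H -> smooth2 f' g' H' ->
  smooth2 (fun x => f x * f' x) (fun i x => f x * g' i x + f' x * g i x)
    (fun i j x => (f x * H' i j x + g' i x * g j x) + (f' x * H i j x + g i x * g' j x)).
Proof.
move=> [fg gH cH] [fg' gH' cH']; split.
- exact: has_gradM.
- by move=> i; apply: has_gradD; exact: has_gradM.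
- move=> i j; have c1 := has_grad_continuous fg; have c2 := has_grad_continuous fg'.
  have c3 k := has_grad_continuous (gH k); have c4 k := has_grad_continuous (gH' k).
  by apply: ctsD; apply: ctsD; apply: ctsM.
Qed.

Lemma smooth2_comp (q q1 q2 : R -> R) f g H : (forall t : R, is_derive t 1 q (q1 t)) ->
  (forall t : R, is_derive t 1 q1 (q2 t)) -> continuous q2 -> smooth2 f g H ->
  smooth2 (fun x => q (f x)) (fun i x => q1 (f x) * g i x)
    (fun i j x => q1 (f x) * H i j x + g i x * (q2 (f x) * g j x)).
Proof.
move=> dq dq1 cq2 [fg gH cH].
have cf := has_grad_continuous fg; have cg k := has_grad_continuous (gH k).
have cq1 := has_grad_continuous (has_grad_comp dq1 fg).
split.
- exact: has_grad_comp.
- by move=> i; apply: has_gradM => //; exact: has_grad_comp.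
- move=> i j; apply: ctsD; first exact: ctsM.
  by apply: ctsM => //; apply: ctsM => // x; apply: continuous_comp; [exact: cf|exact: cq2].
Qed.

Lemma smooth2_inner y : smooth2 (inner y) (fun i _ => y ord0 i) (fun _ _ _ => 0).
Proof.
split; [exact: has_grad_inner|by move=> i; exact: has_grad_cst|by move=> i j; exact: cts_cst].
Qed.

Lemma smooth2_cst c : smooth2 (fun=> c) (fun _ _ => 0) (fun _ _ _ => 0).
Proof. by split; [exact: has_grad_cst|move=> i; exact: has_grad_cst|move=> i j; exact: cts_cst]. Qed.

Lemma smooth2_exp y : smooth2 (fun x => expR (inner y x)) (fun i x => expR (inner y x) * y ord0 i)
  (fun i j x => expR (inner y x) * sq y i j).
Proof.
have de (t : R) : is_derive t 1 expR (expR t) by exact: is_derive_expR.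
have [h1 h2 h3] := smooth2_comp de de (@continuous_expR R) (smooth2_inner y).
have E i j x : expR (inner y x) * 0 + y ord0 i * (expR (inner y x) * y ord0 j) = expR (inner y x) * sq y i j.
  by rewrite sqE; ring.
split => //; first by move=> i; apply: has_grad_ext (h2 i) => // j x; exact: E.
move=> i j; rewrite (_ : (fun x => _) = (fun x => expR (inner y x) * 0 + y ord0 i * (expR (inner y x) * y ord0 j)))//.
by apply/funext => x; rewrite E.
Qed.

Lemma smooth2_sq y : smooth2 (fun x => (inner y x) ^+ 2 / 2) (fun i x => inner y x * y ord0 i)
  (fun i j x => sq y i j).
Proof.
have [h1 h2 h3] := smooth2Z (2^-1) (smooth2M (smooth2_inner y) (smooth2_inner y)).
split.
- by apply: has_grad_ext h1 => [x|i x]; [rewrite expr2 mulrC|field].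
- by move=> i; apply: has_grad_ext (h2 i) => [x|j x]; [field|rewrite sqE; field].
- by move=> i j; exact: cts_cst.
Qed.

Lemma smooth2_sum (I : Type) (r : seq I) (F : I -> V -> R) G H :
  (forall k, smooth2 (F k) (G k) (H k)) ->
  smooth2 (fun x => \sum_(k <- r) F k x) (fun i x => \sum_(k <- r) G k i x) (fun i j x => \sum_(k <- r) H k i j x).
Proof.
move=> s; split.
- by apply: has_grad_sum => k; have [] := s k.
- by move=> i; apply: has_grad_sum => k; have [] := s k.
- by move=> i j; apply: cts_sum => k _; have [] := s k.
Qed.

Lemma smooth2_line f g H (x v : V) : smooth2 f g H ->
  (forall t : R, is_derive t 1 (fun t : R => f (x + t *: v)) (\sum_i v ord0 i * g i (x + t *: v))) /\
  (forall t : R, is_derive t 1 (fun t : R => \sum_i v ord0 i * g i (x + t *: v))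
     (\sum_i \sum_j v ord0 i * v ord0 j * H i j (x + t *: v))).
Proof.
move=> [fg gH _]; split => t; first exact: has_grad_line.
have hs := has_grad_sum (index_enum 'I_n) (fun k => has_gradZ (v ord0 k) (gH k)).
rewrite (_ : \sum_i \sum_j _ = \sum_j v ord0 j * \sum_i v ord0 i * H i j (x + t *: v)); first exact: (has_grad_line x v t hs).
rewrite exchange_big /=; apply: eq_bigr => j _; rewrite mulr_sumr.
by apply: eq_bigr => i _; ring.
Qed.

Lemma smooth2_convex f g H : smooth2 f g H ->
  (forall x v : V, 0 <= \sum_i \sum_j v ord0 i * v ord0 j * H i j x) -> convex_fun f.
Proof.
move=> s Hp a b t t01; have [d1 d2] := smooth2_line b (a - b) s.
have := convex1_deriv2 d1 d2 (fun t => Hp _ _) 1 0 t01.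
rewrite mulr1 mulr0 addr0 scale1r scale0r addr0 [b + (a - b)]addrC subrK.
rewrite (_ : b + t *: (a - b) = t *: a + (1 - t) *: b)//.
by apply/rowP => i; rewrite !mxE; ring.
Qed.

Lemma C2_fun_mul f h : C2_fun f -> C2_fun h -> C2_fun (fun x => f x * h x).
Proof.
by move=> /smooth2P[g [H s]] /smooth2P[g' [H' s']]; apply/smooth2P; do 2 eexists; exact: smooth2M s s'.
Qed.

End SecondOrderCalculus.

(** * Averages against powers of a peaked kernel *)

Section CubeIntegrals.
Variables (R : realType) (n : nat).
Local Notation V := 'rV[R]_n.
Local Notation lebS := (@leb R n : {sigma_finite_measure set V -> \bar R}).
Implicit Types (f g k u : V -> R).

Lemma integrable_cube (D : R) g : continuous g -> (@leb R n).-integrable (cube D) (EFin \o g).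
Proof.
move=> cg; have [M M0 gM] := continuous_bounded_cube D cg.
apply: measurable_bounded_integrable => //.
- exact: measurable_cube.
- exact/leb_outer_bounded/bounded_cube.
- by apply: measurable_continuous_rV => //; exact: measurable_cube.
- exists M; split; first exact: num_real.
  by move=> x Mx y yD; apply: le_trans (ltW Mx); exact: gM.
Qed.

Definition cint (D : R) g : R := Rintegral (@leb R n) (cube D) g.

Lemma cintD D f g : continuous f -> continuous g -> cint D (fun z => f z + g z) = cint D f + cint D g.
Proof. by move=> cf cg; apply: RintegralD; [exact: measurable_cube|exact: integrable_cube..]. Qed.

Lemma cintZ D c f : continuous f -> cint D (fun z => c * f z) = c * cint D f.
Proof. by move=> cf; apply: RintegralZl; [exact: measurable_cube|exact: integrable_cube]. Qed.

Lemma cint_le D f g : continuous f -> continuous g -> (forall z, cube D z -> f z <= g z) -> cint D f <= cint D g.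
Proof. by move=> cf cg fg; apply: le_Rintegral => //; [exact: measurable_cube|exact: integrable_cube..]. Qed.

Lemma cint_norm D f : continuous f -> `|cint D f| <= cint D (fun z => `|f z|).
Proof. by move=> cf; apply: le_normr_Rintegral; [exact: measurable_cube|exact: integrable_cube]. Qed.

Lemma cint_cst D c : cint D (fun=> c) = c * fine (leb (cube D : set V)).
Proof. by rewrite /cint Rintegral_cst//; exact: measurable_cube. Qed.

Lemma cint_sum (I : Type) (r : seq I) D (F : I -> V -> R) : (forall i, continuous (F i)) ->
  cint D (fun z => \sum_(i <- r) F i z) = \sum_(i <- r) cint D (F i).
Proof.
move=> cF; elim: r => [|i r ih].
  rewrite big_nil -[RHS](mul0r (fine (leb (cube D : set V)))) -cint_cst; congr (cint D _).
  by apply/funext => z; rewrite big_nil.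
rewrite big_cons -ih -cintD//; last by apply: cts_sum.
by congr (cint D _); apply/funext => z; rewrite big_cons.
Qed.

Lemma cts_norm g : continuous g -> continuous (fun x => `|g x|).
Proof. by move=> cg x; exact: cvg_norm (cg x). Qed.

Lemma cts_shift g (x : V) : continuous g -> continuous (fun z => g (x + z)).
Proof.
move=> cg z; apply: (@continuous_comp _ _ _ (fun z => x + z) g); last exact: cg.
exact: (@cvgD R V V (nbhs z) (nbhs_filter z) (cst x) id x z (cvg_cst x) cvg_id).
Qed.

Lemma leb_cube_gt0 (r : R) : 0 < r -> 0 < fine (leb (cube r : set V)).
Proof.
move=> r0; apply: (@lt_le_trans _ _ (r ^+ n)); first exact: exprn_gt0.
rewrite -lee_fin fineK; last by rewrite ge0_fin_numE ?leb_outer_ge0//; exact/leb_outer_bounded/bounded_cube.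
apply: (@le_trans _ _ (leb_outer [set r *: a | a in (box (fun=> 0) (fun=> 1) : set V)])).
  by rewrite leb_outer_scale// leb_unit_box mule1.
apply: le_leb_outer => _ [a ha <-] i; rewrite mxE; have /andP[h1 h2] := ha i.
by apply/andP; split; nra.
Qed.

(** The layer-cake formula reduces this to translation invariance of [leb] on level sets. *)
Lemma Rintegral_shift g (r : R) (a : V) : continuous g -> supp_in g (cube r) ->
  Rintegral (@leb R n) setT (fun z => g (a + z)) = Rintegral (@leb R n) setT g.
Proof.
move=> cg sg.
have lay h r' : continuous h -> supp_in h (cube r') ->
    Rintegral (@leb R n) setT h = layer_int (fun A => fine (leb A)) h.
  move=> ch sh; apply/esym/layer_intE.
  have [M M0 hM] := continuous_supp_bounded ch sh.
  have mh : measurable_fun setT h by exact: measurable_continuous_rV.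
  have ih : (@leb R n).-integrable setT (EFin \o h) by exact: integrable_bounded_supp sh.
  have chN : continuous (fun x => - h x) by exact: ctsN.
  have mhN : measurable_fun setT (fun x => - h x) by exact: measurable_continuous_rV.
  have shN : supp_in (fun x => - h x) (cube r') by move=> x; rewrite oppr_eq0 => /sh.
  have bd q t : supp_in q (cube r') -> 0 <= t -> (leb ([set x | (t < q x)%R] : set V) < +oo)%E.
    by move=> sq t0; apply: leb_outer_bounded; apply: sub_bounded_set (supp_gt sq t0) (@bounded_cube _ _ r').
  have : is_layer (fun t => fine (layer lebS (fun=> 1) h t))
     (fun t => fine (layer lebS (fun=> 1) (fun y => - h y) t)) (Rintegral (@leb R n) setT h).
    rewrite [X in is_layer _ _ X](_ : _ = Rintegral (@leb R n) setT (fun y => 1 * h y)); last first.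
      by apply: eq_Rintegral => y _; rewrite mul1r.
    apply: is_layer_measure => //.
    - by apply: eq_integrable ih => // y _ /=; rewrite mul1r.
    - by move=> t t0; rewrite layer_cst//; exact: bd.
    - by move=> t t0; rewrite layer_cst//; exact: bd.
  apply: eq_is_layer => t; rewrite inE /= => t0; rewrite layer_cst//.
  by congr (fine (leb _)); apply/seteqP; split => x /=; rewrite ltrNr.
have cga := @cts_shift g a cg.
have sga : supp_in (fun z => g (a + z)) (cube (`|r| + `|a|)).
  move=> z /sg cz; apply/cube_norm; first by rewrite addr_ge0.
  have -> : z = (a + z) - a by rewrite addrC addKr.
  apply: le_trans (ler_normB _ _) _; rewrite lerD2r; apply/cube_norm => // i.
  have /andP[h1 h2] := cz i; have := ler_norm r; have := ler_norm (- r); rewrite normrN => h3 h4.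
  by apply/andP; split; lra.
rewrite (lay _ _ cga sga) (lay _ _ cg sg) /layer_int.
have sh (P : set V) : leb [set x | P (a + x)] = leb P.
  rewrite -[LHS](leb_shift _ a); congr leb; apply/seteqP; split => [_ [x Px <-]|x Px].
    by rewrite addrC.
  by exists (x - a); rewrite /= ?subrK// addrC subrK.
by congr (_ - _); apply: eq_Rintegral => t _; congr fine; [exact: (sh [set x | t < g x])|exact: (sh [set x | g x < - t])].
Qed.

Section Kernel.
Variables (Q : V -> R) (D : R).
Hypotheses (D0 : 0 < D) (cQ : continuous Q) (Q0 : Q 0 = 1).
Hypothesis Q01 : forall z, cube D z -> 0 <= Q z <= 1.
Hypothesis Q1 : forall z, cube D z -> z != 0 -> Q z < 1.

(** Normalisation in Laplace's method: the powers of a kernel with unique maximum 1 at 0 concentrate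
    at 0. *)
Definition kmass N := cint D (fun z => Q z ^+ N).
Definition kavg N g := (kmass N)^-1 * cint D (fun z => Q z ^+ N * g z).

Let cQN N : continuous (fun z => Q z ^+ N).
Proof.
elim: N => [|N ih]; first by under eq_fun do rewrite expr0; exact: cts_cst.
by rewrite (_ : (fun z => _) = (fun z => Q z * Q z ^+ N)); [exact: ctsM|apply/funext => z; rewrite exprS].
Qed.

(** [Q] exceeds q on a small cube around 0, so the mass decays no faster than q^N, for any q < 1. *)
Lemma kmass_lower (q : R) : 0 <= q -> q < 1 -> exists2 c, 0 < c & forall N, c * q ^+ N <= kmass N.
Proof.
move=> q0 q1; have /cvgrPdist_lt/(_ (1 - q)) := @cQ 0.
rewrite subr_gt0 => /(_ q1) /nbhs_ballP[d /= d0 hd].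
pose d' := Num.min (d / 2) D; have d'0 : 0 < d' by rewrite lt_min D0 divr_gt0.
exists (fine (leb (cube d' : set V))); first exact: leb_cube_gt0.
move=> N; rewrite mulrC -cint_cst /kmass.
have sub : cube d' `<=` (cube D : set V).
  move=> z /(cube_norm _ (ltW d'0)) zd; apply/cube_norm; first exact: ltW.
  by apply: (le_trans zd); rewrite /d' ge_min lexx orbT.
apply: (@le_trans _ _ (cint d' (fun z => Q z ^+ N))).
  apply: cint_le => //; first by apply: cts_cst.
  move=> z cz; apply: lerXn2r; rewrite ?nnegrE//; first by have /andP[] := Q01 (sub _ cz).
  have zd : ball (0 : V) d z.
    rewrite mx_norm_ball /ball_ /= sub0r normrN; move/(cube_norm _ (ltW d'0)) : cz => cz.
    apply: (le_lt_trans cz); rewrite /d' gt_min; apply/orP; left; lra.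
  by have := hd z zd; rewrite Q0 ltr_norml => /andP[_]; lra.
rewrite /cint /Rintegral fine_le//.
- by apply: integrable_fin_num; [exact: measurable_cube|exact: integrable_cube].
- by apply: integrable_fin_num; [exact: measurable_cube|exact: integrable_cube].
- apply: ge0_subset_integral => //; [exact: measurable_cube|exact: measurable_cube| |].
    by apply/measurable_EFinP; apply: measurable_continuous_rV => //; exact: measurable_cube.
  by move=> z cz; rewrite lee_fin exprn_ge0//; have /andP[] := Q01 cz.
Qed.

Lemma kmass_gt0 N : 0 < kmass N.
Proof.
have [c c0 hc] := @kmass_lower (2^-1) ltac:(lra) ltac:(lra).
by apply: lt_le_trans (hc N); rewrite mulr_gt0// exprn_gt0.
Qed.

Lemma kavgD N f g : continuous f -> continuous g -> kavg N (fun z => f z + g z) = kavg N f + kavg N g.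
Proof.
move=> cf cg; rewrite /kavg -mulrDr -cintD; [|exact: ctsM..].
by congr (_ * cint D _); apply/funext => z; rewrite mulrDr.
Qed.

Lemma kavgZ N c f : continuous f -> kavg N (fun z => c * f z) = c * kavg N f.
Proof.
move=> cf; rewrite /kavg mulrCA -[in RHS]cintZ; last exact: ctsM.
by congr (_ * cint D _); apply/funext => z; rewrite mulrCA.
Qed.

Lemma kavg_cst N c : kavg N (fun=> c) = c.
Proof.
rewrite /kavg (_ : (fun z => _) = (fun z => c * Q z ^+ N)); last by apply/funext => z; rewrite mulrC.
by rewrite cintZ// -/(kmass N) mulrCA mulVf ?mulr1// gt_eqF// kmass_gt0.
Qed.

Lemma kavg_le N f g : continuous f -> continuous g -> (forall z, cube D z -> f z <= g z) -> kavg N f <= kavg N g.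
Proof.
move=> cf cg fg; rewrite /kavg ler_pM2l ?invr_gt0 ?kmass_gt0//; apply: cint_le; [exact: ctsM..|].
by move=> z cz; rewrite ler_wpM2l ?fg// exprn_ge0//; have /andP[] := Q01 cz.
Qed.

Lemma kavg_norm N f M : continuous f -> (forall z, cube D z -> `|f z| <= M) -> `|kavg N f| <= M.
Proof.
move=> cf fM; rewrite ler_norml -{1}(kavg_cst N (- M)) -{2}(kavg_cst N M).
have cc (c : R) : continuous (fun _ : V => c) by exact: cts_cst.
by apply/andP; split; apply: kavg_le => // z /fM; rewrite ler_norml => /andP[].
Qed.

(** The threshold on N depends only on the bounds and not on [g]; applied to the increments of a
    function at all centres x, this gives uniform convergence. *)
Lemma kavg_concentrate (d M e : R) : 0 < d -> 0 < e -> \forall N \near \oo, forall g,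
  continuous g -> (forall z, cube D z -> `|g z| <= M) -> (forall z, cube D z -> `|z| <= d -> `|g z| <= e) ->
  `|kavg N g| <= e + e.
Proof.
move=> d0 e0.
pose A : set V := cube D `&` [set z | d <= `|z|].
have cn : continuous (fun z : V => `|z|).
  by move=> z; apply: (@norm_continuous _ V).
have cA : compact A.
  apply: compact_closedI; first exact: compact_cube.
  rewrite (_ : mkset _ = (fun z : V => `|z|) @^-1` [set t | d <= t])//.
  by apply: closed_comp; [move=> z _; exact: cn|exact: closed_ge].
have [rho [r0 r1 hrho]] : exists rho, [/\ 0 <= rho, rho < 1 & forall z, A z -> Q z <= rho].
  have [A0|A0] := pselect (A !=set0); last first.
    by exists 0; split => // z Az; exfalso; apply: A0; exists z.
  have [z0 Az0 hz0] := EVT_max_rV A0 cA (continuous_subspaceT cQ).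
  rewrite inE in Az0; exists (Q z0); case: (Az0) => cz0 dz0; split.
  - by have /andP[] := Q01 cz0.
  - apply: Q1 => //; apply/negP => /eqP z00; move: dz0; rewrite z00 /= normr0 leNgt d0//.
  - by move=> z Az; apply: hz0; rewrite inE.
(* Between rho and 1: away from 0 the integrand decays like rho^N, whereas the mass is at least c
   q^N. *)
pose q := (1 + rho) / 2.
have q0 : 0 < q by rewrite divr_gt0// ltr_pwDl.
have q1 : q < 1 by rewrite /q; lra.
have [c c0 hc] := kmass_lower (ltW q0) q1.
have rq : `|rho / q| < 1.
  rewrite ger0_norm; last by rewrite divr_ge0// ltW.
  by rewrite ltr_pdivrMr// mul1r /q; lra.
pose B := `|M| * fine (leb (cube D : set V)) / c + 1.
have B0 : 0 < B by rewrite ltr_wpDl// divr_ge0 ?(ltW c0)// mulr_ge0// fine_ge0// leb_outer_ge0.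
have /cvgrPdist_lt/(_ _ (divr_gt0 e0 B0)) := cvg_expr rq.
apply: filterS => N; rewrite sub0r normrN => hN g cg gM ge.
have M0 : 0 <= M.
  by apply: le_trans (gM 0 _); rewrite ?normr0//; apply/cube_norm; rewrite ?normr0// ltW.
have mN := kmass_gt0 N.
rewrite /kavg normrM gtr0_norm ?invr_gt0// mulrC ler_pdivrMr//.
apply: le_trans (cint_norm _ _) _; first exact: ctsM.
apply: (@le_trans _ _ (cint D (fun z => e * Q z ^+ N + M * rho ^+ N))).
  apply: cint_le; first by apply: cts_norm; exact: ctsM.
    by apply: ctsD; [exact: ctsZ|exact: cts_cst].
  move=> z cz; have /andP[qz0 qz1] := Q01 cz.
  have QN0 : 0 <= Q z ^+ N by exact: exprn_ge0.
  rewrite normrM ger0_norm//.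
  have [zd|zd] := leP `|z| d.
    by rewrite mulrC ler_wpDr ?ler_wpM2r ?ge// mulr_ge0// exprn_ge0.
  rewrite ler_wpDl ?mulr_ge0 ?(ltW e0)// mulrC ler_pM//; first exact: gM.
  by apply: lerXn2r; rewrite ?nnegrE//; apply: hrho; split => //; exact: ltW.
rewrite cintD; [|by apply: ctsZ|by apply: cts_cst]; rewrite cintZ// cint_cst -/(kmass N) mulrDl lerD2l.
have rqE : rho ^+ N = (rho / q) ^+ N * q ^+ N by rewrite -exprMn divfK// gt_eqF.
have hN' : (rho / q) ^+ N * B <= e.
  by rewrite -ler_pdivlMr//; apply: le_trans (ltW hN); exact: ler_norm.
have L0 : 0 <= fine (leb (cube D : set V)) by rewrite fine_ge0// leb_outer_ge0.
apply: (@le_trans _ _ (e * (c * q ^+ N))); last by rewrite ler_wpM2l// ltW.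
rewrite rqE; have qN : 0 < q ^+ N by rewrite exprn_gt0.
have p0 : 0 <= (rho / q) ^+ N by rewrite exprn_ge0// divr_ge0// ltW.
have hB : M * fine (leb (cube D : set V)) <= B * c.
  rewrite /B mulrDl divfK ?gt_eqF// mul1r ler_wpDr ?(ltW c0)// ler_wpM2r// ler_norm//.
have := ler_wpM2l p0 hB; have := ler_wpM2r (ltW c0) hN'.
move: ((rho / q) ^+ N) (q ^+ N) qN => p s s0 h1 h2.
have : M * (p * s) * fine (leb (cube D : set V)) = (p * (M * fine (leb (cube D : set V)))) * s by ring.
move=> ->; have -> : e * (c * s) = (e * c) * s by ring.
rewrite ler_pM2r//; apply: (le_trans h2); rewrite mulrA; exact: h1.
Qed.

End Kernel.
End CubeIntegrals.

(** * Exponential sums and the kernel made of them *)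

Section ExponentialPolynomials.
Variables (R : realType) (n : nat).
Local Notation V := 'rV[R]_n.
Implicit Types (s : seq (R * V)) (g : V -> R).

Definition expoly s (x : V) : R := \sum_(cy <- s) cy.1 * expR (inner cy.2 x).

Lemma expoly_cat s t x : expoly (s ++ t) x = expoly s x + expoly t x.
Proof. exact: big_cat. Qed.

Lemma expoly_mul s t x : expoly [seq (a.1 * b.1, a.2 + b.2) | a <- s, b <- t] x = expoly s x * expoly t x.
Proof.
rewrite /expoly big_allpairs_dep /= mulr_suml; apply: eq_bigr => a _.
by rewrite mulr_sumr; apply: eq_bigr => b _; rewrite innerDl expRD; ring.
Qed.

Definition is_expoly g := exists s, g =1 expoly s.

Lemma is_expoly_cst c : is_expoly (fun=> c).
Proof. by exists [:: (c, 0)] => x; rewrite /expoly big_seq1 inner0l expR0 mulr1. Qed.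

Lemma is_expolyM g h : is_expoly g -> is_expoly h -> is_expoly (fun x => g x * h x).
Proof. by move=> [s gs] [t ht]; eexists => x; rewrite gs ht -expoly_mul. Qed.

Lemma is_expolyX g N : is_expoly g -> is_expoly (fun x => g x ^+ N).
Proof.
move=> eg; elim: N => [|N [s hs]].
  by have [s hs] := is_expoly_cst 1; exists s => x; rewrite expr0 -(hs x).
have [t ht] := is_expolyM eg (ex_intro _ s hs).
by exists t => x; rewrite exprS -ht.
Qed.

Lemma is_expoly_prod (I : Type) (r : seq I) (F : I -> V -> R) : (forall i, is_expoly (F i)) ->
  is_expoly (fun x => \prod_(i <- r) F i x).
Proof.
move=> eF; elim: r => [|i r ih].
  by have [s hs] := is_expoly_cst 1; exists s => x; rewrite big_nil -(hs x).
have [s hs] := is_expolyM (eF i) ih.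
by exists s => x; rewrite big_cons -hs.
Qed.

(* The powers of [kerQ] are an approximate identity on the cube and exponential sums, so
   convolution of a compactly supported function with them is locally an exponential sum. *)
Definition bump1 (u : R) : R := 2 * expR u - expR (2 * u).

Lemma bump1E u : bump1 u = 1 - (1 - expR u) ^+ 2.
Proof. by rewrite /bump1 (_ : 2 * u = u + u) ?expRD; ring. Qed.

Lemma bump1_0 : bump1 0 = 1.
Proof. by rewrite bump1E expR0 subrr expr2 mul0r subr0. Qed.

Lemma bump1_itv u : `|u| <= 2^-1 -> 0 <= bump1 u <= 1.
Proof.
rewrite ler_norml => /andP[u1 u2]; have e0 := expR_gt0 u.
have e2 : expR u <= 2.
  have := expR_ge1Dx (- u); rewrite expRN => h.
  rewrite -[expR u]invrK -[2]invrK lef_pV2 ?posrE ?invr_gt0//; apply: le_trans h; lra.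
rewrite bump1E; apply/andP; split; last by rewrite gerBl sqr_ge0.
have -> : 1 - (1 - expR u) ^+ 2 = expR u * (2 - expR u) by ring.
by rewrite mulr_ge0 ?subr_ge0// ltW.
Qed.

Lemma bump1_lt1 u : u != 0 -> bump1 u < 1.
Proof.
move=> u0; rewrite bump1E ltrBlDr ltrDl lt_neqAle sqr_ge0 andbT eq_sym sqrf_eq0 subr_eq0.
by apply: contra u0; rewrite -(expR0 R) => /eqP/expR_inj ->.
Qed.

(** The scaling by 2 D sends the coordinates of the cube into [-1/2, 1/2], where [bump1] takes
    values in [0, 1]. *)
Definition kerQ (D : R) (z : V) : R := \prod_i bump1 (z ord0 i / (2 * D)).

Lemma kerQ0 D : kerQ D 0 = 1.
Proof. by apply: big1 => i _; rewrite mxE mul0r bump1_0. Qed.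

Lemma kerQ_coord (D : R) (z : V) i : 0 < D -> cube D z -> `|z ord0 i / (2 * D)| <= 2^-1.
Proof.
move=> D0 /(cube_norm _ (ltW D0)) zD.
rewrite normrM [X in _ * X]gtr0_norm ?invr_gt0 ?mulr_gt0// ler_pdivrMr ?mulr_gt0// mulKf//.
exact: le_trans (coord_le_norm z i) zD.
Qed.

Lemma kerQ_itv D z : 0 < D -> cube D z -> 0 <= kerQ D z <= 1.
Proof.
move=> D0 zD; rewrite /kerQ; apply/andP; split.
  by apply: prodr_ge0 => i _; have /andP[] := bump1_itv (kerQ_coord i D0 zD).
by apply: prodr_ile1 => i _; exact: bump1_itv (kerQ_coord i D0 zD).
Qed.

Lemma kerQ_lt1 D z : 0 < D -> cube D z -> z != 0 -> kerQ D z < 1.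
Proof.
move=> D0 zD z0; have [i zi] : exists i, z ord0 i != 0.
  apply/existsP; apply: contraR z0; rewrite negb_exists => /forallP h.
  by apply/eqP/rowP => i; rewrite mxE; apply/eqP; have := h i; rewrite negbK.
rewrite /kerQ (bigD1 i)//=.
have b1 : bump1 (z ord0 i / (2 * D)) < 1.
  by apply: bump1_lt1; rewrite mulf_neq0// invr_eq0 mulf_neq0// gt_eqF.
have /andP[b0 _] := bump1_itv (kerQ_coord i D0 zD).
apply: le_lt_trans b1; rewrite ler_piMr//.
by apply: prodr_ile1 => j _; exact: bump1_itv (kerQ_coord j D0 zD).
Qed.

Lemma kerQ_expoly D : is_expoly (kerQ D).
Proof.
apply: is_expoly_prod => i.
exists [:: (2, (2 * D)^-1 *: evec R i); (-1, (2 * (2 * D)^-1) *: evec R i)] => z.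
have ie : inner (evec R i) z = z ord0 i.
  rewrite /inner (bigD1 i)//= big1 ?addr0; first by rewrite /evec mxE !eqxx mul1r.
  by move=> j ji; rewrite /evec mxE (negbTE ji) andbF mul0r.
rewrite /expoly !big_cons big_nil addr0 /= !innerZl ie /bump1 mulN1r.
by congr (_ * expR _ - expR _); [rewrite mulrC|rewrite -mulrA; congr (_ * _); rewrite mulrC].
Qed.

Lemma is_expoly_continuous g : is_expoly g -> continuous g.
Proof.
move=> [s gs]; rewrite (_ : g = expoly s); last exact/funext.
apply: cts_sum => cy _; apply: ctsZ => x; apply: continuous_comp; [exact: continuous_inner|exact: continuous_expR].
Qed.

End ExponentialPolynomials.

(** * Mollification by exponential sums *)

Section Mollify.
Variables (R : realType) (n : nat).
Local Notation V := 'rV[R]_n.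
Variables (D : R) (D0 : 0 < D).
Implicit Types (u : V -> R).

(** The average runs over the cube only, where [kerQ] takes values in [0, 1]; outside it an
    exponential sum of this kind need not be bounded. *)
Definition conv N u x := kavg (@kerQ R n D) D N (fun z => u (x + z)).

Let cQ : continuous (@kerQ R n D).
Proof. exact/is_expoly_continuous/kerQ_expoly. Qed.
Let Q0 := @kerQ0 R n D.
Let Q01 := fun z => @kerQ_itv R n D z D0.
Let Q1 := fun z => @kerQ_lt1 R n D z D0.
Let cQN N : continuous (fun z : V => kerQ D z ^+ N).
Proof. exact/is_expoly_continuous/is_expolyX/kerQ_expoly. Qed.

Lemma conv_cvg u x : continuous u -> (fun N => conv N u x) @ \oo --> u x.
Proof.
move=> cu; apply/cvgrPdist_lt => e e0; have e4 : 0 < e / 4 by rewrite divr_gt0.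
pose g z := u (x + z) - u x.
have cg : continuous g by apply: ctsB; [exact: cts_shift|exact: cts_cst].
have [M M0 gM] := continuous_bounded_cube D cg.
have /cvgrPdist_lt/(_ _ e4) := @cg 0; move=> /nbhs_ballP[d /= d0 hd].
have d2 : 0 < d / 2 by rewrite divr_gt0.
have := kavg_concentrate D0 cQ Q0 Q01 Q1 M d2 e4; apply: filterS => N hN.
have /hN : forall z, cube D z -> `|z| <= d / 2 -> `|g z| <= e / 4.
  move=> z _ zd; have := hd z; rewrite /g addr0 subrr sub0r normrN => h; apply/ltW/h.
  by rewrite mx_norm_ball /ball_ /= sub0r normrN; apply: (le_lt_trans zd); lra.
move=> /(_ cg gM); rewrite distrC.
have -> : kavg (kerQ D) D N g = conv N u x - u x.
  rewrite /conv /g (kavgD _ cQ) ?(kavg_cst D0 cQ Q0 Q01)//; [exact: cts_shift|exact: cts_cst].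
lra.
Qed.

Lemma conv_lip_unif u (r C : R) : continuous u ->
  (forall x y, `|x| <= r + D -> `|y| <= r + D -> `|u x - u y| <= C * `|x - y|) ->
  forall e, 0 < e -> \forall N \near \oo, forall x, `|x| <= r -> `|conv N u x - u x| < e.
Proof.
move=> cu lip e e0; have e4 : 0 < e / 4 by rewrite divr_gt0.
pose C' := `|C| + 1; have C'0 : 0 < C' by rewrite ltr_wpDl.
have d0 : 0 < e / 4 / C' by rewrite divr_gt0.
have := kavg_concentrate D0 cQ Q0 Q01 Q1 (C' * D) d0 e4; apply: filterS => N hN x xr.
pose g z := u (x + z) - u x.
have cg : continuous g by apply: ctsB; [exact: cts_shift|exact: cts_cst].
have gC z : cube D z -> `|g z| <= C' * `|z|.
  move=> /(cube_norm _ (ltW D0)) zD; apply: le_trans (lip _ _ _ _) _.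
  - by apply: le_trans (ler_normD _ _) _; apply: lerD.
  - by rewrite ler_wpDr// ltW.
  - by rewrite addrC addKr ler_wpM2r// /C' ler_wpDr// ler_norm.
have -> : conv N u x - u x = kavg (kerQ D) D N g.
  rewrite /conv /g (kavgD _ cQ) ?(kavg_cst D0 cQ Q0 Q01)//; [exact: cts_shift|exact: cts_cst].
have : `|kavg (kerQ D) D N g| <= e / 4 + e / 4.
  apply: hN => // z zD; first by apply: le_trans (gC z zD) _; rewrite ler_wpM2l ?(ltW C'0)//; apply/cube_norm => //; exact: ltW.
  by move=> zd; apply: le_trans (gC z zD) _; rewrite mulrC -ler_pdivlMr.
lra.
Qed.

Lemma conv_bounded u M N x : continuous u -> (forall x, `|u x| <= M) -> `|conv N u x| <= M.
Proof.
by move=> cu uM; apply: (kavg_norm D0 cQ Q0 Q01) => //; exact: cts_shift.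
Qed.

(** The convexity defect of the quadratic term is invariant under translations, so averaging
    preserves semiconvexity with the same constant [L]. *)
Lemma conv_convex u (L : R) (N : nat) : continuous u ->
  convex_fun (fun x => u x + L * \sum_i (x ord0 i) ^+ 2 / 2) ->
  convex_fun (fun x => conv N u x + L * \sum_i (x ord0 i) ^+ 2 / 2).
Proof.
move=> cu cF x y t t01; have [t0 t1] := andP t01.
pose q (z : V) : R := \sum_i (z ord0 i) ^+ 2 / 2.
pose dq := t * q x + (1 - t) * q y - q (t *: x + (1 - t) *: y).
have qz z : t * q (x + z) + (1 - t) * q (y + z) - q (t *: x + (1 - t) *: y + z) = dq.
  rewrite /dq /q !mulr_sumr -!big_split /= -!sumrB; apply: eq_bigr => i _; rewrite !mxE; by field.
have cs (v : V) : continuous (fun z => u (v + z)) by exact: cts_shift.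
have : conv N u (t *: x + (1 - t) *: y) <= t * conv N u x + (1 - t) * conv N u y + L * dq.
  rewrite /conv -!(kavgZ _ cQ)// -(kavgD _ cQ); [|by apply: ctsZ..].
  rewrite -[L * dq](kavg_cst D0 cQ Q0 Q01 N) -(kavgD _ cQ); last 2 first.
  - by apply: ctsD; apply: ctsZ.
  - by apply: cts_cst.
  apply: (kavg_le D0 cQ Q0 Q01) => //.
    by apply: ctsD; [apply: ctsD; apply: ctsZ|apply: cts_cst].
  move=> z _; have := cF (x + z) (y + z) t t01; have := qz z.
  have -> : t *: (x + z) + (1 - t) *: (y + z) = t *: x + (1 - t) *: y + z.
    by apply/rowP => i; rewrite !mxE; ring.
  rewrite -/(q (x + z)) -/(q (y + z)) -/(q (t *: x + (1 - t) *: y + z)) => <-; lra.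
by rewrite -/(q x) -/(q y) -/(q (t *: x + (1 - t) *: y)) /dq; lra.
Qed.

(** Differentiation under the integral; applied twice, it makes the Hessian of the mollification the
    mollified Hessian. *)
Lemma conv_derive u (G : V -> R) M N i x : continuous u -> continuous G ->
  (forall x, is_derive (0 : R) 1 (fun t : R => u (x + t *: evec R i)) (G x)) ->
  (forall x, `|G x| <= M) ->
  is_derive (0 : R) 1 (fun t : R => conv N u (x + t *: evec R i)) (conv N G x).
Proof.
move=> cu cG dG GM.
pose f (t : R) (z : V) := kerQ D z ^+ N * u (x + z + t *: evec R i).
have cf t : continuous (f t).
  apply: ctsM => //; under eq_fun do rewrite addrAC; exact: cts_shift.
have dG' t y : is_derive (t : R) 1 (fun t : R => u (y + t *: evec R i)) (G (y + t *: evec R i)).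
  have [d e] := dG (y + t *: evec R i).
  have E : (fun h : R => h^-1 *: (((fun t : R => u (y + t *: evec R i)) \o shift t) (h *: 1) - u (y + t *: evec R i))) =
      (fun h : R => h^-1 *: (((fun s : R => u (y + t *: evec R i + s *: evec R i)) \o shift 0) (h *: 1) -
        u (y + t *: evec R i + (0 : R) *: evec R i))).
    apply/funext => h /=; congr (_ *: (u _ - u _)); last by rewrite scale0r addr0.
    by rewrite addr0 scalerDl -addrA [t *: _ + _]addrC.
  apply: DeriveDef; first by rewrite /derivable E.
  by rewrite /derive E.
have df t z : is_derive (t : R) 1 (f ^~ z) (kerQ D z ^+ N * G (x + z + t *: evec R i)).
  have := is_deriveZ (kerQ D z ^+ N) (dG' t (x + z)); exact.
have e1 t z : derive1 (f ^~ z) t = kerQ D z ^+ N * G (x + z + t *: evec R i).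
  by rewrite derive1E; have [_ ->] := df t z.
have I0 : (`](-1), 1[%classic : set R) 0 by rewrite /= in_itv /=; lra.
have intf t : (`](-1), 1[%classic : set R) t -> (@leb R n).-integrable (cube D) (EFin \o f t).
  by move=> _; exact: integrable_cube.
have derf t z : (`](-1), 1[%classic : set R) t -> cube D z -> derivable (f ^~ z) t 1.
  by move=> _ _; have [] := df t z.
pose B (z : V) : R := M.
have M0 : 0 <= M by exact: le_trans (normr_ge0 _) (GM 0).
have intB : (@leb R n).-integrable (cube D) (EFin \o B) by apply: integrable_cube; exact: cts_cst.
have fB t z : (`](-1), 1[%classic : set R) t -> cube D z -> `|partial1of2 f t z| <= B z.
  move=> _ zD; rewrite /partial1of2 e1 normrM.
  have /andP[q0 q1] := Q01 zD.
  by rewrite -[leRHS]mul1r ler_pM// ger0_norm ?exprn_ge0// exprn_ile1.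
have mD := @measurable_cube R n D.
have h1 := cvg_differentiation_under_integral mD I0 intf derf (fun=> M0) intB fB.
have h2 := derivable_under_integral mD I0 intf derf (fun=> M0) intB fB.
have h3 := differentiation_under_integral mD I0 intf derf (fun=> M0) intB fB.
have cE t : conv N u (x + t *: evec R i) = (@kmass R n (@kerQ R n D) D N)^-1 * Rintegral (@leb R n) (cube D) (f t).
  rewrite /conv /kavg /cint /f; congr (_ * Rintegral _ _ _); apply/funext => z.
  by rewrite addrAC.
rewrite (_ : (fun t => _) = (fun t : R => (@kmass R n (@kerQ R n D) D N)^-1 * Rintegral (@leb R n) (cube D) (f t))); last first.
  by apply/funext => t; exact: cE.
have d0 : is_derive (0 : R) 1 (fun t => Rintegral (@leb R n) (cube D) (f t)) (Rintegral (@leb R n) (cube D) (fun z => kerQ D z ^+ N * G (x + z))).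
  apply: DeriveDef => //; rewrite -derive1E h3; apply: eq_Rintegral => z _.
  by rewrite /partial1of2 e1 scale0r addr0.
exact: (is_deriveZ (@kmass R n (@kerQ R n D) D N)^-1 d0).
Qed.

(** After the substitution y = x + z the point x sits in the kernel alone, where every exponential
    factors. The domain of integration stops depending on x as soon as the cube around x contains
    the support of [u]; hence the condition on x. *)
Lemma conv_expoly u (r : R) N : continuous u -> supp_in u (cube r) -> exists s : seq (R * V),
  forall x, (forall y, cube r y -> cube D (y - x)) -> conv N u x = expoly s x.
Proof.
move=> cu su; have [s hs] := is_expolyX N (@kerQ_expoly R n D).
have [M M0 uM] := continuous_supp_bounded cu su.
pose F (cy : R * V) (y : V) : R := cy.1 * expR (inner cy.2 y).
have cF cy : continuous (F cy).
  by apply: ctsZ => y; apply: continuous_comp; [exact: continuous_inner|exact: continuous_expR].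
pose km : R := @kmass R n (@kerQ R n D) D N.
exists (map (fun cy : R * V => (km^-1 * cint r (fun y => F cy y * u y), - cy.2)) s) => x hx.
have toT (D' : R) (g : V -> R) : supp_in g (cube D') -> Rintegral (@leb R n) setT g = cint D' g.
  move=> sg; rewrite /cint [RHS]Rintegral_mkcond; apply: eq_Rintegral => z _.
  rewrite patchE; case: ifPn => // zD; apply/eqP; apply: contraNT zD => gz; rewrite inE; exact: sg.
pose g y := kerQ D (y - x) ^+ N * u y.
have cg : continuous g.
  apply: ctsM => //; rewrite (_ : (fun y => _) = (fun y => kerQ D (- x + y) ^+ N)); last by apply/funext => y; rewrite addrC.
  exact: (@cts_shift _ _ (fun z => kerQ D z ^+ N)).
have mul0 (a b : R) : a * b != 0 -> b != 0 by move=> ab; apply: contra_neq ab => ->; rewrite mulr0.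
have sg : supp_in g (cube r) by move=> y /mul0 /su.
have sgx : supp_in (fun z => g (x + z)) (cube D).
  by move=> z /mul0 /su /hx; rewrite addrC addKr.
transitivity (km^-1 * cint r g).
  rewrite -(toT _ _ sg) -(Rintegral_shift x cg sg) (toT _ _ sgx).
  by congr (_ * cint _ _); apply/funext => z; rewrite /g [x + z - x]addrC addKr.
have -> : g = (fun y => \sum_(cy <- s) expR (- inner cy.2 x) * (F cy y * u y)).
  apply/funext => y; rewrite /g hs mulr_suml; apply: eq_bigr => cy _.
  by rewrite innerB expRD /F; ring.
rewrite cint_sum; last by move=> cy; apply: ctsZ; apply: ctsM.
rewrite mulr_sumr /expoly big_map; apply: eq_bigr => cy _ /=.
by rewrite cintZ ?innerNl; [ring|exact: ctsM].
Qed.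

End Mollify.

(** * A cut-off function of class C2 *)

Section Cutoff.
Variables (R : realType) (n : nat).
Local Notation V := 'rV[R]_n.
Implicit Types (f u : V -> R).

(** The first-order error is at most h^2 at every t, across the kink at 0 as well. *)
Lemma is_derive_mul_norm (t : R) : is_derive t 1 (fun t : R => t * `|t|) (2 * `|t|).
Proof.
have key (h : R) : `|(h + t) * `|h + t| - t * `|t| - 2 * `|t| * h| <= h ^+ 2.
  by have [a|a] := leP 0 (h + t); have [b|b] := leP 0 t; rewrite ?(ger0_norm a) ?(ltr0_norm a) ?(ger0_norm b) ?(ltr0_norm b) ler_norml; apply/andP; split; nra.
have cv : (fun h : R => h^-1 *: (((fun t : R => t * `|t|) \o shift t) (h *: 1) - t * `|t|)) @ 0^' --> (2 * `|t| : R).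
  apply/cvgrPdist_lt => e e0; near=> h.
  have h0 : h != 0 by near: h; exact: nbhs_dnbhs_neq.
  have he : `|h| < e by near: h; apply: dnbhs0_lt.
  apply: le_lt_trans he.
  have hp : 0 < `|h| by rewrite normr_gt0.
  rewrite distrC -(ler_pM2l hp) -normrM /= mulrBr [h *: 1]mulr1 mulVKf// -expr2 real_normK ?num_real//.
  by apply: le_trans (key h); rewrite [h * _]mulrC.
apply: DeriveDef; first by apply/cvg_ex; eexists; exact: cv.
by apply: cvg_lim.
Unshelve. all: by end_near. Qed.

(* [Num.max t 0 ^+ 3], written so that it is visibly twice continuously differentiable. *)
Definition pcube (t : R) : R := 2^-1 * (t ^+ 3 + t * (t * `|t|)).

Lemma pcube_le0 t : t <= 0 -> pcube t = 0.
Proof. by move=> t0; rewrite /pcube ler0_norm//; ring. Qed.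

Lemma pcube_ge0 t : 0 <= t -> pcube t = t ^+ 3.
Proof. by move=> t0; rewrite /pcube ger0_norm//; field. Qed.

Lemma is_derive_poly (t : R) k : is_derive t 1 (fun t : R => t ^+ k.+1) (k.+1%:R * t ^+ k).
Proof.
have := @is_deriveX R R id k.+1 t 1 1 (is_derive_id t 1).
rewrite /= (_ : (id : R -> R) ^+ k.+1 = (fun t => t ^+ k.+1)) => [h|]; last first.
  by apply/funext => x; rewrite fctE.
by apply: (is_derive_eq h); rewrite [LHS]mulr1.
Qed.

Lemma is_derive_pcube (t : R) : is_derive t 1 pcube (2^-1 * (3 * t ^+ 2 + 3 * (t * `|t|))).
Proof.
have dn := is_derive_mul_norm t.
have h := is_deriveZ (2^-1 : R) (is_deriveD (is_derive_poly t 2) (is_deriveM (@is_derive_id R R t 1) dn)).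
apply: (is_derive_eq h); rewrite /GRing.scale /=; ring.
Qed.

Lemma is_derive_pcube2 (t : R) : is_derive t 1 (fun t : R => 2^-1 * (3 * t ^+ 2 + 3 * (t * `|t|))) (3 * (t + `|t|)).
Proof.
have dn := is_derive_mul_norm t.
have h := is_deriveZ (2^-1 : R) (is_deriveD (is_deriveZ (3 : R) (is_derive_poly t 1)) (is_deriveZ (3 : R) dn)).
by apply: (is_derive_eq h); rewrite /GRing.scale /= expr1; field.
Qed.

Lemma C2_fun_pcube f : C2_fun f -> C2_fun (fun x => pcube (f x)).
Proof.
move=> /smooth2P[g [H s]]; apply/smooth2P.
have c2 : continuous (fun t : R => 3 * (t + `|t|)).
  by apply: ctsZ; apply: ctsD => [t|]; [exact: cvg_id|exact: norm_continuous].
by do 2 eexists; exact: smooth2_comp is_derive_pcube is_derive_pcube2 c2 s.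
Qed.

Lemma C2_fun_cst (c : R) : C2_fun (fun _ : V => c).
Proof. by apply/smooth2P; do 2 eexists; exact: smooth2_cst. Qed.

Lemma C2_funD f u : C2_fun f -> C2_fun u -> C2_fun (fun x => f x + u x).
Proof.
by move=> /smooth2P[g [H s]] /smooth2P[g' [H' s']]; apply/smooth2P; do 2 eexists; exact: smooth2D s s'.
Qed.

Lemma C2_funZ (c : R) f : C2_fun f -> C2_fun (fun x => c * f x).
Proof. by move=> /smooth2P[g [H s]]; apply/smooth2P; do 2 eexists; exact: (smooth2Z c s). Qed.

Lemma C2_fun_inner y : C2_fun (@inner R n y).
Proof. by apply/smooth2P; do 2 eexists; exact: smooth2_inner. Qed.

Lemma inner_evec i (x : V) : inner (evec R i) x = x ord0 i.
Proof.
rewrite /inner (bigD1 i)//= big1 ?addr0; first by rewrite /evec mxE !eqxx mul1r.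
by move=> j ji; rewrite /evec mxE (negbTE ji) andbF mul0r.
Qed.

(** Each factor equals 1 while |x_i| <= r, and vanishes once |x_i| >= r + 1 because one inner cube
    then reaches 1. *)
Definition cutoff (r : R) (x : V) : R :=
  \prod_i pcube (1 + (-1 * pcube (inner (evec R i) x - r) + -1 * pcube (-1 * inner (evec R i) x - r))).

Lemma cutoff_C2 r : C2_fun (cutoff r).
Proof.
rewrite /cutoff; elim: (index_enum _) => [|i l ih].
  by rewrite (_ : (fun x => _) = (fun=> 1)); [exact: C2_fun_cst|apply/funext => x; rewrite big_nil].
rewrite (_ : (fun x => _) = (fun x : V => pcube (1 + (-1 * pcube (inner (evec R i) x - r) + -1 * pcube (-1 * inner (evec R i) x - r))) *
   (\prod_(j <- l) pcube (1 + (-1 * pcube (inner (evec R j) x - r) + -1 * pcube (-1 * inner (evec R j) x - r)))))); last first.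
  by apply/funext => x; rewrite big_cons.
have ce := C2_fun_inner (evec R i).
apply: C2_fun_mul ih; apply: C2_fun_pcube; apply: C2_funD; first exact: C2_fun_cst.
by apply: C2_funD; apply: C2_funZ; apply: C2_fun_pcube; apply: C2_funD; do ?[exact: C2_fun_cst|apply: C2_funZ].
Qed.

Lemma cutoff1 r x : `|x| <= r -> cutoff r x = 1.
Proof.
move=> xr; apply: big1 => i _; rewrite inner_evec.
have := le_trans (coord_le_norm x i) xr; rewrite ler_norml => /andP[h1 h2].
by rewrite !(@pcube_le0 (_ - r)) ?pcube_ge0; lra.
Qed.

Lemma cutoff_supp r : supp_in (cutoff r) (cube (r + 1)).
Proof.
move=> x; apply: contra_neqP => /existsNP[i /negP].
rewrite negb_and -!ltNge => hi.
rewrite /cutoff (bigD1 i)//= pcube_le0 ?mul0r// inner_evec.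
have p0 t : 0 <= pcube t.
  by have [h|/ltW h] := leP t 0; [rewrite pcube_le0|rewrite pcube_ge0 ?exprn_ge0].
have p1 t : 1 <= t -> 1 <= pcube t by move=> t1; rewrite pcube_ge0 ?exprn_ege1//; lra.
have := p0 (x ord0 i - r); have := p0 (-1 * x ord0 i - r).
by case/orP: hi => hi h1 h2; [have := p1 (-1 * x ord0 i - r) ltac:(lra)|have := p1 (x ord0 i - r) ltac:(lra)]; lra.
Qed.

End Cutoff.

Section QuadraticWeight.
Variables (R : realType) (n : nat).
Local Notation V := 'rV[R]_n.
Implicit Types (f u : V -> R).

(** Half the Euclidean square, with the identity as Hessian; [|x|] itself is the maximum norm. *)
Definition hquad (x : V) : R := \sum_i (x ord0 i) ^+ 2 / 2.

Lemma hquadE x : hquad x = \sum_i inner (evec R i) x ^+ 2 / 2.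
Proof. by apply: eq_bigr => i _; rewrite inner_evec. Qed.

Lemma smooth2_hquad : smooth2 hquad (fun i x => \sum_k inner (evec R k) x * evec R k ord0 i)
  (fun i j _ => (i == j)%:R).
Proof.
have [h1 h2 h3] := smooth2_sum (index_enum 'I_n) (fun k => @smooth2_sq R n (evec R k)).
have E i j : \sum_k sq (evec R k : V) i j = (i == j)%:R.
  rewrite (bigD1 i)//= big1 ?addr0; first by rewrite sqE !mxE !eqxx mul1r eq_sym.
  by move=> k ki; rewrite sqE !mxE eqxx /= [i == k]eq_sym (negbTE ki) mul0r.
split.
- by apply: has_grad_ext h1 => // x; rewrite hquadE.
- by move=> i; apply: has_grad_ext (h2 i) => // j x; exact: E.
- by move=> i j; exact: cts_cst.
Qed.

Lemma supp_derive u (G : V -> R) i (r : R) :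
  supp_in u (cube r) -> (forall x, is_derive (0 : R) 1 (fun t : R => u (x + t *: evec R i)) (G x)) ->
  supp_in G (cube r).
Proof.
move=> su dG x; apply: contra_neqP => xr.
have cl : closed (cube r : set V) by apply: compact_closed; [exact: norm_hausdorff|exact: compact_cube].
have /nbhs_ballP[e /= e0 he] : nbhs x (~` (cube r : set V)) by apply: open_nbhs_nbhs; split => //; exact: closed_openC.
have [_ <-] := dG x; apply: cvg_lim => //; apply: cvg_near_cst; near=> h.
have xh : (~` (cube r : set V)) (x + h *: evec R i).
  apply: he; rewrite mx_norm_ball /ball_ /= opprD addNKr normrN normrZ.
  have : `|evec R i : V| <= 1.
    by apply/cube_norm => // j; rewrite /evec mxE eqxx; case: eqP => _ /=; lra.
  move=> ev; apply: le_lt_trans (_ : `|h| < e); first by rewrite ler_piMr.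
  by near: h; apply: dnbhs0_lt.
have z y : ~ cube r y -> u y = 0 by move=> ny; apply: contra_notP ny => /eqP; exact: su.
by rewrite /= [h *: 1]mulr1 addr0 !z ?subrr ?scaler0 ?scale0r ?addr0.
Unshelve. all: by end_near. Qed.

End QuadraticWeight.

(** * Local approximation by exponential sums with convergence of Hessians *)

Section ExponentialApproximation.
Variables (R : realType) (n : nat).
Local Notation V := 'rV[R]_n.
Implicit Types (f u : V -> R).

(** Transfers derivatives between functions that coincide on an open set only: [f] and its cut-off,
    a mollification and its exponential sum. *)
Lemma is_derive_line_unique f u (U : set V) (x v : V) (a b : R) : open U -> U x -> (forall y, U y -> f y = u y) ->
  is_derive (0 : R) 1 (fun t : R => f (x + t *: v)) a -> is_derive (0 : R) 1 (fun t : R => u (x + t *: v)) b -> a = b.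
Proof.
move=> oU Ux fu [_ <-] [_ <-]; apply: near_eq_derive => //.
have c : continuous (fun t : R => x + t *: v).
  move=> t; apply: (@cvgD R V R (nbhs t) (nbhs_filter t) (cst x) (fun t => t *: v)); first exact: cvg_cst.
  exact: scalel_continuous.
have Uy : nbhs (x + (0 : R) *: v) U by apply: open_nbhs_nbhs; split => //; rewrite scale0r addr0.
have hU : \forall t \near (0 : R), U (x + t *: v) by exact: (c 0 U Uy).
by near=> t; apply: fu; near: t.
Unshelve. all: by end_near.
Qed.

Lemma has_grad_axis f g i (x : V) : has_grad f g ->
  is_derive (0 : R) 1 (fun t : R => f (x + t *: evec R i)) (g i x).
Proof.
move=> fg; have h := has_grad_line x (evec R i) 0 fg; apply: (is_derive_eq h).
rewrite scale0r addr0 (bigD1 i)//= big1 ?addr0; first by rewrite /evec mxE !eqxx mul1r.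
by move=> j ji; rewrite /evec mxE (negbTE ji) andbF mul0r.
Qed.

Lemma smooth2_expoly (s : seq (R * V)) : smooth2 (expoly s)
  (fun i x => \sum_(cy <- s) cy.1 * (expR (inner cy.2 x) * cy.2 ord0 i))
  (fun i j x => \sum_(cy <- s) cy.1 * (expR (inner cy.2 x) * sq cy.2 i j)).
Proof. by apply: smooth2_sum => cy; apply: smooth2Z; exact: smooth2_exp. Qed.

Lemma open_norm_lt (r : R) : open [set x : V | `|x| < r].
Proof.
rewrite (_ : mkset _ = (fun x : V => `|x|) @^-1` [set t | t < r])//.
by apply: open_comp; [move=> z _; exact: (@norm_continuous _ V)|exact: open_lt].
Qed.

(** A quadratic form with entries at most M in absolute value is at least - M n |v|^2, by 2 |a b| <=
    a^2 + b^2. *)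
Lemma smooth2_semiconvex u g (H : 'I_n -> 'I_n -> V -> R) (M L : R) : smooth2 u g H ->
  (forall i j x, `|H i j x| <= M) -> M * n%:R <= L -> convex_fun (fun x => u x + L * hquad x).
Proof.
move=> s HM ML; apply: (smooth2_convex (smooth2D s (smooth2Z L (smooth2_hquad R n)))) => x v.
rewrite (_ : \sum_i _ = (\sum_i \sum_j v ord0 i * v ord0 j * H i j x) + L * \sum_i (v ord0 i) ^+ 2); last first.
  rewrite mulr_sumr -big_split /=; apply: eq_bigr => i _.
  rewrite (eq_bigr (fun j => v ord0 i * v ord0 j * H i j x + v ord0 i * v ord0 j * (L * (i == j)%:R))); last first.
    by move=> j _; rewrite mulrDr.
  rewrite big_split /=; congr (_ + _).
  rewrite (bigD1 i)//= big1 ?addr0; first by rewrite eqxx mulr1 expr2 mulrC.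
  by move=> j ji; rewrite eq_sym (negbTE ji) !mulr0.
have h : - (M * n%:R * \sum_i (v ord0 i) ^+ 2) <= \sum_i \sum_j v ord0 i * v ord0 j * H i j x.
  rewrite (_ : - _ = \sum_i \sum_j - (M * ((v ord0 i) ^+ 2 + (v ord0 j) ^+ 2) / 2)).
    apply: ler_sum => i _; apply: ler_sum => j _.
    have := HM i j x; rewrite ler_norml => /andP[]; move: (H i j x) (v ord0 i) (v ord0 j) => h a b h1 h2.
    have [ab|/ltW ab] := leP 0 (a * b).
      have := ler_wpM2l ab h1; have := sqr_ge0 (a - b); have : 0 <= M by lra.
      by move=> M0 s1; have := mulr_ge0 M0 s1; rewrite !expr2; lra.
    have := ler_wnM2l ab h2; have := sqr_ge0 (a + b); have : 0 <= M by lra.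
    by move=> M0 s1; have := mulr_ge0 M0 s1; rewrite !expr2; lra.
  set S := \sum_i (v ord0 i) ^+ 2; have E i : \sum_j - (M * ((v ord0 i) ^+ 2 + (v ord0 j) ^+ 2) / 2) =
      - (M / 2) * n%:R * (v ord0 i) ^+ 2 + - (M / 2) * S.
    rewrite (eq_bigr (fun j => - (M / 2) * (v ord0 i) ^+ 2 + - (M / 2) * (v ord0 j) ^+ 2)).
      by rewrite big_split /= sumr_const card_ord -mulr_sumr -mulr_natr -/S; ring.
    by move=> j _; field.
  under eq_bigr => i _ do rewrite E.
  by rewrite big_split /= -mulr_sumr sumr_const card_ord -mulr_natr -/S; field.
have s0 : 0 <= \sum_i (v ord0 i) ^+ 2 by apply: sumr_ge0 => i _; exact: sqr_ge0.
have := ler_wpM2r s0 ML; lra.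
Qed.

(** A difference of two convex functions, each locally Lipschitz. *)
Lemma semiconvex_lip u (L r : R) : 0 <= L -> convex_fun (fun x => u x + L * hquad x) ->
  exists C, forall x y : V, `|x| <= r -> `|y| <= r -> `|u x - u y| <= C * `|x - y|.
Proof.
move=> L0 cF; have cq : convex_fun (@hquad R n).
  by have := @smooth2_semiconvex (fun=> 0) _ _ 0 1 (smooth2_cst n 0) _ _; rewrite (_ : (fun x => 0 + 1 * _) = @hquad R n); [apply=> [i j x|]; rewrite ?normr0 ?mul0r|apply/funext => x; rewrite add0r mul1r].
have [C1 _ h1] := convex_bounded (r + 1) cF; have [C2 _ h2] := convex_bounded (r + 1) cq.
exists (2 * C1 + L * (2 * C2)) => x y xr yr.
have l1 := convex_lip cF h1 xr yr; have l2 := convex_lip cq h2 xr yr.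
have -> : u x - u y = (u x + L * hquad x - (u y + L * hquad y)) - L * (hquad x - hquad y) by ring.
apply: le_trans (ler_normB _ _) _; rewrite mulrDl; apply: lerD => //.
by rewrite normrM ger0_norm// -mulrA ler_wpM2l.
Qed.

(** [u] is a cut-off of [f] and [v N] its mollification, an exponential sum only near the origin.
    Neither is convex; the single constant [L] measures how much of [hquad] makes [u] and all [v N]
    convex on the whole space. *)
Theorem local_expoly_approx f g (H : 'I_n -> 'I_n -> V -> R) (r : R) : smooth2 f g H -> 0 < r ->
  exists (u : V -> R) (v : nat -> V -> R) (s : nat -> seq (R * V)) (L : R) (M : R),
  [/\ forall x, `|x| < r -> u x = f x,
      loc_unif_cvg v u,
      convex_fun (fun x => u x + L * hquad x) /\ forall N, convex_fun (fun x => v N x + L * hquad x),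
      forall N x, `|x| < r -> v N x = expoly (s N) x &
      forall (x : V) i j, `|x| < r ->
        (forall N, `|\sum_(cy <- s N) cy.1 * (expR (inner cy.2 x) * sq cy.2 i j)| <= M) /\
        (fun N => \sum_(cy <- s N) cy.1 * (expR (inner cy.2 x) * sq cy.2 i j)) @ \oo --> H i j x].
Proof.
move=> sf r0; have /smooth2P[gu [Hu su]] : C2_fun (fun x => cutoff r x * f x).
  by apply: C2_fun_mul; [exact: cutoff_C2|apply/smooth2P; exists g, H].
set u := (fun x : V => cutoff r x * f x) in su.
pose U := [set x : V | `|x| < r]; have oU : open U by exact: open_norm_lt.
have uf x : U x -> u x = f x by move=> xr; rewrite /u cutoff1 ?mul1r// ltW.
have [s1 s2 s3] := su; have [f1 f2 f3] := sf.
have guU i x : U x -> gu i x = g i x.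
  move=> Ux; exact: is_derive_line_unique oU Ux uf (has_grad_axis i x s1) (has_grad_axis i x f1).
have HuU i j x : U x -> Hu i j x = H i j x.
  move=> Ux; exact: is_derive_line_unique oU Ux (guU i) (has_grad_axis j x (s2 i)) (has_grad_axis j x (f2 i)).
have cu := has_grad_continuous s1; have cgu i := has_grad_continuous (s2 i).
have spu : supp_in u (cube (r + 1)).
  by move=> x ux; apply: cutoff_supp; apply: contra_neq ux; rewrite /u => ->; rewrite mul0r.
have spg i : supp_in (gu i) (cube (r + 1)) by apply: (supp_derive spu) => x; exact: has_grad_axis.
have spH i j : supp_in (Hu i j) (cube (r + 1)) by apply: (supp_derive (spg i)) => x; exact: has_grad_axis.
(* One compactly supported continuous function above all second derivatives yields a bound common to
   all i and j. *)
pose S x : R := \sum_i \sum_j `|Hu i j x|.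
have cS : continuous S by apply: cts_sum => i _; apply: cts_sum => j _; exact: cts_norm.
have spS : supp_in S (cube (r + 1)).
  move=> x; apply: contra_neqP => nx; apply: big1 => i _; apply: big1 => j _.
  by apply/normr0P/eqP; apply: contra_notP nx => /eqP; exact: spH.
have [M M0 SM] := continuous_supp_bounded cS spS.
have HM i j x : `|Hu i j x| <= M.
  apply: le_trans (SM x); apply: le_trans (ler_norm _); rewrite /S (bigD1 i)//= (bigD1 j)//= -addrA lerDl.
  by apply: addr_ge0; apply: sumr_ge0 => k _ //; apply: sumr_ge0.
have gM i : exists M, forall x, `|gu i x| <= M by have [C _ h] := continuous_supp_bounded (cgu i) (spg i); exists C.
pose L := M * n%:R; have L0 : 0 <= L by rewrite mulr_ge0// ltW.
have cF := smooth2_semiconvex su HM (lexx L).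
(* For |x| < r the cube of radius D around x contains the support of [u], which lies in the cube of
   radius r + 1. *)
pose D := 2 * r + 1; have D0 : 0 < D by rewrite /D; lra.
pose v N x : R := conv D N u x.
have [s hs] := choice (fun N => conv_expoly D N cu spu).
have inD x : U x -> forall y : V, cube (r + 1) y -> cube D (y - x).
  move=> Ux y /cube_norm hy; apply/cube_norm; first exact: ltW.
  have r1 : 0 <= r + 1 by lra.
  apply: le_trans (ler_normB _ _) _; apply: le_trans (lerD (hy r1) (ltW Ux)) _; rewrite /D; lra.
have vE N x : U x -> v N x = expoly (s N) x by move=> Ux; apply: hs; exact: inD.
have g1 N i x : U x -> conv D N (gu i) x = \sum_(cy <- s N) cy.1 * (expR (inner cy.2 x) * cy.2 ord0 i).
  move=> Ux; have [e1 _ _] := smooth2_expoly (s N); have [C hC] := gM i.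
  apply: is_derive_line_unique oU Ux (vE N) _ (has_grad_axis i x e1).
  by apply: (conv_derive D0 N x cu (cgu i) _ hC) => y; exact: has_grad_axis.
have g2 N i j x : U x -> conv D N (Hu i j) x = \sum_(cy <- s N) cy.1 * (expR (inner cy.2 x) * sq cy.2 i j).
  move=> Ux; have [_ e1 _] := smooth2_expoly (s N).
  apply: is_derive_line_unique oU Ux (g1 N i) _ (has_grad_axis j x (e1 i)).
  by apply: (conv_derive D0 N x (cgu i) (s3 i j) _ (HM i j)) => y; exact: has_grad_axis.
exists u, v, s, L, M; split => //.
- move=> r' e e0; have [C hC] := semiconvex_lip (r' + D) L0 cF.
  exact: (conv_lip_unif D0 cu hC e0).
- by split => // N; exact: (conv_convex D0 N cu cF).
- move=> x i j Ux; split => [N|]; first by rewrite -g2//; apply: (conv_bounded D0) => //; exact: HM.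
  rewrite -(HuU _ _ _ Ux); under eq_fun do rewrite -g2//.
  exact: (conv_cvg D0 (s3 i j)).
Qed.

End ExponentialApproximation.

(** * Ridge perturbations by general convex profiles *)

Section RidgeSums.
Variables (R : realType) (n k : nat).
Local Notation V := 'rV[R]_n.
Variables (Psi : (V -> R) -> set V -> R) (mv : maval k Psi) (y : V).
Implicit Types (phi : V -> R).

Lemma loc_unif_addl (F : V -> R) (G : nat -> R -> R) (g : R -> R) :
  (forall r e : R, 0 < e -> \forall j \near \oo, forall t, `|t| <= r -> `|G j t - g t| < e) ->
  loc_unif_cvg (fun j x => F x + G j (inner y x)) (fun x => F x + g (inner y x)).
Proof.
move=> h r e e0; have := h ((\sum_i `|y ord0 i|) * `|r|) e e0.
apply: filterS => j hj x xr.
rewrite (_ : _ - _ = G j (inner y x) - g (inner y x)); last by ring.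
apply: hj; apply: le_trans (inner_bound y x) _.
by rewrite ler_wpM2l ?sumr_ge0// (le_trans xr)// ler_norm.
Qed.

Section Base.
Variables (F : V -> R).
Hypothesis cF : convex_fun F.

Let rampF c s := rampsum y F [:: (c, s)].
Let crampF c s : 0 <= c -> convex_fun (rampF c s).
Proof. by move=> c0; apply: rampsum_convex => // cs; rewrite inE => /eqP ->. Qed.

(** Cauchy's equation: additivity settles rational coefficients, weak continuity the others. *)
Lemma ramp_jumpE phi c s : continuous phi -> compact_support phi -> 0 <= c ->
  ramp_jump Psi y F phi c s = c * ramp_jump Psi y F phi 1 s.
Proof.
move=> cp sp c0.
have natE (a : R) : 0 <= a -> forall j, ramp_jump Psi y F phi (j%:R * a) s = j%:R * ramp_jump Psi y F phi a s.
  move=> a0; elim=> [|j ih].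
    rewrite !mul0r; have := ramp_jumpD mv y cF cp sp s (lexx 0) (lexx 0); rewrite addr0; lra.
  rewrite -natr1 !mulrDl !mul1r (ramp_jumpD mv) ?ih// mulr_ge0//.
have fracE j i : ramp_jump Psi y F phi (j%:R / i.+1%:R) s = j%:R / i.+1%:R * ramp_jump Psi y F phi 1 s.
  have i0 : i.+1%:R != 0 :> R by rewrite pnatr_eq0.
  rewrite natE ?invr_ge0// -mulrA; congr (_ * _).
  by apply: (mulfI i0); rewrite mulrA divff// mul1r -natE ?invr_ge0// divff.
pose ci i := (Num.truncn (c * i.+1%:R))%:R / i.+1%:R : R.
have ci0 i : 0 <= ci i by rewrite divr_ge0.
have cic : ci @ \oo --> c.
  apply/cvgrPdist_lt => e e0; near=> i.
  have i0 : 0 < i.+1%:R :> R by rewrite ltr0n.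
  have /andP[h1 h2] : (Num.truncn (c * i.+1%:R))%:R <= c * i.+1%:R < (Num.truncn (c * i.+1%:R)).+1%:R.
    by apply: Num.Theory.truncn_itv; rewrite mulr_ge0.
  have ei : i.+1%:R^-1 < e.
    near: i; have [N _ hN] := @near_infty_natSinv_lt R (PosNum e0); exists N => // i Ni; exact: hN.
  have cE : c = c * i.+1%:R / i.+1%:R by rewrite mulfK// gt_eqF.
  rewrite ltr_norml; apply/andP; split.
    by apply: (@lt_le_trans _ _ 0); rewrite ?oppr_lt0// subr_ge0 /ci ler_pdivrMr.
  apply: le_lt_trans ei; rewrite lerBlDl /ci -[X in _ + X]mul1r -mulrDl ler_pdivlMr//.
  by rewrite natr1 ltW.
have l1 : (fun i => ramp_jump Psi y F phi (ci i) s) @ \oo --> ramp_jump Psi y F phi c s.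
  apply: cvgB; last exact: cvg_cst.
  apply: (mv_cts mv) => //; [by move=> i; exact: crampF|exact: crampF|].
  have E (a : R) : rampF a s = (fun x => F x + a * ramp s (inner y x)).
    by apply/funext => x; rewrite /rampF /rampsum big_seq1.
  rewrite (_ : (fun i => rampF (ci i) s) = (fun i x => F x + ci i * ramp s (inner y x))); last first.
    by apply/funext => i; rewrite E.
  rewrite -/(rampF c s) E; apply: (@loc_unif_addl F (fun i t => ci i * ramp s t) (fun t => c * ramp s t)) => r e e0.
  have K0 : 0 < `|r| + `|s| + 1 by rewrite ltr_wpDl// addr_ge0.
  move/cvgrPdist_lt : cic => /(_ _ (divr_gt0 e0 K0)); apply: filterS => i hi t tr.
  rewrite -mulrBl normrM distrC; apply: (@le_lt_trans _ _ (`|c - ci i| * (`|r| + `|s| + 1))).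
    rewrite ler_wpM2l// /ramp.
    have [h|h] := leP 0 (t - s); last by rewrite normr0 ltW.
    apply: (le_trans (ler_normB _ _)).
    have : `|t| <= `|r| by rewrite (le_trans tr)// ler_norm.
    lra.
  by rewrite -ltr_pdivlMr.
have l2 : (fun i => ramp_jump Psi y F phi (ci i) s) @ \oo --> c * ramp_jump Psi y F phi 1 s.
  rewrite (_ : (fun i => _) = (fun i => ci i * ramp_jump Psi y F phi 1 s)); last first.
    by apply/funext => i; rewrite fracE.
  by apply: cvgM => //; exact: cvg_cst.
exact: (cvg_unique (@Rhausdorff R) l1 l2).
Unshelve. all: by end_near. Qed.

(** On either side of the hyperplane the ramp is affine, so locality and invariance under affine
    functions remove the jump there; on the hyperplane [w] is the constant w s. *)
Lemma ramp_jump_mul phi (w : R -> R) s : continuous phi -> compact_support phi -> continuous w ->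
  ramp_jump Psi y F (fun x => phi x * w (inner y x)) 1 s = w s * ramp_jump Psi y F phi 1 s.
Proof.
move=> cp sp cw.
have cF1 : convex_fun (rampF 1 s) by exact: crampF.
have r1 := mv_radon mv cF1; have r0 := mv_radon mv cF.
have cwl : continuous (fun x : V => w (inner y x)).
  by move=> x; apply: continuous_comp; [exact: continuous_inner|exact: cw].
have cpw : continuous (fun x => phi x * w (inner y x)) by exact: ctsM.
have spw : compact_support (fun x => phi x * w (inner y x)).
  by case: sp => r hr; exists r => x /hr ->; rewrite mul0r.
have cwp : continuous (fun x => w s * phi x) by exact: ctsZ.
have swp : compact_support (fun x => w s * phi x).
  by case: sp => r hr; exists r => x /hr ->; rewrite mulr0.
rewrite /ramp_jump -!layer_intB// -layer_int_funZ//; last exact: rradonB.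
apply: (@layer_int_concentrated _ _ _ [set x | inner y x = s]) => //; last 2 first.
- move=> A bA mA AH.
  pose U1 : set V := [set x | inner y x < s]; pose U2 : set V := [set x | s < inner y x].
  have oU1 : open U1.
    rewrite (_ : U1 = inner y @^-1` [set t | t < s])//; apply: open_comp; last exact: open_lt.
    by move=> x _; exact: continuous_inner.
  have oU2 : open U2.
    rewrite (_ : U2 = inner y @^-1` [set t | s < t])//; apply: open_comp; last exact: open_gt.
    by move=> x _; exact: continuous_inner.
  have mAU1 : measurable (A `&` U1) by apply: measurableI => //; exact: measurable_open_rV.
  have mAU2 : measurable (A `&` U2) by apply: measurableI => //; exact: measurable_open_rV.
  have AE : A = (A `&` U1) `|` (A `&` U2).
    apply/seteqP; split => [x Ax|x [[]//|[]//]].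
    have [h|h|h] := ltgtP (inner y x) s; [by left|by right|].
    by have : (A `&` [set x | inner y x = s]) x by []; rewrite AH.
  have dU : (A `&` U1) `&` (A `&` U2) = set0.
    by apply/seteqP; split => // x [[_ h1] [_ h2]]; move: (lt_trans h1 h2); rewrite ltxx.
  have mr : rradon (fun A : set V => Psi (rampF 1 s) A - Psi F A) by exact: rradonB.
  have bA' : bounded_set ((A `&` U1) `|` (A `&` U2)) by rewrite -AE.
  rewrite -/(rampF 1 s) AE (rradonU r1 mAU1 mAU2 bA' dU) (rradonU r0 mAU1 mAU2 bA' dU).
  have e1 : Psi (rampF 1 s) (A `&` U1) = Psi F (A `&` U1).
    apply: (mv_loc mv) => // x /= h.
    by rewrite /rampF /rampsum big_seq1 /= /ramp max_r ?mulr0 ?addr0// subr_le0 ltW.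
  have aa : affine_fun (fun x : V => inner y x - s) by exists y, (- s).
  have e2 : Psi (rampF 1 s) (A `&` U2) = Psi F (A `&` U2).
    have bU2 : bounded_set (A `&` U2) by apply: sub_bounded_set bA => x [].
    rewrite -(mv_aff mv cF aa bU2 mAU2).
    apply: (mv_loc mv) => //; first by apply: convex_funD => //; exact: convex_affine.
    move=> x /= h; rewrite /rampF /rampsum big_seq1 /= /ramp max_l ?mul1r// subr_ge0 ltW//.
  by rewrite e1 e2; ring.
- by move=> x /= ->; rewrite mulrC.
- exact: rradonB.
- apply: measurable_closed_rV; rewrite (_ : mkset _ = inner y @^-1` [set s])//.
  by apply: closed_comp; [move=> x _; exact: continuous_inner|exact: closed_eq].
Qed.

(** Mesh 1/(m+1) on [-(m+1), m+1], hence 2 (m+1)^2 steps: the interval grows while the mesh shrinks,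
    so one limit serves all bounded ranges. *)
Definition node (m j : nat) : R := - m.+1%:R + j%:R / m.+1%:R.
(** The change of slope of the piecewise linear interpolant at node j + 1. *)
Definition node_wt (g : R -> R) (m j : nat) : R :=
  (g (node m j.+2) - 2 * g (node m j.+1) + g (node m j)) * m.+1%:R.

Lemma nodeS m j : node m j.+1 = node m j + m.+1%:R^-1.
Proof. by rewrite /node -[j.+1%:R]natr1 mulrDl mul1r addrA. Qed.

Lemma node_wt_ge0 g m j : convex1 g -> 0 <= node_wt g m j.
Proof.
move=> cg; rewrite mulr_ge0//.
have h0 : 0 <= (2^-1 : R) by lra.
have h1 : (2^-1 : R) <= 1 by lra.
have := cg (node m j.+2) (node m j) 2^-1; rewrite h0 h1 => /(_ isT).
have -> : 2^-1 * node m j.+2 + (1 - 2^-1) * node m j = node m j.+1 by rewrite !nodeS; field.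
lra.
Qed.

Lemma node_interp g m i t :
  g (node m 0) + (g (node m 1) - g (node m 0)) * m.+1%:R * (t - node m 0) +
    \sum_(0 <= j < i) node_wt g m j * (t - node m j.+1) =
  g (node m i) + (t - node m i) * ((g (node m i.+1) - g (node m i)) * m.+1%:R).
Proof.
have m0 : m.+1%:R != 0 :> R by rewrite pnatr_eq0.
elim: i => [|i ih]; first by rewrite big_geq// addr0; ring.
rewrite big_nat_recr//= addrA ih /node_wt.
move: (g (node m i.+2)) (g (node m i.+1)) (g (node m i)) => a b c.
by rewrite nodeS; field.
Qed.

Definition interp g m t := (g (node m 0) + (g (node m 1) - g (node m 0)) * m.+1%:R * (t - node m 0)) +
    \sum_(0 <= j < 2 * m.+1 * m.+1) node_wt g m j * ramp (node m j.+1) t.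

Definition loc_lip (g : R -> R) := forall r, exists2 L, 0 <= L &
  forall a b, `|a| <= r -> `|b| <= r -> `|g a - g b| <= L * `|a - b|.

Lemma interp_cvg g : loc_lip g -> forall r e : R, 0 < e ->
  \forall m \near \oo, forall t, `|t| <= r -> `|interp g m t - g t| < e.
Proof.
move=> lg r e e0.
have aux (a b u s : R) : a <= s -> s < b -> b = a + u -> u <= 1 -> 0 < u -> - r <= s -> s <= r ->
    [/\ `|a| <= r + 1, `|b| <= r + 1, `|s| <= r + 1, `|a - s| <= u & s - a <= u].
  by move=> h1 h2 h3 h4 h5 h6 h7; rewrite !ler_norml; split; lra.
have [L L0 hL] := lg (r + 1).
near=> m.
have rM : r < m.+1%:R.
  near: m; exists (Num.truncn `|r|).+1 => // m /= h.
  apply: le_lt_trans (ler_norm r) _; apply: lt_le_trans (Num.Theory.truncnS_gt _) _.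
  by rewrite ler_nat ltnS ltnW.
have eM : m.+1%:R^-1 * (2 * L + 1) < e.
  rewrite mulrC -ltr_pdivlMl; last by rewrite ltr_wpDl// mulr_ge0.
  rewrite mulrC; near: m.
  have L1 : 0 < e / (2 * L + 1) by rewrite divr_gt0// ltr_wpDl// mulr_ge0.
  by have [N _ hN] := @near_infty_natSinv_lt R (PosNum L1); exists N => // i Ni; exact: hN.
move=> t; rewrite ler_norml => /andP[tr1 tr2].
set M : R := m.+1%:R in rM eM *; have M0 : 0 < M by rewrite ltr0n.
have M1 : 1 <= M by rewrite ler1n.
pose i := Num.truncn ((t + M) * M).
have /andP[i1 i2] : i%:R <= (t + M) * M < i.+1%:R.
  by apply: Num.Theory.truncn_itv; rewrite mulr_ge0 ?(ltW M0)//; lra.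
have n1 : node m i <= t.
  by rewrite /node -/M addrC lerBlDr ler_pdivrMr.
have n2 : t < node m i.+1.
  by rewrite /node -/M addrC ltrBrDr ltr_pdivlMr.
have iK : (i <= 2 * m.+1 * m.+1)%N.
  rewrite -(ler_nat R) (le_trans i1)// !natrM -/M ler_pM2r//; lra.
have nE : interp g m t = g (node m i) + (t - node m i) * ((g (node m i.+1) - g (node m i)) * M).
  rewrite -node_interp /interp (big_cat_nat (leq0n _) iK)//= -[RHS]addr0 addrA; congr (_ + _ + _).
    rewrite !big_nat; apply: eq_bigr => j /andP[_ ji]; congr (_ * _).
    rewrite /ramp max_l// subr_ge0 (le_trans _ n1)// /node lerD2l ler_pM2r ?invr_gt0//.
    by rewrite ler_nat.
  rewrite big_nat; apply: big1 => j /andP[ij _].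
  rewrite /ramp max_r ?mulr0// subr_le0 (le_trans (ltW n2))// /node lerD2l ler_pM2r ?invr_gt0//.
  by rewrite ler_nat ltnS.
have Mi1 : M^-1 <= 1 by rewrite invf_le1.
have nS := nodeS m i; rewrite -/M in nS.
have Mi0 : 0 < M^-1 by rewrite invr_gt0.
have [bi bi1 bt dt dt'] := aux _ _ _ _ n1 n2 nS Mi1 Mi0 tr1 tr2.
have d1 : `|g (node m i) - g t| <= L * M^-1.
  by apply: le_trans (hL _ _ bi bt) _; rewrite ler_wpM2l.
have d2 : `|g (node m i.+1) - g (node m i)| <= L * M^-1.
  apply: le_trans (hL _ _ bi1 bi) _; rewrite ler_wpM2l// nS addrC addKr ger0_norm// ltW//.
rewrite nE (_ : _ - g t = (g (node m i) - g t) + ((t - node m i) * M) * (g (node m i.+1) - g (node m i))); last by ring.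
apply: le_lt_trans (ler_normD _ _) _.
apply: (@le_lt_trans _ _ (L * M^-1 + L * M^-1)); last first.
  apply: le_lt_trans eM; rewrite mulrDr mulr1; have : L * M^-1 + L * M^-1 = M^-1 * (2 * L) by ring.
  by move=> ->; rewrite lerDl ltW.
apply: lerD => //; rewrite normrM; apply: le_trans d2; rewrite ler_piMl// ger0_norm.
  by rewrite -ler_pdivlMr// mul1r.
by rewrite mulr_ge0 ?(ltW M0)// subr_ge0.
Unshelve. all: by end_near. Qed.

(** Up to an affine function the interpolant of [g] is a sum of ramps, so the effect of a ridge on
    [Psi] is a limit of Riemann-Stieltjes sums of unit jumps against the slope changes of [g]. *)
Lemma ridge_limit phi g : continuous phi -> compact_support phi -> convex1 g -> loc_lip g ->
  (fun m => \sum_(0 <= j < 2 * m.+1 * m.+1) node_wt g m j * ramp_jump Psi y F phi 1 (node m j.+1)) @ \oo -->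
  layer_int (Psi (fun x => F x + g (inner y x))) phi - layer_int (Psi F) phi.
Proof.
move=> cp sp cg lg.
pose r m := [seq (node_wt g m j, node m j.+1) | j <- index_iota 0 (2 * m.+1 * m.+1)].
have r0 m cs : cs \in r m -> 0 <= cs.1 by move=> /mapP[j _ ->]; exact: node_wt_ge0.
have rs m : sorted <=%R [seq cs.2 | cs <- r m].
  rewrite -map_comp sorted_map; apply: (sub_sorted _ (iota_sorted _ _)) => i j ij /=.
  by rewrite /node lerD2l ler_pM2r ?invr_gt0// ler_nat.
pose a m x : R := g (node m 0) + (g (node m 1) - g (node m 0)) * m.+1%:R * (inner y x - node m 0).
have aa m : affine_fun (a m).
  exists (((g (node m 1) - g (node m 0)) * m.+1%:R) *: y),
    (g (node m 0) - (g (node m 1) - g (node m 0)) * m.+1%:R * node m 0) => x.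
  by rewrite innerZl /a; ring.
have E m : (fun x => F x + interp g m (inner y x)) = (fun x => rampsum y F (r m) x + a m x).
  by apply/funext => x; rewrite /interp /rampsum /r big_map /= -/(a m x) addrA addrAC.
have cE m : convex_fun (fun x => F x + interp g m (inner y x)).
  by rewrite E; apply: convex_funD; [apply: rampsum_convex => //; exact: r0|exact: convex_affine].
rewrite (_ : (fun m => _) = (fun m => layer_int (Psi (fun x => F x + interp g m (inner y x))) phi - layer_int (Psi F) phi)).
  apply: cvgB; last exact: cvg_cst.
  apply: (mv_cts mv) => //; first by apply: convex_funD => //; exact: convex_ridge.
  exact/loc_unif_addl/interp_cvg.
apply/funext => m.
have cr : convex_fun (rampsum y F (r m)) by apply: rampsum_convex => //; exact: r0.
have -> : layer_int (Psi (fun x => F x + interp g m (inner y x))) phi = layer_int (Psi (rampsum y F (r m))) phi.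
  by apply: layer_int_eq => // B bB mB; rewrite E; exact: (mv_aff mv).
rewrite (int_rampsum mv y cF cp sp (rs m) (r0 m)) /r big_map; apply: eq_bigr => j _ /=.
by rewrite [RHS]ramp_jumpE//; exact: node_wt_ge0.
Qed.

(** The weights [node_wt] are linear in the profile, hence so is the limit. *)
Lemma ridge_scale phi g c : continuous phi -> compact_support phi -> convex1 g -> loc_lip g -> 0 <= c ->
  layer_int (Psi (fun x => F x + c * g (inner y x))) phi - layer_int (Psi F) phi =
  c * (layer_int (Psi (fun x => F x + g (inner y x))) phi - layer_int (Psi F) phi).
Proof.
move=> cp sp cg lg c0.
have cg' : convex1 (fun t => c * g t).
  move=> u v t t01; rewrite mulrCA [_ * (c * g v)]mulrCA -mulrDr ler_wpM2l//; exact: cg.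
have lg' : loc_lip (fun t => c * g t).
  move=> r; have [L L0 hL] := lg r; exists (c * L); first exact: mulr_ge0.
  by move=> u v ur vr; rewrite -mulrBr normrM ger0_norm// -mulrA ler_wpM2l//; exact: hL.
have l1 := ridge_limit cp sp cg' lg'.
have l2 : (fun m => \sum_(0 <= j < 2 * m.+1 * m.+1) node_wt (fun t => c * g t) m j * ramp_jump Psi y F phi 1 (node m j.+1)) @ \oo -->
    c * (layer_int (Psi (fun x => F x + g (inner y x))) phi - layer_int (Psi F) phi).
  rewrite (_ : (fun m => _) = (fun m => c * \sum_(0 <= j < 2 * m.+1 * m.+1) node_wt g m j * ramp_jump Psi y F phi 1 (node m j.+1))).
    by apply: cvgM; [exact: cvg_cst|exact: ridge_limit].
  apply/funext => m; rewrite mulr_sumr; apply: eq_bigr => j _; rewrite /node_wt; ring.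
exact: (cvg_unique (@Rhausdorff R) l1 l2).
Qed.

Lemma loc_lip_sqr : loc_lip (fun t => t ^+ 2 / 2).
Proof.
move=> r; exists `|r| => // a b ar br.
rewrite (_ : _ - _ = (a + b) / 2 * (a - b)); last by field.
rewrite normrM ler_wpM2r// normrM [`|2^-1|]ger0_norm ?invr_ge0// ler_pdivrMr//.
apply: le_trans (ler_normD _ _) _; have := ler_norm r; lra.
Qed.

Lemma loc_lip_expR : loc_lip expR.
Proof.
move=> r; exists (expR r); first exact: expR_ge0.
have h a b : `|a| <= r -> b <= a -> `|expR a - expR b| <= expR r * `|a - b|.
  move=> ar ba; rewrite !ger0_norm ?subr_ge0 ?ler_expR//.
  apply: (@le_trans _ _ (expR a * (a - b))).
    have := expR_ge1Dx (b - a); rewrite expRB => /(ler_wpM2l (expR_ge0 a)).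
    rewrite mulrCA divff ?gt_eqF ?expR_gt0// mulr1; lra.
  by rewrite ler_wpM2r ?subr_ge0// ler_expR (le_trans (ler_norm _)).
move=> a b ar br; have [ba|ab] := leP b a; first exact: h.
by rewrite distrC [X in _ <= _ * X]distrC; apply: h => //; exact: ltW.
Qed.

(* Ratio of the second differences of exp and of t^2/2 at equally spaced nodes, up to the
   factor exp at the middle node. *)
Lemma exp_second_difference :
  (fun m => (expR m.+1%:R^-1 - 2 + expR (- m.+1%:R^-1)) * m.+1%:R ^+ 2 : R) @ \oo --> (1 : R).
Proof.
have inv0 : (fun m => m.+1%:R^-1 : R) @ \oo --> (0 : R).
  exact: cvg_harmonic.
pose h m : R := m.+1%:R^-1.
pose q (m : nat) : R := (expR (h m) - 1) * m.+1%:R.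
have q1 : q @ \oo --> (1 : R).
  apply: (@squeeze_cvgr _ _ _ _ (fun=> 1) (fun m => (1 - h m)^-1)).
  - near=> m; have m0 : 0 < m.+1%:R :> R by rewrite ltr0n.
    have h0 : 0 < h m by rewrite invr_gt0.
    have h1 : h m < 1.
      by near: m; exists 1%N => // m /= m1; rewrite invf_lt1 ?ltr0n// ltr1n ltnS.
    apply/andP; split.
      by rewrite /q -ler_pdivrMr// mul1r lerBrDl expR_ge1Dx.
    rewrite /q -ler_pdivlMr// lerBlDl.
    have -> : 1 + (1 - h m)^-1 / m.+1%:R = (1 - h m)^-1.
      by rewrite -/(h m); field; rewrite subr_eq0 gt_eqF.
    rewrite -[leLHS]invrK -expRN lef_pV2 ?posrE ?expR_gt0 ?subr_gt0//; exact: expR_ge1Dx.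
  - exact: cvg_cst.
  - rewrite -[X in _ --> X]invr1; apply: cvgV; first exact: oner_neq0.
    by rewrite -[X in _ --> X](subr0 1); apply: cvgB => //; exact: cvg_cst.
rewrite (_ : (fun m => _) = (fun m => q m * q m * expR (- h m))).
  rewrite -[X in _ --> X]mulr1 -{1}[1 in X in _ --> X]mulr1; apply: cvgM; first exact: cvgM.
  rewrite -(expR0 R) -oppr0; apply: continuous_cvg; first exact: continuous_expR.
  exact: cvgN.
apply/funext => m; rewrite /q -/(h m) expRN.
have := expR_gt0 (h m); move: (expR (h m)) => E E0; field.
by rewrite gt_eqF.
Unshelve. all: by end_near. Qed.

(** At the node s the weight of exp is exp(s) E2 m times that of t^2/2, and exp(s) is absorbed into
    the test function by [ramp_jump_mul]; E2 m tends to 1. *)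
Lemma ridge_exp phi c : continuous phi -> compact_support phi -> 0 <= c ->
  layer_int (Psi (fun x => F x + c * expR (inner y x))) phi - layer_int (Psi F) phi =
  c * (layer_int (Psi (fun x => F x + (inner y x) ^+ 2 / 2)) (fun x => phi x * expR (inner y x))
       - layer_int (Psi F) (fun x => phi x * expR (inner y x))).
Proof.
move=> cp sp c0; rewrite (ridge_scale cp sp (@convex1_expR R) loc_lip_expR c0); congr (_ * _).
have cpe : continuous (fun x => phi x * expR (inner y x)).
  apply: ctsM => // x; apply: continuous_comp; [exact: continuous_inner|exact: continuous_expR].
have spe : compact_support (fun x => phi x * expR (inner y x)).
  by case: sp => r hr; exists r => x /hr ->; rewrite mul0r.
have l1 := ridge_limit cp sp (@convex1_expR R) loc_lip_expR.
have l3 := ridge_limit cpe spe (@convex1_sqr R) loc_lip_sqr.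
pose S (m : nat) : R := \sum_(0 <= j < 2 * m.+1 * m.+1) node_wt (fun t => t ^+ 2 / 2) m j *
  ramp_jump Psi y F (fun x => phi x * expR (inner y x)) 1 (node m j.+1).
pose E2 (m : nat) : R := (expR m.+1%:R^-1 - 2 + expR (- m.+1%:R^-1)) * m.+1%:R ^+ 2.
set I2 := (X in _ = X); have l2 : (fun m => E2 m * S m) @ \oo --> 1 * I2.
  by apply: cvgM; [exact: exp_second_difference|exact: l3].
rewrite mul1r in l2; apply: (cvg_unique (@Rhausdorff R) _ l2).
rewrite (_ : (fun m => E2 m * S m) = (fun m => \sum_(0 <= j < 2 * m.+1 * m.+1) node_wt expR m j * ramp_jump Psi y F phi 1 (node m j.+1))) //.
apply/funext => m /=; rewrite mulr_sumr; apply: eq_bigr => j _; rewrite /E2.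
rewrite (ramp_jump_mul _ cp sp (@continuous_expR R)) /node_wt !nodeS !expRD.
have m0 : m.+1%:R != 0 :> R by rewrite pnatr_eq0.
rewrite expRN; have := expR_gt0 (m.+1%:R^-1 : R); move: (expR _) => E E0.
move: (expR (node m j)) (ramp_jump _ _ _ _ _ _) => e t; field.
by rewrite nat1r m0 gt_eqF.
Qed.

End Base.
End RidgeSums.

(** * Minors and sums of squared determinants *)

Section MinorAlgebra.
Variable R : realType.

(** The Schur complement of the bordered matrix [M s] is B + s u w, and s enters [M s] through its
    first column only. *)
Lemma det_rank1_affine m (B : 'M[R]_m) (u : 'cV[R]_m) (w : 'rV[R]_m) :
  exists c, forall s, \det (B + s *: (u *m w)) = \det B + s * c.
Proof.
pose M s : 'M[R]_(1 + m) := block_mx 1%:M w (- (s *: u)) B.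
have detM s : \det (M s) = \det (B + s *: (u *m w)).
  have -> : M s = (block_mx 1%:M 0 (- (s *: u)) 1%:M) *m (block_mx 1%:M w 0 (B + s *: (u *m w))).
    rewrite mulmx_block !(mul1mx, mul0mx, mulmx1, mulmx0, addr0) mulNmx -scalemxAl.
    by rewrite addrCA addNr addr0.
  by rewrite det_mulmx det_lblock det_ublock !det1 !mul1r.
have cfE s : col' (lshift m ord0) (M s) = col' (lshift m ord0) (M 0).
  apply/matrixP => a b; rewrite !mxE.
  have -> : lift (lshift m ord0) b = rshift 1 b by exact: val_inj.
  by case: (fintype.split a) => a'; rewrite !row_mxEr.
have M0 s i : M s i (lshift m ord0) = M 0 i (lshift m ord0) +
    s * (M 1 i (lshift m ord0) - M 0 i (lshift m ord0)).
  by rewrite !mxE; case: (fintype.split i) => i'; rewrite !row_mxEl ?mxE; ring.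
exists (\sum_i (M 1 i (lshift m ord0) - M 0 i (lshift m ord0)) * cofactor (M 0) i (lshift m ord0)) => s.
rewrite -detM -[\det B]/(\det B) (_ : \det B = \det (M 0)); last by rewrite detM scale0r addr0.
rewrite !(expand_det_col _ (lshift m ord0)) mulr_sumr -big_split /=; apply: eq_bigr => i _.
rewrite /cofactor cfE [X in X * _ = _]M0; ring.
Qed.

(** The sign-free version, which minors satisfy; a valuation supplies only [rank1_affine], on
    positive semidefinite matrices and for s >= 0. *)
Definition rank1_affine_all n (p : 'M[R]_n -> R) := forall A (v : 'rV[R]_n) s,
  p (A + s *: sq v) = p A + s * (p (A + sq v) - p A).

Lemma rank1_affine_allW n (p : 'M[R]_n -> R) : rank1_affine_all p -> rank1_affine p.
Proof. by move=> h A v s _ _. Qed.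

Lemma rank1_affine_all_det n k (h : 'M[R]_n -> 'M[R]_k) (u : 'rV[R]_n -> 'cV[R]_k) (w : 'rV[R]_n -> 'rV[R]_k) :
  (forall A v s, h (A + s *: sq v) = h A + s *: (u v *m w v)) ->
  rank1_affine_all (fun A => \det (h A)).
Proof.
move=> hE A v s; have [c cE] := det_rank1_affine (h A) (u v) (w v).
rewrite -{2}[sq v]scale1r !hE !cE; ring.
Qed.

Lemma rank1_affine_all_sum n (I : finType) (P : pred I) (c : I -> R) (q : I -> 'M[R]_n -> R) :
  (forall i, P i -> rank1_affine_all (q i)) -> rank1_affine_all (fun A => \sum_(i | P i) c i * q i A).
Proof.
move=> hq A v s; rewrite -sumrB mulr_sumr -big_split /=; apply: eq_bigr => i Pi.
rewrite hq//; ring.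
Qed.

Lemma minor_rank1 n k (r c : {ffun 'I_k -> 'I_n}) : rank1_affine_all (@minor R n k r c).
Proof.
apply: (@rank1_affine_all_det _ _ (fun A => \matrix_(a, b) A (r a) (c b))
  (fun v => \col_a v ord0 (r a)) (fun v => \row_b v ord0 (c b))) => A v s.
by apply/matrixP => a b; rewrite !mxE !big_ord1 !mxE.
Qed.

Lemma minorZ n k (r c : {ffun 'I_k -> 'I_n}) t (A : 'M[R]_n) : minor r c (t *: A) = t ^+ k * minor r c A.
Proof.
by rewrite /minor -detZ; congr (\det _); apply/matrixP => a b; rewrite !mxE.
Qed.

Lemma minor_sumsq n k (r c : {ffun 'I_k -> 'I_n}) (xi : 'I_k -> 'rV[R]_n) :
  minor r c (\sum_i sq (xi i)) = cdet xi r * cdet xi c.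
Proof.
rewrite /cdet -[X in X * _]det_tr -det_mulmx /minor; congr (\det _).
apply/matrixP => a b; rewrite !mxE summxE; apply: eq_bigr => i _.
by rewrite sqE !mxE.
Qed.

(** The index maps may repeat or disorder their values, as the expansion produces them; increasing
    maps are restored when passing to [minor_comb]. *)
Definition biminor n k (b : {ffun 'I_k -> 'I_n * 'I_n} -> R) (A : 'M[R]_n) : R :=
  \sum_(h : {ffun 'I_k -> 'I_n * 'I_n}) b h * minor [ffun i => (h i).1] [ffun i => (h i).2] A.

Lemma biminor_rank1 n k b : rank1_affine_all (@biminor n k b).
Proof. by apply: rank1_affine_all_sum => h _; exact: minor_rank1. Qed.

Lemma biminorZ n k b t (A : 'M[R]_n) : @biminor n k b (t *: A) = t ^+ k * biminor b A.
Proof.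
rewrite /biminor mulr_sumr; apply: eq_bigr => h _; rewrite minorZ; ring.
Qed.

Lemma biminor_hom n k b : hom_deg k (@biminor n k b).
Proof. by move=> A t _ _; exact: biminorZ. Qed.

Lemma rank1_affineB n (p q : 'M[R]_n -> R) : rank1_affine p -> rank1_affine q ->
  rank1_affine (fun A => p A - q A).
Proof. move=> rp rq A v s SA s0; rewrite rp// rq//; ring. Qed.

Lemma hom_degB n k (p q : 'M[R]_n -> R) : hom_deg k p -> hom_deg k q ->
  hom_deg k (fun A => p A - q A).
Proof. move=> rp rq A s SA s0; rewrite rp// rq//; ring. Qed.

Lemma hom_ext n k (p q : 'M[R]_n -> R) : rank1_affine p -> hom_deg k p ->
  rank1_affine q -> hom_deg k q ->
  (forall xi : 'I_k -> 'rV[R]_n, p (\sum_i sq (xi i)) = q (\sum_i sq (xi i))) ->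
  forall A, SR A -> p A = q A.
Proof.
move=> rp hp rq hq pq A SA; apply/eqP; rewrite -subr_eq0; apply/eqP.
apply: (hom_eq0 (rank1_affineB rp rq) (hom_degB hp hq) _ SA) => s sk.
apply/eqP; rewrite subr_eq0; apply/eqP.
by rewrite /sumsq (big_nth 0) sk big_mkord; exact: pq.
Qed.

Lemma rank1_affine_biminor n k (p : 'M[R]_n -> R) : rank1_affine p -> hom_deg k p ->
  exists b : {ffun 'I_k -> 'I_n * 'I_n} -> R, forall A, SR A -> p A = biminor b A.
Proof.
move=> rp hp; have [b bE] := det_expansion rp hp; exists b.
apply: (hom_ext rp hp (rank1_affine_allW (@biminor_rank1 n k b)) (@biminor_hom n k b)) => xi.
by rewrite bE; apply: eq_bigr => h _; rewrite minor_sumsq.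
Qed.

(** Over an ordered field M M^T has the rank of M^T, hence the same row space, and l M^T lies in the
    latter. *)
Lemma row_sub_gram d m (M : 'M[R]_(m, d)) (l : 'rV[R]_d) :
  exists a : 'rV[R]_m, l *m M^T = a *m (M *m M^T).
Proof.
have r : \rank (M *m M^T) = \rank M^T.
  rewrite mxrank_tr -[RHS](mxrank_mul_ker M M^T).
  suff -> : (M :&: kermx M^T)%MS = 0 by rewrite mxrank0 addn0.
  apply/eqP; rewrite -submx0; apply/rV_subP => u.
  rewrite sub_capmx => /andP[/submxP[a ua] /sub_kermxP uM].
  have : u *m u^T = 0 by rewrite {2}ua trmx_mul mulmxA uM mul0mx.
  move/matrixP/(_ ord0 ord0); rewrite !mxE => /eqP.
  rewrite psumr_eq0; last by move=> i _; rewrite !mxE -expr2 sqr_ge0.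
  move=> /allP u0; suff -> : u = 0 by exact: sub0mx.
  apply/rowP => i; have := u0 i (mem_index_enum i).
  by rewrite !mxE -expr2 sqrf_eq0 => /eqP.
have : (M *m M^T == M^T)%MS by rewrite -(geq_leqif (mxrank_leqif_eq (submxMl M M^T))) r.
move=> /eqmxP e; have : (l *m M^T <= M *m M^T)%MS by rewrite e submxMl.
by move=> /submxP[a ->]; exists a.
Qed.

(** On the span of all [w y] the functional [l] is represented by a vector of that span, that is, by
    a combination of finitely many [w (x j)]. *)
Lemma gram_span (X : Type) d (w : X -> 'rV[R]_d) (l : 'rV[R]_d) :
  exists (m : nat) (x : 'I_m -> X) (c : 'I_m -> R), forall y,
  (l *m (w y)^T) ord0 ord0 = \sum_j c j * (w (x j) *m (w y)^T) ord0 ord0.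
Proof.
suff [m [x hx]] : exists (m : nat) (x : 'I_m -> X), forall y,
    (w y <= \matrix_j w (x j))%MS.
  set M := \matrix_j w (x j) in hx.
  have [a aE] := row_sub_gram M l.
  exists m, x, (fun j => a ord0 j) => y.
  have /submxP[D ->] := hx y.
  rewrite trmx_mul mulmxA aE -[in LHS]mulmxA mxE; apply: eq_bigr => j _; congr (_ * _).
  rewrite -mulmxA -trmx_mul.
  have -> : w (x j) = row j M by rewrite rowK.
  by rewrite -row_mul [in RHS]mxE.
(* Induction on the codimension of the span of the vectors chosen so far. *)
pose Q r := exists (m : nat) (x : 'I_m -> X), (d - \rank (\matrix_j w (x j)) <= r)%N.
suff step r : Q r -> exists (m : nat) (x : 'I_m -> X), forall y, (w y <= \matrix_j w (x j))%MS.
  case: (pselect (exists y : X, True)) => [[y _]|nX].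
    by apply: (step d); exists 1%N, (fun=> y); rewrite leq_subr.
  by exists 0%N, (fun i : 'I_0 => match notF (ltn_ord i) with end) => y; exfalso; apply: nX; exists y.
elim: r => [|r ih] [m [x dx]].
  exists m, x => y; apply: submx_full; rewrite /row_full eqn_leq rank_leq_col/=.
  by move: dx; rewrite leqn0 subn_eq0.
case: (pselect (forall y, (w y <= \matrix_j w (x j))%MS)) => [h|]; first by exists m, x.
move=> /existsNP[y /negP ny]; apply: ih.
exists m.+1, (fun i => if unlift ord0 i is Some j then x j else y).
set M := \matrix_j w (x j) in dx ny; set N := \matrix_j w _.
have MN : (M <= N)%MS.
  apply/row_subP => i; rewrite rowK; have -> : w (x i) = row (lift ord0 i) N by rewrite rowK liftK.
  exact: row_sub.
have yN : (w y <= N)%MS.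
  have -> : w y = row ord0 N by rewrite rowK unlift_none.
  exact: row_sub.
have : (M < N)%MS.
  by rewrite ltmxE MN /=; apply: contra ny => NM; exact: submx_trans NM.
move=> /rank_ltmx; lia.
Qed.

End MinorAlgebra.

(** * From Gram determinants to squared determinants *)

Section CauchyBinet.
Variable R : realType.

(** The Cauchy-Binet formula; summing over all index maps instead of the increasing ones produces
    the factor k!. *)
Lemma sum_cdet_mul n k (xi eta : 'I_k -> 'rV[R]_n) :
  \sum_(f : {ffun 'I_k -> 'I_n}) cdet xi f * cdet eta f =
  k`!%:R * \det (\matrix_(a, b) inner (xi a) (eta b)).
Proof.
have half : \det (\matrix_(a, b) inner (xi a) (eta b)) =
    \sum_(f : {ffun 'I_k -> 'I_n}) (\prod_a xi a ord0 (f a)) * cdet eta f.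
  rewrite /determinant.
  transitivity (\sum_(s : 'S_k) \sum_(f : {ffun 'I_k -> 'I_n})
      (\prod_a xi a ord0 (f a)) * ((-1) ^+ s * \prod_a eta (s a) ord0 (f a))).
    apply: eq_bigr => s _; under eq_bigr do rewrite mxE /inner.
    rewrite bigA_distr_bigA /= mulr_sumr; apply: eq_bigr => f _.
    by rewrite big_split /= mulrCA.
  rewrite exchange_big/=; apply: eq_bigr => f _; rewrite -mulr_sumr; congr (_ * _).
  rewrite /cdet -det_tr /determinant; apply: eq_bigr => s _; congr (_ * _).
  by apply: eq_bigr => a _; rewrite !mxE.
rewrite half.
have perm_f (s : 'S_k) : \sum_(f : {ffun 'I_k -> 'I_n}) (\prod_a xi a ord0 (f a)) * cdet eta f =
    \sum_(f : {ffun 'I_k -> 'I_n}) (\prod_a xi a ord0 (f (s a))) * ((-1) ^+ s * cdet eta f).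
  rewrite (reindex (fun f : {ffun 'I_k -> 'I_n} => [ffun a => f (s a)])); last first.
    apply: onW_bij; exists (fun f : {ffun 'I_k -> 'I_n} => [ffun a => f ((s^-1)%g a)]) => f;
      by apply/ffunP => a; rewrite !ffunE ?permK ?permKV.
  apply: eq_bigr => f _; congr (_ * _); first by apply: eq_bigr => a _; rewrite ffunE.
  have -> : (-1) ^+ s = \det (perm_mx s^-1) :> R by rewrite det_perm odd_permV.
  rewrite /cdet mulrC -det_mulmx; congr (\det _).
  by rewrite -col_permE; apply/matrixP => a b; rewrite !mxE ffunE.
transitivity (\sum_(s : 'S_k) \sum_(f : {ffun 'I_k -> 'I_n}) (\prod_a xi a ord0 (f (s a))) * ((-1) ^+ s * cdet eta f)).
  rewrite exchange_big/=; apply: eq_bigr => f _.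
  rewrite /cdet {1}/determinant mulr_suml; apply: eq_bigr => s _.
  rewrite mulrCA mulrA; congr (_ * _ * _).
  by apply: eq_bigr => a _; rewrite mxE.
under eq_bigr do rewrite -perm_f.
by rewrite sumr_const card_Sn mulr_natl.
Qed.

Lemma kernel_rows m d (E : 'M[R]_(m, d)) r : r = \rank (kermx E^T) ->
  exists w : 'M[R]_(r, d), row_free w /\ w *m E^T = 0.
Proof.
move=> ->; exists (row_base (kermx E^T)); split; first exact: row_base_free.
by apply/sub_kermxP; rewrite eq_row_base.
Qed.

Lemma gram_unit m d (w : 'M[R]_(m, d)) : row_free w -> \det (w *m w^T) != 0.
Proof.
move=> rw; rewrite -unitfE -unitmxE -row_free_unit -kermx_eq0; apply/eqP/row_matrixP => i.
rewrite row0; set u := row i _.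
have : u *m (w *m w^T) = 0 by apply/sub_kermxP; exact: row_sub.
move=> /(congr1 (mulmx^~ u^T)); rewrite mul0mx !mulmxA -mulmxA -trmx_mul => /matrixP/(_ ord0 ord0).
rewrite !mxE => /eqP; rewrite psumr_eq0; last by move=> j _; rewrite !mxE -expr2 sqr_ge0.
move=> /allP h; have : u *m w = 0.
  apply/rowP => j; have := h j (mem_index_enum j).
  by rewrite [X in _ * X]mxE -expr2 sqrf_eq0 [RHS]mxE => /eqP.
by rewrite -[in RHS](mul0mx 1 w) => /(row_free_inj rw).
Qed.

(** [w] spans the orthogonal complement of the rows of [E]. Stacking [w] below [E] and below [X]
    makes the product of the first with the transpose of the second block triangular, with diagonal
    blocks E X^T and w w^T. If the rows of [E] are dependent, C = 0 serves. *)
Lemma det_complement k l (E : 'M[R]_(k, k + l)) :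
  exists (C : R) (w : 'M[R]_(l, k + l)), forall X : 'M[R]_(k, k + l),
    \det (E *m X^T) = C * \det (col_mx X w).
Proof.
have [rE|rE] := boolP (row_free E); last first.
  exists 0, 0 => X; rewrite mul0r; apply/eqP; apply: contraR rE.
  rewrite -unitfE -unitmxE -row_free_unit => /eqP rX.
  by rewrite /row_free eqn_leq rank_leq_row -{1}rX mxrankM_maxl.
have rk : l = \rank (kermx E^T).
  by rewrite mxrank_ker mxrank_tr (eqP rE) addKn.
have [w [fw wE]] := kernel_rows rk.
have Ew : E *m w^T = 0 by apply: trmx_inj; rewrite trmx_mul trmxK wE trmx0.
have key X : \det (col_mx E w) * \det (col_mx X w) = \det (E *m X^T) * \det (w *m w^T).
  rewrite -[\det (col_mx X w)]det_tr -det_mulmx tr_col_mx mul_col_row Ew.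
  by rewrite det_lblock.
have ww := gram_unit fw.
exists (\det (col_mx E w) / \det (w *m w^T)), w => X.
by apply: (mulIf ww); rewrite mulrAC divfK.
Qed.

(** [p] is linear in the vector [W xi] of products of two minors. [gram_span] replaces its
    coefficients by vectors [W (x j)], and the inner product of two such vectors is the square of a
    Cauchy-Binet sum, hence of a Gram determinant. *)
Lemma rank1_affine_sum_det2 k l (p : 'M[R]_(k + l) -> R) : rank1_affine p -> hom_deg k p ->
  exists (m : nat) (c : 'I_m -> R) (w : 'I_m -> 'M[R]_(l, k + l)), forall xi : 'I_k -> 'rV[R]_(k + l),
  p (\sum_i sq (xi i)) = \sum_j c j * \det (col_mx (\matrix_i xi i) (w j)) ^+ 2.
Proof.
move=> rp hp; have [b bE] := det_expansion rp hp.
pose T := {ffun 'I_k -> 'I_(k + l) * 'I_(k + l)} : finType.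
pose f1 (h : T) : {ffun 'I_k -> 'I_(k + l)} := [ffun i => (h i).1].
pose f2 (h : T) : {ffun 'I_k -> 'I_(k + l)} := [ffun i => (h i).2].
pose W (xi : 'I_k -> 'rV[R]_(k + l)) : 'rV[R]_#|T| :=
  \row_j (cdet xi (f1 (enum_val j)) * cdet xi (f2 (enum_val j))).
pose L : 'rV[R]_#|T| := \row_j b (enum_val j).
have big_T (F : T -> R) : \sum_j F (enum_val (j : 'I_#|T|)) = \sum_h F h.
  by rewrite [RHS](reindex (@enum_val T T))//; exact/onW_bij/enum_val_bij.
have [m [x [c cE]]] := gram_span W L.
have /choice[Cw CwE] j : exists Cw : R * 'M[R]_(l, k + l), forall X : 'M[R]_(k, k + l),
    \det ((\matrix_i x j i) *m X^T) = Cw.1 * \det (col_mx X Cw.2).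
  by have [C [w h]] := det_complement (\matrix_i x j i); exists (C, w).
exists m, (fun j => c j * (k`!%:R * (Cw j).1) ^+ 2), (fun j => (Cw j).2) => xi.
rewrite bE; transitivity ((L *m (W xi)^T) ord0 ord0).
  by rewrite mxE -big_T; apply: eq_bigr => j _; rewrite !mxE.
rewrite cE; apply: eq_bigr => j _; rewrite -mulrA; congr (_ * _).
rewrite -exprMn -mulrA -CwE.
have -> : (\matrix_i x j i) *m (\matrix_i xi i)^T = \matrix_(a, b) inner (x j a) (xi b).
  by apply/matrixP => a b'; rewrite !mxE; apply: eq_bigr => i _; rewrite !mxE.
rewrite -sum_cdet_mul mxE.
rewrite (eq_bigr (fun i => cdet (x j) (f1 (enum_val i)) * cdet (xi) (f1 (enum_val i)) *
   (cdet (x j) (f2 (enum_val i)) * cdet xi (f2 (enum_val i))))); last first.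
  by move=> i _; rewrite !mxE mulrACA.
rewrite (big_T (fun h => cdet (x j) (f1 h) * cdet xi (f1 h) * (cdet (x j) (f2 h) * cdet xi (f2 h)))).
rewrite expr2 big_distrlr /= pair_bigA /=.
rewrite (reindex (fun fg : {ffun 'I_k -> 'I_(k + l)} * {ffun 'I_k -> 'I_(k + l)} =>
   [ffun i => (fg.1 i, fg.2 i)] : T)); last first.
  apply: onW_bij; exists (fun h => (f1 h, f2 h)).
    by move=> [f g]; congr (_, _); apply/ffunP => i; rewrite !ffunE.
  by move=> h; apply/ffunP => i; rewrite !ffunE; case: (h i).
apply: eq_bigr => -[f g] _ /=.
have -> : f1 [ffun i => (f i, g i)] = f by apply/ffunP => i; rewrite !ffunE.
by have -> : f2 [ffun i => (f i, g i)] = g by apply/ffunP => i; rewrite !ffunE.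
Qed.

End CauchyBinet.

(** * Valuations on functions of class C2 *)

Section HessianRepresentation.
Variables (R : realType) (n : nat).
Local Notation V := 'rV[R]_n.
Implicit Types (P : 'M[R]_n -> R).

(** Arbitrary filters, so that one hypothesis covers continuity in x and convergence along a
    sequence at fixed x. *)
Definition entrywise_cts P := forall (T : Type) (F : set_system T), Filter F ->
  forall (B : T -> 'M[R]_n) (A : 'M[R]_n), (forall i j, (fun t => B t i j) @ F --> A i j) ->
  (fun t => P (B t)) @ F --> P A.

Definition entrywise_bounded P := forall M : R, exists C, forall A : 'M[R]_n,
  (forall i j, `|A i j| <= M) -> `|P A| <= C.

Definition nice P := [/\ rank1_affine_all P, entrywise_cts P & entrywise_bounded P].

Lemma entrywise_ctsP P (B : V -> 'M[R]_n) : entrywise_cts P -> (forall i j, continuous (fun x => B x i j)) ->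
  continuous (fun x => P (B x)).
Proof. by move=> cP cB x; apply: (cP V _ (nbhs_filter x) B (B x)) => i j; exact: cB. Qed.

Lemma Rintegral_cint (g : V -> R) (r : R) : supp_in g (cube r) -> Rintegral (@leb R n) setT g = cint r g.
Proof.
move=> sg; rewrite /cint [RHS]Rintegral_mkcond; apply: eq_Rintegral => z _.
by rewrite patchE; case: ifPn => // zD; apply/eqP; apply: contraNT zD => gz; rewrite inE; exact: sg.
Qed.

(** [quadf l] has the constant Hessian [sumsq l], and [emat s x] below is the Hessian of [expoly s]
    at x. *)
Definition quadf (l : seq V) (x : V) : R := \sum_(v <- l) inner v x ^+ 2 / 2.
Definition emat (s : seq (R * V)) (x : V) : 'M[R]_n := \sum_(cy <- s) (cy.1 * expR (inner cy.2 x)) *: sq cy.2.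

Lemma ematE s x i j : emat s x i j = \sum_(cy <- s) cy.1 * (expR (inner cy.2 x) * sq cy.2 i j).
Proof. by rewrite /emat summxE; apply: eq_bigr => cy _; rewrite mxE mulrA. Qed.

Lemma emat_cons cy s x : emat (cy :: s) x = emat s x + (cy.1 * expR (inner cy.2 x)) *: sq cy.2.
Proof. by rewrite /emat big_cons addrC. Qed.

Lemma emat_cat s t x : emat (s ++ t) x = emat s x + emat t x.
Proof. exact: big_cat. Qed.

Lemma expoly_cons cy s (x : V) : expoly (cy :: s) x = expoly s x + cy.1 * expR (inner cy.2 x).
Proof. by rewrite /expoly big_cons addrC. Qed.

Lemma continuous_emat s i j : continuous (fun x => emat s x i j).
Proof.
rewrite (_ : (fun x => _) = (fun x => \sum_(cy <- s) cy.1 * (expR (inner cy.2 x) * sq cy.2 i j))).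
  apply: cts_sum => cy _; apply: ctsZ; apply: ctsM; last exact: cts_cst.
  by move=> x; apply: continuous_comp; [exact: continuous_inner|exact: continuous_expR].
by apply/funext => x; rewrite ematE.
Qed.

Lemma convex_sqr (y : V) : convex_fun (fun x => inner y x ^+ 2 / 2).
Proof. by apply: (@convex_ridge _ _ (fun t => t ^+ 2 / 2)); exact: convex1_sqr. Qed.

Lemma convex_exp (y : V) : convex_fun (fun x => expR (inner y x)).
Proof. by apply: (@convex_ridge _ _ expR); exact: convex1_expR. Qed.

Lemma quadf_convex l : convex_fun (quadf l).
Proof. by apply: (@convex_fun_sum _ _ _ l xpredT) => v _; exact: convex_sqr. Qed.

Lemma expoly_convex s : (forall cy, cy \in s -> 0 <= cy.1) -> convex_fun (@expoly R n s).
Proof.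
move=> s0; apply: (@convex_ext _ _ (fun x => \sum_(cy <- s | cy \in s) cy.1 * expR (inner cy.2 x))).
  by move=> x; rewrite -big_seq.
by apply: convex_fun_sum => cy /s0 c0; apply: convex_funZ => //; exact: convex_exp.
Qed.

Lemma affine_match (I G : R -> R) (a b t0 t : R) : (forall t, 0 <= t -> I t - I 0 = t * a) ->
  (forall t, G t - G 0 = t * b) -> 0 <= t0 -> I t0 = G t0 -> I (t0 + 1) = G (t0 + 1) -> 0 <= t -> I t = G t.
Proof.
move=> hI hG t00 e1 e2 tp; have := hI _ tp; have := hI _ t00; have := hI (t0 + 1) ltac:(lra).
have := hG t; have := hG t0; have := hG (t0 + 1); rewrite e1 e2 => g1 g2 g3 i1 i2 i3.
have ab : a = b by lra.
by move: i3 i2; rewrite ab; lra.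
Qed.

Variables (k : nat) (Psi : (V -> R) -> set V -> R) (mv : maval k Psi).

Lemma layer_int_local (f h phi : V -> R) (r rho : R) : convex_fun f -> convex_fun h -> 0 <= r -> r < rho ->
  (forall x, `|x| < rho -> f x = h x) -> continuous phi -> supp_in phi (cube r) ->
  layer_int (Psi f) phi = layer_int (Psi h) phi.
Proof.
move=> cf ch r0 rr fh cp sp; apply: (eq_layer_int cp sp) => A bA mA Ap.
have AU : A = A `&` [set x | `|x| < rho].
  apply/seteqP; split => [x Ax|x []//]; split => //=; apply: le_lt_trans rr.
  by apply/cube_norm => //; exact/sp/Ap.
by rewrite AU; apply: (mv_loc mv) => //; exact: open_norm_lt.
Qed.

Variables (P : 'M[R]_n -> R) (nP : nice P).

Let aP : rank1_affine_all P. Proof. by case: nP. Qed.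
Let cP : entrywise_cts P. Proof. by case: nP. Qed.
Let bP : entrywise_bounded P. Proof. by case: nP. Qed.

Lemma cint_rank1 (r : R) (phi w : V -> R) (B : V -> 'M[R]_n) (v : V) : continuous phi -> continuous w ->
  (forall i j, continuous (fun x => B x i j)) -> exists b, forall t : R,
  cint r (fun x => phi x * P (B x + (t * w x) *: sq v)) - cint r (fun x => phi x * P (B x)) = t * b.
Proof.
move=> cp cw cB; have c1 := entrywise_ctsP cP cB.
have cB' i j : continuous (fun x => (B x + sq v) i j).
  rewrite (_ : (fun x => _) = (fun x => B x i j + sq v i j)); last by apply/funext => x; rewrite mxE.
  by apply: ctsD => //; exact: cts_cst.
have c2 := entrywise_ctsP cP cB'.
exists (cint r (fun x => phi x * w x * (P (B x + sq v) - P (B x)))) => t.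
have cg : continuous (fun x => phi x * w x * (P (B x + sq v) - P (B x))).
  by apply: ctsM; [exact: ctsM|exact: ctsB].
rewrite -cintZ//; apply/eqP; rewrite subr_eq; apply/eqP; rewrite -cintD; [|exact: ctsZ|exact: ctsM].
by congr (cint r _); apply/funext => x; rewrite aP; ring.
Qed.

Hypothesis HP : forall l phi r, continuous phi -> supp_in phi (cube r) ->
  layer_int (Psi (quadf l)) phi = P (sumsq l) * cint r phi.

(** [ridge_exp] expresses a new exponential through the same function with one more square;
    therefore [l] and [phi] are quantified inside the induction on [s]. *)
Lemma rep_expoly_pos s : (forall cy, cy \in s -> 0 <= cy.1) -> forall l phi r, continuous phi -> supp_in phi (cube r) ->
  layer_int (Psi (fun x => quadf l x + expoly s x)) phi = cint r (fun x => phi x * P (sumsq l + emat s x)).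
Proof.
elim: s => [|[c y] s ih] s0 l phi r cp sp.
  rewrite (_ : (fun x => _) = quadf l); last by apply/funext => x; rewrite /expoly big_nil addr0.
  rewrite (HP _ cp sp) -cintZ//; congr (cint r _); apply/funext => x.
  by rewrite /emat big_nil addr0 mulrC.
have c0 : 0 <= c by apply: (s0 (c, y)); rewrite mem_head.
have {}s0 cy : cy \in s -> 0 <= cy.1 by move=> h; apply: s0; rewrite in_cons h orbT.
have cF : convex_fun (fun x => quadf l x + expoly s x).
  by apply: convex_funD; [exact: quadf_convex|exact: expoly_convex].
have ce : continuous (fun x : V => expR (inner y x)).
  by move=> x; apply: continuous_comp; [exact: continuous_inner|exact: continuous_expR].
have cpe : continuous (fun x => phi x * expR (inner y x)) by exact: ctsM.
have spe : supp_in (fun x => phi x * expR (inner y x)) (cube r).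
  by move=> x; move=> h; apply: sp; apply: contra_neq h => ->; rewrite mul0r.
have := ridge_exp mv y cF cp (supp_in_compact sp) c0.
rewrite (_ : (fun x => quadf l x + expoly s x + inner y x ^+ 2 / 2) = (fun x => quadf (y :: l) x + expoly s x)); last first.
  by apply/funext => x; rewrite /quadf big_cons; ring.
rewrite (_ : (fun x => quadf l x + expoly s x + c * _) = (fun x => quadf l x + expoly ((c, y) :: s) x)); last first.
  by apply/funext => x; rewrite expoly_cons addrA.
rewrite (ih s0 (y :: l) _ _ cpe spe) (ih s0 l _ _ cpe spe) (ih s0 l _ _ cp sp).
have cB l' i j : continuous (fun x => (sumsq l' + emat s x) i j).
  rewrite (_ : (fun x => _) = (fun x => sumsq l' i j + emat s x i j)); last by apply/funext => x; rewrite mxE.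
  by apply: ctsD; [exact: cts_cst|exact: continuous_emat].
have cPB l' := entrywise_ctsP cP (cB l').
move=> /eqP; rewrite subr_eq => /eqP ->.
rewrite -[_ - _](_ : cint r (fun x => phi x * expR (inner y x) * P (sumsq (y :: l) + emat s x)) +
  -1 * cint r (fun x => phi x * expR (inner y x) * P (sumsq l + emat s x)) = _); last by rewrite mulN1r.
rewrite -cintZ -?cintD -?cintZ -?cintD; do ?[exact: ctsM|apply: ctsD|apply: ctsZ].
congr (cint r _); apply/funext => x.
rewrite emat_cons addrA aP /= (_ : sumsq (y :: l) + _ = sumsq l + emat s x + sq y); first by ring.
by rewrite /sumsq big_cons -addrA addrC.
Qed.

(* Terms of [s1] may have negative coefficients: adding t exp(l) keeps both sides affine in
   t >= 0, so that agreement for large t descends to t = 0. *)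
Lemma rep_expoly s1 : forall s2, (forall cy, cy \in s2 -> 0 <= cy.1) -> forall l W phi r rho,
  convex_fun W -> 0 <= r -> r < rho -> (forall x, `|x| < rho -> W x = quadf l x + expoly (s1 ++ s2) x) ->
  continuous phi -> supp_in phi (cube r) ->
  layer_int (Psi W) phi = cint r (fun x => phi x * P (sumsq l + emat (s1 ++ s2) x)).
Proof.
elim: s1 => [|[c y] s1 ih] s2 s0 l W phi r rho cW r0 rr WU cp sp.
  rewrite -(rep_expoly_pos s0 l cp sp); apply: layer_int_local rr WU cp sp => //.
  by apply: convex_funD; [exact: quadf_convex|exact: expoly_convex].
have cs := supp_in_compact sp.
pose B x := sumsq l + emat (((c, y) :: s1) ++ s2) x.
have cB i j : continuous (fun x => B x i j).
  rewrite (_ : (fun x => _) = (fun x => sumsq l i j + emat (((c, y) :: s1) ++ s2) x i j)); last by apply/funext => x; rewrite mxE.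
  by apply: ctsD; [exact: cts_cst|exact: continuous_emat].
have ce : continuous (fun x : V => expR (inner y x)).
  by move=> x; apply: continuous_comp; [exact: continuous_inner|exact: continuous_expR].
have [b hb] := cint_rank1 r y cp ce cB.
pose I (t : R) := layer_int (Psi (fun x => W x + t * expR (inner y x))) phi.
pose G (t : R) := cint r (fun x => phi x * P (B x + (t * expR (inner y x)) *: sq y)).
have I0 : I 0 = layer_int (Psi W) phi.
  by congr (layer_int (Psi _) phi); apply/funext => x; rewrite mul0r addr0.
have G0 : G 0 = cint r (fun x => phi x * P (B x)).
  by congr (cint r _); apply/funext => x; rewrite mul0r scale0r addr0.
have IG (t : R) : 0 <= t -> 0 <= c + t -> I t = G t.
  move=> t0 ct0; have s0' cy : cy \in (c + t, y) :: s2 -> 0 <= cy.1.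
    by rewrite in_cons => /predU1P[->//|/s0].
  have cWt : convex_fun (fun x => W x + t * expR (inner y x)).
    by apply: convex_funD => //; apply: convex_funZ => //; exact: convex_exp.
  rewrite /I (ih _ s0' l _ phi r rho)//; last first.
    move=> x xr; rewrite WU// cat_cons expoly_cons !expoly_cat expoly_cons /=; ring.
  congr (cint r _); apply/funext => x; congr (_ * P _).
  rewrite /B cat_cons emat_cons !emat_cat emat_cons /= -!addrA; congr (_ + (_ + _)).
  by rewrite -scalerDl -mulrDl.
rewrite -/(cint r (fun x => phi x * P (B x))) -I0 -G0.
(* From t0 on the coefficient c + t is nonnegative, and the term may join [s2] in the induction
   hypothesis. *)
pose t0 := Num.max 0 (- c).
have t00 : 0 <= t0 by rewrite /t0 le_max lexx.
have t0c : 0 <= c + t0 by have : - c <= t0; [rewrite /t0 le_max lexx orbT|lra].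
apply: (@affine_match I G _ b t0 0 _ _ t00) => //; last 2 first.
- exact: IG.
- by apply: IG; lra.
- by move=> t tp; rewrite I0; exact: (ridge_scale mv y cW cp cs (@convex1_expR R) (@loc_lip_expR R) tp).
- by move=> t; rewrite G0; exact: hb.
Qed.

(** Diagonal forms with independent coefficients, so that each of them can be lowered to 0
    separately. *)
Definition dq (lam : 'I_n -> R) (x : V) : R := \sum_i lam i * (inner (evec R i) x ^+ 2 / 2).
Definition dm (lam : 'I_n -> R) : 'M[R]_n := \sum_i lam i *: sq (evec R i).

Lemma dq_convex lam : (forall i, 0 <= lam i) -> convex_fun (dq lam).
Proof.
by move=> l0; apply: (@convex_fun_sum _ _ _ (index_enum 'I_n) xpredT) => i _; apply: convex_funZ => //; exact: convex_sqr.
Qed.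

Lemma dq_quadf lam : (forall i, 0 <= lam i) ->
  dq lam = quadf [seq Num.sqrt (lam i) *: evec R i | i <- index_enum 'I_n] /\
  dm lam = sumsq [seq Num.sqrt (lam i) *: evec R i | i <- index_enum 'I_n].
Proof.
move=> l0; split; first apply/funext => x; rewrite /dq/dm/quadf/sumsq big_map; apply: eq_bigr => i _.
  by rewrite innerZl exprMn sqr_sqrtr// mulrA.
by apply/matrixP => a b; rewrite mxE !sqE !mxE mulrACA -expr2 sqr_sqrtr.
Qed.

Variables (f : V -> R) (g : 'I_n -> V -> R) (H : 'I_n -> 'I_n -> V -> R).
Hypotheses (cf : convex_fun f) (sf : smooth2 f g H).
Variables (phi : V -> R) (r : R).
Hypotheses (r0 : 0 < r) (cp : continuous phi) (sp : supp_in phi (cube r)).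

Let hess x : 'M[R]_n := \matrix_(i, j) H i j x.

(** For lam >= L the cut-off of [f] and its exponential approximants become convex on the whole
    space after adding [dq lam], so [Psi] may be evaluated on them and the limit taken on both
    sides. *)
Lemma rep_large : exists2 L, 0 <= L & forall lam, (forall i, L <= lam i) ->
  layer_int (Psi (fun x => f x + dq lam x)) phi = cint r (fun x => phi x * P (hess x + dm lam)).
Proof.
have r1 : 0 < r + 1 by rewrite addr_gt0.
have [u [v [s [L [M [uf vu [cu cv] vE ev]]]]]] := local_expoly_approx sf r1.
pose L' := Num.max 0 L; have L0 : 0 <= L' by rewrite /L' le_max lexx.
have LL : L <= L' by rewrite /L' le_max lexx orbT.
exists L' => // lam lamL.
have lam0 i : 0 <= lam i by exact: le_trans (lamL i).
have cW w : convex_fun (fun x => w x + L * hquad x) -> convex_fun (fun x => w x + dq lam x).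
  move=> cw; have c2 : convex_fun (dq (fun i => lam i - L)).
    by apply: dq_convex => i; rewrite subr_ge0; exact: le_trans (lamL i).
  apply: convex_ext (convex_funD cw c2) => x; rewrite -addrA; congr (_ + _).
  by rewrite hquadE /dq mulr_sumr -big_split /=; apply: eq_bigr => i _; rewrite -mulrDl addrC subrK.
have cfd : convex_fun (fun x => f x + dq lam x) by apply: convex_funD => //; exact: dq_convex.
have rr : r < r + 1 by rewrite ltrDl.
have cs := supp_in_compact sp.
rewrite (@layer_int_local _ (fun x => u x + dq lam x) phi r (r + 1) cfd (cW _ cu) (ltW r0) rr) //; last first.
  by move=> x /uf ->.
have [dqE dmE] := dq_quadf lam0.
have vd : loc_unif_cvg (fun N x => v N x + dq lam x) (fun x => u x + dq lam x).
  move=> r' e e0; have := vu r' e e0; apply: filterS => N h x xr.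
  by rewrite [u x + _]addrC addrKA; exact: h.
have lim1 := mv_cts mv (fun N => cW _ (cv N)) (cW _ cu) vd cp cs.
suff lim2 : (fun N => layer_int (Psi (fun x => v N x + dq lam x)) phi) @ \oo --> cint r (fun x => phi x * P (hess x + dm lam)).
  exact: (cvg_unique _ lim1 lim2).
have repN N : layer_int (Psi (fun x => v N x + dq lam x)) phi = cint r (fun x => phi x * P (emat (s N) x + dm lam)).
  rewrite (@rep_expoly (s N) [::] _ [seq Num.sqrt (lam i) *: evec R i | i <- index_enum 'I_n] _ phi r (r + 1))//.
  - by congr (cint r _); apply/funext => x; rewrite cats0 -dmE addrC.
  - exact: cW.
  - exact: ltW.
  - by move=> x xr; rewrite vE// cats0 dqE addrC.
rewrite (_ : (fun N => _) = (fun N => cint r (fun x => phi x * P (emat (s N) x + dm lam)))); last exact/funext.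
have cH i j : continuous (fun x => (hess x + dm lam) i j).
  rewrite (_ : (fun x => _) = (fun x => H i j x + dm lam i j)); last by apply/funext => x; rewrite !mxE.
  by apply: ctsD; [by case: sf|exact: cts_cst].
have cE N i j : continuous (fun x => (emat (s N) x + dm lam) i j).
  rewrite (_ : (fun x => _) = (fun x => emat (s N) x i j + dm lam i j)); last by apply/funext => x; rewrite !mxE.
  by apply: ctsD; [exact: continuous_emat|exact: cts_cst].
have suppM w : supp_in (fun x => phi x * w x) (cube r).
  by move=> x h; apply: sp; apply: contra_neq h => ->; rewrite mul0r.
have [C hC] := bP (M + \sum_i \sum_j `|dm lam i j|).
have phiU x : phi x != 0 -> `|x| < r + 1.
  by move=> /sp /(cube_norm _ (ltW r0)) h; apply: le_lt_trans h rr.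
under eq_fun do rewrite -(Rintegral_cint (suppM _)).
rewrite -(Rintegral_cint (suppM _)).
apply: (@Rintegral_dct _ _ _ _ _ _ (fun x => `|phi x| * `|C|)).
- by move=> N; apply: measurable_continuous_rV => //; apply: ctsM => //; exact: entrywise_ctsP.
- by apply: measurable_continuous_rV => //; apply: ctsM => //; exact: entrywise_ctsP.
- apply: aeW => x; have [->|p0] := eqVneq (phi x) 0.
    by under eq_fun do rewrite mul0r; rewrite mul0r; exact: cvg_cst.
  apply: cvgMr; apply: cP => i j; under eq_fun do rewrite mxE ematE; rewrite !mxE.
  by apply: cvgD; [have [] := ev x i j (phiU x p0)|exact: cvg_cst].
- have [Mp _ hMp] := continuous_supp_bounded cp sp.
  apply: (@integrable_bounded_supp _ _ _ (Mp * `|C|) r).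
  + by apply: measurable_continuous_rV => //; apply: ctsM; [exact: cts_norm|exact: cts_cst].
  + by move=> x; rewrite normrM !normr_id ler_wpM2r.
  + by move=> x h; apply: sp; apply: contra_neq h => ->; rewrite normr0 mul0r.
- move=> x N; rewrite normrM; have [->|p0] := eqVneq (phi x) 0; first by rewrite normr0 !mul0r.
  rewrite ler_wpM2l//; apply: le_trans (ler_norm _); apply: hC => i j.
  rewrite mxE ematE; apply: le_trans (ler_normD _ _) _; apply: lerD.
    by have [h _] := ev x i j (phiU x p0).
  by rewrite (bigD1 i)//= (bigD1 j)//= -addrA lerDl addr_ge0//; apply: sumr_ge0 => // a _; apply: sumr_ge0.
Qed.

Let upd (lam : 'I_n -> R) i t : 'I_n -> R := fun j => if j == i then t else lam j.

Let dq_upd lam i t x : dq (upd lam i t) x = dq (upd lam i 0) x + t * (inner (evec R i) x ^+ 2 / 2).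
Proof.
rewrite /dq (bigD1 i)//= [in RHS](bigD1 i)//= /upd !eqxx mul0r add0r addrC; congr (_ + _).
by apply: eq_bigr => j /negbTE ->.
Qed.

Let dm_upd lam i t : dm (upd lam i t) = dm (upd lam i 0) + t *: sq (evec R i).
Proof.
rewrite /dm (bigD1 i)//= [in RHS](bigD1 i)//= /upd !eqxx scale0r add0r addrC; congr (_ + _).
by apply: eq_bigr => j /negbTE ->.
Qed.

(** The diagonal coefficients are lowered one at a time: in each of them both sides are affine on
    the half-line, by [ridge_scale] and [cint_rank1], and they agree beyond L. *)
Theorem rep_C2 : layer_int (Psi f) phi = cint r (fun x => phi x * P (hess x)).
Proof.
have [L L0 hL] := rep_large.
suff key (l : seq 'I_n) : forall lam, (forall i, 0 <= lam i) -> (forall i, i \notin l -> L <= lam i) ->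
  layer_int (Psi (fun x => f x + dq lam x)) phi = cint r (fun x => phi x * P (hess x + dm lam)).
  have := key (enum 'I_n) (fun=> 0) (fun=> lexx _).
  rewrite (_ : dm _ = 0); last by apply: big1 => i _; rewrite scale0r.
  rewrite (_ : (fun x => f x + _) = f); last first.
    by apply/funext => x; rewrite /dq big1 ?addr0// => i _; rewrite mul0r.
  move=> ->; last by move=> i; rewrite mem_enum.
  by congr (cint r _); apply/funext => x; rewrite addr0.
elim: l => [|i l ih] lam lam0 lamL; first by apply: hL => i; exact: lamL.
have upd_lam : upd lam i (lam i) = lam.
  by apply/funext => j; rewrite /upd; case: eqP => [->|].
have l0 j : 0 <= upd lam i 0 j by rewrite /upd; case: ifP.
pose F x := f x + dq (upd lam i 0) x.
have cF : convex_fun F by apply: convex_funD => //; exact: dq_convex.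
pose I t := layer_int (Psi (fun x => F x + t * (inner (evec R i) x ^+ 2 / 2))) phi.
pose G t := cint r (fun x => phi x * P ((hess x + dm (upd lam i 0)) + (t * 1) *: sq (evec R i))).
have IE t : I t = layer_int (Psi (fun x => f x + dq (upd lam i t) x)) phi.
  by congr (layer_int (Psi _) phi); apply/funext => x; rewrite dq_upd addrA.
have GE t : G t = cint r (fun x => phi x * P (hess x + dm (upd lam i t))).
  by rewrite /G; congr (cint r _); apply/funext => x; rewrite [dm (upd lam i t)]dm_upd mulr1 addrA.
have IG t : L <= t -> I t = G t.
  move=> tL; rewrite IE GE; apply: ih => j; first by rewrite /upd; case: ifP => // _; exact: le_trans tL.
  move=> jl; rewrite /upd; case: ifPn => // ji; apply: lamL.
  by rewrite in_cons negb_or ji.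
have cB a b : continuous (fun x => (hess x + dm (upd lam i 0)) a b).
  rewrite (_ : (fun x => _) = (fun x => H a b x + dm (upd lam i 0) a b)); last by apply/funext => x; rewrite !mxE.
  by apply: ctsD; [by case: sf|exact: cts_cst].
have c1 : continuous (fun _ : V => 1 : R) by exact: cts_cst.
have [b hb] := cint_rank1 r (evec R i) cp c1 cB.
have I0 : I 0 = layer_int (Psi F) phi.
  by congr (layer_int (Psi _) phi); apply/funext => x; rewrite mul0r addr0.
have G0 : G 0 = cint r (fun x => phi x * P (hess x + dm (upd lam i 0))).
  by congr (cint r _); apply/funext => x; rewrite mul0r scale0r addr0.
suff : I (lam i) = G (lam i) by rewrite IE GE upd_lam.
apply: (@affine_match I G _ b L (lam i) _ _ L0 _ _ (lam0 i)).
- move=> t t0; rewrite I0.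
  exact: (ridge_scale mv (evec R i) cF cp (supp_in_compact sp) (@convex1_sqr R) (@loc_lip_sqr R) t0).
- by move=> t; rewrite G0; exact: hb.
- exact: IG.
- by apply: IG; lra.
Qed.

End HessianRepresentation.

(** * Measures with a continuous density *)

Section Density.
Variables (R : realType) (n : nat).
Local Notation V := 'rV[R]_n.
Local Notation lebS := (@leb R n : {sigma_finite_measure set V -> \bar R}).
Implicit Types (g w phi : V -> R) (B : set V).

Definition dens g B : R := Rintegral (@leb R n) B g.

Lemma bounded_sub_cube B : bounded_set B -> exists2 r, 0 < r & B `<=` cube r.
Proof.
move=> [M [_ hM]]; exists (`|M| + 1); first by rewrite ltr_wpDl.
move=> x Bx; apply/cube_norm; first by rewrite addr_ge0.
by apply: (hM _ _ x Bx); apply: le_lt_trans (ler_norm M) _; rewrite ltrDl.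
Qed.

Lemma integrable_bounded_set g B : continuous g -> bounded_set B -> measurable B ->
  (@leb R n).-integrable B (EFin \o g).
Proof.
move=> cg bB mB; have [r r0 Br] := bounded_sub_cube bB.
by apply: (integrableS (measurable_cube r)) => //; exact: integrable_cube.
Qed.

Lemma densB g h B : continuous g -> continuous h -> bounded_set B -> measurable B ->
  dens (fun x => g x - h x) B = dens g B - dens h B.
Proof.
by move=> cg ch bB mB; rewrite /dens RintegralB//; exact: integrable_bounded_set.
Qed.

Let dens_radon_ge0 w : continuous w -> (forall x, 0 <= w x) -> rradon (dens w).
Proof.
move=> cw w0 K bK A mA AK tA.
have bA j : bounded_set (A j) by exact: sub_bounded_set (AK j) bK.
have bU : bounded_set (\bigcup_j A j) by apply: sub_bounded_set bK; exact: bigcup_sub.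
have mU : measurable (\bigcup_j A j) by exact: bigcup_measurable.
have iU := integrable_bounded_set cw bU mU.
have fU := integrable_fin_num mU iU.
have fA j : (\int[@leb R n]_(x in A j) (w x)%:E)%E \is a fin_num.
  by apply: integrable_fin_num => //; exact: integrable_bounded_set.
have h : ((fun N => \sum_(0 <= j < N) \int[@leb R n]_(x in A j) (w x)%:E) @ \oo -->
    \int[@leb R n]_(x in \bigcup_j A j) (w x)%:E)%E.
  rewrite (integral_bigcup tA mA iU); apply: is_cvg_nneseries => j _ _.
  by apply: integral_ge0 => x _; rewrite lee_fin.
rewrite /dens /Rintegral (_ : (fun N => _) = (fun N => fine (\sum_(0 <= j < N) \int[@leb R n]_(x in A j) (w x)%:E)%E)).
  by apply: (fine_cvg); rewrite fineK.
by apply/funext => N; rewrite -sum_fine.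
Qed.

Let supp_mul phi w r : supp_in phi (cube r) -> supp_in (fun x => phi x * w x) (cube r).
Proof. by move=> sp x h; apply: sp; apply: contra_neq h => ->; rewrite mul0r. Qed.

Let layer_int_dens_ge0 w phi r : continuous w -> (forall x, 0 <= w x) -> continuous phi ->
  supp_in phi (cube r) -> layer_int (dens w) phi = cint r (fun x => phi x * w x).
Proof.
move=> cw w0 cp sp; rewrite -(Rintegral_cint (@supp_mul phi w r sp)).
have cpN : continuous (fun x => - phi x) by exact: ctsN.
have fin q t : continuous q -> supp_in q (cube r) -> 0 <= t -> (layer lebS w q t < +oo)%E.
  move=> cq sq t0; have bq : bounded_set [set x | (t < q x)%R].
    exact: sub_bounded_set (supp_gt sq t0) (@bounded_cube _ _ r).
  have mq : measurable [set x | (t < q x)%R] by exact: measurable_gt.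
  by have := integrable_fin_num mq (integrable_bounded_set cw bq mq); rewrite fin_numE ltey => /andP[].
have spN : supp_in (fun x => - phi x) (cube r) by move=> x; rewrite oppr_eq0 => /sp.
have cwp : continuous (fun x => w x * phi x) by exact: ctsM.
have swp : supp_in (fun x => w x * phi x) (cube r).
  by move=> x h; apply: sp; apply: contra_neq h => ->; rewrite mulr0.
have [M _ hM] := continuous_supp_bounded cwp swp.
apply: layer_intE.
have h : is_layer (fun t => fine (layer lebS w phi t)) (fun t => fine (layer lebS w (fun x => - phi x) t))
    (Rintegral (@leb R n) setT (fun x => phi x * w x)).
  rewrite [X in is_layer _ _ X](_ : _ = Rintegral (@leb R n) setT (fun x => w x * phi x)); last first.
    by apply: eq_Rintegral => x _; rewrite mulrC.
  apply: (@is_layer_measure _ _ V lebS w phi) => //; last 2 first.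
  - by move=> t t0; exact: fin.
  - by move=> t t0; exact: fin.
  - exact: measurable_continuous_rV.
  - exact: measurable_continuous_rV.
  - by apply: (@integrable_bounded_supp _ _ _ M r) => //; exact: measurable_continuous_rV.
apply: eq_is_layer h => t _ //; rewrite /layer /dens /Rintegral.
by congr (fine (integral _ _ _)); apply/seteqP; split => x /=; rewrite ltrNr.
Qed.

Let posneg g : continuous g -> [/\ continuous (fun x => Num.max (g x) 0), continuous (fun x => Num.max (- g x) 0) &
  forall x, g x = Num.max (g x) 0 - Num.max (- g x) 0].
Proof.
move=> cg; have c0 : continuous (fun _ : V => 0 : R) by exact: cts_cst.
split; [exact: cts_max|by apply: cts_max => //; exact: ctsN|].
move=> x; have [h|/ltW h] := leP 0 (g x).
  by rewrite [Num.max (- _) _]max_r ?oppr_le0// subr0.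
by rewrite [Num.max (- _) _]max_l ?oppr_ge0// sub0r opprK.
Qed.

Let max0 (a : R) : 0 <= Num.max a 0. Proof. by rewrite le_max lexx orbT. Qed.

Let dens_posneg g B : continuous g -> bounded_set B -> measurable B ->
  dens g B = dens (fun x => Num.max (g x) 0) B - dens (fun x => Num.max (- g x) 0) B.
Proof.
by move=> cg bB mB; have [c1 c2 e] := posneg cg; rewrite -densB//; apply: eq_Rintegral => x _; rewrite -e.
Qed.

Lemma rradon_ext (m m' : set V -> R) : (forall B, bounded_set B -> measurable B -> m B = m' B) ->
  rradon m -> rradon m'.
Proof.
move=> mm' rm K bK A mA AK tA.
have bA j : bounded_set (A j) by exact: sub_bounded_set (AK j) bK.
have bU : bounded_set (\bigcup_j A j) by apply: sub_bounded_set bK; exact: bigcup_sub.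
have mU : measurable (\bigcup_j A j) by exact: bigcup_measurable.
have -> : (fun N => \sum_(0 <= j < N) m' (A j)) = (fun N => \sum_(0 <= j < N) m (A j)).
  by apply/funext => N; apply: eq_bigr => j _; rewrite (mm' _ (bA j) (mA j)).
by rewrite -(mm' _ bU mU); exact: (rm K bK A mA AK tA).
Qed.

Lemma dens_radon g : continuous g -> rradon (dens g).
Proof.
move=> cg; have [c1 c2 e] := posneg cg.
have h := rradonB (dens_radon_ge0 c1 (fun x => max0 _)) (dens_radon_ge0 c2 (fun x => max0 _)).
by apply: rradon_ext h => B bB mB; rewrite -dens_posneg.
Qed.

Lemma layer_int_dens g phi r : continuous g -> continuous phi -> supp_in phi (cube r) ->
  layer_int (dens g) phi = cint r (fun x => phi x * g x).
Proof.
move=> cg cp sp; have [c1 c2 e] := posneg cg; have cs := supp_in_compact sp.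
rewrite (layer_int_eq cp cs (fun B bB mB => dens_posneg cg bB mB)) layer_intB//; last 2 first.
- by apply: dens_radon_ge0 => // x; exact: max0.
- by apply: dens_radon_ge0 => // x; exact: max0.
rewrite (layer_int_dens_ge0 c1 (fun x => max0 _) cp sp) (layer_int_dens_ge0 c2 (fun x => max0 _) cp sp).
rewrite -[_ - _](_ : cint r (fun x => phi x * Num.max (g x) 0) + -1 * cint r (fun x => phi x * Num.max (- g x) 0) = _); last by rewrite mulN1r.
rewrite -cintZ -?cintD; do ?[exact: ctsM|apply: ctsZ].
by congr (cint r _); apply/funext => x; rewrite [in RHS]e; ring.
Qed.

(** The layer-cake formula with the indicator of [B] as weight. *)
Lemma leb_int_dens g B : continuous g -> bounded_set B -> measurable B -> leb_int B g = dens g B.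
Proof.
move=> cg bB mB; apply: layer_intE.
have mg : measurable_fun setT g by exact: measurable_continuous_rV.
have mgN : measurable_fun setT (fun x => - g x) by apply: measurable_continuous_rV => //; exact: ctsN.
have lay q t : measurable_fun setT q -> layer lebS (\1_B : V -> R) q t = leb_outer (B `&` [set x | t < q x]).
  move=> mq; rewrite /layer integral_indic//.
  rewrite (_ : mkset _ = q @^-1` `]t, +oo[%classic).
    by rewrite -[X in measurable X]setTI; exact: mq.
  by apply/seteqP; split => y /=; rewrite in_itv/= andbT.
have fin q t : measurable_fun setT q -> (layer lebS (\1_B : V -> R) q t < +oo)%E.
  by move=> mq; rewrite lay//; apply: leb_outer_bounded; apply: sub_bounded_set bB => x [].
have h : is_layer (fun t => fine (layer lebS (\1_B : V -> R) g t))
    (fun t => fine (layer lebS (\1_B : V -> R) (fun x => - g x) t)) (dens g B).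
  have -> : dens g B = Rintegral (@leb R n) setT (fun x => \1_B x * g x).
    rewrite /dens Rintegral_mkcond; apply: eq_Rintegral => x _; rewrite patchE indicE.
    by case: ifP; rewrite ?mul1r ?mul0r.
  apply: (@is_layer_measure _ _ V lebS (\1_B : V -> R) g) => //.
  - have := integrable_bounded_set cg bB mB; rewrite (integrable_mkcond _ mB); apply: eq_integrable => // x _.
    by rewrite patchE indicE /=; case: ifP; rewrite ?mul1r ?mul0r.
  - by move=> t _; exact: fin.
  - by move=> t _; exact: fin.
apply: eq_is_layer h => t _; rewrite lay//.
by congr (fine (leb_outer (B `&` _))); apply/seteqP; split => x /=; rewrite ltrNr.
Qed.

Lemma hessian_cts f : C2_fun f -> forall i j, continuous (fun x : V => hessian f x i j).
Proof.
move=> /smooth2P[g [H s]] i j; rewrite (_ : (fun x => _) = H i j); first by case: s.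
by apply/funext => x; rewrite (smooth2_hessian x s) mxE.
Qed.

Theorem rep_C2_set (k : nat) Psi (P : 'M[R]_n -> R) : maval k Psi -> nice P ->
  (forall l phi r, continuous phi -> supp_in phi (cube r) -> layer_int (Psi (quadf l)) phi = P (sumsq l) * cint r phi) ->
  forall f, convex_fun f -> C2_fun f -> forall B, bounded_set B -> measurable B ->
  Psi f B = leb_int B (fun x => P (hessian f x)).
Proof.
move=> mv nP HP f cf C2f B bB mB; have [_ cP _] := nP.
have cg := entrywise_ctsP cP (hessian_cts C2f).
rewrite leb_int_dens//; apply: rradon_eq => //; first exact: (mv_radon mv).
  exact: dens_radon.
move=> phi cp /compact_support_cube[r r0 sp].
have [g [H s]] := (smooth2P f).1 C2f.
have r1 : 0 < `|r| + 1 by rewrite ltr_wpDl.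
have {}sp : supp_in phi (cube (`|r| + 1)).
  move=> x /sp h i; have /andP[h1 h2] := h i; have := ler_norm r; have := ler_norm (- r); rewrite normrN => h3 h4.
  by apply/andP; split; lra.
rewrite (rep_C2 mv nP HP cf s r1 cp sp) (layer_int_dens cg cp sp).
by congr (cint _ _); apply/funext => x; rewrite (smooth2_hessian x s).
Qed.

End Density.

(** * Density of convex functions of class C2 *)

Section SmoothMax.
Variables (R : realType) (n : nat).
Local Notation V := 'rV[R]_n.
Implicit Types (f g h : V -> R).

(* Convolution of the positive part with the hat function on [-1, 1]. *)
Definition sramp (t : R) : R := 6^-1 * (pcube (t + 1) + -2 * pcube t + pcube (t - 1)).

Lemma sramp_le t : t <= -1 -> sramp t = 0.
Proof. by move=> h; rewrite /sramp !pcube_le0; lra. Qed.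

Lemma sramp_ge t : 1 <= t -> sramp t = t.
Proof. by move=> h; rewrite /sramp !pcube_ge0; try lra; field. Qed.

Lemma is_derive_shift (q q' : R -> R) (a : R) : (forall t : R, is_derive t 1 q (q' t)) ->
  forall t : R, is_derive t 1 (fun t => q (t + a)) (q' (t + a)).
Proof.
move=> dq t; have da : is_derive t 1 (fun t : R => t + a) 1.
  by have h := is_deriveD (@is_derive_id R R t 1) (is_derive_cst a t 1); apply: (is_derive_eq h); rewrite addr0.
have h := @is_derive1_comp R q (fun t : R => t + a) t _ _ (dq (t + a)) da.
by apply: (is_derive_eq h); rewrite mulr1.
Qed.

Lemma sramp_convex1 : convex1 sramp.
Proof.
pose d1 (t : R) := 2^-1 * (3 * t ^+ 2 + 3 * (t * `|t|)); pose d2 (t : R) := 3 * (t + `|t|).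
have h3 (q q' : R -> R) : (forall t : R, is_derive t 1 q (q' t)) -> forall t : R,
    is_derive t 1 (fun t => 6^-1 * (q (t + 1) + -2 * q t + q (t - 1))) (6^-1 * (q' (t + 1) + -2 * q' t + q' (t - 1))).
  move=> dq t; apply: (is_deriveZ (6^-1 : R)).
  exact: (is_deriveD (is_deriveD (is_derive_shift 1 dq t) (is_deriveZ (-2 : R) (dq t))) (is_derive_shift (-1) dq t)).
apply: (@convex1_deriv2 R sramp _ _ (h3 _ _ (@is_derive_pcube R)) (h3 _ _ (@is_derive_pcube2 R))) => t.
have h : 2 * `|t| <= `|t + 1| + `|t - 1|.
  apply: le_trans (ler_normD _ _); have -> : t + 1 + (t - 1) = 2 * t by ring.
  by rewrite normrM ger0_norm.
move: h; move: (`|t|) (`|t + 1|) (`|t - 1|) => a b c h; rewrite mulr_ge0//; lra.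
Qed.

Lemma sramp_ge0 t : 0 <= sramp t.
Proof.
have [h|h] := leP t (-1); first by rewrite sramp_le.
have t3 : 0 < t + 3 by lra.
(* The point -1 is a convex combination of -3 and t, and [sramp] vanishes at both -3 and -1. *)
have := @sramp_convex1 (-3) t ((t + 1) / (t + 3)) _; rewrite (@sramp_le (-3)); last by lra.
have l01 : 0 <= (t + 1) / (t + 3) <= 1 by rewrite divr_ge0 ?ler_pdivrMr; lra.
have -> : (t + 1) / (t + 3) * -3 + (1 - (t + 1) / (t + 3)) * t = -1.
  by field; rewrite gt_eqF.
rewrite sramp_le// mulr0 add0r => /(_ l01).
have -> : 1 - (t + 1) / (t + 3) = 2 / (t + 3) by field; rewrite gt_eqF.
by rewrite pmulr_rge0// divr_gt0.
Qed.

Lemma sramp_mono : {homo sramp : a b / a <= b}.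
Proof.
move=> a b; rewrite le_eqVlt => /predU1P[->//|ab].
have [a1|a1] := leP a (-1); first by rewrite sramp_le// sramp_ge0.
have b3 : 0 < b + 3 by lra.
have l01 : 0 <= (a + 3) / (b + 3) <= 1 by rewrite divr_ge0 ?ler_pdivrMr//; lra.
have := @sramp_convex1 b (-3) ((a + 3) / (b + 3)) l01; rewrite (@sramp_le (-3)); last by lra.
have -> : (a + 3) / (b + 3) * b + (1 - (a + 3) / (b + 3)) * -3 = a by field; rewrite gt_eqF.
rewrite mulr0 addr0 => h; apply: (le_trans h); have /andP[_ l1] := l01.
by rewrite ler_piMl// sramp_ge0.
Qed.

(** The counterpart of max(t, 0) - t = max(-t, 0). It makes [smax] symmetric, hence monotone in both
    arguments. *)
Lemma sramp_sym t : sramp t - t = sramp (- t).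
Proof.
have pN (u : R) : pcube u = u ^+ 3 + pcube (- u) by rewrite /pcube normrN; field.
rewrite /sramp (pN (t + 1)) (pN t) (pN (t - 1)).
have -> : - t + 1 = - (t - 1) by ring.
have -> : - t - 1 = - (t + 1) by ring.
by field.
Qed.

Lemma sramp_max t : Num.max t 0 <= sramp t <= Num.max t 0 + 1.
Proof.
have p t' : 0 <= t' -> t' <= sramp t' <= t' + 1.
  move=> t0; apply/andP; split; first by rewrite -subr_ge0 sramp_sym sramp_ge0.
  rewrite -lerBlDl sramp_sym; apply: (@le_trans _ _ (sramp 1)); last by rewrite sramp_ge.
  by apply: sramp_mono; lra.
have [t0|t0] := leP 0 t; first exact: p.
have := p (- t) ltac:(lra); have := sramp_sym t; lra.
Qed.

Definition smax (d : R) f g (x : V) : R := g x + d * sramp (d^-1 * (f x - g x)).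

(** Monotonicity in both arguments allows the values at z to be raised to their chord values F and
    G; convexity of [sramp] does the rest. *)
Lemma smax_convex d f g : 0 < d -> convex_fun f -> convex_fun g -> convex_fun (smax d f g).
Proof.
move=> d0 cf cg x y t t01; have [t0 t1] := andP t01.
set z := t *: x + _.
pose F := t * f x + (1 - t) * f y; pose G := t * g x + (1 - t) * g y.
have fF : f z <= F by exact: cf.
have gG : g z <= G by exact: cg.
have di : 0 < d^-1 by rewrite invr_gt0.
have s1 : smax d f g z <= G + d * sramp (d^-1 * (F - G)).
  apply: (@le_trans _ _ (g z + d * sramp (d^-1 * (F - g z)))).
    by rewrite lerD2l ler_pM2l//; apply: sramp_mono; rewrite ler_pM2l// lerD2r.
  have e (u : R) : u + d * sramp (d^-1 * (F - u)) = F + d * sramp (d^-1 * (u - F)).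
    have -> : d^-1 * (u - F) = - (d^-1 * (F - u)) by ring.
    by rewrite -sramp_sym; move: (sramp _) => s; field; rewrite gt_eqF.
  by rewrite !e lerD2l ler_pM2l//; apply: sramp_mono; rewrite ler_pM2l// lerD2r.
apply: (le_trans s1).
have := sramp_convex1 (d^-1 * (f x - g x)) (d^-1 * (f y - g y)) t01.
rewrite -(ler_pM2l d0) (_ : t * (d^-1 * (f x - g x)) + (1 - t) * (d^-1 * (f y - g y)) = d^-1 * (F - G)); last by rewrite /F /G; ring.
by rewrite /smax -/G; move: (sramp _) (sramp _) (sramp _) => a b c h; rewrite /G; lra.
Qed.

Lemma smax_C2 d f g : C2_fun f -> C2_fun g -> C2_fun (smax d f g).
Proof.
move=> C2f C2g; have C2u : C2_fun (fun x => d^-1 * (f x + -1 * g x)).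
  exact: (C2_funZ d^-1 (C2_funD C2f (C2_funZ (-1) C2g))).
rewrite (_ : smax d f g = fun x => g x + d * (6^-1 * (pcube (d^-1 * (f x + -1 * g x) + 1) + -2 * pcube (d^-1 * (f x + -1 * g x)) + pcube (d^-1 * (f x + -1 * g x) + -1)))).
  apply: (C2_funD C2g); do 2 apply: C2_funZ; apply: C2_funD; first apply: C2_funD.
  - exact: (C2_fun_pcube (C2_funD C2u (C2_fun_cst n 1))).
  - exact: (C2_funZ (-2) (C2_fun_pcube C2u)).
  - exact: (C2_fun_pcube (C2_funD C2u (C2_fun_cst n (-1)))).
by apply/funext => x; rewrite /smax /sramp mulN1r.
Qed.

Lemma smax_bound d f g x : 0 < d -> Num.max (f x) (g x) <= smax d f g x <= Num.max (f x) (g x) + d.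
Proof.
move=> d0; have := sramp_max (d^-1 * (f x - g x)).
have -> : Num.max (d^-1 * (f x - g x)) 0 = d^-1 * (Num.max (f x) (g x) - g x).
  have di : 0 < d^-1 by rewrite invr_gt0.
  rewrite -[X in Num.max _ X](mulr0 d^-1) -maxr_pMr ?(ltW di)//; congr (_ * _).
  by rewrite /Num.max subr_lt0; case: ifP; rewrite ?subrr.
rewrite /smax; move: (Num.max _ _) (sramp _) => a b.
rewrite ler_pdivrMl// -lerBlDr ler_pdivlMl// mulrBr mulr1 => /andP[h1 h2].
by apply/andP; split; lra.
Qed.

Fixpoint smaxl (d : R) (l0 : V -> R) (l : seq (V -> R)) : V -> R :=
  if l is g :: l' then smax d g (smaxl d l0 l') else l0.

Lemma smaxl_spec d l0 l : 0 < d -> (forall g, g = l0 \/ List.In g l -> convex_fun g /\ C2_fun g) ->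
  convex_fun (smaxl d l0 l) /\ C2_fun (smaxl d l0 l).
Proof.
move=> d0; elim: l => [|g l ih] h; first by apply: h; left.
have [|c1 c2] := ih; first by move=> g' [->|gl]; apply: h; [left|right; right].
have [g1 g2] := h g (or_intror (or_introl erefl)).
by rewrite /=; split; [exact: (smax_convex d0 g1 c1)|exact: (smax_C2 d g2 c2)].
Qed.

Lemma smaxl_le d l0 l x (b : R) : 0 < d -> (forall g, g = l0 \/ List.In g l -> g x <= b) ->
  smaxl d l0 l x <= b + d * (size l)%:R.
Proof.
move=> d0; elim: l => [|g l ih] h /=; first by rewrite mulr0 addr0; apply: h; left.
have h1 : smaxl d l0 l x <= b + d * (size l)%:R by apply: ih => g' [->|gl]; apply: h; [left|right; right].
have h2 : g x <= b + d * (size l)%:R by rewrite ler_wpDr ?mulr_ge0 ?(ltW d0)//; apply: h; right; left.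
have /andP[_ h3] := smax_bound g (smaxl d l0 l) x d0.
apply: (le_trans h3); rewrite -natr1 mulrDr mulr1 addrA lerD2r.
by rewrite ge_max h1 h2.
Qed.

Lemma smaxl_ge d l0 l x g : 0 < d -> g = l0 \/ List.In g l -> g x <= smaxl d l0 l x.
Proof.
move=> d0; elim: l => [|g' l ih] /=; first by case=> [->|].
have /andP[h3 _] := smax_bound g' (smaxl d l0 l) x d0.
move=> h; apply: le_trans h3; rewrite le_max; apply/orP.
case: h => [h|[<-|h]]; [right|left|right] => //; apply: ih; [by left|by right].
Qed.

End SmoothMax.

Section ConvexDensity.
Variables (R : realType) (n : nat).
Local Notation V := 'rV[R]_n.
Implicit Types (f g h : V -> R).

(** Moreau-Yosida regularisation: the minimiser z of f w + k/2 |w - x|^2 has the subgradient k (x -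
    z), and a large k keeps z so close to x that its affine minorant is almost exact at x. *)
Lemma near_subgradient f x (e : R) : convex_fun f -> 0 < e -> exists p c,
  (forall w, inner p w + c <= f w) /\ f x - e <= inner p x + c.
Proof.
move=> cf e0; have cc := convex_continuous cf.
pose nq (w : V) : R := \sum_i (w ord0 i - x ord0 i) ^+ 2.
have nq_ge (w : V) i : (w ord0 i - x ord0 i) ^+ 2 <= nq w.
  by rewrite /nq (bigD1 i)//= lerDl sumr_ge0// => j _; exact: sqr_ge0.
have nq0 (w : V) : 0 <= nq w by apply: sumr_ge0 => j _; exact: sqr_ge0.
pose r := `|x| + 1; have r0 : 0 <= r by rewrite addr_ge0.
have [C C0 fC] := convex_bounded r cf.
have /cvgrPdist_lt/(_ e e0)/nbhs_ballP[d /= d0 hd] := cc x.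
pose d' := Num.min d 1 / 2; have d'0 : 0 < d' by rewrite divr_gt0// lt_min d0 ltr01.
have d'd : d' < d.
  by rewrite ltr_pdivrMr//; apply: (@le_lt_trans _ _ d); [rewrite ge_min lexx|rewrite ltr_pMr// ltr1n].
have d'1 : d' < 1 by rewrite ltr_pdivrMr// mul1r; apply: (@le_lt_trans _ _ 1); [rewrite ge_min lexx orbT|rewrite ltr1n].
(* k/2 d'^2 = 2 (C + 1) exceeds the oscillation of [f] on the cube, which forces the minimiser into
   distance d' of x. *)
pose k : R := 4 * (C + 1) / d' ^+ 2.
have k0 : 0 < k by rewrite divr_gt0 ?exprn_gt0// mulr_gt0// ltr_wpDl.
pose F w := f w + k / 2 * nq w.
have cF : continuous F.
  apply: ctsD => //; apply: ctsZ; apply: cts_sum => i _.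
  rewrite (_ : (fun w => _) = (fun w : V => (w ord0 i - x ord0 i) * (w ord0 i - x ord0 i))); last by apply/funext => w; rewrite expr2.
  by apply: ctsM; apply: ctsB; do ?[exact: cts_cst|exact: coord_continuous].
have K0 : (cube r : set V) !=set0 by exists x; apply/cube_norm => //; rewrite /r lerDl.
have [z cz zmin] := EVT_min_rV K0 (@compact_cube _ _ r) (continuous_subspaceT cF).
rewrite inE in cz.
have Kx : cube r x by apply/cube_norm => //; rewrite /r lerDl.
have nqx : nq x = 0 by apply: big1 => i _; rewrite subrr expr0n.
have Fzx : f z + k / 2 * nq z <= f x.
  by have := zmin x (mem_set Kx); rewrite /F nqx mulr0 addr0.
have nqz : nq z <= d' ^+ 2.
  have := fC z ((cube_norm _ r0).1 cz); have := fC x ((cube_norm _ r0).1 Kx).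
  rewrite !ler_norml => /andP[_ h1] /andP[h2 _].
  have : k / 2 * nq z <= 2 * (C + 1) by lra.
  have -> : 2 * (C + 1) = k / 2 * d' ^+ 2 by rewrite /k; field; rewrite gt_eqF.
  by rewrite ler_pM2l// divr_gt0.
have zx : `|z - x| <= d'.
  apply/cube_norm; first exact: ltW.
  by move=> i; rewrite !mxE; have h := le_trans (nq_ge z i) nqz; rewrite -ler_norml -ler_sqr ?nnegrE ?(ltW d'0)// real_normK ?num_real.
have zr : `|z| < r.
  have -> : z = x + (z - x) by rewrite addrC subrK.
  by apply: le_lt_trans (ler_normD _ _) _; rewrite /r ltrD2l; apply: le_lt_trans zx d'1.
have key w : f z + k * inner (x - z) (w - z) <= f w.
  apply/ler_addgt0Pr => eps eps0.
  pose B := k / 2 * \sum_i (w ord0 i - z ord0 i) ^+ 2 + 1.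
  have S0 : 0 <= \sum_i (w ord0 i - z ord0 i) ^+ 2 by apply: sumr_ge0 => i _; exact: sqr_ge0.
  have k2 : 0 <= k / 2 by rewrite divr_ge0// ltW.
  have B0 : 0 < B by apply: ltr_wpDl => //; exact: mulr_ge0.
  have W0 : 0 < `|w - z| + 1 by rewrite ltr_wpDl.
  (* Small enough for three purposes: t is a convex weight, the second-order term stays below eps,
     and the point z + t (w - z) stays in the cube. *)
  pose t := Num.min (Num.min 1 (eps / B)) ((r - `|z|) / (`|w - z| + 1)).
  have t0 : 0 < t by rewrite !lt_min ltr01 !divr_gt0// subr_gt0.
  have t1 : t <= 1 by rewrite !ge_min lexx.
  have tB : t * B <= eps by rewrite -ler_pdivlMr// !ge_min lexx orbT.
  have tW : t * `|w - z| <= r - `|z|.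
    have : t <= (r - `|z|) / (`|w - z| + 1) by rewrite ge_min lexx orbT.
    by rewrite ler_pdivlMr// => h; apply: le_trans h; rewrite ler_pM2l// lerDl ler01.
  pose zt := t *: w + (1 - t) *: z.
  have ztE : zt = z + t *: (w - z) by apply/rowP => i; rewrite !mxE; ring.
  have Kzt : cube r zt.
    apply/cube_norm => //; rewrite ztE; apply: le_trans (ler_normD _ _) _.
    by rewrite normrZ gtr0_norm// -lerBrDl.
  have := zmin zt (mem_set Kzt); rewrite /F.
  have t01 : 0 <= t <= 1 by rewrite (ltW t0) t1.
  have := cf w z t t01; rewrite -/zt => h1 h2.
  have nqt : nq zt = nq z - 2 * t * inner (x - z) (w - z) + t ^+ 2 * \sum_i (w ord0 i - z ord0 i) ^+ 2.
    rewrite /nq /inner !mulr_sumr -sumrB -big_split /=; apply: eq_bigr => i _; rewrite /zt !mxE; ring.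
  rewrite nqt in h2; rewrite -(ler_pM2l t0) -subr_ge0.
  have tB' := ler_wpM2l (ltW t0) tB.
  move: h2 h1 tB'; rewrite /B; move: (f zt) (f z) (f w) (inner _ _) (\sum_i _) (nq z) => a b c i s q h2 h1.
  have -> : t * (t * (k / 2 * s + 1)) = k / 2 * (t ^+ 2 * s) + t * t by ring.
  have := mulr_ge0 (ltW t0) (ltW t0); move: h2.
  have -> : k / 2 * (q - 2 * t * i + t ^+ 2 * s) = k / 2 * q - t * (k * i) + k / 2 * (t ^+ 2 * s) by field.
  move: (k / 2 * q) (k / 2 * (t ^+ 2 * s)) (k * i) (t * t) => q' s' i' tt.
  by rewrite !mulrDr; lra.
exists (k *: (x - z)), (f z - k * inner (x - z) z); split => [w|].
  by have := key w; rewrite innerZl innerB; lra.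
rewrite innerZl; have : `|f x - f z| < e.
  apply: hd; rewrite mx_norm_ball /ball_ /= distrC; exact: le_lt_trans zx d'd.
have i0 : 0 <= inner (x - z) (x - z) by apply: sumr_ge0 => i _; rewrite -expr2 sqr_ge0.
have := mulr_ge0 (ltW k0) i0; rewrite innerB mulrBr ltr_norml => h /andP[_]; lra.
Qed.

(** On a cube, compactness selects finitely many almost exact affine minorants; their smooth maximum
    is convex, of class C^2 and close to [f]. *)
Theorem C2_dense f : convex_fun f -> exists fs : nat -> V -> R,
  (forall j, convex_fun (fs j) /\ C2_fun (fs j)) /\ loc_unif_cvg fs f.
Proof.
move=> cf; have cc := convex_continuous cf.
suff ex (m : nat) : exists g, [/\ convex_fun g, C2_fun g & forall x, `|x| <= m%:R -> `|g x - f x| < m.+1%:R^-1].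
  have [fs hfs] := choice ex; exists fs; split=> [j|r e e0]; first by have [] := hfs j.
  near=> j => x xr; have [_ _ h] := hfs j; apply: lt_trans (h x _) _.
    apply: (le_trans xr); near: j; exact: nbhs_infty_ger.
  by near: j; exact: near_infty_natSinv_lt (PosNum e0).
pose e : R := m.+1%:R^-1 / 4; have e0 : 0 < e by rewrite !divr_gt0.
have [p hp] := choice (fun x => near_subgradient x cf e0).
have [c hc] := choice hp.
pose l (y : V) : V -> R := fun w => inner (p y) w + c y.
have cl y : continuous (l y) by apply: ctsD; [exact: continuous_inner|exact: cts_cst].
have lcv y : convex_fun (l y) /\ C2_fun (l y).
  split; last by apply: C2_funD; [exact: C2_fun_inner|exact: C2_fun_cst].
  by apply: convex_funD; [exact: convex_inner|exact: convex_fun_cst].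
have := @compact_cube R n m%:R; rewrite compact_cover => /(_ V setT (fun y => [set w | f w - e * 2 < l y w])).
case=> [y _||D _ Dcov].
- rewrite (_ : mkset _ = (fun w => f w - e * 2 - l y w) @^-1` [set t | t < 0]); last by apply/seteqP; split => w /=; rewrite subr_lt0.
  apply: open_comp; last exact: open_lt.
  by move=> w _; apply: ctsB => //; apply: ctsB => //; exact: cts_cst.
- move=> y _; exists y => //=; have [_ h] := hc y; apply: lt_le_trans h; lra.
pose L := [seq l y | y <- finmap.enum_fset D].
(* Each smooth maximum overshoots by at most d, and [size L] of them are nested. *)
pose d := e / (size L).+1%:R; have d0 : 0 < d by rewrite divr_gt0.
have inL g : g = l 0 \/ List.In g L -> exists y, g = l y.
  case=> [->|]; first by exists 0.
  by rewrite /L; elim: (finmap.enum_fset D) => //= y s ih [<-|/ih//]; exists y.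
have [s1 s2] : convex_fun (smaxl d (l 0) L) /\ C2_fun (smaxl d (l 0) L).
  by apply: smaxl_spec => // g /inL[y ->].
exists (smaxl d (l 0) L); split => // x xm.
have up : smaxl d (l 0) L x <= f x + d * (size L)%:R.
  by apply: smaxl_le => // g /inL[y ->]; have [h _] := hc y; exact: h.
have dL : d * (size L)%:R <= e.
  by rewrite /d -mulrA ler_piMr ?(ltW e0)// mulrC ler_pdivrMr// mul1r ler_nat.
have low : f x - e * 2 <= smaxl d (l 0) L x.
  have [y /= yD hy] := Dcov x ((cube_norm _ (ler0n _ _)).2 xm).
  apply: le_trans (ltW hy) _; apply: smaxl_ge => //; right.
  by rewrite /L; have : y \in finmap.enum_fset D := yD; elim: (finmap.enum_fset D) => //= y' s ih; rewrite in_cons => /predU1P[->|/ih h]; [left|right].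
rewrite ltr_norml; apply/andP; split; have : m.+1%:R^-1 = 4 * e by rewrite /e; field.
  by move=> ->; lra.
by move=> ->; lra.
Unshelve. all: by end_near. Qed.

Lemma C2_determined (Psi Psi' : (V -> R) -> set V -> R) :
  (forall f, convex_fun f -> rradon (Psi f)) -> (forall f, convex_fun f -> rradon (Psi' f)) ->
  (forall fs f phi, (forall j, convex_fun (fs j)) -> convex_fun f -> loc_unif_cvg fs f ->
     continuous phi -> compact_support phi -> (fun j => layer_int (Psi (fs j)) phi) @ \oo --> layer_int (Psi f) phi) ->
  (forall fs f phi, (forall j, convex_fun (fs j)) -> convex_fun f -> loc_unif_cvg fs f ->
     continuous phi -> compact_support phi -> (fun j => layer_int (Psi' (fs j)) phi) @ \oo --> layer_int (Psi' f) phi) ->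
  (forall f, convex_fun f -> C2_fun f -> forall B : set V, bounded_set B -> measurable B -> Psi f B = Psi' f B) ->
  forall f, convex_fun f -> forall B : set V, bounded_set B -> measurable B -> Psi f B = Psi' f B.
Proof.
move=> rP rP' cP cP' h f cf; have [fs [fsC fsf]] := C2_dense cf.
apply: rradon_eq; [exact: rP|exact: rP'|] => phi cp sp.
have cfs j : convex_fun (fs j) by have [] := fsC j.
have l1 := cP _ _ _ cfs cf fsf cp sp; have l2 := cP' _ _ _ cfs cf fsf cp sp.
have E : (fun j => layer_int (Psi (fs j)) phi) = (fun j => layer_int (Psi' (fs j)) phi).
  by apply/funext => j; apply: layer_int_eq => // B bB mB; apply: h => //; have [] := fsC j.
rewrite E in l1; exact: (cvg_unique _ l1 l2).
Qed.

End ConvexDensity.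

(** * Valuations on quadratic functions *)

Section TranslationInvariance.
Variables (R : realType) (n : nat).
Local Notation V := 'rV[R]_n.
Implicit Types (m : set V -> R) (b : 'I_n -> R).

(** h s = g s - s * g 1 is additive and vanishes on the natural numbers, so N h(t) = h(N t - floor(N
    t)) stays bounded as N grows. *)
Lemma additive_bounded (g : R -> R) (C : R) : (forall s t, 0 <= s -> 0 <= t -> g (s + t) = g s + g t) ->
  (forall s, 0 <= s <= 1 -> `|g s| <= C) -> forall t, 0 <= t -> g t = t * g 1.
Proof.
move=> gD gC t t0; pose h s := g s - s * g 1.
have hD s u : 0 <= s -> 0 <= u -> h (s + u) = h s + h u by move=> s0 u0; rewrite /h gD//; ring.
have hnat N : h N%:R = 0.
  elim: N => [|N ih]; last by rewrite -natr1 hD// ih /h; ring.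
  by have := hD 0 0 (lexx _) (lexx _); rewrite addr0; lra.
have hmul N s : 0 <= s -> h (N%:R * s) = N%:R * h s.
  move=> s0; elim: N => [|N ih]; first by rewrite !mul0r (hnat 0%N).
  by rewrite -natr1 !mulrDl !mul1r hD ?mulr_ge0// ih.
have hC s : 0 <= s <= 1 -> `|h s| <= C + `|g 1|.
  move=> /andP[s0 s1]; apply: le_trans (ler_normB _ _) _; apply: lerD; first by apply: gC; rewrite s0.
  by rewrite normrM ger0_norm// ler_piMl.
apply/eqP; rewrite -subr_eq0 -/(h t); apply: contraT => ht.
have ht0 : 0 < `|h t| by rewrite normr_gt0.
pose N := (Num.trunc ((C + `|g 1|) / `|h t|)).+1.
have hN : C + `|g 1| < N%:R * `|h t| by rewrite -ltr_pdivrMr//; exact: truncnS_gt.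
have Nt0 : 0 <= N%:R * t by rewrite mulr_ge0.
have /andP[k1 k2] := truncn_itv Nt0.
have := hC (N%:R * t - (Num.trunc (N%:R * t))%:R); rewrite subr_ge0 k1 lerBlDr -natr1 in k2 *.
have hk : h (N%:R * t - (Num.trunc (N%:R * t))%:R) = N%:R * h t.
  have e : 0 <= N%:R * t - (Num.trunc (N%:R * t))%:R by rewrite subr_ge0.
  by have := hD _ _ e (ler0n _ (Num.trunc (N%:R * t))); rewrite subrK hnat addr0 -hmul.
rewrite hk addrC (ltW k2) => /(_ isT); rewrite normrM ger0_norm// => h'.
by have := le_lt_trans h' hN; rewrite ltxx.
Qed.

(** Half-open boxes, because they subdivide without overlap. *)
Definition hbox (a b : 'I_n -> R) : set V := [set x | forall i, a i < x ord0 i <= b i].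

Lemma measurable_hbox a b : measurable (hbox a b).
Proof.
rewrite (_ : hbox a b = \bigcap_(i in setT) [set x : V | a i < x ord0 i <= b i]); last first.
  by apply/seteqP; split=> [x ox i _|x ox i]; [exact: ox|exact: (ox i I)].
apply: fin_bigcap_measurable => // i _.
rewrite (_ : mkset _ = [set x : V | a i < x ord0 i] `&` ~` [set x : V | b i < x ord0 i]); last first.
  by apply/seteqP; split => x /=; [move=> /andP[-> h]; split => //; apply/negP; rewrite -leNgt|move=> [-> /negP]; rewrite -leNgt].
by apply: measurableI; [|apply: measurableC]; apply: measurable_gt; exact: coord_continuous.
Qed.

Lemma bounded_hbox a b : bounded_set (hbox a b).
Proof.
by apply: sub_bounded_set (bounded_box a b) => x hx i; have /andP[/ltW -> ->] := hx i.
Qed.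

Lemma rradon_bound m (r : R) : rradon m -> exists C, forall A, measurable A -> A `<=` cube r -> `|m A| <= C.
Proof.
move=> rm; have [mp [mn [mE _]]] := rradon_rep r rm.
exists (fine (mp setT) + fine (mn setT)) => A mA Ar; rewrite mE//; apply: le_trans (ler_normB _ _) _.
have le (mu : {finite_measure set V -> \bar R}) : `|fine (mu A)| <= fine (mu setT).
  rewrite ger0_norm ?fine_ge0//; apply: fine_le; rewrite ?fin_num_measure//.
  by apply: le_measure; rewrite ?inE.
exact: lerD.
Qed.

Lemma rradon_cvg_below m (A : nat -> set V) : rradon m -> bounded_set (\bigcup_j A j) ->
  (forall j, measurable (A j)) -> {homo A : i j / (i <= j)%N >-> (i <= j)%O} ->
  (fun j => m (A j)) @ \oo --> m (\bigcup_j A j).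
Proof.
move=> rm bA mA homA; have [r _ Ar] := bounded_sub_cube bA.
have [mp [mn [mE _]]] := rradon_rep r rm.
have mU : measurable (\bigcup_j A j) by exact: bigcup_measurable.
have lim (mu : {finite_measure set V -> \bar R}) : (fun j => fine (mu (A j))) @ \oo --> fine (mu (\bigcup_j A j)).
  apply: (fine_cvg); rewrite fineK ?fin_num_measure//.
  exact: (nondecreasing_cvg_mu mA mU homA).
rewrite mE// (_ : (fun j => m (A j)) = (fun j => fine (mp (A j)) - fine (mn (A j)))).
  by apply: cvgB; exact: lim.
by apply/funext => j; rewrite mE//; apply: subset_trans Ar => x Ax; exists j.
Qed.

Lemma rradon_eq_hbox m m' : rradon m -> rradon m' -> (forall a b, m (hbox a b) = m' (hbox a b)) ->
  forall B : set V, bounded_set B -> measurable B -> m B = m' B.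
Proof.
move=> rm rm' h; apply: rradon_eq_obox => // a b.
pose A (k : nat) := hbox a (fun i => b i - k.+1%:R^-1).
have mA k : measurable (A k) by exact: measurable_hbox.
have UA : obox a b = \bigcup_k A k.
  apply/seteqP; split => [x xab|x [k _ xk] i]; last first.
    by have /andP[-> h'] := xk i; apply: le_lt_trans h' _; rewrite gtrBl invr_gt0.
  have : \forall k \near \oo, forall i, k.+1%:R^-1 < b i - x ord0 i.
    apply: filter_forall => i; have /andP[_] := xab i; rewrite -subr_gt0 => bx.
    exact: near_infty_natSinv_lt (PosNum bx).
  case=> k _ /(_ k (leqnn k)) hk; exists k => // i; have /andP[-> _] := xab i.
  by have := hk i; rewrite ltrBrDl => /ltW hk'; rewrite lerBrDr.
have bU : bounded_set (\bigcup_k A k) by rewrite -UA; apply: sub_bounded_set (bounded_box a b) => x hx i; have /andP[/ltW -> /ltW ->] := hx i.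
have homA : {homo A : i j / (i <= j)%N >-> (i <= j)%O}.
  move=> i j ij; apply/subsetPset => x xi l; have /andP[-> h'] := xi l.
  by apply: le_trans h' _; rewrite lerD2l lerN2 lef_pV2 ?posrE// ler_nat.
have l1 := rradon_cvg_below rm bU mA homA; have l2 := rradon_cvg_below rm' bU mA homA.
rewrite UA; rewrite (_ : (fun j => m (A j)) = (fun j => m' (A j))) in l1; last by apply/funext => j; exact: h.
exact: (cvg_unique _ l1 l2).
Qed.

Definition upd b i t : 'I_n -> R := fun j => if j == i then t else b j.

Section Cauchy.
Variables (m : set V -> R) (rm : rradon m).
Hypothesis tm : forall (x : V) (B : set V), bounded_set B -> measurable B -> m [set b + x | b in B] = m B.
Let F b := m (hbox (fun=> 0) b).

(** The longer box is cut at x_i = s and the upper piece is translated back. *)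
Lemma hbox_upd_add b i s t : 0 <= s -> 0 <= t -> F (upd b i (s + t)) = F (upd b i s) + F (upd b i t).
Proof.
move=> s0 t0; pose x : V := s *: evec R i.
have xi j : x ord0 j = if j == i then s else 0.
  by rewrite /x !mxE eqxx /=; case: eqP => _; rewrite ?mulr1 ?mulr0.
have e : hbox (fun=> 0) (upd b i (s + t)) = hbox (fun=> 0) (upd b i s) `|` [set y + x | y in hbox (fun=> 0) (upd b i t)].
  apply/seteqP; split=> y; last first.
    case=> [hy j|[z hz <-] j].
      by have := hy j; rewrite /upd; case: eqP => // _ /andP[-> h']; rewrite (le_trans h')// lerDl.
    rewrite mxE xi; have := hz j; rewrite /upd; case: eqP => _ /andP[h1 h2]; apply/andP; split; lra.
  move=> hy; have [ys|ys] := leP (y ord0 i) s.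
    by left=> j; have := hy j; rewrite /upd; case: eqP => // -> /andP[-> _].
  right; exists (y - x); last by rewrite subrK.
  move=> j; have -> : (y - x) ord0 j = y ord0 j - x ord0 j by rewrite mxE [(- x) _ _]mxE.
  have := hy j; rewrite /upd xi.
  by case: eqP => [->|_]; rewrite ?subr0// => /andP[h1 h2]; apply/andP; split; lra.
rewrite /F e rradonU//.
- by rewrite tm//; [exact: bounded_hbox|exact: measurable_hbox].
- exact: measurable_hbox.
- rewrite (_ : [set _ | _ in _] = [set y | hbox (fun=> 0) (upd b i t) (y + - x)]).
    exact: (measurable_shift (- x) (measurable_hbox (fun=> 0) (upd b i t))).
  apply/seteqP; split => [_ [y hy <-]|y hy]; first by rewrite /= addrK.
  by exists (y - x); rewrite ?subrK.
- by rewrite -e; exact: bounded_hbox.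
- apply/seteqP; split => // y [hy [z hz zy]].
  have := hy i; have := hz i; rewrite -zy mxE xi /upd !eqxx => /andP[h1 _] /andP[_ h2]; lra.
Qed.

Lemma hbox_upd_mul b i t : 0 <= t -> F (upd b i t) = t * F (upd b i 1).
Proof.
move=> t0; pose c := \sum_j `|b j| + 1.
have [C hC] := rradon_bound c rm.
apply: (@additive_bounded (fun t => F (upd b i t)) C) => // [s u s0 u0|s /andP[s0 s1]].
  exact: hbox_upd_add.
apply: hC; first exact: measurable_hbox.
move=> x hx j; have /andP[h1 h2] := hx j; have c0 : 0 <= c by rewrite addr_ge0// sumr_ge0.
apply/andP; split; first by apply: le_trans (ltW h1); rewrite oppr_le0.
apply: (le_trans h2); rewrite /upd /c; case: eqP => _.
  by apply: (le_trans s1); rewrite lerDr sumr_ge0.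
by rewrite (bigD1 j)//= -addrA; apply: le_trans (ler_norm _) _; rewrite lerDl addr_ge0// sumr_ge0.
Qed.

Lemma hbox_prod b : (forall i, 0 <= b i) -> F b = (\prod_i b i) * F (fun=> 1).
Proof.
move=> b0; suff key (l : seq 'I_n) : uniq l -> F b = (\prod_(i <- l) b i) * F (fun j => if j \in l then 1 else b j).
  rewrite (key (index_enum 'I_n)); last exact: index_enum_uniq.
  by congr (_ * F _); apply/funext => j; rewrite mem_index_enum.
elim: l => [_|i l ih /= /andP[il ul]]; first by rewrite big_nil mul1r.
rewrite (ih ul) big_cons [b i * _]mulrC -mulrA; congr (_ * _).
set bl := (fun j => if j \in l then 1 else b j).
have -> : bl = upd bl i (b i) by apply/funext => j; rewrite /upd; case: eqP => [->|//]; rewrite /bl (negbTE il).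
rewrite hbox_upd_mul//; congr (_ * F _); apply/funext => j.
by rewrite /upd /bl in_cons; case: eqP.
Qed.

Lemma hbox_shift a b : (forall i, a i <= b i) -> m (hbox a b) = (\prod_i (b i - a i)) * F (fun=> 1).
Proof.
move=> ab; rewrite -(@hbox_prod (fun i => b i - a i)); last by move=> i; rewrite subr_ge0.
rewrite /F -[RHS](tm (\row_i a i)); [|exact: bounded_hbox|exact: measurable_hbox].
congr m; apply/seteqP; split => [x hx|_ [y hy <-] i].
  exists (x - \row_i a i); last by rewrite subrK.
  by move=> i; have := hx i; rewrite !mxE => /andP[h1 h2]; apply/andP; split; lra.
by have := hy i; rewrite !mxE => /andP[h1 h2]; apply/andP; split; lra.
Qed.

Lemma hbox_empty a b i : b i < a i -> m (hbox a b) = 0.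
Proof.
move=> ba; rewrite (_ : hbox a b = set0) ?rradon0//.
by apply/seteqP; split => // x hx; have /andP[h1 h2] := hx i; lra.
Qed.

End Cauchy.

Let lm (B : set V) : R := fine (leb B).

Lemma leb_rradon : rradon lm.
Proof.
have c1 : continuous (fun _ : V => 1 : R) by exact: cts_cst.
have h := dens_radon c1.
by apply: rradon_ext h => B bB mB; rewrite /dens Rintegral_cst// mul1r.
Qed.

(** ]-1, 1]^n contains the closed unit cube and, by [hbox_shift], has 2^n times the measure of ]0,
    1]^n. *)
Lemma leb_hbox_gt0 : 0 < lm (hbox (fun=> 0) (fun=> 1)).
Proof.
have tl x (B : set V) : bounded_set B -> measurable B -> lm [set b + x | b in B] = lm B by move=> _ _; rewrite /lm leb_shift.
have h11 (i : 'I_n) : (-1 : R) <= 1 by lra.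
have := hbox_shift leb_rradon tl h11.
have : 1 <= lm (hbox (fun=> -1) (fun=> 1)).
  rewrite -lee_fin fineK; last by rewrite ge0_fin_numE ?leb_outer_ge0//; exact/leb_outer_bounded/bounded_hbox.
  rewrite -(leb_unit_box R n); apply: le_leb_outer => x hx i; have /andP[h1 h2] := hx i.
  by apply/andP; split => //; apply: lt_le_trans h1; rewrite ltrN10.
move=> h1 h2; rewrite {}h2 in h1; have p : 0 <= lm (hbox (fun=> 0) (fun=> 1)) by rewrite fine_ge0// leb_outer_ge0.
rewrite lt_neqAle p andbT eq_sym; apply: contraTneq h1 => ->.
by rewrite mulr0 -ltNge.
Qed.

Definition unit_mass m : R := m (hbox (fun=> 0) (fun=> 1)) / lm (hbox (fun=> 0) (fun=> 1)).

Theorem translation_invariant_leb m : rradon m ->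
  (forall (x : V) (B : set V), bounded_set B -> measurable B -> m [set b + x | b in B] = m B) ->
  forall B : set V, bounded_set B -> measurable B -> m B = unit_mass m * fine (leb B).
Proof.
move=> rm tm; have l0 := leb_hbox_gt0.
apply: rradon_eq_hbox => //; first by apply: rradonZ; exact: leb_rradon.
have tl x (B : set V) : bounded_set B -> measurable B -> lm [set b + x | b in B] = lm B by move=> _ _; rewrite /lm leb_shift.
move=> a b; have [ab|] := pselect (forall i, a i <= b i).
  rewrite (hbox_shift rm tm ab) -/(lm _) (hbox_shift leb_rradon tl ab) /unit_mass.
  by field; rewrite gt_eqF.
move=> /existsNP[i /negP]; rewrite -ltNge => ba.
by rewrite (hbox_empty rm ba) -/(lm _) (hbox_empty leb_rradon ba) mulr0.
Qed.

End TranslationInvariance.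

(** * The density of a valuation on quadratic functions *)

Section QuadraticDensity.
Variables (R : realType) (n k : nat).
Local Notation V := 'rV[R]_n.
Variables (Psi : (V -> R) -> set V -> R) (mv : maval k Psi).

Definition quadm (A : 'M[R]_n) (x : V) : R := (x *m A *m x^T) ord0 ord0 / 2.

Lemma quadmE l : quadm (sumsq l) = quadf l.
Proof.
apply/funext => x; rewrite /quadm /sumsq mulmx_sumr mulmx_suml summxE mulr_suml; apply: eq_bigr => v _.
have e : x *m v^T = (inner v x)%:M.
  apply/matrixP => i j; rewrite !ord1 !mxE eqxx mulr1n; apply: eq_bigr => a _.
  by rewrite !mxE mulrC.
congr (_ / 2); rewrite /sq !mulmxA e -mulmxA.
have -> : v *m x^T = (inner v x)%:M
  by apply/matrixP => i j; rewrite !ord1 !mxE eqxx mulr1n; apply: eq_bigr => a _; rewrite mxE.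
by rewrite -scalar_mxM mxE eqxx mulr1n expr2.
Qed.

(** The constant density of [Psi] at the quadratic function with Hessian [A]; it has this meaning
    for positive semidefinite [A], where [quadm A] is convex. *)
Definition qdens (A : 'M[R]_n) : R := unit_mass (Psi (quadm A)).

(** Translating a quadratic function changes it by an affine one, so its measure is translation
    invariant. *)
Lemma qdens_leb l (B : set V) : bounded_set B -> measurable B ->
  Psi (quadf l) B = qdens (sumsq l) * fine (leb B).
Proof.
move=> bB mB; rewrite /qdens quadmE; apply: translation_invariant_leb => //.
  exact: (mv_radon mv (quadf_convex l)).
move=> x {bB mB}B bB mB; rewrite -(mv_trans mv x (quadf_convex l) bB mB).
rewrite (_ : (fun y => quadf l (y + x)) = (fun y => quadf l y + (inner (\sum_(v <- l) inner v x *: v) y + quadf l x))).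
  by apply: (mv_aff mv) => //; [exact: quadf_convex|exists (\sum_(v <- l) inner v x *: v), (quadf l x)].
apply/funext => y; rewrite /quadf.
have -> : inner (\sum_(v <- l) inner v x *: v) y = \sum_(v <- l) inner v x * inner v y.
  by elim: l => [|v l ih]; rewrite ?big_nil ?inner0l// !big_cons innerDl ih innerZl.
by rewrite addrA -!big_split /=; apply: eq_bigr => v _; rewrite innerD; field.
Qed.

Lemma qdens_layer l phi r : continuous phi -> supp_in phi (cube r) ->
  layer_int (Psi (quadf l)) phi = qdens (sumsq l) * cint r phi.
Proof.
move=> cp sp; have cs := supp_in_compact sp; have c1 : continuous (fun _ : V => 1 : R) by exact: cts_cst.
rewrite (@layer_int_eq _ _ _ (fun B => qdens (sumsq l) * dens (fun=> 1) B) phi cp cs); last first.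
  by move=> B bB mB; rewrite qdens_leb// /dens Rintegral_cst// mul1r.
rewrite layer_intZ//; last exact: dens_radon.
rewrite (layer_int_dens c1 cp sp); congr (_ * cint r _); apply/funext => x; exact: mulr1.
Qed.

(** Supplies a test function with nonzero integral, against which densities can be read off. *)
Lemma cint_cutoff_gt0 : 0 < cint 2 (@cutoff R n 1).
Proof.
have cc : continuous (@cutoff R n 1) by have /smooth2P[g [H [h _ _]]] := @cutoff_C2 R n 1; exact: has_grad_continuous h.
have p0 (t : R) : 0 <= pcube t by have [h|/ltW h] := leP t 0; [rewrite pcube_le0|rewrite pcube_ge0 ?exprn_ge0].
have c0 x : 0 <= @cutoff R n 1 x by apply: prodr_ge0 => i _.
apply: lt_le_trans (@leb_cube_gt0 R n 1 ltr01) _.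
rewrite -[leLHS]mul1r -cint_cst.
rewrite (_ : cint 1 (fun=> 1) = cint 1 (@cutoff R n 1)); last first.
  by apply: eq_Rintegral => x; rewrite inE => cx; apply/esym/cutoff1/cube_norm.
rewrite /cint /Rintegral fine_le//.
- by apply: integrable_fin_num; [exact: measurable_cube|exact: integrable_cube].
- by apply: integrable_fin_num; [exact: measurable_cube|exact: integrable_cube].
- apply: ge0_subset_integral => //; [exact: measurable_cube|exact: measurable_cube| | |].
  + by apply/measurable_EFinP; apply: measurable_continuous_rV => //; exact: measurable_cube.
  + by move=> x _; rewrite lee_fin.
  + by move=> x h i; have /andP[h1 h2] := h i; apply/andP; split; lra.
Qed.

(** [ridge_scale] for the profile t^2/2, divided by the integral of one test function. *)
Lemma qdens_rank1_affine : rank1_affine qdens.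
Proof.
move=> A v s [l ->] s0.
have cc : continuous (@cutoff R n 1) by have /smooth2P[g [H [h _ _]]] := @cutoff_C2 R n 1; exact: has_grad_continuous h.
have sp : supp_in (@cutoff R n 1) (cube 2) by have := @cutoff_supp R n 1; rewrite (_ : 1 + 1 = 2).
have cs := supp_in_compact sp.
have := ridge_scale mv v (quadf_convex l) cc cs (@convex1_sqr R) (@loc_lip_sqr R) s0.
have e1 : (fun x => quadf l x + inner v x ^+ 2 / 2) = quadf (v :: l).
  by apply/funext => x; rewrite /quadf big_cons addrC.
have e2 : (fun x => quadf l x + s * (inner v x ^+ 2 / 2)) = quadf (Num.sqrt s *: v :: l).
  by apply/funext => x; rewrite /quadf big_cons innerZl exprMn sqr_sqrtr// mulrA addrC.
rewrite e1 e2 !(qdens_layer _ cc sp).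
have s1 : sumsq (v :: l) = sumsq l + sq v by rewrite /sumsq big_cons addrC.
have s2 : sumsq (Num.sqrt s *: v :: l) = sumsq l + s *: sq v.
  rewrite /sumsq big_cons addrC; congr (_ + _); apply/matrixP => a b.
  by rewrite [RHS]mxE !sqE !mxE mulrACA -expr2 sqr_sqrtr.
have := cint_cutoff_gt0; rewrite s1 s2; move: (cint 2 _) => c c_gt0.
set a := qdens _; set b := qdens _; set d := qdens _ => h.
apply: (mulIf (lt0r_neq0 c_gt0)); rewrite -[LHS](subrK (b * c)) h; ring.
Qed.

Lemma qdens_hom : hom_deg k qdens.
Proof.
move=> A t [l ->] t0; rewrite /qdens /unit_mass mulrA; congr (_ / _).
rewrite -(mv_hom mv _ t0); [|by rewrite quadmE; exact: quadf_convex|exact: bounded_hbox|exact: measurable_hbox].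
congr (Psi _ _); apply/funext => x; rewrite /quadm -scalemxAr -scalemxAl mxE; ring.
Qed.

End QuadraticDensity.

(** * Mixed discriminants and mixed Monge-Ampere measures *)

Section MixedDiscriminant.
Variables (R : numFieldType) (n : nat).
Implicit Types (A : 'I_n -> 'M[R]_n) (g : {ffun 'I_n -> 'I_n}).

Definition altsign (T : {set 'I_n}) : R := (-1) ^+ #|~: T|.

(** Inclusion-exclusion over the sets T that contain the image of g: a point outside the image
    cancels the sum, so only bijections survive. *)
Lemma alt_sum g : \sum_(T : {set 'I_n}) altsign T * \prod_a (g a \in T)%:R = (injectiveb g)%:R.
Proof.
pose im (i : 'I_n) : bool := i \in codom g.
transitivity (\prod_i (1 - (~~ im i)%:R : R)).
  rewrite bigA_distr; apply: eq_bigr => T _.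
  rewrite [RHS](bigID (mem T))/= [X in _ = X * _]big1; last by move=> i ->.
  rewrite mul1r [RHS](eq_bigr (fun i => -1 * (~~ im i)%:R)); last by move=> i /negbTE ->; rewrite mulN1r.
  rewrite [RHS]big_split /= prodr_const /altsign; congr (_ ^+ _ * _).
    by apply: eq_card => i; rewrite !inE.
  have [h|/existsP[a ga]] := boolP [forall a, g a \in T].
    rewrite big1; last by move=> a _; rewrite (forallP h).
    rewrite big1// => i iT; suff -> : im i = false by [].
    by apply/negbTE; apply: contra iT => /codomP[a ->]; exact: (forallP h).
  rewrite (bigD1 a)//= (negbTE ga) mul0r (bigD1 (g a))//=.
  by rewrite /im codom_f /= mul0r.
have [inj|ninj] := boolP (injectiveb g).
  rewrite big1// => i _; have gb := injF_bij (injectiveP _ inj).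
  suff -> : im i by rewrite subr0.
  by have [h _ hg] := gb; apply/codomP; exists (h i).
have [i ni] : exists i, ~~ im i.
  apply/existsP; apply: contraR ninj; rewrite negb_exists => /forallP h.
  have hc : #|codom g| == #|{: 'I_n}| by apply/eqP/eq_card => i; have := h i; rewrite negbK /im => ->.
  have inj := elimT (@image_injP _ _ g predT) hc.
  by apply/injectiveP => a b; exact: inj.
by rewrite (bigD1 i)//= ni subrr mul0r.
Qed.

Definition rowmix A g : 'M[R]_n := \matrix_(a, b) A (g a) a b.

Lemma det_lincomb (lam : 'I_n -> R) A :
  \det (\sum_i lam i *: A i) = \sum_(g : {ffun 'I_n -> 'I_n}) (\prod_a lam (g a)) * \det (rowmix A g).
Proof.
rewrite /determinant (eq_bigr (fun s : 'S_n => \sum_(g : {ffun 'I_n -> 'I_n}) (-1) ^+ s * ((\prod_a lam (g a)) * \prod_a A (g a) a (s a)))); last first.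
  move=> s _; rewrite -mulr_sumr; congr (_ * _).
  rewrite (eq_bigr (fun a => \sum_i lam i * A i a (s a))); last first.
    by move=> a _; rewrite summxE; apply: eq_bigr => i _; rewrite mxE.
  rewrite bigA_distr_bigA /=; apply: eq_bigr => g _; exact: big_split.
rewrite exchange_big; apply: eq_bigr => g _; rewrite mulr_sumr; apply: eq_bigr => s _.
by rewrite mulrCA; congr (_ * (_ * _)); apply: eq_bigr => a _; rewrite mxE.
Qed.

Lemma det_subsum A (T : {set 'I_n}) :
  \det (\sum_(i in T) A i) = \sum_(g : {ffun 'I_n -> 'I_n}) (\prod_a (g a \in T)%:R) * \det (rowmix A g).
Proof.
rewrite -(det_lincomb (fun i => (i \in T)%:R) A) big_mkcond; congr (\det _); apply: eq_bigr => i _.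
by case: (i \in T); rewrite ?scale1r ?scale0r.
Qed.

(** The mixed discriminant by its polarisation formula. The mixed measure is given by the same
    signed sum over subsets, so its density can be computed term by term. *)
Definition mixdet A : R := (n`!)%:R^-1 * \sum_(T : {set 'I_n}) altsign T * \det (\sum_(i in T) A i).

Lemma mixdetE A : mixdet A = (n`!)%:R^-1 * \sum_(g : {ffun 'I_n -> 'I_n} | injectiveb g) \det (rowmix A g).
Proof.
congr (_ * _); rewrite (eq_bigr (fun T => \sum_(g : {ffun 'I_n -> 'I_n}) altsign T * \prod_a (g a \in T)%:R * \det (rowmix A g))); last first.
  by move=> T _; rewrite det_subsum mulr_sumr; apply: eq_bigr => g _; rewrite mulrA.
rewrite exchange_big [RHS]big_mkcond; apply: eq_bigr => g _.
by rewrite -mulr_suml alt_sum; case: (injectiveb g); rewrite ?mul1r ?mul0r.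
Qed.

Lemma card_inj_self : #|[pred g : {ffun 'I_n -> 'I_n} | injectiveb g]| = n`!.
Proof. by rewrite -cardsE card_inj_ffuns card_ord ffactnn. Qed.

Lemma fact_neq0 : (n`!)%:R != 0 :> R.
Proof. by rewrite pnatr_eq0 -lt0n fact_gt0. Qed.

(** For each bijection g, reindexing f by f o g turns its contribution into the full expansion of
    the determinant; the n! equal contributions cancel the normalisation. *)
Lemma det_polarization (lam : 'I_n -> R) A : \det (\sum_i lam i *: A i) =
  \sum_(f : {ffun 'I_n -> 'I_n}) (\prod_a lam (f a)) * mixdet (A \o f).
Proof.
rewrite (eq_bigr (fun f : {ffun 'I_n -> 'I_n} => (n`!)%:R^-1 * \sum_(g : {ffun 'I_n -> 'I_n} | injectiveb g) (\prod_a lam (f a)) * \det (rowmix (A \o f) g))); last first.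
  by move=> f _; rewrite mixdetE mulrCA mulr_sumr.
rewrite -mulr_sumr exchange_big /=.
rewrite (eq_bigr (fun _ => \det (\sum_i lam i *: A i))); last first.
  move=> g /injectiveP gi; rewrite det_lincomb.
  have [h gK hK] := injF_bij gi.
  rewrite [RHS](reindex (fun f : {ffun 'I_n -> 'I_n} => [ffun a => f (g a)])) /=; last first.
    by exists (fun f => [ffun a => f (h a)]) => f _; apply/ffunP => a; rewrite !ffunE ?gK ?hK.
  apply: eq_bigr => f _.
  have -> : rowmix (A \o f) g = rowmix A [ffun a => f (g a)] by apply/matrixP => a b; rewrite !mxE ffunE.
  congr (_ * _).
  rewrite (reindex g) /=; last by exists h => a _; rewrite ?gK ?hK.
  by apply: eq_bigr => a _; rewrite ffunE.
by rewrite sumr_const card_inj_self -[X in _^-1 * X]mulr_natl mulKf// fact_neq0.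
Qed.

End MixedDiscriminant.

(** * Mixed discriminants with k equal arguments *)

Section MixedDiscriminantPowers.
Variables (R : numFieldType) (k l : nat).
Local Notation n := (k + l)%N.

Definition mixarg (A : 'M[R]_n) (W : 'I_l -> 'M[R]_n) (i : 'I_n) : 'M[R]_n :=
  match fintype.split i with inl _ => A | inr j => W j end.

(** A bijection g picks exactly k rows from the repeated argument, and each of them contributes a
    factor t. *)
Lemma mixdet_mixargZ (t : R) A W : mixdet (mixarg (t *: A) W) = t ^+ k * mixdet (mixarg A W).
Proof.
rewrite !mixdetE mulrCA; congr (_ * _); rewrite mulr_sumr; apply: eq_bigr => g /injectiveP gi.
pose c (i : 'I_n) : R := if fintype.split i is inl _ then t else 1.
have -> : rowmix (mixarg (t *: A) W) g = diag_mx (\row_a c (g a)) *m rowmix (mixarg A W) g.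
  apply/matrixP => a b; rewrite mul_diag_mx !mxE /c /mixarg; case: (fintype.split _) => j; rewrite ?mxE ?mul1r//.
rewrite det_mulmx det_diag; congr (_ * _).
have [h gK hK] := injF_bij gi.
rewrite (eq_bigr (fun a => c (g a))); last by move=> a _; rewrite mxE.
transitivity (\prod_i c i).
  by rewrite [RHS](reindex g) //=; exists h => a _; rewrite ?gK ?hK.
rewrite big_split_ord /= [X in _ * X]big1 ?mulr1; last first.
  by move=> i _; rewrite /c (unsplitK (inr i)).
rewrite (eq_bigr (fun _ => t)); last by move=> i _; rewrite /c (unsplitK (inl i)).
by rewrite prodr_const card_ord.
Qed.

(** The mixed discriminant of k identity blocks of size k and the squares of the remaining l
    coordinate vectors; it equals k! / (k + l)!. *)
Definition mixcst : R := ((k + l)`!)%:R^-1 *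
  \sum_(T : {set 'I_n}) altsign R T * ((\sum_(i0 < k) (lshift l i0 \in T)%:R) ^+ k * \prod_(j < l) (rshift k j \in T)%:R).

(** Expanding the k-th power turns the sum into [alt_sum] for maps that fix the last l indices;
    every term is 0 or 1, and the identity contributes 1. *)
Lemma mixcst_gt0 : 0 < mixcst.
Proof.
rewrite /mixcst mulr_gt0 ?invr_gt0 ?ltr0n ?fact_gt0//.
pose ext (h : {ffun 'I_k -> 'I_k}) : {ffun 'I_n -> 'I_n} :=
  [ffun i => match fintype.split i with inl a => lshift l (h a) | inr j => rshift k j end].
rewrite (eq_bigr (fun T => \sum_(h : {ffun 'I_k -> 'I_k}) altsign R T * \prod_a (ext h a \in T)%:R)); last first.
  move=> T _; rewrite -mulr_sumr; congr (_ * _).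
  rewrite (eq_bigr (fun h : {ffun 'I_k -> 'I_k} => (\prod_a (lshift l (h a) \in T)%:R) * \prod_(j < l) (rshift k j \in T)%:R)); last first.
    move=> h _; rewrite big_split_ord /=; congr (_ * _).
      by apply: eq_bigr => a _; rewrite ffunE (unsplitK (inl a)).
    by apply: eq_bigr => a _; rewrite ffunE (unsplitK (inr a)).
  by rewrite -mulr_suml -(bigA_distr_bigA (fun _ j => (lshift l j \in T)%:R)) /= prodr_const card_ord.
rewrite exchange_big /= (eq_bigr (fun h => (injectiveb (ext h))%:R)); last by move=> h _; exact: alt_sum.
rewrite (bigD1 [ffun a => a])//= ltr_pwDl//; last by apply: sumr_ge0.
rewrite ltr0n lt0b; apply/injectiveP => i j.
have e a : ext [ffun a => a] a = a.
  rewrite ffunE; case: splitP => b eb; apply: val_inj => //=; by rewrite ffunE.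
by rewrite !e.
Qed.

(** Every sum over T has the form V^T diag(d) V with the same stacked matrix V, so det V ^+ 2
    factors out and the rest depends on T alone. *)
Lemma mixdet_sq (xi : 'I_k -> 'rV[R]_n) (w : 'M[R]_(l, n)) :
  mixdet (mixarg (\sum_i (xi i)^T *m xi i) (fun j => (row j w)^T *m row j w)) =
  mixcst * \det (col_mx (\matrix_i xi i) w) ^+ 2.
Proof.
set V := col_mx _ _.
rewrite /mixdet /mixcst -mulrA; congr (_ * _); rewrite mulr_suml; apply: eq_bigr => T _.
rewrite -mulrA; congr (_ * _).
pose d (i : 'I_n) : R := match fintype.split i with inl _ => (\sum_(i0 < k) (lshift l i0 \in T)%:R) | inr j => (rshift k j \in T)%:R end.
have -> : \sum_(i in T) mixarg (\sum_i (xi i)^T *m xi i) (fun j => (row j w)^T *m row j w) i =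
    V^T *m diag_mx (\row_i d i) *m V.
  have rk (s : nat) (M : 'M[R]_(s, n)) (a b : 'I_n) : (\sum_i (row i M)^T *m row i M) a b = \sum_i M i a * M i b.
    by rewrite summxE; apply: eq_bigr => i _; rewrite mxE big_ord1 !mxE.
  apply/matrixP => a b; rewrite -mulmxA mxE.
  rewrite (eq_bigr (fun i => d i * (V i a * V i b))); last first.
    by move=> i _; rewrite mul_diag_mx !mxE mulrCA.
  rewrite summxE big_mkcond !big_split_ord /=; congr (_ + _).
    rewrite (eq_bigr (fun i : 'I_k => (lshift l i \in T)%:R * \sum_i0 xi i0 ord0 a * xi i0 ord0 b)); last first.
      move=> i _; rewrite /mixarg (unsplitK (inl i)) summxE; case: ifP => _; rewrite ?mul0r ?mul1r//.
      by apply: eq_bigr => i0 _; rewrite mxE big_ord1 !mxE.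
    rewrite -mulr_suml [RHS](eq_bigr (fun i : 'I_k => (\sum_(i0 < k) (lshift l i0 \in T)%:R) * (xi i ord0 a * xi i ord0 b))); last first.
      by move=> i _; rewrite /d (unsplitK (inl i)) /V !col_mxEu !mxE.
    by rewrite -mulr_sumr.
  apply: eq_bigr => j _; rewrite /d (unsplitK (inr j)) /V !col_mxEd /mixarg (unsplitK (inr j)).
  by case: ifP => _; rewrite ?mul0r ?mul1r// mxE big_ord1 !mxE.
rewrite !det_mulmx det_tr det_diag mulrAC -expr2 mulrC; congr (_ * _).
rewrite (eq_bigr d); last by move=> i _; rewrite mxE.
rewrite big_split_ord /=; congr (_ * _).
  rewrite (eq_bigr (fun _ => (\sum_(i0 < k) (lshift l i0 \in T)%:R))) ?prodr_const ?card_ord//.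
  by move=> i _; rewrite /d (unsplitK (inl i)).
by apply: eq_bigr => j _; rewrite /d (unsplitK (inr j)).
Qed.

End MixedDiscriminantPowers.

(** * Determinants and minors as admissible densities *)

Section NicePolynomials.
Variables (R : realType) (n : nat).
Local Notation V := 'rV[R]_n.

Lemma cvg_sum_filter (T : Type) (F : set_system T) (FF : Filter F) (I : Type) (r : seq I) (h : I -> T -> R) (a : I -> R) :
  (forall i, h i x @[x --> F] --> a i) -> \sum_(i <- r) h i x @[x --> F] --> \sum_(i <- r) a i.
Proof.
move=> ha; elim: r => [|i r ih].
  by under eq_fun do rewrite big_nil; rewrite big_nil; exact: cvg_cst.
by under eq_fun do rewrite big_cons; rewrite big_cons; exact: cvgD.
Qed.

Lemma cvg_prod_filter (T : Type) (F : set_system T) (FF : Filter F) (I : Type) (r : seq I) (h : I -> T -> R) (a : I -> R) :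
  (forall i, h i x @[x --> F] --> a i) -> \prod_(i <- r) h i x @[x --> F] --> \prod_(i <- r) a i.
Proof.
move=> ha; elim: r => [|i r ih].
  by under eq_fun do rewrite big_nil; rewrite big_nil; exact: cvg_cst.
by under eq_fun do rewrite big_cons; rewrite big_cons; exact: cvgM.
Qed.

Lemma cvg_det (T : Type) (F : set_system T) (FF : Filter F) k (B : T -> 'M[R]_k) (A : 'M[R]_k) :
  (forall i j, (fun t => B t i j) @ F --> A i j) -> (fun t => \det (B t)) @ F --> \det A.
Proof.
move=> BA; apply: cvg_sum_filter => s; apply: cvgMr; apply: cvg_prod_filter => i; exact: BA.
Qed.

Lemma det_bound k (M : R) (A : 'M[R]_k) : (forall i j, `|A i j| <= M) -> `|\det A| <= \sum_(s : 'S_k) M ^+ k.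
Proof.
move=> AM; apply: le_trans (ler_norm_sum _ _ _) _; apply: ler_sum => s _.
rewrite normrM normrX normrN1 expr1n mul1r normr_prod.
rewrite (_ : M ^+ k = \prod_(i < k) M); last by rewrite prodr_const card_ord.
by apply: ler_prod => i _; rewrite normr_ge0 AM.
Qed.

Lemma nice_det : nice (fun A : 'M[R]_n => \det A).
Proof.
split.
- apply: (@rank1_affine_all_det _ _ _ id (fun v => v^T) id) => // A v s.
- by move=> T F FF B A BA; exact: cvg_det.
- by move=> M; eexists => A AM; exact: (det_bound AM).
Qed.

Lemma nice_biminor k b : nice (@biminor R n k b).
Proof.
split; first exact: biminor_rank1.
- move=> T F FF B A BA; apply: cvg_sum_filter => h; apply: cvgMr; apply: cvg_det => i j.
  by under eq_fun do rewrite mxE; rewrite mxE; exact: BA.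
- move=> M; exists (\sum_h `|b h| * \sum_(s : 'S_k) M ^+ k) => A AM.
  apply: le_trans (ler_norm_sum _ _ _) _; apply: ler_sum => h _; rewrite normrM ler_wpM2l//.
  by apply: det_bound => i j; rewrite mxE.
Qed.

(** An n x n minor with arbitrary index maps is the determinant of R A C^T with selection matrices R
    and C, so in degree n only multiples of det occur. *)
Lemma biminor_top b (A : 'M[R]_n) : @biminor R n n b A = biminor b 1%:M * \det A.
Proof.
rewrite /biminor mulr_suml; apply: eq_bigr => h _; rewrite -mulrA; congr (_ * _).
have key (r c : {ffun 'I_n -> 'I_n}) (B : 'M[R]_n) :
    minor r c B = \det (\matrix_(a, i) (i == r a)%:R : 'M[R]_n) * \det B * \det (\matrix_(a, i) (i == c a)%:R : 'M[R]_n).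
  rewrite -[in \det (\matrix_(a, i) (i == c a)%:R)]det_tr -!det_mulmx; congr (\det _).
  apply/matrixP => a e; rewrite !mxE (bigD1 (c e))//= !mxE eqxx mulr1.
  rewrite [X in _ + X]big1 ?addr0; last by move=> j /negbTE jc; rewrite !mxE jc mulr0.
  rewrite (bigD1 (r a))//= !mxE eqxx mul1r big1 ?addr0// => j /negbTE jr.
  by rewrite !mxE jr mul0r.
by rewrite !key det1 mulr1 mulrAC.
Qed.

End NicePolynomials.

(** * Density of the Monge-Ampere measure *)

Section MongeAmpereDensity.
Variables (R : realType) (n : nat).
Local Notation V := 'rV[R]_n.
Implicit Types (f g : V -> R) (B : set V).

(** The gradient of |x|^2/2 is the identity map; this fixes the normalisation of the Monge-Ampere
    density. *)
Lemma subgrad_hquad B : subgrad (@hquad R n) B = B.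
Proof.
have key (x y : V) : subdiff (@hquad R n) x y <-> y = x.
  have e (z : V) : hquad z - hquad x - inner x (z - x) = hquad (z - x).
    by rewrite /hquad /inner -!sumrB; apply: eq_bigr => i _; rewrite !mxE; field.
  have p (z : V) : 0 <= hquad z by apply: sumr_ge0 => i _; rewrite divr_ge0 ?sqr_ge0.
  split=> [/(_ y)|-> z]; last by have := p (z - x); rewrite -e; lra.
  have i2 : inner y (y - x) = inner x (y - x) + 2 * hquad (y - x).
    by rewrite /hquad /inner mulr_sumr -big_split /=; apply: eq_bigr => i _; rewrite !mxE; field.
  rewrite i2 => h; have := e y; have := p (y - x) => h1 h2.
  have : hquad (y - x) = 0 by lra.
  move=> /eqP; rewrite psumr_eq0; last by move=> i _; rewrite divr_ge0 ?sqr_ge0.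
  move=> /allP h0; apply/rowP => i; have := h0 i (mem_index_enum i).
  by rewrite /= mulf_eq0 invr_eq0 pnatr_eq0 orbF sqrf_eq0 !mxE subr_eq0 => /eqP.
apply/seteqP; split => y; first by case=> x Bx /key ->.
by move=> By; exists y => //; exact/key.
Qed.

Lemma hquad_quadf : @hquad R n = quadf [seq evec R i | i <- index_enum 'I_n].
Proof. by apply/funext => x; rewrite hquadE /quadf big_map. Qed.

Lemma sumsq_evec : sumsq [seq evec R i | i <- index_enum 'I_n] = 1%:M :> 'M[R]_n.
Proof.
rewrite /sumsq big_map; apply/matrixP => a b; rewrite summxE (bigD1 a)//= big1 ?addr0.
  by rewrite sqE !mxE !eqxx mul1r eq_sym.
by move=> k ka; rewrite sqE !mxE eqxx /= [a == k]eq_sym (negbTE ka) mul0r.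
Qed.

(** [maf] is itself a valuation of degree n, so its density on quadratic functions is a multiple of
    det, and the value at [hquad] shows that the multiple is 1. *)
Lemma maf_quadf l phi r : continuous phi -> supp_in phi (cube r) ->
  layer_int (maf (quadf l)) phi = \det (sumsq l : 'M[R]_n) * cint r phi.
Proof.
move=> cp sp; have mv := @maval_maf R n.
rewrite (qdens_layer mv l cp sp); congr (_ * _).
have [b hb] := rank1_affine_biminor (qdens_rank1_affine mv) (qdens_hom mv).
have q1 : qdens (@maf R n) 1%:M = 1.
  have l0 := leb_hbox_gt0 R n; apply: (mulIf (lt0r_neq0 l0)).
  rewrite mul1r -sumsq_evec -(qdens_leb mv _ (bounded_hbox _ _) (measurable_hbox _ _)) -hquad_quadf.
  by rewrite /maf subgrad_hquad.
have SR1 : SR (1%:M : 'M[R]_n) by rewrite -sumsq_evec; eexists.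
rewrite hb; last by eexists.
by rewrite biminor_top -hb// q1 mul1r.
Qed.

Lemma maf_C2 f B : convex_fun f -> C2_fun f -> bounded_set B -> measurable B ->
  maf f B = dens (fun x => \det (hessian f x)) B.
Proof.
move=> cf C2f bB mB; have [_ cP _] := nice_det R n.
rewrite (rep_C2_set (@maval_maf R n) (nice_det R n) maf_quadf cf C2f bB mB).
by apply: leb_int_dens => //; exact: (entrywise_ctsP cP (hessian_cts C2f)).
Qed.

Lemma rradon_sum (I : finType) (c : I -> R) (m : I -> set V -> R) : (forall i, rradon (m i)) ->
  rradon (fun B => \sum_i c i * m i B).
Proof.
move=> rm; elim: (index_enum I) => [|i r ih].
  rewrite (_ : (fun B => _) = (fun B => 0 * maf (fun=> 0) B)); last by apply/funext => B; rewrite big_nil mul0r.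
  by apply: rradonZ; apply: maf_radon; exact: convex_fun_cst.
rewrite (_ : (fun B => _) = (fun B => c i * m i B + \sum_(j <- r) c j * m j B)); last by apply/funext => B; rewrite big_cons.
by apply: rradonD => //; exact: rradonZ.
Qed.

Lemma layer_int_sum (I : finType) (c : I -> R) (m : I -> set V -> R) phi : (forall i, rradon (m i)) ->
  continuous phi -> compact_support phi ->
  layer_int (fun B => \sum_i c i * m i B) phi = \sum_i c i * layer_int (m i) phi.
Proof.
move=> rm cp cs.
have rs (r : seq I) : rradon (fun B => \sum_(i <- r) c i * m i B).
  elim: r => [|i r ih].
    rewrite (_ : (fun B => _) = (fun B => 0 * maf (fun=> 0) B)); last by apply/funext => B; rewrite big_nil mul0r.
    by apply: rradonZ; apply: maf_radon; exact: convex_fun_cst.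
  rewrite (_ : (fun B => _) = (fun B => c i * m i B + \sum_(j <- r) c j * m j B)); last by apply/funext => B; rewrite big_cons.
  by apply: rradonD => //; exact: rradonZ.
elim: (index_enum I) => [|i r ih].
  rewrite (_ : (fun B => _) = (fun B => 0 * maf (fun=> 0) B)); last by apply/funext => B; rewrite big_nil mul0r.
  rewrite layer_intZ ?mul0r ?big_nil//; apply: maf_radon; exact: convex_fun_cst.
rewrite (_ : (fun B => _) = (fun B => c i * m i B + \sum_(j <- r) c j * m j B)); last by apply/funext => B; rewrite big_cons.
by rewrite layer_intD//; [rewrite layer_intZ// big_cons ih|exact: rradonZ].
Qed.

Lemma dens_sum (I : finType) (c : I -> R) (g : I -> V -> R) B : (forall i, continuous (g i)) ->
  bounded_set B -> measurable B -> dens (fun x => \sum_i c i * g i x) B = \sum_i c i * dens (g i) B.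
Proof.
move=> cg bB mB; elim: (index_enum I) => [|i r ih].
  rewrite big_nil (_ : (fun x => _) = (fun=> 0)); last by apply/funext => x; rewrite big_nil.
  by rewrite /dens Rintegral_cst// mul0r.
rewrite big_cons -ih (_ : (fun x => _) = (fun x => c i * g i x + \sum_(j <- r) c j * g j x)); last by apply/funext => x; rewrite big_cons.
rewrite /dens RintegralD//.
- by rewrite RintegralZl//; exact: integrable_bounded_set.
- by apply: integrable_bounded_set => //; exact: ctsZ.
- by apply: integrable_bounded_set => //; apply: cts_sum => j _; exact: ctsZ.
Qed.

Lemma convex_lincomb (I : finType) (lam : I -> R) (fs : I -> V -> R) : (forall i, 0 <= lam i) -> (forall i, convex_fun (fs i)) ->
  convex_fun (fun x => \sum_i lam i * fs i x).
Proof.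
by move=> l0 cf; apply: (@convex_fun_sum _ _ _ (index_enum I) xpredT) => i _; exact: convex_funZ.
Qed.

Lemma C2_lincomb (I : finType) (lam : I -> R) (fs : I -> V -> R) : (forall i, C2_fun (fs i)) ->
  C2_fun (fun x => \sum_i lam i * fs i x) /\
  forall x, hessian (fun x => \sum_i lam i * fs i x) x = \sum_i lam i *: hessian (fs i) x.
Proof.
move=> C2f; have [gH hs] := choice (fun i => (iffLR (smooth2P (fs i)) (C2f i))).
have [H hs'] := choice hs.
have s := smooth2_sum (index_enum I) (fun i => smooth2Z (lam i) (hs' i)).
split; first by apply/smooth2P; do 2 eexists; exact: s.
move=> x; rewrite (smooth2_hessian x s); apply/matrixP => a b; rewrite mxE summxE; apply: eq_bigr => i _.
by rewrite mxE (smooth2_hessian x (hs' i)) mxE.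
Qed.

Lemma loc_unif_lincomb (I : finType) (lam : I -> R) (fs : nat -> I -> V -> R) (f : I -> V -> R) :
  (forall i, loc_unif_cvg (fun j => fs j i) (f i)) ->
  loc_unif_cvg (fun j x => \sum_i lam i * fs j i x) (fun x => \sum_i lam i * f i x).
Proof.
move=> h r e e0.
have E0 i : 0 < e / (#|I|.+1%:R * (`|lam i| + 1)) by rewrite divr_gt0// mulr_gt0// ltr_wpDl.
have : \forall j \near \oo, forall i (x : V), `|x| <= r -> `|fs j i x - f i x| < e / (#|I|.+1%:R * (`|lam i| + 1)).
  by apply: filter_forall => i; exact: h.
apply: filterS => j hj x xr.
rewrite -sumrB; apply: le_lt_trans (ler_norm_sum _ _ _) _.
apply: (@le_lt_trans _ _ (\sum_(i : I) e / #|I|.+1%:R)).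
  apply: ler_sum => i _; rewrite -mulrBr normrM.
  have := ltW (hj i x xr); rewrite invfM mulrA ler_pdivlMr ?ltr_wpDl// => h'.
  by apply: le_trans h'; rewrite mulrC ler_wpM2l// lerDl ler01.
rewrite sumr_const -[_ *+ _]mulr_natr -mulrA gtr_pMr// mulrC ltr_pdivrMr// mul1r ltr_nat.
by [].
Qed.

End MongeAmpereDensity.

(** * Polarisation of the Monge-Ampere measure *)

Section MixedMeasure.
Variables (R : realType) (n : nat).
Local Notation V := 'rV[R]_n.
Implicit Types (f g : V -> R) (fs : 'I_n -> V -> R) (B : set V).

Definition subsum (T : {set 'I_n}) fs : V -> R := fun x => \sum_i (i \in T)%:R * fs i x.

(* The polarisation formula for the mixed measure; [mixedMA_mix] identifies it with [mixedMA]. *)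
Definition mix fs B : R := (n`!)%:R^-1 * \sum_(T : {set 'I_n}) altsign R T * maf (subsum T fs) B.

Lemma subsum_convex T fs : (forall i, convex_fun (fs i)) -> convex_fun (subsum T fs).
Proof. by move=> cf; apply: convex_lincomb => // i; rewrite ler0n. Qed.

Lemma rradon_mix fs : (forall i, convex_fun (fs i)) -> rradon (mix fs).
Proof.
by move=> cf; apply: rradonZ; apply: rradon_sum => T; apply: maf_radon; exact: subsum_convex.
Qed.

Lemma layer_int_mix fs phi : (forall i, convex_fun (fs i)) -> continuous phi -> compact_support phi ->
  layer_int (mix fs) phi = (n`!)%:R^-1 * \sum_(T : {set 'I_n}) altsign R T * layer_int (maf (subsum T fs)) phi.
Proof.
move=> cf cp cs; have rT T : rradon (maf (subsum T fs)) by apply: maf_radon; exact: subsum_convex.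
by rewrite /mix layer_intZ//; [rewrite layer_int_sum|exact: rradon_sum].
Qed.

Lemma mix_continuous (fs : nat -> 'I_n -> V -> R) (f : 'I_n -> V -> R) phi :
  (forall j i, convex_fun (fs j i)) -> (forall i, convex_fun (f i)) ->
  (forall i, loc_unif_cvg (fun j => fs j i) (f i)) -> continuous phi -> compact_support phi ->
  (fun j => layer_int (mix (fs j)) phi) @ \oo --> layer_int (mix f) phi.
Proof.
move=> cfs cf fsf cp cs; rewrite layer_int_mix//.
rewrite (_ : (fun j => _) = (fun j => (n`!)%:R^-1 * \sum_(T : {set 'I_n}) altsign R T * layer_int (maf (subsum T (fs j))) phi)).
  apply: cvgMr; apply: cvg_sum_filter => T; apply: cvgMr.
  apply: (mv_cts (@maval_maf R n)) => //; [by move=> j; exact: subsum_convex|exact: subsum_convex|].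
  exact: loc_unif_lincomb.
by apply/funext => j; rewrite layer_int_mix.
Qed.

Lemma mixdet_hessian_cts fs : (forall i, C2_fun (fs i)) -> continuous (fun x => mixdet (fun i => hessian (fs i) x)).
Proof.
move=> C2f; have [_ cP _] := nice_det R n.
apply: ctsZ; apply: cts_sum => T _; apply: ctsZ; apply: (entrywise_ctsP cP) => a b.
rewrite (_ : (fun x => _) = (fun x => \sum_(i in T) hessian (fs i) x a b)); last by apply/funext => x; rewrite summxE.
by apply: cts_sum => i _; exact: hessian_cts.
Qed.

Lemma mix_C2 fs B : (forall i, convex_fun (fs i)) -> (forall i, C2_fun (fs i)) -> bounded_set B -> measurable B ->
  mix fs B = dens (fun x => mixdet (fun i => hessian (fs i) x)) B.
Proof.
move=> cf C2f bB mB; have [_ cP _] := nice_det R n.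
have C2T (T : {set 'I_n}) := C2_lincomb (fun i => (i \in T)%:R) C2f.
have cT (T : {set 'I_n}) := entrywise_ctsP cP (hessian_cts (C2T T).1).
rewrite /mix (eq_bigr (fun T => altsign R T * dens (fun x => \det (hessian (subsum T fs) x)) B)); last first.
  by move=> T _; rewrite maf_C2//; [exact: subsum_convex|exact: (C2T T).1].
rewrite -(dens_sum _ cT bB mB).
have e (x : V) : mixdet (fun i => hessian (fs i) x) =
    \sum_(T : {set 'I_n}) (n`!)%:R^-1 * (altsign R T * \det (hessian (subsum T fs) x)).
  rewrite /mixdet mulr_sumr; apply: eq_bigr => T _; rewrite (C2T T).2 big_mkcond.
  congr (_ * (_ * \det _)); apply: eq_bigr => i _.
  by case: (i \in T); rewrite ?scale1r ?scale0r.
rewrite /dens -RintegralZl//; last first.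
  by apply: integrable_bounded_set => //; apply: cts_sum => T _; exact: ctsZ.
by apply: eq_Rintegral => x _; rewrite e mulr_sumr.
Qed.

Lemma maf_polarization_C2 (lam : 'I_n -> R) fs B : (forall i, 0 <= lam i) -> (forall i, convex_fun (fs i)) ->
  (forall i, C2_fun (fs i)) -> bounded_set B -> measurable B ->
  maf (fun x => \sum_i lam i * fs i x) B =
  \sum_(f : {ffun 'I_n -> 'I_n}) (\prod_a lam (f a)) * mix (fs \o f) B.
Proof.
move=> l0 cf C2f bB mB; have [C2s Hs] := C2_lincomb lam C2f.
rewrite maf_C2//; last exact: convex_lincomb.
rewrite (eq_bigr (fun f : {ffun 'I_n -> 'I_n} => (\prod_a lam (f a)) * dens (fun x => mixdet (fun i => hessian (fs (f i)) x)) B)); last first.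
  by move=> f _; rewrite (mix_C2 (fun i => cf (f i)) (fun i => C2f (f i)) bB mB).
rewrite -dens_sum//; last by move=> f; apply: mixdet_hessian_cts => i; exact: C2f.
by congr (dens _ B); apply/funext => x; rewrite Hs det_polarization.
Qed.

(** For C^2 functions this is [det_polarization] under the integral; in general both sides are
    weakly continuous in the functions [fs], and C^2 functions are dense. *)
Lemma maf_polarization (lam : 'I_n -> R) fs B : (forall i, 0 <= lam i) -> (forall i, convex_fun (fs i)) ->
  bounded_set B -> measurable B ->
  maf (fun x => \sum_i lam i * fs i x) B =
  \sum_(f : {ffun 'I_n -> 'I_n}) (\prod_a lam (f a)) * mix (fs \o f) B.
Proof.
move=> l0 cf; move: B; apply: rradon_eq.
- by apply: maf_radon; exact: convex_lincomb.
- by apply: rradon_sum => f; apply: rradon_mix => i; exact: cf.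
move=> phi cp cs; have [u hu] := choice (fun i => C2_dense (cf i)).
have cu i j : convex_fun (u i j) by have [h _] := hu i; have [] := h j.
have C2u i j : C2_fun (u i j) by have [h _] := hu i; have [] := h j.
have uf i : loc_unif_cvg (u i) (fs i) by have [] := hu i.
have lim1 : (fun j => layer_int (maf (fun x => \sum_i lam i * u i j x)) phi) @ \oo -->
    layer_int (maf (fun x => \sum_i lam i * fs i x)) phi.
  apply: (mv_cts (@maval_maf R n)) => //.
  - by move=> j; apply: convex_lincomb.
  - exact: convex_lincomb.
  - exact: (@loc_unif_lincomb _ _ _ _ (fun j i => u i j)).
have rm (h : 'I_n -> V -> R) : (forall i, convex_fun (h i)) -> forall f : {ffun 'I_n -> 'I_n}, rradon (mix (h \o f)).
  by move=> ch f; apply: rradon_mix => i; exact: ch.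
rewrite layer_int_sum//; last exact: rm.
have lim2 : (fun j => \sum_(f : {ffun 'I_n -> 'I_n}) (\prod_a lam (f a)) * layer_int (mix ((fun i => u i j) \o f)) phi) @ \oo -->
    \sum_(f : {ffun 'I_n -> 'I_n}) (\prod_a lam (f a)) * layer_int (mix (fs \o f)) phi.
  apply: cvg_sum_filter => f; apply: cvgMr.
  by apply: (@mix_continuous (fun j => (fun i => u i j) \o f)) => // [j i|i|i] /=; [exact: cu|exact: cf|exact: uf].
suff E : (fun j => layer_int (maf (fun x => \sum_i lam i * u i j x)) phi) =
    (fun j => \sum_(f : {ffun 'I_n -> 'I_n}) (\prod_a lam (f a)) * layer_int (mix ((fun i => u i j) \o f)) phi).
  by rewrite E in lim1; exact: (cvg_unique _ lim1 lim2).
apply/funext => j; rewrite -layer_int_sum//; last by apply: rm => i; exact: cu.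
by apply: layer_int_eq => // B bB mB; exact: (maf_polarization_C2 l0 (fun i => cu i j) (fun i => C2u i j) bB mB).
Qed.

End MixedMeasure.

(** * One-sided derivatives of polynomials on the orthant *)

Section OneSidedDerivatives.
Variables (R : realType) (n : nat) (I : finType).
Implicit Types (G : ('I_n -> R) -> R) (c : I -> R) (e : I -> 'I_n -> nat) (lam : 'I_n -> R).

(** Polynomial on the closed orthant only, where the combinations of convex functions are convex;
    one-sided derivatives do not leave it. [e f i] is the exponent of [lam i] in the monomial
    [f]. *)
Definition orthant_poly c e G := forall lam, (forall i, 0 <= lam i) ->
  G lam = \sum_f c f * \prod_i lam i ^+ e f i.

Lemma is_derive_expn (m : nat) (a : R) : is_derive (0 : R) 1 (fun t => (a + t) ^+ m) (m%:R * a ^+ m.-1).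
Proof.
case: m => [|m].
  by under eq_fun do rewrite expr0; apply: (is_derive_eq (is_derive_cst (1 : R) _ _)); rewrite mul0r.
have h := is_derive_shift a (fun t => is_derive_poly t m) 0.
rewrite (_ : (fun t => (a + t) ^+ m.+1) = (fun t => (t + a) ^+ m.+1)); last by apply/funext => t; rewrite addrC.
by apply: (is_derive_eq h); rewrite add0r.
Qed.

(** The truncated predecessor is harmless at exponent 0, since the new coefficient carries the
    factor 0. *)
Lemma rpartial_poly c e G i : orthant_poly c e G ->
  orthant_poly (fun f => c f * (e f i)%:R) (fun f j => if j == i then (e f i).-1 else e f j) (rpartial i G).
Proof.
move=> hG lam l0; rewrite /rpartial.
pose K f := \prod_(j | j != i) lam j ^+ e f j.
pose g (t : R) := \sum_f (c f * K f) * (lam i + t) ^+ e f i.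
have gE t : 0 <= t -> G (fun j => lam j + (if j == i then t else 0)) = g t.
  move=> t0; rewrite hG; last by move=> j; rewrite addr_ge0//; case: ifP.
  apply: eq_bigr => f _; rewrite (bigD1 i)//= eqxx mulrCA [RHS]mulrC; congr (_ * (_ * _)).
  by apply: eq_bigr => j /negbTE ->; rewrite addr0.
have dg : is_derive (0 : R) 1 g (\sum_f (c f * K f) * ((e f i)%:R * lam i ^+ (e f i).-1)).
  have h := @is_derive_sum R R R #|I| (fun k t => (c (enum_val k) * K (enum_val k)) * (lam i + t) ^+ e (enum_val k) i) 0 1
    (fun k => (c (enum_val k) * K (enum_val k)) * ((e (enum_val k) i)%:R * lam i ^+ (e (enum_val k) i).-1))
    (fun k => is_deriveZ (c (enum_val k) * K (enum_val k)) (is_derive_expn (e (enum_val k) i) (lam i))).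
  have E (F : I -> R) : \sum_f F f = \sum_(k < #|I|) F (enum_val k) by rewrite -big_enum_val.
  rewrite E; rewrite (_ : g = \sum_(k < #|I|) (fun t => (c (enum_val k) * K (enum_val k)) * (lam i + t) ^+ e (enum_val k) i)) //.
  by apply/funext => t; rewrite /g E fct_sumE.
have g0 : G lam = g 0.
  rewrite -gE//; congr G; apply/funext => j; by case: ifP; rewrite addr0.
have [dv de] := dg.
have lim : (fun t : R => (G (fun j => lam j + (if j == i then t else 0)) - G lam) / t) @ 0^'+ -->
    \sum_f (c f * K f) * ((e f i)%:R * lam i ^+ (e f i).-1).
  rewrite -de; have /cvg_dnbhs_at_right := dv; apply: cvg_trans.
  apply: near_eq_cvg; near=> t; have t0 : 0 < t by near: t; exact: nbhs_right_gt.
  by rewrite gE ?(ltW t0)// g0 /= addr0 [t *: 1]mulr1 [LHS]mulrC.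
rewrite (cvg_lim _ lim)//; apply: eq_bigr => f _.
rewrite (bigD1 i)//= eqxx (eq_bigr (fun j => lam j ^+ e f j)); last by move=> j /negbTE ->.
by rewrite -/(K f); ring.
Unshelve. all: by end_near. Qed.

Lemma dmix_poly c e G (l : seq 'I_n) : uniq l -> orthant_poly c e G ->
  orthant_poly (fun f => c f * \prod_(i <- l) (e f i)%:R) (fun f i => if i \in l then (e f i).-1 else e f i) (dmix l G).
Proof.
elim: l => [_ h lam l0|i l ih /= /andP[il ul] h].
  by rewrite /= h//; apply: eq_bigr => f _; rewrite big_nil mulr1.
have := rpartial_poly i (ih ul h); rewrite (negbTE il) => h' lam l0; rewrite h'//.
apply: eq_bigr => f _; rewrite big_cons [X in _ = c f * X * _]mulrC mulrA; congr (_ * _).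
by apply: eq_bigr => j _; rewrite in_cons; case: eqP => [->|]//=.
Qed.

End OneSidedDerivatives.

Section MixedMAFormula.
Variables (R : realType) (n : nat).
Local Notation V := 'rV[R]_n.

(** One derivative in every variable, taken at 0, leaves the monomials with all exponents 1, which
    belong to the bijections f. Each contributes [mix fs B], which is symmetric in the functions,
    and their number n! cancels the normalisation. *)
Lemma mixedMA_mix (fs : 'I_n -> V -> R) (B : set V) : (forall i, convex_fun (fs i)) -> bounded_set B -> measurable B ->
  mixedMA fs B = real_complex R (mix fs B).
Proof.
move=> cf bB mB; rewrite /mixedMA; congr (real_complex R _).
set G := (fun lam : 'I_n -> R => _).
pose e (f : {ffun 'I_n -> 'I_n}) (i : 'I_n) := #|[pred a | f a == i]|.
pose c (f : {ffun 'I_n -> 'I_n}) := mix (fs \o f) B.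
have hG : orthant_poly c e G.
  move=> lam l0; rewrite /G /MA /= -/(maf _ B) maf_polarization//; apply: eq_bigr => f _.
  rewrite mulrC; congr (_ * _); rewrite (partition_big f xpredT)//=; apply: eq_bigr => i _.
  by rewrite (eq_bigr (fun _ => lam i)) ?prodr_const// => a /eqP ->.
rewrite (dmix_poly (enum_uniq 'I_n) hG)//.
rewrite (eq_bigr (fun f : {ffun 'I_n -> 'I_n} => (injectiveb f)%:R * mix fs B)); last first.
  move=> f _; rewrite -mulrA big_enum -big_split /=.
  have [inj|ninj] := boolP (injectiveb f).
    have [h fK hK] := injF_bij (injectiveP _ inj).
    rewrite mul1r big1 ?mulr1.
      rewrite /c /mix; congr (_ * _).
      rewrite [RHS](reindex (fun T : {set 'I_n} => f @: T)) /=; last first.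
        exists (fun T : {set 'I_n} => h @: T) => T _; rewrite -imset_comp -[RHS]imset_id; apply: eq_imset => a /=; by rewrite ?fK ?hK.
      apply: eq_bigr => T _; congr (_ * maf _ B).
        rewrite /altsign; congr (_ ^+ _); rewrite -(card_imset (~: T) (injectiveP _ inj)); congr #|pred_of_set _|.
        apply/setP => a; rewrite !inE; apply/imsetP/idP => [[b hb ->]|ha].
          by rewrite mem_imset ?inE in hb *; [|exact/injectiveP].
        exists (h a); rewrite ?hK// inE; apply: contra ha => hT; by apply/imsetP; exists (h a); rewrite ?hK.
      apply/funext => x; rewrite /subsum [RHS](reindex f) /=; last by exists h => a _; rewrite ?fK ?hK.
      by apply: eq_bigr => a _; rewrite mem_imset//; exact/injectiveP.
    move=> i _; suff -> : e f i = 1%N by rewrite mul1r mem_enum expr0.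
    rewrite /e (eq_card (B := pred1 (h i))) ?card1// => a; rewrite !inE.
    by apply/eqP/eqP => [<-|->]; rewrite ?fK ?hK.
  (* A value taken twice leaves a positive power of its variable, which vanishes at 0. *)
  rewrite mul0r; have [a [b [ab fab]]] : exists a b, a != b /\ f a = f b.
    move: ninj => /injectivePn[a [b ab fab]]; by exists a, b.
  have e2 : (2 <= e f (f a))%N.
    rewrite /e; have -> : 2%N = #|[set a; b]%SET| by rewrite cards2 ab.
    by apply: subset_leq_card; apply/fintype.subsetP => x; rewrite !inE => /orP[/eqP ->|/eqP ->]; rewrite ?fab.
  rewrite (bigD1 (f a))//= mem_enum inE; case: (e f (f a)) e2 => [|[|m]]// _.
  by rewrite /= expr0n /= mulr0 !mul0r mulr0.
rewrite -mulr_suml (_ : \sum_(f : {ffun 'I_n -> 'I_n}) _ = (n`!)%:R); first by rewrite mulrC mulKf// fact_neq0.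
rewrite -card_inj_self -sum1_card natr_sum [RHS]big_mkcond; apply: eq_bigr => f _.
by rewrite -[f \in _]/(injectiveb f); case: (injectiveb f).
Qed.

End MixedMAFormula.

(** * Classification of real-valued valuations *)

Section QuadraticFunctions.
Variables (R : realType) (n : nat).
Local Notation V := 'rV[R]_n.

Lemma quadratic_C2 (q : V -> R) : quadratic_poly q -> C2_fun q /\ exists W, forall x, hessian q x = W.
Proof.
case=> A [b [c qE]].
pose F (ij : 'I_n * 'I_n) (x : V) := inner (evec R ij.1) x * inner (evec R ij.2) x.
have s := smooth2D (smooth2_sum (index_enum ('I_n * 'I_n)%type) (fun ij => smooth2Z (A ij.1 ij.2) (smooth2M (smooth2_inner (evec R ij.1)) (smooth2_inner (evec R ij.2)))))
  (smooth2D (smooth2_inner b) (smooth2_cst n c)).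
set f := (fun x : V => _) in s.
have -> : q = f.
  apply/funext => x; rewrite qE /f -addrA; congr (_ + _).
  rewrite mxE (eq_bigr (fun j => \sum_i A i j * (inner (evec R i) x * inner (evec R j) x))).
    by rewrite exchange_big pair_big.
  move=> j _; rewrite !mxE mulr_suml; apply: eq_bigr => i _; rewrite !inner_evec; ring.
split; first by apply/smooth2P; do 2 eexists; exact: s.
exists (hessian f 0) => x; rewrite !(smooth2_hessian _ s); apply/matrixP => i j; rewrite !mxE.
congr (_ + _); apply: eq_bigr => ij _; congr (_ * _).
by rewrite !mulr0.
Qed.

(** A translation changes the function by an affine one: this is how fixed quadratic arguments
    become compatible with translation equivariance. *)
Definition qaffine (q : V -> R) := forall x, affine_fun (fun y => q y - q (y + x)).

Lemma affine_lincomb (I : finType) (lam : I -> R) (q : I -> V -> R) : (forall i, affine_fun (q i)) ->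
  affine_fun (fun x => \sum_i lam i * q i x).
Proof.
move=> hq; have [y hy] := choice hq; have [c hc] := choice hy.
exists (\sum_i lam i *: y i), (\sum_i lam i * c i) => x.
have -> : inner (\sum_i lam i *: y i) x = \sum_i lam i * inner (y i) x.
  elim: (index_enum I) => [|i r ih]; first by rewrite !big_nil inner0l.
  by rewrite !big_cons innerDl innerZl ih.
by rewrite -big_split /=; apply: eq_bigr => i _; rewrite hc mulrDr.
Qed.

Lemma qaffine_lincomb (I : finType) (lam : I -> R) (q : I -> V -> R) : (forall i, qaffine (q i)) ->
  qaffine (fun x => \sum_i lam i * q i x).
Proof.
move=> hq x; have [y [c h]] := affine_lincomb lam (fun i => hq i x).
exists y, c => z; rewrite -h -sumrB; apply: eq_bigr => i _; by rewrite mulrBr.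
Qed.

Lemma quadratic_qaffine (q : V -> R) : quadratic_poly q -> qaffine q.
Proof.
case=> A [b [c qE]] x.
have qE' y : q y = \sum_(ij : 'I_n * 'I_n) A ij.1 ij.2 * (y ord0 ij.1 * y ord0 ij.2) + (inner b y + c).
  rewrite qE -addrA; congr (_ + _); rewrite mxE (eq_bigr (fun j => \sum_i A i j * (y ord0 i * y ord0 j))).
    by rewrite exchange_big pair_big.
  by move=> j _; rewrite !mxE mulr_suml; apply: eq_bigr => i _; ring.
have [i|y [d hy]] := @qaffine_lincomb _ (fun ij : 'I_n * 'I_n => A ij.1 ij.2) (fun ij y => y ord0 ij.1 * y ord0 ij.2) _ x.
  move=> z; exists (- (z ord0 i.1 *: evec R i.2 + z ord0 i.2 *: evec R i.1)), (- (z ord0 i.1 * z ord0 i.2)) => y.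
  by rewrite innerNl innerDl !innerZl !inner_evec !mxE; ring.
exists y, (d - inner b x) => z; rewrite !qE' innerD; have := hy z.
move: (\sum_ij _) (\sum_ij _) => s2 s1 h.
have -> : s1 + (inner b z + c) - (s2 + (inner b z + inner b x + c)) = (s1 - s2) - inner b x by ring.
by rewrite h addrA.
Qed.

End QuadraticFunctions.

Section MixedValuation.
Variables (R : realType) (n k : nat).
Local Notation V := 'rV[R]_n.

Lemma maval_lincomb (I : finType) (c : I -> R) (Psi : I -> (V -> R) -> set V -> R) :
  (forall i, maval k (Psi i)) -> maval k (fun f B => \sum_i c i * Psi i f B).
Proof.
move=> mv; split.
- by move=> f cf; apply: rradon_sum => i; exact: (mv_radon (mv i)).
- move=> fs f cfs cf fsf phi cp cs.
  have rs g : convex_fun g -> forall i, rradon (Psi i g) by move=> cg i; exact: (mv_radon (mv i)).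
  rewrite (layer_int_sum _ (rs _ cf) cp cs) (_ : (fun j => _) = (fun j => \sum_i c i * layer_int (Psi i (fs j)) phi)).
    by apply: cvg_sum_filter => i; apply: cvgMr; exact: (mv_cts (mv i)).
  by apply/funext => j; rewrite (layer_int_sum _ (rs _ (cfs j)) cp cs).
- move=> f g cf cg cm B bB mB; rewrite -!big_split /=; apply: eq_bigr => i _.
  by rewrite -!mulrDr (mv_val (mv i)).
- by move=> f l cf al B bB mB; apply: eq_bigr => i _; rewrite (mv_aff (mv i)).
- by move=> f h U cf ch oU fh B bB mB; apply: eq_bigr => i _; rewrite (mv_loc (mv i) cf ch oU fh bB mB).
- by move=> f x cf B bB mB; apply: eq_bigr => i _; rewrite (mv_trans (mv i)).
- move=> f t cf t0 B bB mB; rewrite mulr_sumr; apply: eq_bigr => i _.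
  by rewrite (mv_hom (mv i) cf t0 bB mB) mulrCA.
Qed.

Variables (q : nat -> V -> R).
Hypotheses (cq : forall j, convex_fun (q j)) (qq : forall j, quadratic_poly (q j)).

Lemma quad_args_convex f : convex_fun f -> forall i, convex_fun (@quad_args R n k f q i).
Proof. by move=> cf i; rewrite /quad_args; case: ifP. Qed.

(** Every term of the polarisation formula is [maf] at a T * f + Q T with a T >= 0, so the axioms
    other than homogeneity pass from [maf] to [mix] term by term. *)
Let a (T : {set 'I_n}) : R := \sum_i (i \in T)%:R * (i < k)%N%:R.
Let Q (T : {set 'I_n}) (x : V) : R := \sum_i ((i \in T)%:R * (~~ (i < k)%N)%:R) * q (i - k)%N x.

Let subsum_quad T f : subsum T (@quad_args R n k f q) = (fun x => a T * f x + Q T x).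
Proof.
apply/funext => x; rewrite /subsum /a /Q mulr_suml -big_split /=; apply: eq_bigr => i _.
by rewrite /quad_args; case: ltnP => _; rewrite ?mulr1 ?mulr0 ?mul0r ?addr0 ?add0r.
Qed.

Let a0 T : 0 <= a T.
Proof. by apply: sumr_ge0 => i _; rewrite mulr_ge0. Qed.

Let cQ T : convex_fun (Q T).
Proof. by apply: convex_lincomb => // i; rewrite mulr_ge0. Qed.

Let aQ T : qaffine (Q T).
Proof. by apply: qaffine_lincomb => i; exact: quadratic_qaffine. Qed.

Let caQ T f : convex_fun f -> convex_fun (fun x => a T * f x + Q T x).
Proof. by move=> cf; apply: convex_funD => //; exact: convex_funZ. Qed.

Let Psi f := mix (@quad_args R n k f q).

Let mixE f B : Psi f B = (n`!)%:R^-1 * \sum_(T : {set 'I_n}) altsign R T * maf (fun x => a T * f x + Q T x) B.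
Proof. by congr (_ * _); apply: eq_bigr => T _; rewrite subsum_quad. Qed.

Let eq_mix f g B B' : (forall T, maf (fun x => a T * f x + Q T x) B = maf (fun x => a T * g x + Q T x) B') ->
  Psi f B = Psi g B'.
Proof. by move=> h; rewrite !mixE; congr (_ * _); apply: eq_bigr => T _; rewrite h. Qed.

Let Psi_radon f : convex_fun f -> rradon (Psi f).
Proof. by move=> cf; apply: rradon_mix; exact: quad_args_convex. Qed.

Let Psi_cts fs f phi : (forall j, convex_fun (fs j)) -> convex_fun f -> loc_unif_cvg fs f ->
  continuous phi -> compact_support phi -> (fun j => layer_int (Psi (fs j)) phi) @ \oo --> layer_int (Psi f) phi.
Proof.
move=> cfs cf fsf cp cs; apply: mix_continuous => //.
- by move=> j; exact: quad_args_convex.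
- exact: quad_args_convex.
- move=> i; rewrite /quad_args; case: ifP => // _ r e e0.
  by apply: nearW => j x _; rewrite subrr normr0.
Qed.

Definition qhess (i : 'I_n) : 'M[R]_n := hessian (q (i - k)%N) 0.

Let hess_quad f x : C2_fun f -> (fun i => hessian (@quad_args R n k f q i) x) =
  (fun i : 'I_n => if (i < k)%N then hessian f x else qhess i).
Proof.
move=> C2f; apply/funext => i; rewrite /quad_args; case: ifP => _; first reflexivity.
by have [_ [W hW]] := quadratic_C2 (qq (i - k)%N); rewrite /qhess !hW.
Qed.

Lemma mix_quad_C2 f (B : set V) : convex_fun f -> C2_fun f -> bounded_set B -> measurable B ->
  mix (@quad_args R n k f q) B = dens (fun x => mixdet (fun i : 'I_n => if (i < k)%N then hessian f x else qhess i)) B.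
Proof.
move=> cf C2f bB mB; have C2q i : C2_fun (@quad_args R n k f q i).
  by rewrite /quad_args; case: ifP => _; [exact: C2f|have [h _] := quadratic_C2 (qq (i - k)%N); exact: h].
rewrite (mix_C2 (quad_args_convex cf) C2q bB mB).
by congr (dens _ B); apply/funext => x; rewrite (hess_quad x C2f).
Qed.

(** Assumed at this point because its proof writes n as k + l, which the classification section
    does. *)
Hypothesis hom_mixdet : forall (t : R) (A : 'M[R]_n) (W : 'I_n -> 'M[R]_n),
  mixdet (fun i : 'I_n => if (i < k)%N then t *: A else W i) =
  t ^+ k * mixdet (fun i : 'I_n => if (i < k)%N then A else W i).

Lemma maval_mix : maval k (fun f => mix (@quad_args R n k f q)).
Proof.
have mva := @maval_maf R n.
have maxD (u v s t : R) : 0 <= s -> Num.max (s * u + t) (s * v + t) = s * Num.max u v + t.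
  by move=> s0; rewrite maxr_pMr// addr_maxl.
have minD (u v s t : R) : 0 <= s -> Num.min (s * u + t) (s * v + t) = s * Num.min u v + t.
  by move=> s0; rewrite minr_pMr// addr_minl.
change (maval k Psi); split; [exact: Psi_radon|by move=> fs f cfs cf fsf phi cp cs; exact: Psi_cts|..].
- move=> f g cf cg cm B bB mB; rewrite !mixE -!mulrDr -!big_split /=; congr (_ * _).
  apply: eq_bigr => T _; rewrite -!mulrDr; congr (_ * _).
  rewrite -(mv_val mva (caQ T cf) (caQ T cg) _ bB mB); last first.
    by apply: convex_ext (caQ T cm) => x; rewrite minD.
  by congr (maf _ B + maf _ B); apply/funext => x; rewrite ?maxD ?minD.
- move=> f l cf [y [c hl]] B bB mB; apply: eq_mix => T.
  rewrite -(mv_aff mva (caQ T cf) (l := fun x => a T * l x) _ bB mB).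
    by congr (maf _ B); apply/funext => x; ring.
  by exists (a T *: y), (a T * c) => x; rewrite hl innerZl mulrDr.
- move=> f h U cf ch oU fh B bB mB; apply: eq_mix => T.
  by apply: (mv_loc mva (caQ T cf) (caQ T ch) oU) => // x Ux; rewrite fh.
- move=> f x cf B bB mB; apply: eq_mix => T.
  have cfx : convex_fun (fun y => a T * f (y + x) + Q T (y + x)).
    move=> u v t t01; have := caQ T cf (u + x) (v + x) t01.
    rewrite (_ : t *: (u + x) + (1 - t) *: (v + x) = t *: u + (1 - t) *: v + x)//.
    by apply/rowP => i; rewrite !mxE; ring.
  rewrite -(mv_trans mva x (caQ T cf) bB mB) -(mv_aff mva cfx (aQ T x) bB mB).
  by congr (maf _ B); apply/funext => y; ring.
(* The single terms are not homogeneous in [f]. Homogeneity is read off the density for C^2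
   functions and extended by density. *)
- move=> f t cf t0; move: f cf.
  apply: (@C2_determined R n (fun f => Psi (fun x => t * f x)) (fun f B => t ^+ k * Psi f B)).
  + by move=> f cf; apply: Psi_radon; exact: convex_funZ.
  + by move=> f cf; apply: rradonZ; exact: Psi_radon.
  + move=> fs f phi cfs cf fsf cp cs; apply: Psi_cts => //; [by move=> j; exact: convex_funZ|exact: convex_funZ|].
    have h := @loc_unif_lincomb R n 'I_1 (fun=> t) (fun j _ => fs j) (fun=> f) (fun=> fsf).
    move=> r e e0; have := h r e e0; apply: filterS => j hj x xr.
    by have := hj x xr; rewrite !big_ord1.
  + move=> fs f phi cfs cf fsf cp cs; rewrite layer_intZ//; last exact: Psi_radon.
    rewrite (_ : (fun j => _) = (fun j => t ^+ k * layer_int (Psi (fs j)) phi)).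
      by apply: cvgMr; exact: Psi_cts.
    by apply/funext => j; rewrite layer_intZ//; exact: Psi_radon.
  + move=> f cf C2f B bB mB.
    rewrite /Psi (mix_quad_C2 (convex_funZ t0 cf) (C2_funZ t C2f) bB mB) (mix_quad_C2 cf C2f bB mB).
    have Ht x : hessian (fun x => t * f x) x = t *: hessian f x.
      have [_ h] := @C2_lincomb R n 'I_1 (fun=> t) (fun=> f) (fun=> C2f).
      by have := h x; rewrite big_ord1 => <-; congr (hessian _ x); apply/funext => y; rewrite big_ord1.
    rewrite /dens -RintegralZl//.
      by apply: eq_Rintegral => x _; rewrite Ht hom_mixdet.
    apply: integrable_bounded_set => //; rewrite (_ : (fun x => _) = (fun x => mixdet (fun i => hessian (@quad_args R n k f q i) x))).
      apply: mixdet_hessian_cts => i; rewrite /quad_args.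
      by case: ifP => _; [exact: C2f|have [h _] := quadratic_C2 (qq (i - k)%N); exact: h].
    by apply/funext => x; rewrite (hess_quad x C2f).
Qed.

End MixedValuation.

Section Classification.
Variables (R : realType) (k l : nat).
Local Notation n := (k + l)%N.
Local Notation V := 'rV[R]_n.

Lemma mixargE (A : 'M[R]_n) (W : 'I_n -> 'M[R]_n) :
  (fun i : 'I_n => if (i < k)%N then A else W i) = mixarg A (fun j => W (rshift k j)).
Proof.
apply/funext => i; rewrite /mixarg; case: fintype.splitP => j ij //.
by congr W; exact: val_inj.
Qed.

Lemma hom_mixdet (t : R) (A : 'M[R]_n) (W : 'I_n -> 'M[R]_n) :
  mixdet (fun i : 'I_n => if (i < k)%N then t *: A else W i) =
  t ^+ k * mixdet (fun i : 'I_n => if (i < k)%N then A else W i).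
Proof. by rewrite !mixargE mixdet_mixargZ. Qed.

Lemma hessian_quadf s (x : V) : C2_fun (quadf s) /\ hessian (quadf s) x = sumsq s.
Proof.
have h := smooth2_sum s (fun v => @smooth2_sq R n v).
split; first by apply/smooth2P; do 2 eexists; exact: h.
by rewrite (smooth2_hessian x h); apply/matrixP => i j; rewrite mxE /sumsq summxE.
Qed.

(** Beyond l the family, indexed by nat, is filled with the zero function, the quadratic form of the
    empty list. *)
Definition qrows (w : 'M[R]_(l, n)) (j : nat) : V -> R :=
  quadf (if insub j is Some j' then [:: row j' w] else [::]).

Lemma quadratic_quadf s : quadratic_poly (@quadf R n s).
Proof.
exists (2^-1 *: sumsq s), 0, 0 => x; rewrite inner0l !addr0 -quadmE /quadm.
by rewrite -scalemxAr -scalemxAl [RHS]mxE mulrC.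
Qed.

Lemma qrows_convex w j : convex_fun (qrows w j).
Proof. exact: quadf_convex. Qed.

Lemma qrows_quadratic w j : quadratic_poly (qrows w j).
Proof. exact: quadratic_quadf. Qed.

Definition mixrows w (f : V -> R) := mix (@quad_args R n k f (qrows w)).

Lemma maval_mixrows w : maval k (mixrows w).
Proof. exact: (maval_mix (qrows_convex w) (qrows_quadratic w) hom_mixdet). Qed.

Lemma qdens_mixrows w (xi : 'I_k -> V) :
  qdens (mixrows w) (\sum_i sq (xi i)) = mixcst R k l * \det (col_mx (\matrix_i xi i) w) ^+ 2.
Proof.
pose s := [seq xi i | i <- index_enum 'I_k].
have -> : \sum_i sq (xi i) = sumsq s by rewrite /sumsq big_map.
have l0 := leb_hbox_gt0 R n; apply: (mulIf (lt0r_neq0 l0)).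
have bh := @bounded_hbox R n (fun=> 0) (fun=> 1); have mh := @measurable_hbox R n (fun=> 0) (fun=> 1).
rewrite -(qdens_leb (maval_mixrows w) s bh mh) /mixrows.
rewrite (mix_quad_C2 k (qrows_convex w) (qrows_quadratic w) (quadf_convex s) (hessian_quadf s 0).1 bh mh).
have e (x : V) : mixdet (fun i : 'I_n => if (i < k)%N then hessian (quadf s) x else qhess k (qrows w) i) =
    mixcst R k l * \det (col_mx (\matrix_i xi i) w) ^+ 2.
  rewrite (hessian_quadf s x).2 mixargE -mixdet_sq; congr mixdet; congr mixarg.
    by rewrite /sumsq big_map.
  apply/funext => j; rewrite /qhess /= addKn /qrows insubT; first exact: ltn_ord.
  move=> jl; rewrite (_ : Sub _ _ = j); last exact: val_inj.
  by rewrite (hessian_quadf _ 0).2 /sumsq big_seq1.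
rewrite /dens (eq_Rintegral _ (g := fun=> mixcst R k l * \det (col_mx (\matrix_i xi i) w) ^+ 2)); last by move=> x _; rewrite e.
by rewrite Rintegral_cst.
Qed.

Definition mixcomb m (c : 'I_m -> R) (w : 'I_m -> 'M[R]_(l, n)) (f : V -> R) (B : set V) : R :=
  \sum_j c j * mixrows (w j) f B.

Lemma maval_mixcomb m c w : maval k (@mixcomb m c w).
Proof. by apply: maval_lincomb => j; exact: maval_mixrows. Qed.

Lemma qdens_mixcomb m c w A : qdens (@mixcomb m c w) A = \sum_j c j * qdens (mixrows (w j)) A.
Proof. by rewrite /qdens /unit_mass /mixcomb mulr_suml; apply: eq_bigr => j _; rewrite mulrA. Qed.

(** [rank1_affine_sum_det2] writes [p] through squared determinants, each of which is, up to the
    positive factor [mixcst], the density of one mixed operator. *)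
Lemma mixcomb_exists p : rank1_affine p -> hom_deg k p ->
  exists m c w, forall A, SR A -> qdens (@mixcomb m c w) A = p A.
Proof.
move=> rp hp; have [m [c [w pE]]] := rank1_affine_sum_det2 rp hp.
exists m, (fun j => c j / mixcst R k l), w; set Psi := mixcomb _ _.
have mv : maval k Psi by exact: maval_mixcomb.
apply: (hom_ext (qdens_rank1_affine mv) (qdens_hom mv) rp hp) => xi.
rewrite qdens_mixcomb pE; apply: eq_bigr => j _.
by rewrite qdens_mixrows mulrA divfK// gt_eqF// mixcst_gt0.
Qed.

Lemma maval_C2 Psi b : maval k Psi -> (forall A, SR A -> qdens Psi A = @biminor R n k b A) ->
  forall f, convex_fun f -> C2_fun f -> forall B : set V, bounded_set B -> measurable B ->
  Psi f B = leb_int B (fun x => biminor b (hessian f x)).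
Proof.
move=> mv hb; apply: (rep_C2_set mv (@nice_biminor R n k b)) => s phi r cp sp.
by rewrite (qdens_layer mv s cp sp) hb//; exists s.
Qed.

Lemma maval_biminor Psi : maval k Psi -> exists b, forall A, SR A -> qdens Psi A = @biminor R n k b A.
Proof. by move=> mv; exact: (rank1_affine_biminor (qdens_rank1_affine mv) (qdens_hom mv)). Qed.

(** Two valuations with the same density on quadratic functions agree on C^2 functions, and then
    everywhere. *)
Theorem maval_mixcombE Psi : maval k Psi -> exists m c w, forall f, convex_fun f ->
  forall B : set V, bounded_set B -> measurable B -> Psi f B = @mixcomb m c w f B.
Proof.
move=> mv; have [m [c [w h]]] := mixcomb_exists (qdens_rank1_affine mv) (qdens_hom mv).
exists m, c, w; have mv' := maval_mixcomb c w; have [b hb] := maval_biminor mv.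
apply: C2_determined.
- by move=> f cf; exact: (mv_radon mv).
- by move=> f cf; exact: (mv_radon mv').
- by move=> fs f phi cfs cf fsf cp cs; exact: (mv_cts mv).
- by move=> fs f phi cfs cf fsf cp cs; exact: (mv_cts mv').
move=> f cf C2f B bB mB.
by rewrite (maval_C2 mv hb)// (maval_C2 mv' (b := b))// => A SA; rewrite h// hb.
Qed.

Theorem biminor_mixcomb (b : {ffun 'I_k -> 'I_n * 'I_n} -> R) : exists m c w,
  forall f, convex_fun f -> C2_fun f -> forall B : set V, bounded_set B -> measurable B ->
  @mixcomb m c w f B = leb_int B (fun x => biminor b (hessian f x)).
Proof.
have [m [c [w h]]] := mixcomb_exists (rank1_affine_allW (@biminor_rank1 _ n k b)) (@biminor_hom _ n k b).
exists m, c, w; exact: maval_C2 (maval_mixcomb c w) h.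
Qed.

End Classification.

(** * Forms and minors *)

Section Minors.
Variables (R : realType).

Lemma minor_noninj n k (r c : {ffun 'I_k -> 'I_n}) (H : 'M[R]_n) : ~~ injectiveb r -> minor r c H = 0.
Proof.
move=> /injectivePn[a [b ab rab]]; apply: (determinant_alternate ab) => j.
by rewrite !mxE rab.
Qed.

Lemma minor_tr n k (r c : {ffun 'I_k -> 'I_n}) (H : 'M[R]_n) : minor r c H = minor c r H^T.
Proof. by rewrite /minor -det_tr; congr (\det _); apply/matrixP => a b; rewrite !mxE. Qed.

Lemma minor_reorder n k (r r' : {ffun 'I_k -> 'I_n}) : injective r -> (forall a, exists b, r a = r' b) ->
  exists e : bool, forall c (H : 'M[R]_n), minor r c H = (-1) ^+ e * minor r' c H.
Proof.
move=> ri /choice[f rf]; have fi : injective f by move=> a b /(congr1 r'); rewrite -!rf => /ri.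
exists (perm fi : bool) => c H; rewrite /minor -det_perm -det_mulmx -row_permE; congr (\det _).
by apply/matrixP => a b; rewrite !mxE permE -rf.
Qed.

Lemma minor_reorderC n k (c c' : {ffun 'I_k -> 'I_n}) : injective c -> (forall a, exists b, c a = c' b) ->
  exists e : bool, forall r (H : 'M[R]_n), minor r c H = (-1) ^+ e * minor r c' H.
Proof.
move=> ci cc'; have [e he] := minor_reorder ci cc'.
by exists e => r H; rewrite minor_tr he -minor_tr.
Qed.

(** The increasing enumeration of [S], with the proof of its cardinality used to give it the domain
    'I_k. *)
Definition set_map n k (S : {set 'I_n}) (hS : #|S| = k) : {ffun 'I_k -> 'I_n} :=
  [ffun a => enum_val (cast_ord (esym hS) a)].

Lemma set_map_inj n k S hS : injective (@set_map n k S hS).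
Proof. by move=> a b; rewrite !ffunE => /enum_val_inj /cast_ord_inj. Qed.

Lemma set_map_onto n k (S : {set 'I_n}) (hS : #|S| = k) i : i \in S -> exists a, i = set_map hS a.
Proof.
by move=> iS; exists (cast_ord hS (enum_rank_in iS i)); rewrite ffunE cast_ordK enum_rankK_in.
Qed.

Lemma set_map_mem n k S hS a : @set_map n k S hS a \in S.
Proof. by rewrite ffunE enum_valP. Qed.

Lemma set_map_incr n k S hS : incr_map (@set_map n k S hS).
Proof.
apply/'forall_forallP => a b; apply/implyP => ab; rewrite !ffunE.
have n0 : 'I_n := set_map hS a.
rewrite !(enum_val_nth n0) /=; have srt : sorted ltn [seq val i | i <- enum S].
  rewrite /enum_mem -enumT /= sorted_map; apply: sorted_filter; first by move=> x y z; exact: ltn_trans.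
  by rewrite -sorted_map val_enum_ord iota_ltn_sorted.
have bS : (b < size (enum S))%N by rewrite -cardE hS.
have aS : (a < size (enum S))%N by exact: ltn_trans bS.
rewrite -!(nth_map n0 0%N val)//.
by apply: (sorted_ltn_nth ltn_trans) => //; rewrite inE size_map.
Qed.

(** The tangent frame of the graph of df at a point with Hessian [H]: the images of the coordinate
    vectors. *)
Definition graph_frame n (H : 'M[R]_n) (b : 'I_n) : 'rV[R]_n * 'rV[R]_n := (evec R b, \row_(j < n) H j b).

(** On this frame the dx rows are coordinate vectors. Moving the columns in I to the front makes the
    matrix block triangular with an identity block; what remains is the minor of [H] with rows J and
    columns outside I. *)
Lemma dxdxi_minor n k l (I J : {set 'I_n}) (hI : #|I| = l) (hJ : #|J| = k) (hC : #|~: I| = k) : (l + k)%N = n ->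
  exists e : bool, forall H : 'M[R]_n,
  dxdxi I J (graph_frame H) = (-1) ^+ e * minor (set_map hJ) (set_map hC) H.
Proof.
move=> lk; subst n.
pose q (b : 'I_(l + k)) := match fintype.split b with inl b' => set_map hI b' | inr b' => set_map hC b' end.
have qi : injective q.
  move=> a b; rewrite /q; case: (split_ordP a) => a' ->; case: (split_ordP b) => b' ->.
  - by move=> /set_map_inj ->.
  - move=> e; have := set_map_mem hC b'.
    by rewrite -e inE set_map_mem.
  - move=> e; have := set_map_mem hC a'.
    by rewrite e inE set_map_mem.
  - by move=> /set_map_inj ->.
exists (((perm qi)^-1)%g : bool) => H; rewrite /dxdxi; set M := \matrix_(a, b) _.
have ME a b : M a b = match fintype.split a with
    inl a' => (set_map hI a' == b)%:R | inr a' => H (set_map hJ a') b end.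
  rewrite mxE; case: (split_ordP a) => a' ->.
    rewrite nth_cat size_map -cardE hI /= ltn_ord (nth_map (set_map hI a')) -?cardE ?hI//=.
    rewrite /evec mxE eqxx /= ffunE (enum_val_nth (set_map hI a')) //=.
    by congr (_ == b)%:R; apply: set_nth_default; rewrite -cardE hI.
  rewrite nth_cat size_map -cardE hI /= ltnNge leq_addr /= addKn.
  rewrite (nth_map (set_map hJ a')) -?cardE ?hJ//= mxE ffunE (enum_val_nth (set_map hJ a')) //=.
  by congr (H _ b); apply: set_nth_default; rewrite -cardE hJ.
have : col_perm (perm qi) M = block_mx 1%:M 0 (\matrix_(a, b) H (set_map hJ a) (set_map hI b))
    (\matrix_(a, b) H (set_map hJ a) (set_map hC b)).
  apply/matrixP => a b; rewrite mxE permE ME /q.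
  case: (split_ordP a) => a' ->; case: (split_ordP b) => b' ->.
  - by rewrite block_mxEul mxE (inj_eq (@set_map_inj _ _ _ _)).
  - rewrite block_mxEur mxE.
    case: eqP => // e; have := set_map_mem hC b'; by rewrite -e inE set_map_mem.
  - by rewrite block_mxEdl mxE.
  - by rewrite block_mxEdr mxE.
move=> /(congr1 determinant); rewrite det_lblock det1 mul1r col_permE det_mulmx det_perm /minor => <-.
by rewrite mulrC -mulrA -signr_addb addbb mulr1.
Qed.

End Minors.

Section FormsAndMinors.
Variables (R : realType) (n k : nat) (kn : (k <= n)%N).
Local Notation toC := (real_complex R).
Implicit Types (F : 'M[R]_n -> R[i]).

Definition is_minor_comb F := exists c, forall H, F H = @minor_comb R n k c H.
Definition is_form F := exists c, forall H, F H = form_eval k c (graph_frame H).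

Lemma is_minor_comb_sum (I : finType) (P : pred I) (a : I -> R[i]) (F : I -> 'M[R]_n -> R[i]) :
  (forall i, P i -> is_minor_comb (F i)) -> is_minor_comb (fun H => \sum_(i | P i) a i * F i H).
Proof.
move=> hF; have /choice[c hc] i : exists c, P i -> forall H, F i H = @minor_comb R n k c H.
  by have [/hF[c hc]|_] := boolP (P i); [exists c|exists (fun _ _ => 0)].
exists (fun r s => \sum_(i | P i) a i * c i r s) => H.
rewrite (eq_bigr (fun i => \sum_(r | incr_map r) \sum_(s | incr_map s) a i * c i r s * toC (minor r s H))).
  rewrite exchange_big; apply: eq_bigr => r _; rewrite exchange_big; apply: eq_bigr => s _.
  by rewrite mulr_suml.
move=> i Pi; rewrite hc// mulr_sumr; apply: eq_bigr => r _; rewrite mulr_sumr; apply: eq_bigr => s _.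
by rewrite mulrA.
Qed.

Lemma is_form_sum (I : finType) (P : pred I) (a : I -> R[i]) (F : I -> 'M[R]_n -> R[i]) :
  (forall i, P i -> is_form (F i)) -> is_form (fun H => \sum_(i | P i) a i * F i H).
Proof.
move=> hF; have /choice[c hc] i : exists c, P i -> forall H, F i H = form_eval k c (graph_frame H).
  by have [/hF[c hc]|_] := boolP (P i); [exists c|exists (fun _ _ => 0)].
exists (fun r s => \sum_(i | P i) a i * c i r s) => H; rewrite /form_eval.
rewrite (eq_bigr (fun i => \sum_(r : {set 'I_n} | #|r| == (n - k)%N) \sum_(s : {set 'I_n} | #|s| == k)
   a i * c i r s * toC (dxdxi r s (graph_frame H)))).
  rewrite exchange_big; apply: eq_bigr => r _; rewrite exchange_big; apply: eq_bigr => s _.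
  by rewrite mulr_suml.
move=> i Pi; rewrite hc// mulr_sumr; apply: eq_bigr => r _; rewrite mulr_sumr; apply: eq_bigr => s _.
by rewrite mulrA.
Qed.

Lemma is_minor_comb_eq F F' : F =1 F' -> is_minor_comb F -> is_minor_comb F'.
Proof. by move=> FF' [c hc]; exists c => H; rewrite -FF'. Qed.

Lemma is_form_eq F F' : F =1 F' -> is_form F -> is_form F'.
Proof. by move=> FF' [c hc]; exists c => H; rewrite -FF'. Qed.

Lemma is_minor_combZ (a : R[i]) F : is_minor_comb F -> is_minor_comb (fun H => a * F H).
Proof.
move=> hF; apply: is_minor_comb_eq (@is_minor_comb_sum 'I_1 xpredT (fun=> a) (fun=> F) (fun _ _ => hF)) => H.
by rewrite big_ord1.
Qed.

Lemma is_formZ (a : R[i]) F : is_form F -> is_form (fun H => a * F H).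
Proof.
move=> hF; apply: is_form_eq (@is_form_sum 'I_1 xpredT (fun=> a) (fun=> F) (fun _ _ => hF)) => H.
by rewrite big_ord1.
Qed.

Let toC_sign (e : bool) : toC ((-1) ^+ e) = (-1) ^+ e. Proof. by rewrite rmorphXn rmorphN1. Qed.

(** Repeated indices make the minor vanish; otherwise sorting the indices costs a sign. *)
Lemma minor_is_minor_comb (r c : {ffun 'I_k -> 'I_n}) : is_minor_comb (fun H => toC (minor r c H)).
Proof.
have zero : is_minor_comb (fun=> 0).
  exists (fun _ _ => 0) => H; rewrite /minor_comb big1// => i _; rewrite big1// => j _; exact: mul0r.
have [/injectiveP ri|nr] := boolP (injectiveb r); last first.
  by apply: is_minor_comb_eq zero => H; rewrite minor_noninj.
have [/injectiveP ci|nc] := boolP (injectiveb c); last first.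
  by apply: is_minor_comb_eq zero => H; rewrite minor_tr minor_noninj.
have im (s : {ffun 'I_k -> 'I_n}) : injective s -> #|s @: [set: 'I_k]%SET| = k.
  by move=> si; rewrite card_imset// cardsT card_ord.
have onto (s : {ffun 'I_k -> 'I_n}) (si : injective s) : forall a, exists b, s a = set_map (im s si) b.
  by move=> a; apply: set_map_onto; apply: imset_f; exact: finset.in_setT.
have [e1 h1] := minor_reorder R ri (onto r ri); have [e2 h2] := minor_reorderC R ci (onto c ci).
pose r' := set_map (im r ri); pose c' := set_map (im c ci).
apply: (@is_minor_comb_eq (fun H => (-1) ^+ e1 * ((-1) ^+ e2 * toC (minor r' c' H)))).
  by move=> H; rewrite h1 h2 !rmorphM /= !toC_sign.
do 2 apply: is_minor_combZ.
exists (fun s t => ((s == r') && (t == c'))%:R) => H.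
rewrite /minor_comb (bigD1 r')/=; last exact: set_map_incr.
rewrite [X in _ + X]big1 ?addr0; last first.
  by move=> s /andP[_ /negbTE ->]; apply: big1 => t _; rewrite mul0r.
rewrite (bigD1 c')/=; last exact: set_map_incr.
rewrite !eqxx mul1r big1 ?addr0// => t /andP[_ /negbTE ->]; by rewrite andbF mul0r.
Qed.

Lemma dxdxi_is_form (I J : {set 'I_n}) : #|I| = (n - k)%N -> #|J| = k -> is_form (fun H => toC (dxdxi I J (graph_frame H))).
Proof.
move=> hI hJ; exists (fun s t => ((s == I) && (t == J))%:R) => H.
rewrite /form_eval (bigD1 I)/= ?hI//.
rewrite [X in _ + X]big1 ?addr0; last first.
  by move=> s /andP[_ /negbTE ->]; apply: big1 => t _; rewrite mul0r.
rewrite (bigD1 J)/= ?hJ// !eqxx mul1r big1 ?addr0// => t /andP[_ /negbTE ->]; by rewrite andbF mul0r.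
Qed.

(** Inverts [dxdxi_minor]: J is the set of rows of the minor and I the complement of its columns. *)
Lemma minor_is_form (r c : {ffun 'I_k -> 'I_n}) : is_form (fun H => toC (minor r c H)).
Proof.
have zero : is_form (fun=> 0).
  exists (fun _ _ => 0) => H; rewrite /form_eval big1// => i _; rewrite big1// => j _; exact: mul0r.
have [/injectiveP ri|nr] := boolP (injectiveb r); last first.
  by apply: is_form_eq zero => H; rewrite minor_noninj.
have [/injectiveP ci|nc] := boolP (injectiveb c); last first.
  by apply: is_form_eq zero => H; rewrite minor_tr minor_noninj.
have im (s : {ffun 'I_k -> 'I_n}) : injective s -> #|s @: [set: 'I_k]%SET| = k.
  by move=> si; rewrite card_imset// cardsT card_ord.
pose J := r @: [set: 'I_k]%SET; pose I := ~: (c @: [set: 'I_k]%SET).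
have hJ : #|J| = k by exact: im.
have hC : #|~: I| = k by rewrite finset.setCK; exact: im.
have hI : #|I| = (n - k)%N by have := cardsC I; rewrite hC card_ord => h; lia.
have [e he] := dxdxi_minor R hI hJ hC (subnK kn).
have [e1 h1] := @minor_reorder R _ _ r (set_map hJ) ri (fun a => set_map_onto hJ (imset_f _ (finset.in_setT a))).
have [e2 h2] : exists e : bool, forall s (H : 'M[R]_n), minor s c H = (-1) ^+ e * minor s (set_map hC) H.
  by apply: minor_reorderC => // a; apply: set_map_onto; rewrite finset.setCK imset_f// finset.in_setT.
apply: (@is_form_eq (fun H => (-1) ^+ e1 * ((-1) ^+ e2 * ((-1) ^+ e * toC (dxdxi I J (graph_frame H)))))).
  move=> H; rewrite h1 h2 he !rmorphM /= !toC_sign; do 2 congr (_ * _).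
  by rewrite mulrA -signr_addb addbb mul1r.
by do 3 apply: is_formZ; exact: dxdxi_is_form.
Qed.

Lemma biminor_is_form (b1 b2 : {ffun 'I_k -> 'I_n * 'I_n} -> R) :
  is_form (fun H => toC (biminor b1 H) + 'i%C * toC (biminor b2 H)).
Proof.
apply: (@is_form_eq (fun H => \sum_(h : {ffun 'I_k -> 'I_n * 'I_n}) (toC (b1 h) + 'i%C * toC (b2 h)) *
   toC (minor [ffun i => (h i).1] [ffun i => (h i).2] H))).
  move=> H; rewrite !rmorph_sum /= mulr_sumr -big_split /=; apply: eq_bigr => h _.
  by rewrite !rmorphM /=; ring.
by apply: is_form_sum => h _; exact: minor_is_form.
Qed.

Lemma form_is_minor_comb c : is_minor_comb (fun H => form_eval k c (graph_frame H)).
Proof.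
have dm (I J : {set 'I_n}) : #|I| == (n - k)%N -> #|J| == k -> is_minor_comb (fun H => toC (dxdxi I J (graph_frame H))).
  move=> /eqP hI /eqP hJ; have hC : #|~: I| = k by have := cardsC I; rewrite hI card_ord => h; lia.
  have [e he] := dxdxi_minor R hI hJ hC (subnK kn).
  apply: (@is_minor_comb_eq (fun H => (-1) ^+ e * toC (minor (set_map hJ) (set_map hC) H))).
    by move=> H; rewrite he rmorphM /= toC_sign.
  by apply: is_minor_combZ; exact: minor_is_minor_comb.
rewrite /form_eval; apply: (@is_minor_comb_eq (fun H => \sum_(I : {set 'I_n} | #|I| == (n - k)%N) 1 *
    \sum_(J : {set 'I_n} | #|J| == k) c I J * toC (dxdxi I J (graph_frame H)))).
  by move=> H; apply: eq_bigr => I _; rewrite mul1r.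
by apply: is_minor_comb_sum => I hI; apply: is_minor_comb_sum => J hJ; exact: dm.
Qed.

(** [p] stands for the real or the imaginary part. *)
Lemma minor_comb_biminor (p : R[i] -> R) (c : {ffun 'I_k -> 'I_n} -> {ffun 'I_k -> 'I_n} -> R[i]) :
  {morph p : x y / x + y} -> (forall z r, p (z * toC r) = p z * r) ->
  exists b : {ffun 'I_k -> 'I_n * 'I_n} -> R, forall H : 'M[R]_n, p (minor_comb c H) = biminor b H.
Proof.
move=> pD pZ; have p0 : p 0 = 0 by have := pZ 0 0; rewrite mul0r mulr0.
exists (fun h => (incr_map [ffun i => (h i).1])%:R * (incr_map [ffun i => (h i).2])%:R * p (c [ffun i => (h i).1] [ffun i => (h i).2])) => H.
rewrite /minor_comb (big_morph p pD p0) big_mkcond /=.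
rewrite (eq_bigr (fun r => \sum_s (incr_map r)%:R * (incr_map s)%:R * p (c r s) * minor r s H)); last first.
  move=> r _; case: ifP => hr; last by rewrite big1// => s _; rewrite !mul0r.
  rewrite (big_morph p pD p0) big_mkcond /=; apply: eq_bigr => s _.
  by case: ifP => hs; rewrite ?mul0r ?mulr0 ?mul0r// !mul1r pZ.
rewrite pair_big /biminor /= [LHS](reindex (fun h : {ffun 'I_k -> 'I_n * 'I_n} => ([ffun i => (h i).1], [ffun i => (h i).2]))) //.
exists (fun rs : {ffun 'I_k -> 'I_n} * {ffun 'I_k -> 'I_n} => [ffun i => (rs.1 i, rs.2 i)]) => [h _|[r s] _].
  by apply/ffunP => i; rewrite !ffunE; case: (h i).
by congr (_, _); apply/ffunP => i; rewrite !ffunE.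
Qed.

End FormsAndMinors.

(** * Complex-valued valuations *)

Section ComplexValued.
Variables (R : realType) (n k : nat).
Local Notation V := 'rV[R]_n.
Local Notation toC := (real_complex R).

Lemma convex_translate (f : V -> R) x : convex_fun f -> convex_fun (fun y => f (y + x)).
Proof.
move=> cf u v t t01; have := cf (u + x) (v + x) t t01.
rewrite (_ : t *: (u + x) + (1 - t) *: (v + x) = t *: u + (1 - t) *: v + x)//.
by apply/rowP => i; rewrite !mxE; ring.
Qed.

Lemma translate_borel (B : set V) x : bounded_set B -> measurable B ->
  bounded_set [set b + x | b in B] /\ measurable [set b + x | b in B].
Proof.
move=> bB mB; have -> : [set b + x | b in B] = [set y | B (y - x)].
  apply/seteqP; split => [_ [y By <-]|y By]; first by rewrite /= addrK.
  by exists (y - x) => //; rewrite subrK.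
split; last exact: measurable_shift.
have [M [_ hM]] := bB; exists (M + 1 + `|x|); split; first exact: num_real.
move=> y yM z Bz; rewrite -(subrK x z); apply: le_trans (ler_normD _ _) _.
rewrite (le_trans _ (ltW yM))// lerD2r; apply: hM => //; by rewrite ltrDl.
Qed.

(** The axioms involve only values at convex functions and bounded Borel sets, a domain stable under
    all operations that occur in them. *)
Lemma maval_congr (Psi Psi' : (V -> R) -> set V -> R) : maval k Psi ->
  (forall f, convex_fun f -> forall B : set V, bounded_set B -> measurable B -> Psi' f B = Psi f B) ->
  maval k Psi'.
Proof.
move=> mv E; split.
- by move=> f cf; apply: rradon_ext (mv_radon mv cf) => B bB mB; rewrite E.
- move=> fs f cfs cf fsf phi cp cs.
  rewrite (layer_int_eq cp cs (E f cf)) (_ : (fun j => _) = (fun j => layer_int (Psi (fs j)) phi)).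
    exact: (mv_cts mv).
  by apply/funext => j; apply: layer_int_eq => // B bB mB; rewrite E.
- by move=> f g cf cg cm B bB mB; rewrite !E//; [exact: mv_val mv _ _ cf cg cm B bB mB|exact: convex_fun_max].
- move=> f l cf al B bB mB; rewrite !E//; first exact: (mv_aff mv).
  by apply: convex_funD => //; exact: convex_affine.
- move=> f h U cf ch oU fh B bB mB; rewrite !E//; first exact: (mv_loc mv cf ch oU fh bB mB).
  + exact: sub_bounded_set bB.
  + by apply: measurableI => //; exact: sub_sigma_algebra.
  + exact: sub_bounded_set bB.
  + by apply: measurableI => //; exact: sub_sigma_algebra.
- move=> f x cf B bB mB; have [bB' mB'] := translate_borel x bB mB.
  by rewrite !E//; [exact: (mv_trans mv)|exact: convex_translate].
- by move=> f t cf t0 B bB mB; rewrite !E//; [exact: (mv_hom mv)|exact: convex_funZ].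
Qed.

Lemma complex_ReD : {morph (@complex.Re R) : x y / x + y}. Proof. by case=> [? ?] [? ?]. Qed.

Lemma complex_ImD : {morph (@complex.Im R) : x y / x + y}. Proof. by case=> [? ?] [? ?]. Qed.

Lemma complex_ReZ (z : R[i]) t : complex.Re (z * toC t) = complex.Re z * t.
Proof. by case: z => x y; simpc. Qed.

Lemma complex_ImZ (z : R[i]) t : complex.Im (z * toC t) = complex.Im z * t.
Proof. by case: z => x y; simpc. Qed.

Lemma complex_ext (u v : R[i]) : complex.Re u = complex.Re v -> complex.Im u = complex.Im v -> u = v.
Proof. by case: u v => [? ?] [? ?] /= -> ->. Qed.

Variable Psi : (V -> R) -> set V -> R[i].

Lemma is_MAVal_k_ReIm : maval k (fun f B => complex.Re (Psi f B)) ->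
  maval k (fun f B => complex.Im (Psi f B)) -> is_MAVal_k k Psi.
Proof.
move=> mr mi; split.
- move=> f g cf cg cm B bB mB; apply: complex_ext; rewrite ?complex_ReD ?complex_ImD.
    exact: (mv_val mr cf cg cm bB mB).
  exact: (mv_val mi cf cg cm bB mB).
- by move=> f l cf al B bB mB; apply: complex_ext; [exact: (mv_aff mr)|exact: (mv_aff mi)].
- move=> f h U cf ch oU fh B bB mB.
  by apply: complex_ext; [exact: (mv_loc mr cf ch oU fh bB mB)|exact: (mv_loc mi cf ch oU fh bB mB)].
- by move=> f x cf B bB mB; apply: complex_ext; [exact: (mv_trans mr)|exact: (mv_trans mi)].
- move=> f t cf t0 B bB mB; apply: complex_ext; rewrite mulrC ?complex_ReZ ?complex_ImZ mulrC.
    exact: (mv_hom mr cf t0 bB mB).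
  exact: (mv_hom mi cf t0 bB mB).
Qed.

Section Part.
Variable p : R[i] -> R.
Hypotheses (pD : {morph p : x y / x + y}) (pZ : forall z r, p (z * toC r) = p z * r).
Hypothesis prad : forall f, convex_fun f -> rradon (fun B => p (Psi f B)).
Hypothesis pcts : forall fs f phi, (forall j, convex_fun (fs j)) -> convex_fun f -> loc_unif_cvg fs f ->
  continuous phi -> compact_support phi ->
  (fun j => layer_int (fun B => p (Psi (fs j) B)) phi) @ \oo --> layer_int (fun B => p (Psi f B)) phi.

Lemma is_MAVal_k_maval : is_MAVal_k k Psi -> maval k (fun f B => p (Psi f B)).
Proof.
case=> hv ha hl ht hh; split.
- exact: prad.
- by move=> fs f cfs cf fsf phi cp cs; exact: pcts.
- by move=> f g cf cg cm B bB mB; rewrite -!pD; congr p; exact: hv cf cg cm B bB mB.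
- by move=> f l cf al B bB mB; congr p; exact: ha cf al B bB mB.
- by move=> f h U cf ch oU fh B bB mB; congr p; exact: hl cf ch oU fh B bB mB.
- by move=> f x cf B bB mB; congr p; exact: ht.
- by move=> f t cf t0 B bB mB; rewrite mulrC -pZ mulrC; congr p; exact: hh cf t0 B bB mB.
Qed.

(** Agreement with a known valuation on C^2 functions forces agreement everywhere by density, and
    the axioms are inherited. *)
Lemma C2_maval Psi' : maval k Psi' ->
  (forall f, convex_fun f -> C2_fun f -> forall B : set V, bounded_set B -> measurable B -> p (Psi f B) = Psi' f B) ->
  maval k (fun f B => p (Psi f B)).
Proof.
move=> mv h; apply: (maval_congr mv); apply: C2_determined => //.
- by move=> f cf; exact: (mv_radon mv).
- by move=> fs f phi cfs cf fsf cp cs; exact: (mv_cts mv).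
Qed.

End Part.

Hypotheses (rad : forall f, convex_fun f -> is_radon (Psi f)) (cts : conv_continuous Psi).

Lemma Re_radon f : convex_fun f -> rradon (fun B => complex.Re (Psi f B)).
Proof. by move=> cf K bK A mA AK tA; have [] := rad cf bK mA AK tA. Qed.

Lemma Im_radon f : convex_fun f -> rradon (fun B => complex.Im (Psi f B)).
Proof. by move=> cf K bK A mA AK tA; have [] := rad cf bK mA AK tA. Qed.

Lemma Re_cts fs f phi : (forall j, convex_fun (fs j)) -> convex_fun f -> loc_unif_cvg fs f ->
  continuous phi -> compact_support phi ->
  (fun j => layer_int (fun B => complex.Re (Psi (fs j) B)) phi) @ \oo -->
  layer_int (fun B => complex.Re (Psi f B)) phi.
Proof. by move=> cfs cf fsf cp cs; have [] := cts cfs cf fsf cp cs. Qed.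

Lemma Im_cts fs f phi : (forall j, convex_fun (fs j)) -> convex_fun f -> loc_unif_cvg fs f ->
  continuous phi -> compact_support phi ->
  (fun j => layer_int (fun B => complex.Im (Psi (fs j) B)) phi) @ \oo -->
  layer_int (fun B => complex.Im (Psi f B)) phi.
Proof. by move=> cfs cf fsf cp cs; have [] := cts cfs cf fsf cp cs. Qed.

End ComplexValued.

Local Open Scope complex_scope.

Theorem theorem1p2 (R : realType) (n k : nat)
  (Psi : ('rV[R]_n -> R) -> set 'rV[R]_n -> R[i]) :
  (k <= n)%N ->
  (* Psi maps Conv(R^n,R) into M(R^n) and is continuous *)
  (forall f, convex_fun f -> is_radon (Psi f)) ->
  conv_continuous Psi ->
  [<->
    (* 1 *) is_MAVal_k k Psi;
    (* 2 *) (exists (m : nat) (c : 'I_m -> R[i]) (q : 'I_m -> nat -> 'rV[R]_n -> R),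
               (forall j l, (l < n - k)%N ->
                  quadratic_poly (q j l) /\ convex_fun (q j l)) /\
               (forall f, convex_fun f ->
                  meq (Psi f)
                      (fun B => \sum_(j < m) c j * mixedMA (quad_args k f (q j)) B)));
    (* 3 *) (exists c : {set 'I_n} -> {set 'I_n} -> R[i],
               forall f, convex_fun f -> C2_fun f ->
               forall B, bounded_set B -> borel B ->
                 Psi f B = graph_int k c f B);
    (* 4 *) (exists c : {ffun 'I_k -> 'I_n} -> {ffun 'I_k -> 'I_n} -> R[i],
               forall f, convex_fun f -> C2_fun f ->
               forall B, bounded_set B -> borel B ->
                 Psi f B = leb_cint B (fun x => minor_comb c (hessian f x)))].
Proof.
(* With n written as k + l, matrices can be stacked from k and l rows. *)
move=> kn; have [l ln] : exists l, n = (k + l)%N by exists (n - k)%N; rewrite subnKC.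
subst n; move=> rad cts.
tfae.
- move=> MV; have mr := is_MAVal_k_maval (@complex_ReD R) (@complex_ReZ R) (Re_radon rad) (Re_cts cts) MV.
  have mi := is_MAVal_k_maval (@complex_ImD R) (@complex_ImZ R) (Im_radon rad) (Im_cts cts) MV.
  have [m1 [c1 [w1 h1]]] := maval_mixcombE mr.
  have [m2 [c2 [w2 h2]]] := maval_mixcombE mi.
  pose w j := match fintype.split j with inl j => w1 j | inr j => w2 j end.
  (* The operators for the real part come first, those for the imaginary part follow with
     coefficients multiplied by ['i]. *)
  pose c (j : 'I_(m1 + m2)) : R[i] :=
    match fintype.split j with inl j => (c1 j)%:C | inr j => 'i * (c2 j)%:C end.
  exists (m1 + m2)%N, c, (fun j => qrows (w j)); split.
    by move=> j j' _; split; [exact: qrows_quadratic|exact: qrows_convex].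
  move=> f cf B bB mB.
  have E j : mixedMA (@quad_args R (k + l) k f (qrows (w j))) B = (mixrows (w j) f B)%:C.
    apply: mixedMA_mix => //; apply: quad_args_convex => // j'; exact: qrows_convex.
  rewrite (eq_bigr (fun j => c j * (mixrows (w j) f B)%:C)) => [|j _]; last by rewrite E.
  have sl j : fintype.split (lshift m2 j) = inl j :> 'I_m1 + 'I_m2 := unsplitK (inl j).
  have sr j : fintype.split (rshift m1 j) = inr j :> 'I_m1 + 'I_m2 := unsplitK (inr j).
  rewrite big_split_ord /=.
  rewrite (eq_bigr (fun j => (c1 j * mixrows (w1 j) f B)%:C)) => [|j _]; last first.
    by rewrite /c /w sl; exact: (esym (rmorphM (real_complex R) _ _)).
  rewrite [X in _ + X](eq_bigr (fun j => 'i * (c2 j * mixrows (w2 j) f B)%:C)) => [|j _]; last first.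
    by rewrite /c /w sr -mulrA; congr (_ * _); exact: (esym (rmorphM (real_complex R) _ _)).
  rewrite -mulr_sumr -!rmorph_sum /=.
  have := h1 f cf B bB mB; have := h2 f cf B bB mB; rewrite /mixcomb => <- <-.
  by apply: complex_ext; simpc.
- move=> [m [c [q [hq h]]]].
  (* Only the indices i < l are known to give convex quadratic polynomials; they are the ones that
     [quad_args] reads, so the others may be reset to 0. *)
  pose q' j i := if (i < l)%N then q j i else fun=> 0.
  have cq' j i : convex_fun (q' j i).
    rewrite /q'; case: ltnP => il; first by have [] := hq j i; rewrite ?addKn.
    by move=> x y t _; rewrite !mulr0 addr0.
  have qq' j i : quadratic_poly (q' j i).
    rewrite /q'; case: ltnP => il; first by have [] := hq j i; rewrite ?addKn.
    by exists 0, 0, 0 => x; rewrite mulmx0 mul0mx mxE inner0l !addr0.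
  have E f : convex_fun f -> forall B : set 'rV[R]_(k + l), bounded_set B -> measurable B ->
    Psi f B = \sum_(j < m) c j * (mix (@quad_args R (k + l) k f (q' j)) B)%:C.
    move=> cf B bB mB; rewrite (h f cf B bB mB); apply: eq_bigr => j _; congr (_ * _).
    rewrite (_ : quad_args k f (q j) = quad_args k f (q' j)).
      by apply: mixedMA_mix => //; exact: quad_args_convex.
    apply/funext => i; rewrite /quad_args /q'; case: ltnP => // ki.
    by rewrite ltn_subLR// ltn_ord.
  have mv p (pD : {morph p : x y / x + y}) (pZ : forall (z : R[i]) r, p (z * r%:C) = p z * r) :
      maval k (fun f B => p (Psi f B)).
    apply: (maval_congr (maval_lincomb (fun j => p (c j)) (fun j => maval_mix (cq' j) (qq' j) (@hom_mixdet R k l)))).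
    have p0 : p 0 = 0 by have := pZ 0 0; rewrite mul0r mulr0.
    move=> f cf B bB mB; rewrite (E f cf B bB mB) (big_morph p pD p0).
    by apply: eq_bigr => j _; rewrite pZ.
  have mvr := mv _ (@complex_ReD R) (@complex_ReZ R); have mvi := mv _ (@complex_ImD R) (@complex_ImZ R).
  have [b1 hb1] := maval_biminor mvr; have [b2 hb2] := maval_biminor mvi.
  have [d hd] := biminor_is_form kn b1 b2; exists d => f cf C2f B bB mB.
  apply: complex_ext; rewrite /graph_int /leb_cint /=.
    have := maval_C2 mvr hb1 cf C2f bB mB => ->.
    congr (leb_int B _); apply/funext => x; have := hd (hessian f x); rewrite /graph_frame => <-.
    by simpc.
  have := maval_C2 mvi hb2 cf C2f bB mB => ->.
  congr (leb_int B _); apply/funext => x; have := hd (hessian f x); rewrite /graph_frame => <-.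
  by simpc.
- move=> [c hc]; have [d hd] := form_is_minor_comb kn c; exists d => f cf C2f B bB mB.
  rewrite (hc f cf C2f B bB mB) /graph_int; congr (leb_cint B _); apply/funext => x.
  exact: hd.
(* The minor density is realised by mixed operators, separately for real and imaginary parts; these
   are valuations, and [Psi] agrees with them on C^2 functions. *)
- move=> [c hc]; have [b1 hb1] := minor_comb_biminor c (@complex_ReD R) (@complex_ReZ R).
  have [b2 hb2] := minor_comb_biminor c (@complex_ImD R) (@complex_ImZ R).
  have [m1 [c1 [w1 h1]]] := biminor_mixcomb b1; have [m2 [c2 [w2 h2]]] := biminor_mixcomb b2.
  apply: is_MAVal_k_ReIm.
    apply: (C2_maval (Re_radon rad) (Re_cts cts) (maval_mixcomb c1 w1)) => f cf C2f B bB mB.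
    rewrite (h1 f cf C2f B bB mB) (hc f cf C2f B bB mB) /=.
    by congr (leb_int B _); apply/funext => x; rewrite -hb1.
  apply: (C2_maval (Im_radon rad) (Im_cts cts) (maval_mixcomb c2 w2)) => f cf C2f B bB mB.
  rewrite (h2 f cf C2f B bB mB) (hc f cf C2f B bB mB) /=.
  by congr (leb_int B _); apply/funext => x; rewrite -hb2.
Qed.
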